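(* Let $n\ge 2$, let $\Omega\subset\mathbb{R}^n$ be a nonempty, bounded, open, connected set of class $C^2$, and let $f\in L^\infty(\Omega)$ with $f\ge 0$. Let $h\colon\mathbb{R}^n\to[0,+\infty]$ be a Borel function such that the set $K:=\operatorname{co}\{\xi\in\mathbb{R}^n:\ h(\xi)=0\}$ (convex hull) is a compact convex set containing $0$ as an interior point, with boundary $\partial K$ of class $C^2$ and strictly positive principal curvatures. Let $$\Lambda:=\sup\{\lambda\ge 0:\ h(\xi)\ge\lambda(\rho(\xi)-1)\ \ \forall \xi\in\mathbb{R}^n\}\in[0,+\infty],$$ where $\rho$ is the gauge function of $K$, and assume that there exists $H^*\le H_0$ such that $c(H^*,r_\Omega)\,\|f\|_{\infty}\le\Lambda$. Let $$J(u)=\int_\Omega [h(Du)-f\,u]\,dx,\qquad u\in W^{1,1}_0(\Omega).$$ Then the Minkowski distance $d$ from $\partial\Omega$ associated to $K$ is a minimizer of $J$ in $W^{1,1}_0(\Omega)$. Moreover, if $u$ is a minimizer of $J$ in $W^{1,1}_0(\Omega)$, then $u\in\mathrm{Lip}^1_0(\Omega,\rho)$.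
   Context: Gauges: $\rho(\xi)=\inf\{t\ge0:\ \xi\in tK\}$; $K^0=\{p\in\mathbb{R}^n:\ \langle p,x\rangle\le1\ \forall x\in K\}$ is the polar set of $K$ and $\rho^0$ denotes the gauge function of $K^0$. Under the assumptions on $K$, $\rho$ and $\rho^0$ are of class $C^2$ in $\mathbb{R}^n\setminus\{0\}$. Minkowski distance: $d(x)=\min_{y\in\partial\Omega}\rho^0(x-y)$ for $x\in\overline\Omega$. The inradius is $r_\Omega=\max_{x\in\Omega}d(x)$. Function spaces: $\mathrm{Lip}^1(\Omega,\rho)$ is the set of $u\in C(\overline\Omega)$ with $u(x)-u(y)\le\rho^0(x-y)$ whenever the closed segment joining $x$ and $y$ is contained in $\overline\Omega$; equivalently, the set of Lipschitz functions $u$ on $\overline\Omega$ with $Du\in K$ a.e. in $\Omega$. $\mathrm{Lip}^1_0(\Omega,\rho)$ is the set of $u\in\mathrm{Lip}^1(\Omega,\rho)$ with $u=0$ on $\partial\Omega$. (A Sobolev function belongs to such a set if it has a representative in it.) Anisotropic curvatures: the signed distance $d^s$ is $d^s=d$ on $\overline\Omega$ and $d^s(x)=-\min_{z\in\overline\Omega}\rho^0(z-x)$ for $x\in\mathbb{R}^n\setminus\Omega$; it is of class $C^2$ in a tubular neighborhood $\mathcal U$ of $\partial\Omega$. The Cahn–Hoffman field is $n_\rho(x)=-D\rho(Dd^s(x))$, $x\in\mathcal U$. For $y\in\partial\Omega$ the restriction of $Dn_\rho(y)$ to the tangent space $T_y$ of $\partial\Omega$ at $y$ is a linear map $T_y\to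 T_y$ with $n-1$ real eigenvalues $\tilde\kappa_1(y),\dots,\tilde\kappa_{n-1}(y)$ (the principal $\rho$-curvatures). Set $\widetilde H(y)=\frac1{n-1}\sum_{i=1}^{n-1}\tilde\kappa_i(y)$ and $H_0=\min_{y\in\partial\Omega}\widetilde H(y)$. The function $c\colon\mathbb{R}\times(0,\infty)\to\mathbb{R}$ is $c(t,r)=\frac{1-(1-tr)^n}{nt}$ if $t\ne0$, and $c(0,r)=r$. *)

(* Defs.v *)
From HB Require Import structures.
From mathcomp Require Import all_boot all_order all_algebra.
From mathcomp Require Import all_classical all_reals all_analysis.
From mathcomp Require Import measurable_realfun.

Set Implicit Arguments.
Unset Strict Implicit.
Unset Printing Implicit Defensive.

Import Order.TTheory GRing.Theory Num.Theory.
Import numFieldNormedType.Exports.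

Local Open Scope classical_set_scope.
Local Open Scope ring_scope.

Section cover_outer_measure.
Local Open Scope ereal_scope.
Context {R : realType} {T I : Type}.
Variables (S : I -> set T) (v : I -> \bar R) (i0 : I).
Hypotheses (v_ge0 : forall i, 0 <= v i) (vi0 : v i0 = 0).

Definition cover_outer (A : set T) : \bar R :=
  ereal_inf [set \sum_(k <oo) v (c k) |
             c in [set c : nat -> I | A `<=` \bigcup_k S (c k)]].

Lemma cover_outer_ge0 A : 0 <= cover_outer A.
Proof. by apply: le_ereal_inf_tmp => _ [c _ <-]; exact: nneseries_ge0. Qed.

Lemma cover_outer0 : cover_outer set0 = 0.
Proof.
apply/eqP; rewrite eq_le cover_outer_ge0 andbT.
apply: ereal_inf_lbound; exists (fun=> i0) => //=.
by rewrite eseries0.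
Qed.

Lemma le_cover_outer : {homo cover_outer : A B / A `<=` B >-> A <= B}.
Proof.
move=> A B AB; apply/ereal_inf_le_tmp => _ [c Bc <-].
by exists c => //; exact: subset_trans Bc.
Qed.

Lemma cover_outer_sigma_subadditive : sigma_subadditive cover_outer.
Proof.
move=> A; have [[i ioo]|] := pselect (exists i, cover_outer (A i) = +oo).
  rewrite (eseries_pinfty _ _ ioo) ?leey// => n _.
  by rewrite -ltNye (lt_le_trans _ (cover_outer_ge0 _)).
rewrite -forallNE => Aoo.
suff add2e (e : {posnum R}) :
    cover_outer (\bigcup_n A n) <= \sum_(i <oo) cover_outer (A i) + e%:num%:E.
  by apply/lee_addgt0Pr => _/posnumP[].
rewrite (le_trans _ (epsilon_trick _ _ _))//; last first.
  by move=> n; exact: cover_outer_ge0.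
pose P n (c : nat -> I) := A n `<=` \bigcup_k S (c k) /\
  \sum_(k <oo) v (c k) <= cover_outer (A n) + (e%:num / (2 ^ n.+1)%:R)%:E.
have [G PG] : {G : nat -> nat -> I & forall n, P n (G n)}.
  apply: (@choice _ _ P) => n; rewrite /P /cover_outer.
  set X := (X in ereal_inf X); move infX : (ereal_inf X) => iX.
  case: iX infX => [r Xr|Xoo|Xoo].
  - have en1 : (0 < e%:num / (2 ^ n.+1)%:R)%R by [].
    have /(lb_ereal_inf_adherent en1) : ereal_inf X \is a fin_num by rewrite Xr.
    by move=> [x [c Ac <-] xX]; exists c; split => //; rewrite -Xr; exact/ltW.
  - by have := Aoo n; rewrite /cover_outer Xoo.
  - suff : lbound X 0 by move/le_ereal_inf_tmp; rewrite Xoo.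
    by move=> /= _ [c Ac <-]; exact: nneseries_ge0.
have vG_ge0 x : 0 <= (v \o uncurry G) x by exact: v_ge0.
apply: (@le_trans _ _ (\esum_(i in setT) (v \o uncurry G) i)).
  apply: ereal_inf_lbound => /=.
  have /card_esym/ppcard_eqP[f] := card_nat2.
  exists (uncurry G \o f).
    apply: (@subset_trans _ (\bigcup_n \bigcup_k S (G n k))) => [t [i _]|].
      by move=> /(PG i).1 -[j _ ?]; exists i => //; exists j.
    move=> t [i _ [j _ Bijt]]; exists (f^-1%FUN (i, j)) => //=.
    by rewrite invK ?inE.
  rewrite -(esum_pred_image (v \o uncurry G) _ xpredT) ?[fun=> _]set_true//.
  by rewrite image_eq.
rewrite (_ : esum _ _ = \sum_(i <oo) \sum_(j <oo) v (G i j)); last first.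
  pose J : nat -> set (nat * nat) := fun i => [set (i, j) | j in setT].
  rewrite (_ : setT = \bigcup_k J k); last first.
    by rewrite predeqE => -[a b]; split => // _; exists a => //; exists b.
  rewrite esum_bigcupT /=; last 2 first.
    - apply/trivIsetP => i j _ _ ij.
      rewrite predeqE => -[n m] /=; split => //= -[] [_] _ [<-{n} _].
      by move=> [m' _] [] /esym/eqP; rewrite (negbTE ij).
    - by move=> /= [n m]; exact: v_ge0.
  rewrite -(image_id [set: nat]) -fun_true esum_pred_image//; last first.
    by move=> n _; exact: esum_ge0.
  apply: eq_eseriesr => /= j _.
  rewrite -(esum_pred_image (v \o uncurry G) (pair j) predT)//=; last first.
    by move=> ? ? _ _; exact: (@can_inj _ _ _ snd).
  by congr esum; rewrite predeqE => -[a b]; split; move=> [i _ <-]; exists i.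
apply: lee_lim.
- apply: is_cvg_nneseries => n *.
  by apply: nneseries_ge0 => m *; exact: (vG_ge0 (n, m)).
- by apply: is_cvg_nneseries => n *; apply: adde_ge0 => //; exact: cover_outer_ge0.
- by near=> n; apply: lee_sum => i _; exact: (PG i).2.
Unshelve. all: by end_near. Qed.

End cover_outer_measure.

Section lebesgue_measure_rV.
Variables (R : realType) (n : nat).
Local Notation E := 'rV[R]_n.

(* [Some (a, b)] stands for the closed box with corners [a] and [b], [None] for
   the empty set; the latter makes the covers at most countable, and is needed
   for dimension 0 only. *)
Definition obox (o : option (E * E)) : set E :=
  if o is Some (a, b) then [set x | forall i, a 0 i <= x 0 i <= b 0 i]
  else set0.

Definition obox_volume (o : option (E * E)) : \bar R :=
  if o is Some (a, b) then (\prod_i Num.max 0 (b 0 i - a 0 i))%:E else 0%E.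

Lemma obox_volume_ge0 o : (0 <= obox_volume o)%E.
Proof.
by case: o => [[a b]|//] /=; rewrite lee_fin prodr_ge0// => i _; rewrite le_max lexx.
Qed.

Definition lebesgue_outer : set E -> \bar R := cover_outer obox obox_volume.

HB.instance Definition _ := isOuterMeasure.Build R E lebesgue_outer
  (@cover_outer0 R _ _ obox obox_volume None obox_volume_ge0 erefl)
  (@cover_outer_ge0 R _ _ obox obox_volume obox_volume_ge0)
  (@le_cover_outer R _ _ obox obox_volume)
  (@cover_outer_sigma_subadditive R _ _ obox obox_volume obox_volume_ge0).

Definition lebesgueRn := caratheodory_type lebesgue_outer.
HB.instance Definition _ := Measurable.on lebesgueRn.

Definition leb : set lebesgueRn -> \bar R := lebesgue_outer.
HB.instance Definition _ := isMeasure.Build _ lebesgueRn R leb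
  (@caratheodory_measure0 R E lebesgue_outer)
  (@caratheodory_measure_ge0 R E lebesgue_outer)
  (@caratheodory_measure_sigma_additive R E lebesgue_outer).

Definition borelRn := g_sigma_algebraType (@open E).
HB.instance Definition _ := Measurable.on borelRn.

Definition borel_fun (h : E -> \bar R) : Prop :=
  measurable_fun [set: borelRn] h.

End lebesgue_measure_rV.
Arguments leb {R n}.

Section euclidean_space.
Variables (R : realType) (n : nat).
Local Notation E := 'rV[R]_n.
Implicit Types (A : set E) (x y v : E) (f : E -> R).

Definition dotp x y : R := \sum_i x 0 i * y 0 i.
Definition enorm x : R := Num.sqrt (dotp x x).

Definition boundary A : set E := closure A `\` interior A.

Definition partial (i : 'I_n) f : E -> R := 'D_(delta_mx 0 i) f.
Definition grad f x : E := \row_i partial i f x.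

(* meant for open sets [U] *)
Fixpoint Ck (k : nat) (U : set E) f : Prop :=
  (forall x, U x -> {for x, continuous f}) /\
  if k is k'.+1 then
    forall i, (forall x, U x -> derivable f x (delta_mx 0 i)) /\
              Ck k' U (partial i f)
  else True.

(* [psi] is a C^2 defining function of [A] in the open set [U]: there [A] lies
   on the side [psi < 0] of its boundary, which is the regular level set
   [psi = 0], so that [grad psi] is an outward normal. *)
Definition C2_defining A (U : set E) (psi : E -> R) : Prop :=
  [/\ open U, Ck 2 U psi, (forall x, U x -> grad psi x != 0) &
      forall x, U x -> (interior A x <-> psi x < 0) /\
                       (closure A x <-> psi x <= 0)].

Definition C2_boundary A : Prop :=
  forall y, boundary A y -> exists U psi, U y /\ C2_defining A U psi.

Definition tangent (S : set E) y v : Prop :=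
  exists gamma : R -> E, [/\ gamma 0 = y, (\forall t \near (0 : R), S (gamma t)) &
                             is_derive (0 : R) (1 : R) gamma v].

(* The rows of [B] form a basis of the tangent space at [y] of the
   hypersurface [S], so that [conjmx B 'J F y] is the matrix of the restriction
   of the differential of [F] to this space when the latter is stable. *)
Definition tangent_basis (S : set E) y (B : 'M[R]_(n.-1, n)) : Prop :=
  row_free B /\ forall v, tangent S y v <-> (v <= B)%MS.

Definition unit_normal (psi : E -> R) x : E :=
  (enorm (grad psi x))^-1 *: grad psi x.

(* Eigenvalues of the Weingarten map, the differential of the outward unit
   normal on the tangent space; spheres have positive curvatures. *)
Definition principal_curvature A y (k : R) : Prop :=
  exists U psi, [/\ C2_defining A U psi, U y &
    exists B, [/\ tangent_basis (boundary A) y B,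
      stablemx B ('J (unit_normal psi) y) &
      eigenvalue (conjmx B ('J (unit_normal psi) y)) k]].

Definition convex_hull A : set E :=
  \bigcap_(C in [set C | convex_set C /\ A `<=` C]) C.

Definition gauge (K : set E) x : R :=
  inf [set t | 0 <= t /\ exists2 k, K k & x = t *: k].

Definition polar (K : set E) : set E :=
  [set p | forall x, K x -> dotp p x <= 1].

Definition minkowski_dist (Omega K : set E) x : R :=
  inf [set gauge (polar K) (x - y) | y in boundary Omega].

Definition inradius (Omega K : set E) : R :=
  sup [set minkowski_dist Omega K x | x in Omega].

Definition signed_dist (Omega K : set E) x : R :=
  if x \in closure Omega then minkowski_dist Omega K x
  else - inf [set gauge (polar K) (z - x) | z in closure Omega].

Definition cahn_hoffman (Omega K : set E) x : E :=
  - grad (gauge K) (grad (signed_dist Omega K) x).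

(* the roots of the characteristic polynomial, listed with multiplicity *)
Definition is_rho_curvatures (Omega K : set E) y (ks : seq R) : Prop :=
  exists B, [/\ tangent_basis (boundary Omega) y B,
    stablemx B ('J (cahn_hoffman Omega K) y) &
    char_poly (conjmx B ('J (cahn_hoffman Omega K) y)) =
      \prod_(k <- ks) ('X - k%:P)].

Definition rho_curvatures (Omega K : set E) y : seq R :=
  xget [::] [set ks | is_rho_curvatures Omega K y ks].

Definition mean_rho_curvature (Omega K : set E) y : R :=
  (n.-1)%:R^-1 * \sum_(k <- rho_curvatures Omega K y) k.

Definition min_mean_rho_curvature (Omega K : set E) : R :=
  inf [set mean_rho_curvature Omega K y | y in boundary Omega].

Definition cfun (t r : R) : R :=
  if t == 0 then r else (1 - (1 - t * r) ^+ n) / (n%:R * t).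

Definition segment x y : set E :=
  [set (1 - t) *: x + t *: y | t in [set t : R | 0 <= t <= 1]].

Definition Lip1 (Omega K : set E) (u : E -> R) : Prop :=
  {within closure Omega, continuous u} /\
  forall x y, segment x y `<=` closure Omega ->
    u x - u y <= gauge (polar K) (x - y).

Definition Lip10 (Omega K : set E) (u : E -> R) : Prop :=
  Lip1 Omega K u /\ forall x, boundary Omega x -> u x = 0.

End euclidean_space.

(* Elements of Lebesgue and Sobolev spaces on [Omega] are represented by
   functions on the whole space, whose values outside [Omega] are irrelevant. *)
Section sobolev.
Variables (R : realType) (n : nat) (Omega : set 'rV[R]_n).
Local Notation E := 'rV[R]_n.
Local Notation mu := (@leb R n).
Implicit Types (u f phi : E -> R) (g : E -> E).

Definition Linf_norm f : \bar R := 'N[mu]_+oo [EFin \o (f \_ Omega)]%E.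

Definition in_Linf f : Prop :=
  measurable_fun (Omega : set (lebesgueRn R n)) f /\ (Linf_norm f < +oo)%E.

Definition in_L1 u : Prop := mu.-integrable Omega (EFin \o u).

Definition test_function phi : Prop :=
  (forall k, Ck k setT phi) /\
  exists C : set E, [/\ compact C, C `<=` Omega & forall x, ~ C x -> phi x = 0].

Definition is_weak_grad u g : Prop :=
  (forall i, in_L1 (fun x => g x 0 i)) /\
  forall phi, test_function phi -> forall i,
    \int[mu]_(x in Omega) (u x * partial i phi x) =
    - \int[mu]_(x in Omega) (g x 0 i * phi x).

Definition W11 u : Prop := in_L1 u /\ exists g, is_weak_grad u g.

Definition weak_grad u : E -> E := xget (fun=> 0) [set g | is_weak_grad u g].

(* equivalent to the norm built from the Euclidean length of the gradient, hence
   giving the same closure of the test functions *)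
Definition W11_norm u : \bar R :=
  (\int[mu]_(x in Omega) (`|u x|%R)%:E +
   \sum_(i < n) \int[mu]_(x in Omega) (`|weak_grad u x 0 i|%R)%:E)%E.

Definition W110 u : Prop :=
  W11 u /\ forall e : R, 0 < e ->
    exists2 phi, test_function phi & (W11_norm (u \- phi)%R < e%:E)%E.

Definition functional_J (h : E -> \bar R) f u : \bar R :=
  (\int[mu]_(x in Omega) (h (weak_grad u x) - (f x * u x)%:E))%E.

End sobolev.

Definition minimizer {R : realType} {X : Type} (J : X -> \bar R) (A : set X) (u : X)
    : Prop :=
  A u /\ forall v, A v -> (J u <= J v)%E.

Definition growth_const {R : realType} {n : nat} (K : set 'rV[R]_n)
    (h : 'rV[R]_n -> \bar R) : \bar R :=
  ereal_sup [set lam%:E | lam in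
    [set lam : R | 0 <= lam /\ forall xi, ((lam * (gauge K xi - 1))%:E <= h xi)%E]].

(* Main.v *)
Require Import Defs.
From HB Require Import structures.
From mathcomp Require Import all_boot all_order all_algebra fingroup perm.
From mathcomp Require Import all_classical all_reals all_analysis.
From mathcomp Require Import measurable_realfun.
From mathcomp Require Import zify ring lra.
From mathcomp Require complex.

Set Implicit Arguments.
Unset Strict Implicit.
Unset Printing Implicit Defensive.

Import Order.TTheory GRing.Theory Num.Theory.
Import numFieldNormedType.Exports.

Local Open Scope classical_set_scope.
Local Open Scope ring_scope.

(* Let [S] be the boundary of [Omega], [d] the Minkowski distance from [S], [rho]
   the gauge of [K] and [c] the function [cfun n Hs]. Each point of [Omega] lies
   on a ray [y + t *: cahn y] with [y] in [S], along which [d] grows like [t], and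
   almost every point is interior to such a ray; there [d] is strictly
   differentiable and [rho] of its gradient is 1. Since the boundary points of
   [K] are extreme, [h] vanishes on them, whence [J d = - \int f d].
   Moving inwards by [t] along the rays scales volumes by at most
   [(1 - Hs t)^(n - 1)], by the inequality between arithmetic and geometric
   means for the principal [rho]-curvatures. Integrating along the rays the bound
   [u - d <= \int (rho (Du) - 1)^+] gives, for test functions and then on
   [W^(1,1)_0], [\int (u - d)^+ <= \int c (r - d) (rho (Du) - 1)^+] with [r] the
   inradius. As [h] is at least [c r ||f|| (rho - 1)^+], this yields [J d <= J u],
   and equality forces [rho (Du) <= 1] almost everywhere; the mollifications of
   test functions approximating [u] then converge to a Lipschitz function. *)

(** * Lebesgue outer measure and linear changes of variables *)

(** The measure of a box is only ever bounded above: Carathéodory measurability, translation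
    invariance and upper bounds for images of sets carry the argument. Positivity enters through a
    case distinction, since all integrals vanish if the whole space is null. The distance is
    differentiable inside the rays only, and points nearby may be end points of rays. Derivatives
    are therefore strict: they control the increments between any two points near the base point.
    This gives local Lipschitz estimates, hence measure bounds, without a neighbourhood of
    smoothness, and makes the gradients of mollifications converge. Iterated integrals are avoided:
    integrals along rays are Riemann sums with steps r/N, integrals of transported functions are
    compared through superlevel sets, and mollifications through finite combinations of translates.
    The equality case rests on the strict inequality between c(r - d) and c(r) inside [Omega]; for f
    = 0 it is replaced by the vanishing of the integral of [h] of the gradient. *)

Section row_norm.
Variables (R : realType) (n : nat).
Implicit Types x y : 'rV[R]_n.

Lemma norm_coord_le x i : `|x 0 i| <= `|x|.
Proof.
rewrite [leRHS]mx_normrE.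
exact: (le_bigmax (0 : R) (fun ij : 'I_1 * 'I_n => `|x ij.1 ij.2|) (0, i)).
Qed.

Lemma norm_row_le x (c : R) : 0 <= c -> (forall i, `|x 0 i| <= c) -> `|x| <= c.
Proof.
by move=> c0 H; rewrite [leLHS]mx_normrE; apply: bigmax_le => // -[i j] _ /=; rewrite ord1.
Qed.

End row_norm.

Lemma le_at_right0 (R : realType) (g : R -> R) (y : R) : {for 0, continuous g} ->
  (forall e, 0 < e -> y <= g e) -> y <= g 0.
Proof.
move=> cg H; rewrite leNgt; apply/negP => gy.
have /nbhs_ballP[e /= e0 He] : \forall t \near (0 : R), g t < y by exact: cvgr_lt cg _ gy.
have := H (e / 2) (divr_gt0 e0 (ltr0Sn _ 1)); apply/negP; rewrite -ltNge; apply: He.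
by rewrite /ball /= sub0r normrN gtr0_norm ?divr_gt0// ltr_pdivrMr// ltr_pMr// ltr1n.
Qed.

Lemma continuous_addX (R : realType) (n : nat) :
  {for 0, continuous (fun e : R => (1 + e) ^+ n)}.
Proof.
apply: (@continuous_comp _ _ _ (fun e : R => 1 + e) (fun x : R => x ^+ n)).
  by apply: cvgD; [exact: cvg_cst|exact: cvg_id].
exact: exprn_continuous.
Qed.

Lemma cvg_prod_seq (R : realType) (T : Type) (F : set_system T) (FF : Filter F)
    (I : Type) (s : seq I) (g : I -> T -> R) (l : I -> R) :
  (forall i, g i x @[x --> F] --> l i) ->
  (\prod_(i <- s) g i x) @[x --> F] --> \prod_(i <- s) l i.
Proof.
move=> gl; elim: s => [|i s IH].
  by under eq_fun do rewrite big_nil; rewrite big_nil; exact: cvg_cst.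
by under eq_fun do rewrite big_cons; rewrite big_cons; exact: cvgM.
Qed.

Section outer_measure.
Variables (R : realType) (n : nat).
Local Notation E := 'rV[R]_n.
Local Notation mu := (@lebesgue_outer R n).
Implicit Types (A X : set E) (f : E -> E).

Lemma outer_le A X : A `<=` X -> (mu A <= mu X)%E.
Proof. exact: le_outer_measure. Qed.

Lemma outer_obox (o : option (E * E)) : (mu (obox o) <= obox_volume o)%E.
Proof.
apply: ereal_inf_lbound => /=.
exists (fun k : nat => if k == 0%N then o else None); first by move=> x ox; exists 0%N.
rewrite (nneseries_split 0 1); last by move=> k _; exact: obox_volume_ge0.
rewrite add0n big_nat1 eseries0 ?adde0//.
by move=> [|i].
Qed.

Lemma outer_sub_seq (I : eqType) (s : seq I) (P : pred I) (F : I -> set E) A :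
  (forall x, A x -> exists i, [/\ i \in s, P i & F i x]) ->
  (mu A <= \sum_(i <- s | P i) mu (F i))%E.
Proof.
elim: s A => [|i s IH] A AF.
  rewrite big_nil (_ : A = set0) ?outer_measure0//.
  by rewrite -subset0 => x /AF[i []].
have {}IH : (mu (A `\` [set x | P i /\ F i x]) <= \sum_(j <- s | P j) mu (F j))%E.
  apply: IH => x [/AF[j [+ Pj Fj]]] /not_andP nF; rewrite inE => /orP[/eqP ji|js].
    by subst j; case: nF.
  by exists j.
rewrite big_cons; case: ifPn => Pi.
  apply: (@le_trans _ _ (mu (F i `|` (A `\` [set x | P i /\ F i x])))%E).
    by apply: outer_le => x Ax; have [?|?] := pselect (F i x); [left|right; split=> // -[]].
  by apply: (le_trans (outer_measureU2 mu _ _)); exact: leeD.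
rewrite (_ : A `\` _ = A) in IH => //.
by apply/seteqP; split => x; [case|split=> // -[]; rewrite (negbTE Pi)].
Qed.

(* The infimum of the covering sums of [A] is compared term by term. *)
Lemma outer_image_le_boxes f A (C : R) : 0 < C ->
  (forall o, (mu (f @` (A `&` obox o)) <= C%:E * obox_volume o)%E) ->
  (mu (f @` A) <= C%:E * mu A)%E.
Proof.
move=> C0 H; rewrite -lee_pdivrMl//; apply: le_ereal_inf_tmp => _ [c Ac <-].
rewrite lee_pdivrMl//.
apply: (@le_trans _ _ (\sum_(k <oo) mu (f @` (A `&` obox (c k))))%E).
  apply: le_trans (outer_measure_sigma_subadditive mu _).
  apply: outer_le => _ [x Ax <-].
  by have [k _ kx] := Ac _ Ax; exists k => //; exists x.
rewrite -nneseriesZl ?(ltW C0)//; last by move=> *; exact: obox_volume_ge0.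
by apply: lee_nneseries => k _; rewrite ?outer_measure_ge0 ?H.
Qed.

(** For the sup norm, a set of diameter at most [d] lies in the cube of side [d] whose lowest corner
    is the coordinatewise infimum. *)
Lemma outer_diam_le A (d : R) : 0 <= d ->
  (forall x y, A x -> A y -> `|x - y| <= d) -> (mu A <= (d ^+ n)%:E)%E.
Proof.
move=> d0 Ad; have [->|/set0P[x0 Ax0]] := eqVneq A set0.
  by rewrite outer_measure0 lee_fin exprn_ge0.
have Adi x y i : A x -> A y -> x 0 i - y 0 i <= d.
  move=> Ax Ay; apply: le_trans (Ad _ _ Ax Ay).
  by apply: le_trans (norm_coord_le _ i); rewrite !mxE ler_norm.
pose lo := \row_i inf [set x 0 i | x in A].
have hA i : has_inf [set x 0 i | x in A].
  split; first by exists (x0 0 i), x0.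
  by exists (x0 0 i - d) => _ [y Ay <-]; have := Adi _ _ i Ax0 Ay; lra.
apply: (@le_trans _ _ (obox_volume (Some (lo, \row_i (lo 0 i + d))))); last first.
  rewrite /= lee_fin (eq_bigr (fun=> d)) ?prodr_const ?card_ord// => i _.
  by rewrite !mxE addrAC subrr add0r; apply/max_idPr.
apply: le_trans (outer_obox _); apply: outer_le => x Ax /= i; rewrite !mxE.
apply/andP; split; first by apply: ge_inf => //; [exact: (hA i).2|exists x].
rewrite -lerBlDr; apply: lb_le_inf; first exact: (hA i).1.
by move=> _ [y Ay <-]; have := Adi _ _ i Ax Ay; lra.
Qed.

(** A box is cut into cubes of side [e]; the image of each has diameter at most [c * e], and the
    cubes exceed the box by at most [e] in each direction. The limit as [e] tends to 0 is taken on
    the polynomial [g]. *)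
Lemma outer_lipschitz f A (c : R) : 0 < c ->
  (forall x y, A x -> A y -> `|f x - f y| <= c * `|x - y|) ->
  (mu (f @` A) <= (c ^+ n)%:E * mu A)%E.
Proof.
move=> c0 fA; apply: outer_image_le_boxes; first exact: exprn_gt0.
case=> [[a b]|]; last by rewrite setI0 image_set0 outer_measure0 mule0.
have [ab|/existsNP[i /negP]] := pselect (forall i, a 0 i <= b 0 i); last first.
  rewrite -ltNge => ba; rewrite (_ : _ `&` _ = set0).
    by rewrite image_set0 outer_measure0 mule_ge0 ?obox_volume_ge0// lee_fin exprn_ge0// ltW.
  rewrite -subset0 => x [_ /(_ i)/andP[ax xb]].
  by have := lt_le_trans ba (le_trans ax xb); rewrite ltxx.
pose g (e : R) := c ^+ n * \prod_i (b 0 i - a 0 i + e).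
have cg : {for 0, continuous g}.
  apply: cvgMr; apply: (@cvg_prod_seq _ _ _ _ _ _ (fun i e => b 0 i - a 0 i + e)) => i.
  by apply: cvgD; [exact: cvg_cst|exact: cvg_id].
suff H (e : R) : 0 < e -> (mu (f @` (A `&` obox (Some (a, b)))) <= (g e)%:E)%E.
  have g0 : (mu (f @` (A `&` obox (Some (a, b)))) <= (g 0)%:E)%E.
    move: H; case: (mu _) => [r|/(_ 1 ltr01)|]// H; last exact: leNye.
    by rewrite lee_fin; apply: le_at_right0 => // e e0; rewrite -lee_fin H.
  apply: (le_trans g0); rewrite /g /= -EFinM lee_fin ler_pM2l ?exprn_gt0//.
  by apply: ler_prod => i _; rewrite addr0 subr_ge0 ab/= le_max lexx orbT.
move=> e0.
(* One cell more than the truncated quotient, as the coordinate of a point may equal [b 0 i]. All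
   indices are embedded in ['I_M] so that the choices of cells form one finite type of functions. *)
pose N i := (Num.truncn ((b 0 i - a 0 i) / e)).+1.
pose M := \max_i N i.
pose Q (i : 'I_n) := [pred j : 'I_M | (j < N i)%N].
pose cube (k : {ffun 'I_n -> 'I_M}) : set E :=
  [set x | forall i, a 0 i + (k i)%:R * e <= x 0 i <= a 0 i + (k i).+1%:R * e].
apply: (@le_trans _ _ (\sum_(k in family Q) mu (f @` (A `&` cube k)))%E).
  apply: outer_sub_seq => _ [x [Ax abx] <-].
  pose t i := Num.truncn ((x 0 i - a 0 i) / e).
  have xa i : 0 <= (x 0 i - a 0 i) / e.
    by rewrite divr_ge0 ?(ltW e0)// subr_ge0; have /andP[] := abx i.
  have tN i : (t i < N i)%N.
    rewrite ltnS; apply: le_truncn; rewrite ler_pM2r ?invr_gt0// lerD2r.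
    by have /andP[] := abx i.
  have tM i : (t i < M)%N by apply: leq_trans (tN i) _; exact: leq_bigmax.
  exists [ffun i => Ordinal (tM i)]; split => //.
  - by apply/familyP => i; rewrite ffunE; exact: tN.
  - exists x => //; split => // i; rewrite ffunE/=.
    have /andP[t1 t2] := truncn_itv (xa i).
    by rewrite -lerBrDl -ler_pdivlMr// t1/= -lerBlDl -ler_pdivrMr// ltW.
apply: (@le_trans _ _ (\sum_(k in family Q) ((c * e) ^+ n)%:E)%E).
  apply: lee_sum => k _; apply: outer_diam_le; first by rewrite mulr_ge0// ltW.
  move=> _ _ [x [Ax xk] <-] [y [Ay yk] <-]; apply: (le_trans (fA _ _ Ax Ay)).
  rewrite ler_pM2l//; apply: norm_row_le => [|i]; first exact: ltW.
  rewrite !mxE ler_norml; have /andP[] := xk i; have /andP[] := yk i.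
  by rewrite -natr1 mulrDl mul1r => *; apply/andP; split; lra.
rewrite sumEFin lee_fin /g exprMn -big_distrr/= ler_pM2l ?exprn_gt0//.
have -> : \sum_(k in family Q) e ^+ n = \sum_(k in family Q) \prod_(i < n) e.
  by apply: eq_bigr => k _; rewrite prodr_const card_ord.
rewrite -(bigA_distr_big_dep Q (fun _ _ => e)).
apply: ler_prod => i _; rewrite sumr_ge0 => [|? _]; last exact: ltW.
have NM : (N i <= M)%N by exact: leq_bigmax.
rewrite (_ : \sum_(j | Q i j) e = \sum_(j < N i) e); last first.
  by rewrite (big_ord_widen _ (fun=> e) NM).
rewrite sumr_const card_ord /=.
rewrite -mulr_natl -natr1 mulrDl mul1r lerD2r -ler_pdivlMr// truncn_le.
by rewrite divr_ge0 ?(ltW e0)// subr_ge0 ab.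
Qed.

End outer_measure.

Section linear_scaling.
Variables (R : realType) (n : nat).
Local Notation E := 'rV[R]_n.
Local Notation mu := (@lebesgue_outer R n).
Implicit Types (A : set E) (L M : 'M[R]_n) (k : R).

Definition outer_scales L k := 0 <= k /\
  forall A, (mu ((mulmx^~ L) @` A) <= k%:E * mu A)%E.

Lemma outer_scales_mul L M k l :
  outer_scales L k -> outer_scales M l -> outer_scales (L *m M) (k * l).
Proof.
move=> [k0 Lk] [l0 Ml]; split=> [|A]; first exact: mulr_ge0.
rewrite (_ : (mulmx^~ (L *m M)) @` A = (mulmx^~ M) @` ((mulmx^~ L) @` A)); last first.
  by rewrite image_comp; congr image; apply/funext => x /=; rewrite mulmxA.
apply: (le_trans (Ml _)); rewrite mulrC EFinM -muleA; apply: lee_wpmul2l.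
  by rewrite lee_fin.
exact: Lk.
Qed.

(** Boxes go to boxes; a negative factor exchanges the two ends of a side, whence [Num.min] and
    [Num.max]. *)
Lemma outer_coord_scale (s : {perm 'I_n}) (d : E) A : (forall i, d 0 i != 0) ->
  (mu ((fun x : E => \row_i (d 0 i * x 0 (s i))%R) @` A)
    <= (\prod_i `|d 0 i|)%R%:E * mu A)%E.
Proof.
move=> d0; apply: outer_image_le_boxes.
  by apply: prodr_gt0 => i _; rewrite normr_gt0.
case=> [[a b]|]; last by rewrite setI0 image_set0 outer_measure0 mule0.
have [ab|/existsNP[i /negP]] := pselect (forall i, a 0 i <= b 0 i); last first.
  rewrite -ltNge => ba; rewrite (_ : _ `&` _ = set0).
    by rewrite image_set0 outer_measure0 mule_ge0 ?obox_volume_ge0// lee_fin prodr_ge0.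
  rewrite -subset0 => x [_ /(_ i)/andP[ax xb]].
  by have := lt_le_trans ba (le_trans ax xb); rewrite ltxx.
pose lo := \row_i Num.min (d 0 i * a 0 (s i)) (d 0 i * b 0 (s i)).
pose hi := \row_i Num.max (d 0 i * a 0 (s i)) (d 0 i * b 0 (s i)).
apply: (@le_trans _ _ (obox_volume (Some (lo, hi)))).
  apply: le_trans (outer_obox _); apply: outer_le => _ [x [_ xab] <-] i.
  rewrite !mxE ge_min le_max; have /andP[ax xb] := xab (s i).
  have [d1|d1] := leP 0 (d 0 i).
    by rewrite (ler_wpM2l d1 ax) (ler_wpM2l d1 xb) orbT.
  by rewrite !(ler_nM2l d1) ax xb orbT.
rewrite /= -EFinM lee_fin [X in _ * X](reindex_inj (@perm_inj _ s))/= -big_split/=.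
apply: ler_prod => i _; rewrite le_max lexx/= !mxE.
have ba : 0 <= b 0 (s i) - a 0 (s i) by rewrite subr_ge0.
rewrite (max_idPr ba); have [d1|/ltW d1] := leP 0 (d 0 i).
  have H := ler_wpM2l d1 (ab (s i)).
  by rewrite (max_idPr H) (min_idPl H) ger0_norm// mulrBr (max_idPr _)// subr_ge0.
have H := ler_wnM2l d1 (ab (s i)).
by rewrite (max_idPl H) (min_idPr H) ler0_norm// mulNr mulrBr opprB (max_idPr _)// subr_ge0.
Qed.

Lemma outer_scales_diag (d : E) : (forall i, d 0 i != 0) ->
  outer_scales (diag_mx d) (\prod_i `|d 0 i|).
Proof.
move=> d0; split => [|A]; first exact: prodr_ge0.
rewrite (_ : mulmx^~ _ = fun x : E => \row_i (d 0 i * x 0 ((1%g : {perm 'I_n}) i))).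
  exact: outer_coord_scale.
by apply/funext => x; apply/rowP => i; rewrite mul_mx_diag !mxE perm1 mulrC.
Qed.

Lemma outer_scales_perm (s : {perm 'I_n}) : outer_scales (perm_mx s) 1.
Proof.
split => // A.
have -> : mulmx^~ (perm_mx s) =
    fun x : E => \row_i ((const_mx 1 : E) 0 i * x 0 ((s^-1)%g i)).
  apply/funext => x; apply/rowP => i; rewrite -[s in LHS]invgK -col_permE !mxE mul1r.
  by [].
apply: (le_trans (outer_coord_scale _ _ _)); first by move=> i; rewrite mxE oner_neq0.
by rewrite (eq_bigr (fun=> 1)) => [|i _]; rewrite ?big1_eq// mxE normr1.
Qed.

Lemma outer_scales_cvg L (g : R -> R) : {for 0, continuous g} -> 0 < g 0 ->
  (forall e, 0 < e -> outer_scales L (g e)) -> outer_scales L (g 0).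
Proof.
move=> cg g0 H; split => [|A]; first exact: ltW.
have a0 : (0 <= mu A)%E := outer_measure_ge0 mu A; case mA : (mu A) => [a| |]; last 2 first.
- by rewrite gt0_muley ?leey.
- by move: a0; rewrite mA.
have : forall e, 0 < e -> (mu ((mulmx^~ L) @` A) <= (g e * a)%:E)%E.
  by move=> e e0; rewrite EFinM -mA (H e e0).2.
case: (mu _) => [y|/(_ 1 ltr01)|]// Hy; last exact: leNye.
rewrite -EFinM lee_fin; apply: (@le_at_right0 _ (fun e => g e * a)) => [|e e0].
  by apply: cvgM => //; exact: cvg_cst.
by rewrite -lee_fin Hy.
Qed.

(* Conjugation by [diag (e ^+ w)] sends a unipotent matrix whose off-diagonal
   entries decrease [w] to one at distance O(e) from the identity. *)
Lemma outer_scales_unipotent L (w : 'I_n -> nat) : (forall i, L i i = 1) ->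
  (forall i j, i != j -> L i j != 0 -> (w j < w i)%N) -> outer_scales L 1.
Proof.
move=> L1 Lw.
pose C := \sum_i \sum_j `|L i j|.
have C0 : 0 <= C by apply: sumr_ge0 => i _; apply: sumr_ge0.
pose g (e : R) := (1 + C * e) ^+ n.
have g0 : g 0 = 1 by rewrite /g mulr0 addr0 expr1n.
have cg : {for 0, continuous g}.
  apply: (@continuous_comp _ _ _ (fun e : R => 1 + C * e) (fun x => x ^+ n)); last exact: exprn_continuous.
  by apply: cvgD; [exact: cvg_cst|apply: cvgMr; exact: cvg_id].
rewrite -g0; apply: outer_scales_cvg => //; first by rewrite g0.
move=> e' e'0; pose e := Num.min e' 1.
have e0 : 0 < e by rewrite lt_min e'0 ltr01.
have e1 : e <= 1 by rewrite ge_min lexx orbT.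
pose d : E := \row_i e ^+ w i; pose d' : E := \row_i (e ^+ w i)^-1.
have d0 i : 0 < d 0 i by rewrite mxE exprn_gt0.
have d'0 i : 0 < d' 0 i by rewrite mxE invr_gt0 exprn_gt0.
pose L' : 'M[R]_n := \matrix_(i, j) (e ^+ w i * L i j / e ^+ w j).
have LE : L = diag_mx d' *m (L' *m diag_mx d).
  apply/matrixP => i j; rewrite mul_diag_mx mul_mx_diag !mxE.
  by field; rewrite !expf_neq0 ?gt_eqF.
have scL' : outer_scales L' (g e).
  split => [|A]; first by rewrite /g exprn_ge0// addr_ge0// mulr_ge0// ltW.
  apply: outer_lipschitz => [|x y _ _]; first by rewrite ltr_wpDr// mulr_ge0// ltW.
  rewrite -mulmxBl; set v := x - y; apply: norm_row_le => [|j].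
    by rewrite mulr_ge0// addr_ge0// mulr_ge0// ltW.
  rewrite mxE (bigD1 j)//= mulrDl mul1r; apply: (le_trans (ler_normD _ _)).
  apply: lerD.
    by rewrite [L' j j]mxE L1 mulr1 divff ?mulr1 ?norm_coord_le// expf_neq0// gt_eqF.
  apply: (le_trans (ler_norm_sum _ _ _)).
  apply: (@le_trans _ _ (\sum_i `|v| * (`|L i j| * e))).
    rewrite [leRHS](bigID (fun i => i != j))/= ler_wpDr//.
      by apply: sumr_ge0 => i _; rewrite !mulr_ge0// ltW.
    apply: ler_sum => i ij; rewrite normrM ler_pM ?norm_coord_le// [L' i j]mxE.
    have [->|Lij] := eqVneq (L i j) 0; first by rewrite mulr0 mul0r normr0 mul0r.
    have wij := Lw _ _ ij Lij.
    rewrite mulrAC mulrC normrM ler_wpM2l// -expfB// ger0_norm ?exprn_ge0 ?(ltW e0)//.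
    by rewrite -{2}[e]expr1 ler_wiXn2l ?(ltW e0)// subn_gt0.
  rewrite -mulr_sumr mulrC ler_wpM2r// -mulr_suml ler_wpM2r ?(ltW e0)//.
  by apply: ler_sum => i _; rewrite (bigD1 j)//= lerDl sumr_ge0.
have : outer_scales L (g e).
  have -> : g e = (\prod_i `|d' 0 i|) * (g e * \prod_i `|d 0 i|).
    rewrite mulrCA -big_split/= big1 ?mulr1// => i _.
    by rewrite !gtr0_norm// !mxE mulVf// expf_neq0// gt_eqF.
  rewrite LE; apply: outer_scales_mul; first by apply: outer_scales_diag => i; rewrite gt_eqF.
  by apply: outer_scales_mul => //; apply: outer_scales_diag => i; rewrite gt_eqF.
move=> [ge0 H]; have gg : g e <= g e'.
  rewrite /g lerXn2r ?nnegrE ?addr_ge0 ?mulr_ge0 ?(ltW e0) ?(ltW e'0)//.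
  by rewrite lerD2l ler_wpM2l// ge_min lexx.
split => [|A]; first exact: le_trans gg.
by apply: (le_trans (H A)); apply: lee_wpmul2r; rewrite ?outer_measure_ge0// lee_fin.
Qed.

End linear_scaling.

(** The LUP decomposition leads to permutations, diagonal matrices and unipotent triangular ones,
    the upper factor being a diagonal matrix times a unipotent one. The weights [i] and [n - i]
    decrease along the off-diagonal entries of lower and upper triangular matrices respectively. *)
Lemma outer_scales_det (R : realType) (n : nat) (A : 'M[R]_n) :
  A \in unitmx -> outer_scales A `|\det A|.
Proof.
case: n A => [A _|n A uA].
  rewrite det_mx00 normr1; split => // X; rewrite mul1e; apply: outer_le => _ [x Xx <-].
  by rewrite [x *m A]thinmx0; rewrite [x]thinmx0 in Xx.
have := cormen_lup_correct A; have := cormen_lup_perm A; have := cormen_lup_lower A.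
have := cormen_lup_upper A; have := cormen_lup_detL A.
case: (cormen_lup A) => [[P L] U] /= dL Uu Ll /is_perm_mxP[s ->] PA.
have AE : A = perm_mx (s^-1)%g *m (L *m U).
  by rewrite -mulmxE in PA; rewrite -PA mulmxA -perm_mxM mulVg perm_mx1 mul1mx.
have dU : \det U = \prod_i U i i.
  rewrite -det_tr det_trig; first by apply: eq_bigr => i _; rewrite mxE.
  by apply/is_trig_mxP => i j ij; rewrite mxE Uu.
have dA : `|\det A| = `|\det U|.
  by rewrite AE !det_mulmx det_perm dL mul1r normrM normr_sign mul1r.
have U0 i : U i i != 0.
  have : \prod_i U i i != 0.
    by rewrite -dU -normr_eq0 -dA normr_eq0 -unitfE -unitmxE.
  by move/prodf_neq0; apply.
pose u : 'rV[R]_n.+1 := \row_i U i i.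
pose V : 'M[R]_n.+1 := \matrix_(i, j) (U i j / U i i).
have UE : U = diag_mx u *m V.
  by apply/matrixP => i j; rewrite mul_diag_mx !mxE mulrC divfK.
(* The factors belong, in this order, to the permutation, the lower matrix, the diagonal and the
   unipotent upper matrix. *)
have -> : `|\det A| = 1 * (1 * (`|\det A| * 1)) by rewrite !mul1r mulr1.
rewrite {1}AE; apply: outer_scales_mul; first exact: outer_scales_perm.
apply: outer_scales_mul.
  apply: (@outer_scales_unipotent _ _ _ (fun i => i : nat)) => [i|i j ij].
    by rewrite Ll// eqxx.
  by apply: contraNltn => ji; rewrite Ll// (negbTE ij).
rewrite UE; apply: outer_scales_mul.
  rewrite dA dU normr_prod (eq_bigr (fun i => `|u 0 i|)) => [|i _]; last by rewrite mxE.
  by apply: outer_scales_diag => i; rewrite mxE.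
apply: (@outer_scales_unipotent _ _ _ (fun i => n - i)%N) => [i|i j ij].
  by rewrite mxE divff.
rewrite mxE mulf_eq0 negb_or => /andP[Uij _].
have : (i < j)%N.
  by rewrite ltn_neqAle ij/= leqNgt; apply: contraNN Uij => ji; rewrite Uu.
by have := ltn_ord j; lia.
Qed.

(** The interval from [a] to [b] is cut at [c]; empty parts count as having length 0. *)
Lemma max_split_le (R : realDomainType) (a b c : R) :
  Num.max 0 (Num.min b c - a) + Num.max 0 (b - Num.max a c) <= Num.max 0 (b - a).
Proof.
have [bc|bc] := leP b c; have [ac|ac] := leP a c; rewrite le_max;
  [set x := b - a; set y := b - c|set x := b - a; set y := b - a
  |set x := c - a; set y := b - c|set x := c - a; set y := b - a];
  have [x0|x0] := leP 0 x; have [y0|y0] := leP 0 y; apply/orP;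
  rewrite /x /y in x0 y0 *; solve [left; lra|right; lra].
Qed.

Section lebesgue_measurable.
Variables (R : realType) (n : nat).
Local Notation E := 'rV[R]_n.
Local Notation mu := (@lebesgue_outer R n).
Local Notation T := (lebesgueRn R n).
Implicit Types (A : set E) (x y z : E).

(** Each box of a cover is cut by the hyperplane into two boxes whose volumes add up to at most its
    own, by [max_split_le] in the direction [i]; this is Carathéodory's criterion. *)
Lemma measurable_halfspace (i : 'I_n) (c : R) : measurable ([set x : E | x 0 i < c] : set T).
Proof.
apply: (@le_caratheodory_measurable _ _ mu) => X.
apply: le_ereal_inf_tmp => _ [k Xk <-].
pose lo (o : option (E * E)) : option (E * E) := if o is Some (a, b) then
  Some (a, \row_j (if j == i then Num.min (b 0 j) c else b 0 j)) else None.
pose hi (o : option (E * E)) : option (E * E) := if o is Some (a, b) then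
  Some (\row_j (if j == i then Num.max (a 0 j) c else a 0 j), b) else None.
have ge0 o : (0 <= obox_volume o :> \bar R)%E by exact: obox_volume_ge0.
apply: (@le_trans _ _ (\sum_(j <oo) obox_volume (lo (k j)) +
                       \sum_(j <oo) obox_volume (hi (k j)))%E).
  apply: leeD; apply: ereal_inf_lbound.
    exists (lo \o k) => // x [Xx /= xc]; have [j _ kj] := Xk _ Xx; exists j => //=.
    case: (k j) kj => [[a b]|//] /= kj l; have := kj l; rewrite mxE.
    by case: eqP => [->|//] /andP[-> xb]; rewrite le_min xb ltW.
  exists (hi \o k) => // x [Xx /= /negP]; rewrite -leNgt => xc.
  have [j _ kj] := Xk _ Xx; exists j => //=.
  case: (k j) kj => [[a b]|//] /= kj l; have := kj l; rewrite mxE.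
  by case: eqP => [->|//] /andP[xa ->]; rewrite ge_max xa xc.
rewrite -nneseriesD//; apply: lee_nneseries => j _; first by rewrite adde_ge0.
case: (k j) => [[a b]|] /=; last by rewrite adde0.
rewrite -EFinD lee_fin [X in X + _ <= _](bigD1 i)//= [X in _ + X <= _](bigD1 i)//= [leRHS](bigD1 i)//= !mxE eqxx.
under eq_bigr => l /negbTE li do rewrite mxE li.
under [X in _ + _ * X <= _]eq_bigr => l /negbTE li do rewrite mxE li.
rewrite -mulrDl; apply: ler_wpM2r.
  by apply: prodr_ge0 => l _; rewrite le_max lexx.
exact: max_split_le.
Qed.

Lemma measurable_coord (i : 'I_n) : measurable_fun setT (fun x : T => x 0 i).
Proof.
apply: (measurability _ (RGenInftyO.measurableE R)) => _ [_ [c ->] <-].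
rewrite setTI; have -> : (fun x : T => x 0 i) @^-1` `]-oo, c[ = [set x : E | x 0 i < c].
  by apply/seteqP; split => x /=; rewrite in_itv.
exact: measurable_halfspace.
Qed.

(** Open cubes with rational centres and inverse integer radii. This countable base turns local
    estimates into countable covers; it is enumerated through [unpickle], with the empty set for the
    codes of no relevant cube. *)
Definition ratcell (p : 'rV[rat]_n * nat) : set E :=
  [set x | `|map_mx ratr p.1 - x| < p.2.+1%:R^-1].

Lemma ratcell_closed_small z (r : R) : 0 < r -> exists2 p, ratcell p z &
  forall x, `|map_mx ratr p.1 - x| <= p.2.+1%:R^-1 -> `|x - z| < r.
Proof.
move=> r0; have [k kr] : exists k : nat, k.+1%:R^-1 < r / 2.
  exists (Num.truncn (r / 2)^-1).
  by rewrite invf_plt ?posrE ?divr_gt0// truncnS_gt.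
have k0 : 0 < k.+1%:R^-1 / 2 :> R by rewrite divr_gt0.
have /choice[q qz] i : exists q : rat, `|ratr q - z 0 i| < k.+1%:R^-1 / 2.
  have [q] : exists q : rat, ratr q \in `](z 0 i - k.+1%:R^-1 / 2), (z 0 i + k.+1%:R^-1 / 2)[.
    by apply: rat_in_itvoo; rewrite ltrD2l (lt_trans _ k0)// oppr_lt0.
  by rewrite in_itv/= => H; exists q; rewrite ltr_distl.
have pz : ratcell (\row_i q i, k) z.
  rewrite /ratcell/=; apply: (@le_lt_trans _ _ (k.+1%:R^-1 / 2)).
    by apply: norm_row_le => [|i]; rewrite ?(ltW k0)// !mxE ltW.
  by rewrite ltr_pdivrMr// ltr_pMr ?invr_gt0// ltr1n.
exists (\row_i q i, k) => // x /= px; move: pz; rewrite /ratcell/= => pz.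
have -> : x - z = (map_mx ratr (\row_i q i) - z) - (map_mx ratr (\row_i q i) - x).
  by rewrite opprB [RHS]addrC subrKA.
apply: (le_lt_trans (ler_normB _ _)); rewrite (splitr r).
by apply: ltrD; [exact: lt_trans kr|exact: le_lt_trans kr].
Qed.

Lemma ratcell_small z (r : R) : 0 < r ->
  exists2 p, ratcell p z & forall x, ratcell p x -> `|x - z| < r.
Proof.
by move=> /(ratcell_closed_small z)[p pz pr]; exists p => // x /ltW; exact: pr.
Qed.

Lemma measurable_ratcell p : measurable (ratcell p : set T).
Proof.
have e0 : 0 < p.2.+1%:R^-1 :> R by [].
have -> : ratcell p = \bigcap_(i in [set: 'I_n]) ((fun x : T => x 0 i) @^-1`
   `](ratr (p.1 0 i) - p.2.+1%:R^-1), (ratr (p.1 0 i) + p.2.+1%:R^-1)[).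
  apply/seteqP; split => x /=.
    move=> px i _ /=; rewrite in_itv/=.
    by have := le_lt_trans (norm_coord_le _ i) px; rewrite !mxE distrC ltr_distl.
  move=> px; rewrite /ratcell/= [X in X < _]mx_normrE.
  apply/bigmax_ltP; split => // -[i j] _; rewrite !mxE /= ord1 distrC ltr_distl.
  by have := px j Logic.I; rewrite /= in_itv/=.
apply: fin_bigcap_measurable => // i _; rewrite -[X in measurable X]setTI.
by apply: measurable_coord.
Qed.

Lemma open_measurableRn A : open A -> measurable (A : set T).
Proof.
move=> oA; pose F k : set E := if unpickle k is Some p then
  (if pselect (ratcell p `<=` A) then ratcell p else set0) else set0.
have -> : A = \bigcup_k F k.
  apply/seteqP; split => x; last first.
    move=> [k _]; rewrite /F; case: unpickle => // p; case: pselect => //= pA px.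
    exact: pA.
  move=> Ax; have /nbhs_ballP[r /= r0 rA] : nbhs x A by exact: open_nbhs_nbhs.
  have [p px pr] := ratcell_small x r0; exists (pickle p) => //.
  rewrite /F pickleK; case: pselect => // npA; exfalso; apply: npA => y /pr yx.
  by apply: rA; rewrite -ball_normE /ball_/= distrC.
apply: bigcupT_measurable => k; rewrite /F; case: unpickle => [p|]; last exact: measurable0.
by case: pselect => ?; [exact: measurable_ratcell|exact: measurable0].
Qed.

Lemma closed_measurableRn A : closed A -> measurable (A : set T).
Proof.
by move=> cA; rewrite -[A]setCK; apply: measurableC; apply: open_measurableRn; exact: closed_openC.
Qed.

Lemma continuous_measurableRn (f : E -> R) : continuous f -> measurable_fun (setT : set T) f.
Proof.
move=> cf; apply: (measurability _ (RGenInftyO.measurableE R)) => _ [_ [c ->] <-].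
rewrite setTI; apply: open_measurableRn; apply: open_comp => // x _; exact: cf.
Qed.

Lemma null_measurableRn A : mu A = 0%E -> measurable (A : set T).
Proof.
move=> A0; apply: (@le_caratheodory_measurable _ _ mu) => X.
apply: (@le_trans _ _ (0 + mu X)%E); last by rewrite add0e.
apply: leeD; last exact: outer_le.
by rewrite -A0; exact: outer_le.
Qed.

(* [f] is close to the composition of a (1+e)-Lipschitz map with [L] near [z]. *)
Lemma outer_C1_image (f : E -> E) A (w : R) :
  (forall z, A z -> exists L : 'M[R]_n, [/\ L \in unitmx, `|\det L| <= w &
     forall e, 0 < e -> exists2 r, 0 < r & forall x y, A x -> A y ->
       `|x - z| < r -> `|y - z| < r -> `|f x - f y - (x - y) *m L| <= e * `|x - y|]) ->
  (mu (f @` A) <= w%:E * mu A)%E.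
Proof.
move=> H; have [->|/set0P[z0 Az0]] := eqVneq A set0.
  by rewrite image_set0 outer_measure0 mule0.
have w0 : 0 < w.
  have [L [uL Lw _]] := H _ Az0; apply: lt_le_trans Lw.
  by rewrite normr_gt0 -unitfE -unitmxE.
suff HH e : 0 < e -> (mu (f @` A) <= (w * (1 + e) ^+ n)%:E * mu A)%E.
  have : (0 <= mu A)%E := outer_measure_ge0 mu A.
  case mA : (mu A) => [a| |//] a0; last by rewrite gt0_muley ?leey.
  have : forall e, 0 < e -> (mu (f @` A) <= (w * (1 + e) ^+ n * a)%:E)%E.
    by move=> e e0; rewrite EFinM -mA HH.
  case: (mu _) => [y|/(_ 1 ltr01)|]// Hy; last exact: leNye.
  rewrite -EFinM lee_fin.
  have -> : w * a = w * (1 + 0) ^+ n * a by rewrite addr0 expr1n mulr1.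
  apply: (@le_at_right0 _ (fun e => w * (1 + e) ^+ n * a)) => [|e e0].
    by apply: cvgMl; apply: cvgMr; exact: continuous_addX.
  by rewrite -lee_fin Hy.
move=> e0; set w' := w * _.
have w'0 : 0 < w' by rewrite mulr_gt0// exprn_gt0// addr_gt0.
(* All subsets of the cell must satisfy the estimate, so that it passes to the disjoint pieces
   [seqDU F k]. These are measurable, hence the measures of the parts of [A] in them add up to at
   most that of [A]. *)
pose good p := forall B, B `<=` A `&` ratcell p -> (mu (f @` B) <= w'%:E * mu B)%E.
have Hgood z : A z -> exists2 p, good p & ratcell p z.
  move=> Az; have [L [uL Lw Ld]] := H _ Az.
  pose C := 1 + \sum_i \sum_j `|invmx L i j|.
  have C0 : 0 < C by rewrite ltr_wpDr// sumr_ge0// => i _; rewrite sumr_ge0.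
  have CL (v : E) : `|v *m invmx L| <= C * `|v|.
    apply: norm_row_le => [|j]; first by rewrite mulr_ge0// ltW.
    rewrite mxE; apply: (le_trans (ler_norm_sum _ _ _)).
    apply: (@le_trans _ _ (\sum_i `|v| * `|invmx L i j|)).
      by apply: ler_sum => i _; rewrite normrM ler_wpM2r// norm_coord_le.
    rewrite -mulr_sumr mulrC ler_wpM2r// ler_wpDl//.
    by apply: ler_sum => i _; rewrite (bigD1 j)//= lerDl sumr_ge0.
  have [r r0 Hr] := Ld (e / C) (divr_gt0 e0 C0).
  have [p pz pr] := ratcell_small z r0; exists p => // B BA.
  have LipB x y : B x -> B y -> `|f x *m invmx L - f y *m invmx L| <= (1 + e) * `|x - y|.
    move=> /BA[Ax px] /BA[Ay py]; rewrite -mulmxBl.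
    have -> : (f x - f y) *m invmx L = (x - y) + (f x - f y - (x - y) *m L) *m invmx L.
      by rewrite [X in _ = _ + X]mulmxBl mulmxK// [RHS]addrC subrK.
    rewrite mulrDl mul1r; apply: (le_trans (ler_normD _ _)); rewrite lerD2l.
    apply: (le_trans (CL _)); rewrite -ler_pdivlMl// mulrA [C^-1 * _]mulrC.
    by apply: Hr => //; apply: pr.
  have [_ /(_ ((fun x => f x *m invmx L) @` B)) H1] := outer_scales_det uL.
  rewrite image_comp (_ : image _ _ = f @` B) in H1; last first.
    by apply: eq_imagel => x _ /=; rewrite mulmxKV.
  apply: (le_trans H1); rewrite EFinM -muleA.
  apply: (@le_trans _ _ (w%:E * mu ((fun x => f x *m invmx L) @` B))%E).
    by apply: lee_wpmul2r; rewrite ?outer_measure_ge0// lee_fin.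
  apply: lee_wpmul2l; first by rewrite lee_fin ltW.
  by apply: outer_lipschitz => //; rewrite addr_gt0.
pose F k : set E := if unpickle k is Some p then
  (if pselect (good p) then ratcell p else set0) else set0.
have mF k : measurable (F k : set T).
  rewrite /F; case: unpickle => [p|]; last exact: measurable0.
  by case: pselect => ?; [exact: measurable_ratcell|exact: measurable0].
have FG k B : B `<=` A `&` F k -> (mu (f @` B) <= w'%:E * mu B)%E.
  rewrite /F; case: unpickle => [p|]; last first.
    by rewrite setI0 subset0 => ->; rewrite image_set0 outer_measure0 mule0.
  case: pselect => [gp|?]; first exact: gp.
  by rewrite setI0 subset0 => ->; rewrite image_set0 outer_measure0 mule0.
have AF : A `<=` \bigcup_k seqDU F k.
  rewrite -seqDU_bigcup_eq => z /Hgood[p gp pz]; exists (pickle p) => //.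
  by rewrite /F pickleK; case: pselect.
apply: (@le_trans _ _ (\sum_(k <oo) mu (f @` (A `&` seqDU F k)))%E).
  apply: le_trans (outer_measure_sigma_subadditive mu _).
  apply: outer_le => _ [x Ax <-]; have [k _ kx] := AF _ Ax.
  by exists k => //; exists x.
apply: (@le_trans _ _ (\sum_(k <oo) w'%:E * mu (A `&` seqDU F k))%E).
  apply: lee_nneseries => k _; first by move=> _; exact: outer_measure_ge0.
  by apply: FG => x [Ax kx]; split => //; exact: subset_seqDU kx.
rewrite nneseriesZl; last by move=> *; exact: outer_measure_ge0.
apply: lee_wpmul2l; first by rewrite lee_fin ltW.
apply: le_trans (caratheodory_lime_le _ _ A); last exact: trivIset_seqDU.
  by rewrite leeDl// outer_measure_ge0.
by move=> k; exact: (seqDU_measurable mF).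
Qed.

(** Countably many rational cells suffice, each with its own Lipschitz constant. *)
Lemma outer_null_image (f : E -> E) A :
  (forall z, A z -> exists C r, [/\ 0 < C, 0 < r & forall x y, A x -> A y ->
     `|x - z| < r -> `|y - z| < r -> `|f x - f y| <= C * `|x - y|]) ->
  mu A = 0%E -> mu (f @` A) = 0%E.
Proof.
move=> H A0; pose good p := mu (f @` (A `&` ratcell p)) = 0%E.
pose F k : set E := if unpickle k is Some p then
  (if pselect (good p) then f @` (A `&` ratcell p) else set0) else set0.
have F0 k : mu (F k) = 0%E.
  rewrite /F; case: unpickle => [p|]; last exact: outer_measure0.
  by case: pselect => // ?; exact: outer_measure0.
apply/eqP; rewrite eq_le outer_measure_ge0 andbT.
have -> : (0 = \sum_(k <oo) mu (F k))%E by rewrite eseries0.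
apply: le_trans (outer_measure_sigma_subadditive mu F); apply: outer_le => _ [z Az <-].
have [C [r [C0 r0 Hr]]] := H _ Az; have [p pz pr] := ratcell_small z r0.
exists (pickle p) => //; rewrite /F pickleK; case: pselect => [?|np]; first by exists z.
exfalso; apply: np; apply/eqP; rewrite eq_le outer_measure_ge0 andbT.
apply: (@le_trans _ _ ((C ^+ n)%:E * mu (A `&` ratcell p))%E).
  by apply: outer_lipschitz => // x y [Ax /pr ?] [Ay /pr ?]; exact: Hr.
rewrite (_ : mu (A `&` ratcell p) = 0)%E ?mule0//.
by apply/eqP; rewrite eq_le outer_measure_ge0 andbT -A0; exact: outer_le.
Qed.

End lebesgue_measurable.

(** * Translation invariance and outer regularity *)

Section lebesgue_translation.
Variables (R : realType) (n : nat).
Local Notation E := 'rV[R]_n.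
Local Notation mu := (@leb R n).
Local Notation T := (lebesgueRn R n).
Implicit Types (A : set E) (x y a : E).

Lemma leb_shift_image a A : mu ((+%R a) @` A) = mu A.
Proof.
have le b B : (mu ((+%R b) @` B) <= mu B)%E.
  have := @outer_lipschitz R n (+%R b) B 1 ltr01; rewrite expr1n mul1e; apply.
  by move=> x y _ _; rewrite mul1r opprD addrACA subrr add0r.
apply/eqP; rewrite eq_le le/=.
have {1}-> : A = (+%R (- a)) @` ((+%R a) @` A); last exact: le.
rewrite image_comp (_ : _ \o _ = id) ?image_id//.
by apply/funext => x; exact: addKr.
Qed.

Lemma leb_shift a A : mu ((+%R a) @^-1` A) = mu A.
Proof.
rewrite -(leb_shift_image a); congr (mu _); apply/seteqP; split => x.
  by move=> [y /= ? <-].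
by move=> Ax; exists (- a + x); rewrite /= addrA subrr add0r.
Qed.

Lemma leb_shift_le a A B : (+%R a) @` A `<=` B -> (@lebesgue_outer R n A <= @lebesgue_outer R n B)%E.
Proof. by move=> AB; rewrite -[leLHS](leb_shift_image a); exact: outer_le. Qed.

Lemma measurable_shift a : measurable_fun setT (+%R a : T -> T).
Proof.
move=> _ A mA; rewrite setTI.
apply: (@le_caratheodory_measurable _ _ (@lebesgue_outer R n)) => X.
have mX := mA ((+%R a) @` X).
apply: (@le_trans _ _ (@lebesgue_outer R n ((+%R a) @` X))).
  rewrite mX; apply: leeD; apply: (@leb_shift_le a) => _ [x [Xx Ax] <-];
  by split => //; exists x.
by apply: (@leb_shift_le (- a)) => _ [_ [x Xx <-] <-]; rewrite addKr.
Qed.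

Lemma integral_pushforward_shift a (f : T -> \bar R) :
  (\int[pushforward mu (+%R a : T -> T)]_y f y = \int[mu]_x f x)%E.
Proof.
refine (@eq_measure_integral _ T R setT mu (pushforward mu (+%R a : T -> T)) f _) => A _ _.
exact: leb_shift.
Unshelve. exact: measurable_shift.
Qed.

Lemma ge0_integral_shift a (f : E -> \bar R) : measurable_fun (setT : set T) f ->
  (forall x, (0 <= f x)%E) -> (\int[mu]_x f (a + x)%R = \int[mu]_x f x)%E.
Proof.
move=> mf f0.
have := ge0_integral_pushforward (measurable_shift a) mu measurableT mf (fun x _ => f0 x).
by rewrite preimage_setT integral_pushforward_shift => ->.
Qed.

Lemma integrable_shift a (f : E -> \bar R) : mu.-integrable setT f ->
  mu.-integrable setT (fun x => f (a + x)).
Proof.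
move=> /integrableP[mf fi]; apply/integrableP; split.
  exact: (measurableT_comp mf (measurable_shift a)).
have mf' : measurable_fun (setT : set T) (fun x => `|f x|%E) by exact: measurableT_comp.
by rewrite (ge0_integral_shift a mf' (fun=> abse_ge0 _)).
Qed.

Lemma integral_shift a (f : E -> \bar R) : mu.-integrable setT f ->
  (\int[mu]_x f (a + x)%R = \int[mu]_x f x)%E.
Proof.
move=> fi; have mf := measurable_int _ fi.
have := @integral_pushforward _ _ _ _ _ _ (measurable_shift a) mu setT f mf
  (integrable_shift a fi) measurableT.
by rewrite preimage_setT integral_pushforward_shift => ->.
Qed.

Lemma leb_bounded_lty A : bounded_set A -> (mu A < +oo)%E.
Proof.
move=> /pinfty_ex_gt0[M M0 AM]; apply: (@le_lt_trans _ _ ((M + M) ^+ n)%:E); last exact: ltry.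
apply: outer_diam_le => [|x y Ax Ay]; first by rewrite addr_ge0// ltW.
by apply: (le_trans (ler_normB _ _)); apply: lerD; exact: AM.
Qed.

Lemma obox_open_cover (o : option (E * E)) (e : R) : 0 < e ->
  exists O : set E, [/\ open O, obox o `<=` O & (mu O <= obox_volume o + e%:E)%E].
Proof.
move=> e0; case: o => [[a b]|]; last first.
  exists set0; split; [exact: open0|by []|].
  by rewrite measure0 add0e lee_fin ltW.
pose g (t : R) := \prod_i Num.max 0 (b 0 i - a 0 i + t *+ 2).
have cg : {for 0, continuous g}.
  apply: (@cvg_prod_seq _ _ _ _ _ _ (fun i t => Num.max 0 (b 0 i - a 0 i + t *+ 2))) => i.
  have H : (b 0 i - a 0 i + t *+ 2) @[t --> (0 : R)] --> b 0 i - a 0 i + 0 *+ 2.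
    by apply: cvgD; [exact: cvg_cst|apply: cvgMn; exact: cvg_id].
  exact: (@continuous_max _ _ (cst 0) (fun t => b 0 i - a 0 i + t *+ 2) 0 (cvg_cst _) H).
have /nbhs_ballP[d /= d0 Hd] : \forall t \near (0 : R), g t < g 0 + e.
  by apply: cvgr_lt cg _ _; rewrite ltrDl.
pose t := d / 2; have t0 : 0 < t by rewrite divr_gt0.
have gt : g t < g 0 + e.
  by apply: Hd; rewrite /ball/= sub0r normrN gtr0_norm// ltr_pdivrMr// ltr_pMr// ltr1n.
exists (\bigcap_(i in [set` enum 'I_n]) ((fun x : E => x 0 i) @^-1` `](a 0 i - t), (b 0 i + t)[)).
split.
- rewrite bigcap_seq; apply: big_ind => [||i _]; [exact: openT|exact: openI|].
  by apply: open_comp => // x _; exact: coord_continuous.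
- by move=> x /= abx i _; rewrite /= in_itv/=; have /andP[] := abx i; lra.
- apply: (@le_trans _ _ (obox_volume (Some (\row_i (a 0 i - t), \row_i (b 0 i + t))))).
    apply: le_trans (outer_obox _); apply: outer_le => x xab i; rewrite !mxE.
    by have := xab i (mem_enum _ i); rewrite /= in_itv/= => /andP[/ltW -> /ltW ->].
  rewrite /= -EFinD lee_fin; have -> : \prod_i Num.max 0 (b 0 i - a 0 i) = g 0.
    by apply: eq_bigr => i _; rewrite mul0rn addr0.
  apply: le_trans (ltW gt); rewrite le_eqVlt; apply/orP; left; apply/eqP.
  by apply: eq_bigr => i _; rewrite !mxE mulr2n; congr (Num.max 0 _); ring.
Qed.

(** Each box of a nearly optimal cover is enlarged to an open set at a geometric share of the
    error. *)
Lemma leb_outer_regular A (e : R) : (mu A < +oo)%E -> 0 < e ->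
  exists O : set E, [/\ open O, A `<=` O & (mu O <= mu A + e%:E)%E].
Proof.
move=> Aoo e0; have e20 : 0 < e / 2 by rewrite divr_gt0.
have Af : mu A \is a fin_num by rewrite ge0_fin_numE.
have [_ [c Ac <-] Hc] := lb_ereal_inf_adherent e20 Af.
have pos2 k : 0 < e / 2 / (2 ^ k.+1)%:R.
  by rewrite divr_gt0// ltr0n expn_gt0.
have /choice[U HU] := fun k => obox_open_cover (c k) (pos2 k).
exists (\bigcup_k U k); split.
- by apply: bigcup_open => k _; have [] := HU k.
- by move=> x /Ac[k _ kx]; exists k => //; have [_ + _] := HU k; exact.
- apply: (le_trans (outer_measure_sigma_subadditive (@lebesgue_outer R n) U)).
  apply: (@le_trans _ _ (\sum_(k <oo) (obox_volume (c k) + (e / 2 / (2 ^ k.+1)%:R)%:E)))%E.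
    by apply: lee_nneseries => k _; [move=> _; exact: outer_measure_ge0|have [] := HU k].
  apply: le_trans (epsilon_trick _ _ _) _; [|exact: ltW|].
    by move=> k; exact: obox_volume_ge0.
  rewrite [e in leRHS]splitr EFinD addeA leeD2r//; exact: ltW.
Qed.

End lebesgue_translation.

(** * Strict derivatives *)

Section dot_product.
Variables (R : realType) (n : nat).
Implicit Types (x y v : 'rV[R]_n) (M : 'M[R]_n).

Lemma dotpE x y : dotp x y = (x *m y^T) 0 0.
Proof. by rewrite mxE; apply: eq_bigr => i _; rewrite mxE. Qed.

Lemma dotpC x y : dotp x y = dotp y x.
Proof. by apply: eq_bigr => i _; rewrite mulrC. Qed.

Lemma dotpDl x y v : dotp (x + y) v = dotp x v + dotp y v.
Proof. by rewrite !dotpE mulmxDl mxE. Qed.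

Lemma dotpDr x y v : dotp v (x + y) = dotp v x + dotp v y.
Proof. by rewrite !(dotpC v) dotpDl. Qed.

Lemma dotpZl a x y : dotp (a *: x) y = a * dotp x y.
Proof. by rewrite !dotpE -scalemxAl mxE. Qed.

Lemma dotpZr a x y : dotp x (a *: y) = a * dotp x y.
Proof. by rewrite !(dotpC x) dotpZl. Qed.

Lemma dotpNl x y : dotp (- x) y = - dotp x y.
Proof. by rewrite -scaleN1r dotpZl mulN1r. Qed.

Lemma dotpNr x y : dotp x (- y) = - dotp x y.
Proof. by rewrite !(dotpC x) dotpNl. Qed.

Lemma dotpBl x y v : dotp (x - y) v = dotp x v - dotp y v.
Proof. by rewrite dotpDl dotpNl. Qed.

Lemma dotpBr x y v : dotp v (x - y) = dotp v x - dotp v y.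
Proof. by rewrite dotpDr dotpNr. Qed.

Lemma dotp0l x : dotp 0 x = 0.
Proof. by rewrite dotpE mul0mx mxE. Qed.

Lemma dotp0r x : dotp x 0 = 0.
Proof. by rewrite dotpC dotp0l. Qed.

Lemma dotp_mulmxl x y M : dotp (x *m M) y = dotp x (y *m M^T).
Proof. by rewrite !dotpE trmx_mul trmxK mulmxA. Qed.

Lemma dotp_ge0 x : 0 <= dotp x x.
Proof. by apply: sumr_ge0 => i _; rewrite -expr2 sqr_ge0. Qed.

Lemma dotp_eq0 x : (dotp x x == 0) = (x == 0).
Proof.
apply/eqP/eqP => [/eqP|->]; last by rewrite dotp0l.
rewrite psumr_eq0 => [/allP H|i _]; last by rewrite -expr2 sqr_ge0.
apply/rowP => i; have := H i (mem_index_enum _); rewrite mxE -expr2 sqrf_eq0.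
by move/eqP.
Qed.

Lemma dotp_gt0 x : x != 0 -> 0 < dotp x x.
Proof. by move=> x0; rewrite lt0r dotp_eq0 x0 dotp_ge0. Qed.

Lemma dotp_inj x y : (forall v, dotp x v = dotp y v) -> x = y.
Proof. by move=> H; apply/eqP; rewrite -subr_eq0 -dotp_eq0 dotpBl H subrr. Qed.

Definition l1norm x : R := \sum_i `|x 0 i|.

Lemma l1norm_ge0 x : 0 <= l1norm x.
Proof. exact: sumr_ge0. Qed.

Lemma dotp_le_l1norm x v : `|dotp x v| <= l1norm x * `|v|.
Proof.
apply: (le_trans (ler_norm_sum _ _ _)); rewrite /l1norm mulr_suml; apply: ler_sum => i _.
by rewrite normrM ler_wpM2l// norm_coord_le.
Qed.

Lemma dotp_delta x i : dotp x (delta_mx 0 i) = x 0 i.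
Proof.
rewrite /dotp (bigD1 i)//= mxE !eqxx mulr1 big1 ?addr0// => j ji.
by rewrite mxE (negbTE ji) mulr0.
Qed.

End dot_product.

Section line_derivative.
Variables (R : realType) (n : nat).
Implicit Types (a v : 'rV[R]_n) (f : 'rV[R]_n -> R).

Lemma is_derive_line f a v (t : R) : derivable f (a + t *: v) v ->
  is_derive t (1 : R) (fun s : R => f (a + s *: v)) ('D_v f (a + t *: v)).
Proof.
have E : (fun h : R => h^-1 *: (((fun s : R => f (a + s *: v)) \o shift t) (h *: (1 : R)) - f (a + t *: v))) =
    (fun h : R => h^-1 *: ((f \o shift (a + t *: v)) (h *: v) - f (a + t *: v))).
  apply/funext => h; congr (_ *: (f _ - _)).
  by rewrite /= /shift/= [h *: 1]mulr1 scalerDl addrCA.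
move=> df; apply: DeriveDef; first by rewrite /derivable E.
by rewrite /derive E.
Qed.

Lemma MVT_line f a v (df : R -> R) :
  (forall t : R, 0 <= t <= 1 -> is_derive t (1 : R) (fun s : R => f (a + s *: v)) (df t)) ->
  exists2 t : R, 0 <= t <= 1 & f (a + v) - f a = df t.
Proof.
move=> H.
have [||t tI E] := @MVT_segment R (fun s : R => f (a + s *: v)) df 0 1 ler01.
- by move=> x /subset_itv_oo_cc; rewrite in_itv/=; exact: H.
- apply: derivable_within_continuous => x; rewrite in_itv/= => xI.
  by have [] := H x xI.
exists t => //; move: E.
by rewrite scale1r scale0r addr0 subr0 mulr1.
Qed.

End line_derivative.

Section strict_derivative.
Variables (R : realType) (n : nat).
Local Notation E := 'rV[R]_n.
Implicit Types (f h : E -> R) (F G : E -> E) (x y z v g : E) (M : 'M[R]_n).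

(** Strict differentiability: both points vary. Unlike the Fréchet derivative it gives near [y] a
    Lipschitz estimate for [f] minus a linear map, as [outer_C1_image] demands; unlike C^1
    regularity it is a condition at a single point. *)
Definition sderiv f y g := forall e, 0 < e ->
  \forall p \near (y, y), `|f p.1 - f p.2 - dotp g (p.1 - p.2)| <= e * `|p.1 - p.2|.

Definition sjacobian F y M := forall e, 0 < e ->
  \forall p \near (y, y), `|F p.1 - F p.2 - (p.1 - p.2) *m M| <= e * `|p.1 - p.2|.

Lemma sjacobianP F y M : sjacobian F y M <->
  forall j, sderiv (fun z => F z 0 j) y (\row_i M i j).
Proof.
have E1 z j : dotp (\row_i M i j) z = (z *m M) 0 j.
  by rewrite mxE; apply: eq_bigr => i _; rewrite mxE mulrC.
split => [H j e e0|H e e0].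
  apply: filterS (H e e0) => p; apply: le_trans.
  by rewrite E1; apply: le_trans (norm_coord_le _ j); rewrite !mxE.
have : \forall p \near (y, y), forall j,
    `|F p.1 0 j - F p.2 0 j - dotp (\row_i M i j) (p.1 - p.2)| <= e * `|p.1 - p.2|.
  exact: (@filter_forall _ _ _ (nbhs (y, y)) _ (fun j => H j e e0)).
apply: filterS => p Hp; apply: norm_row_le => [|j]; first by rewrite mulr_ge0// ltW.
by have := Hp j; rewrite E1 !mxE.
Qed.

Lemma sderiv_near f y g (e : R) : sderiv f y g -> 0 < e -> exists2 r, 0 < r &
  forall z w, `|z - y| < r -> `|w - y| < r -> `|f z - f w - dotp g (z - w)| <= e * `|z - w|.
Proof.
move=> H e0; have /nbhs_ballP[r /= r0 Hr] := H e e0; exists r => // z w zr wr.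
by apply: (Hr (z, w)); split; rewrite /= -ball_normE /ball_/= distrC.
Qed.

Lemma sjacobian_near F y M (e : R) : sjacobian F y M -> 0 < e -> exists2 r, 0 < r &
  forall z w, `|z - y| < r -> `|w - y| < r -> `|F z - F w - (z - w) *m M| <= e * `|z - w|.
Proof.
move=> H e0; have /nbhs_ballP[r /= r0 Hr] := H e e0; exists r => // z w zr wr.
by apply: (Hr (z, w)); split; rewrite /= -ball_normE /ball_/= distrC.
Qed.

Lemma sderiv_lip f y g : sderiv f y g -> exists2 C, 0 < C &
  \forall p \near (y, y), `|f p.1 - f p.2| <= C * `|p.1 - p.2|.
Proof.
move=> H; exists (1 + l1norm g); first by rewrite ltr_wpDr// l1norm_ge0.
apply: filterS (H 1 ltr01) => p Hp.
rewrite -[f p.1 - f p.2](subrK (dotp g (p.1 - p.2))) mulrDl.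
by apply: (le_trans (ler_normD _ _)); apply: lerD => //; exact: dotp_le_l1norm.
Qed.

Lemma cvg_near_diag f y : {for y, continuous f} ->
  (f p.1 @[p --> (y, y)] --> f y) /\ (f p.2 @[p --> (y, y)] --> f y).
Proof.
move=> fy; split=> P /fy Py.
  by exists (f @^-1` P, setT) => [|p []//]; split => //; exact: filterT.
by exists (setT, f @^-1` P) => [|p []//]; split => //; exact: filterT.
Qed.

Lemma sderiv_continuous f y g : sderiv f y g -> {for y, continuous f}.
Proof.
move=> /sderiv_lip[C C0 /nbhs_ballP[r /= r0 Hr]].
apply/(@cvgrPdist_le _ _ _ (nbhs y)) => e e0; apply/nbhs_ballP.
exists (Num.min r (e / C)) => [|z]; first by rewrite /= lt_min r0 divr_gt0.
rewrite -ball_normE /ball_/= lt_min => /andP[zr ze].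
apply: (le_trans (Hr (y, z) _)); last by rewrite /= mulrC -ler_pdivlMr// ltW.
by split => /=; [exact: ballxx|rewrite -ball_normE].
Qed.

Lemma sderiv_cst (c : R) y : sderiv (cst c) y 0.
Proof. by move=> e e0; near=> p; rewrite subrr dotp0l subr0 normr0 mulr_ge0// ltW.
Unshelve. all: by end_near. Qed.

Lemma sderiv_coord i y : sderiv (fun z => z 0 i) y (delta_mx 0 i).
Proof.
move=> e e0; near=> p; rewrite dotpC dotp_delta !mxE subrr normr0 mulr_ge0// ltW//.
Unshelve. all: by end_near. Qed.

Lemma sderivD f h y g k : sderiv f y g -> sderiv h y k -> sderiv (fun z => f z + h z) y (g + k).
Proof.
move=> Hf Hh e e0; have e2 : 0 < e / 2 by exact: divr_gt0.
near=> p; have -> : f p.1 + h p.1 - (f p.2 + h p.2) - dotp (g + k) (p.1 - p.2) =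
  (f p.1 - f p.2 - dotp g (p.1 - p.2)) + (h p.1 - h p.2 - dotp k (p.1 - p.2)).
  by rewrite dotpDl; ring.
rewrite [e in leRHS]splitr mulrDl; apply: (le_trans (ler_normD _ _)).
by apply: lerD; near: p; [exact: Hf|exact: Hh].
Unshelve. all: by end_near. Qed.

Lemma sderiv_sum (I : Type) (s : seq I) (f : I -> E -> R) y (g : I -> E) :
  (forall i, sderiv (f i) y (g i)) ->
  sderiv (fun z => \sum_(i <- s) f i z) y (\sum_(i <- s) g i).
Proof.
move=> H; elim: s => [|i s IH].
  rewrite big_nil (_ : (fun _ => _) = cst 0); first exact: sderiv_cst.
  by apply/funext => z; rewrite big_nil.
rewrite big_cons (_ : (fun _ => _) = fun z => f i z + \sum_(j <- s) f j z).
  exact: sderivD.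
by apply/funext => z; rewrite big_cons.
Qed.

Lemma sderivM f h y g k : sderiv f y g -> sderiv h y k ->
  sderiv (fun z => f z * h z) y (f y *: k + h y *: g).
Proof.
move=> Hf Hh e e0.
have [f1 _] := cvg_near_diag (sderiv_continuous Hf).
have [_ h2] := cvg_near_diag (sderiv_continuous Hh).
pose A := `|f y| + 1; pose B := `|h y| + 1; pose C := l1norm g + l1norm k + 1.
have A0 : 0 < A by rewrite ltr_wpDl. have B0 : 0 < B by rewrite ltr_wpDl.
have C0 : 0 < C by rewrite ltr_wpDl// addr_ge0 ?l1norm_ge0.
have e4 : 0 < e / 4 by rewrite divr_gt0.
near=> p.
have -> : f p.1 * h p.1 - f p.2 * h p.2 - dotp (f y *: k + h y *: g) (p.1 - p.2) =
  f p.1 * (h p.1 - h p.2 - dotp k (p.1 - p.2)) + (f p.1 - f y) * dotp k (p.1 - p.2) +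
  (h p.2 * (f p.1 - f p.2 - dotp g (p.1 - p.2)) + (h p.2 - h y) * dotp g (p.1 - p.2)).
  by rewrite dotpDl !dotpZl; ring.
have fA : `|f p.1| <= A.
  rewrite -[f p.1](subrK (f y)) addrC; apply: (le_trans (ler_normD _ _)).
  by rewrite lerD2l distrC; near: p; exact: cvgr_dist_le.
have hB : `|h p.2| <= B.
  rewrite -[h p.2](subrK (h y)) addrC; apply: (le_trans (ler_normD _ _)).
  by rewrite lerD2l distrC; near: p; exact: cvgr_dist_le.
have H1 : `|h p.1 - h p.2 - dotp k (p.1 - p.2)| <= e / 4 / A * `|(p.1 - p.2)|.
  by near: p; apply: Hh; exact: divr_gt0.
have H2 : `|f p.1 - f p.2 - dotp g (p.1 - p.2)| <= e / 4 / B * `|(p.1 - p.2)|.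
  by near: p; apply: Hf; exact: divr_gt0.
have H3 : `|f p.1 - f y| <= e / 4 / C.
  by rewrite distrC; near: p; apply: cvgr_dist_le => //; exact: divr_gt0.
have H4 : `|h p.2 - h y| <= e / 4 / C.
  by rewrite distrC; near: p; apply: cvgr_dist_le => //; exact: divr_gt0.
have Hk : `|dotp k (p.1 - p.2)| <= C * `|(p.1 - p.2)|.
  by apply: (le_trans (dotp_le_l1norm _ _)); rewrite ler_wpM2r// ler_wpDr// lerDr l1norm_ge0.
have Hg : `|dotp g (p.1 - p.2)| <= C * `|(p.1 - p.2)|.
  by apply: (le_trans (dotp_le_l1norm _ _)); rewrite ler_wpM2r// ler_wpDr// lerDl l1norm_ge0.
have -> : e * `|(p.1 - p.2)| = A * (e / 4 / A * `|(p.1 - p.2)|) + (e / 4 / C) * (C * `|(p.1 - p.2)|) +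
  (B * (e / 4 / B * `|(p.1 - p.2)|) + (e / 4 / C) * (C * `|(p.1 - p.2)|)).
  by field; rewrite !gt_eqF.
apply: (le_trans (ler_normD _ _)); apply: lerD; apply: (le_trans (ler_normD _ _));
  by apply: lerD; rewrite normrM ler_pM.
Unshelve. all: by end_near. Qed.

Lemma sderivV f y g : sderiv f y g -> f y != 0 ->
  sderiv (fun z => (f z)^-1) y (- (f y) ^- 2 *: g).
Proof.
move=> Hf fy0 e e0.
have [f1 f2] := cvg_near_diag (sderiv_continuous Hf).
have f12 : (f p.1 * f p.2)^-1 @[p --> (y, y)] --> (f y * f y)^-1.
  by apply: cvgV; [rewrite mulf_neq0|exact: cvgM].
pose A := `|(f y * f y)^-1| + 1; pose C := l1norm g + 1.
have A0 : 0 < A by rewrite ltr_wpDl.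
have C0 : 0 < C by rewrite ltr_wpDl// l1norm_ge0.
have e2 : 0 < e / 2 by exact: divr_gt0.
have fyn : 0 < `|f y| by rewrite normr_gt0.
near=> p.
have n1 : f p.1 != 0.
  rewrite -normr_gt0; near: p; apply: (@cvgr_gt _ _ _ _ (fun p => `|f p.1|) `|f y|) => //.
  exact: cvg_norm.
have n2 : f p.2 != 0.
  rewrite -normr_gt0; near: p; apply: (@cvgr_gt _ _ _ _ (fun p => `|f p.2|) `|f y|) => //.
  exact: cvg_norm.
have -> : (f p.1)^-1 - (f p.2)^-1 - dotp (- (f y) ^- 2 *: g) (p.1 - p.2) =
  - ((f p.1 * f p.2)^-1 * (f p.1 - f p.2 - dotp g (p.1 - p.2))) +
  ((f y * f y)^-1 - (f p.1 * f p.2)^-1) * dotp g (p.1 - p.2).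
  by rewrite dotpZl; field; rewrite n1 n2 fy0.
have H1 : `|f p.1 - f p.2 - dotp g (p.1 - p.2)| <= e / 2 / A * `|(p.1 - p.2)|.
  by near: p; apply: Hf; exact: divr_gt0.
have H3 : `|(f y * f y)^-1 - (f p.1 * f p.2)^-1| <= e / 2 / C.
  by near: p; apply: cvgr_dist_le => //; exact: divr_gt0.
have H2 : `|(f p.1 * f p.2)^-1| <= A.
  rewrite -[X in `|X|](subrK (f y * f y)^-1) addrC; apply: (le_trans (ler_normD _ _)).
  by rewrite lerD2l distrC; near: p; exact: cvgr_dist_le.
have Hg : `|dotp g (p.1 - p.2)| <= C * `|(p.1 - p.2)|.
  by apply: (le_trans (dotp_le_l1norm _ _)); rewrite ler_wpM2r// /C lerDl.
have -> : e * `|(p.1 - p.2)| = A * (e / 2 / A * `|(p.1 - p.2)|) + (e / 2 / C) * (C * `|(p.1 - p.2)|).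
  by field; rewrite !gt_eqF.
apply: (le_trans (ler_normD _ _)); rewrite normrN.
by apply: lerD; rewrite normrM ler_pM.
Unshelve. all: by end_near. Qed.

Lemma sjacobian_lip F y M : sjacobian F y M -> exists2 C, 0 < C &
  \forall p \near (y, y), `|F p.1 - F p.2| <= C * `|p.1 - p.2|.
Proof.
move=> H; pose C := \sum_i \sum_j `|M i j|.
have C0 : 0 <= C by apply: sumr_ge0 => i _; apply: sumr_ge0.
exists (1 + C); first by rewrite ltr_wpDr.
apply: filterS (H 1 ltr01) => p Hp; set v := p.1 - p.2.
rewrite -[F p.1 - F p.2](subrK (v *m M)) mulrDl.
apply: (le_trans (ler_normD _ _)); apply: lerD => //.
apply: norm_row_le => [|j]; first exact: mulr_ge0.
rewrite mxE; apply: (le_trans (ler_norm_sum _ _ _)).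
rewrite mulr_suml; apply: ler_sum => i _; rewrite normrM mulrC.
by apply: ler_pM; rewrite ?norm_coord_le// (bigD1 j)//= lerDl sumr_ge0.
Qed.

Lemma sjacobian_continuous F y M : sjacobian F y M -> {for y, continuous F}.
Proof.
move=> /sjacobian_lip[C C0 /nbhs_ballP[r /= r0 Hr]].
apply/(@cvgrPdist_le _ _ _ (nbhs y)) => e e0; apply/nbhs_ballP.
exists (Num.min r (e / C)) => [|z]; first by rewrite /= lt_min r0 divr_gt0.
rewrite -ball_normE /ball_/= lt_min => /andP[zr ze].
apply: (le_trans (Hr (y, z) _)); last by rewrite /= mulrC -ler_pdivlMr// ltW.
by split => /=; [exact: ballxx|rewrite -ball_normE].
Qed.

Lemma sderiv_comp f F y g M : sjacobian F y M -> sderiv f (F y) g ->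
  sderiv (f \o F) y (g *m M^T).
Proof.
move=> HF Hf e e0; have [C C0 HC] := sjacobian_lip HF.
have cF := sjacobian_continuous HF.
have cFF : (F p.1, F p.2) @[p --> (y, y)] --> (F y, F y).
  move=> P [[P1 P2] /= [/cF Q1 /cF Q2] PP].
  by exists (F @^-1` P1, F @^-1` P2) => // -[a b] [/= Pa Pb]; exact: PP.
pose B := l1norm g + 1; have B0 : 0 < B by rewrite ltr_wpDl// l1norm_ge0.
have e2 : 0 < e / 2 by exact: divr_gt0.
near=> p.
have -> : (f \o F) p.1 - (f \o F) p.2 - dotp (g *m M^T) (p.1 - p.2) =
  (f (F p.1) - f (F p.2) - dotp g (F p.1 - F p.2)) + dotp g (F p.1 - F p.2 - (p.1 - p.2) *m M).
  by rewrite [dotp g (_ - _ *m _)]dotpBr dotp_mulmxl trmxK /=; ring.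
have H1 : `|f (F p.1) - f (F p.2) - dotp g (F p.1 - F p.2)| <= e / 2 / C * `|F p.1 - F p.2|.
  near: p; have e2C : 0 < e / 2 / C by exact: divr_gt0.
  exact: (cFF _ (Hf _ e2C)).
have H2 : `|F p.1 - F p.2| <= C * `|(p.1 - p.2)| by near: p.
have H3 : `|F p.1 - F p.2 - (p.1 - p.2) *m M| <= e / 2 / B * `|(p.1 - p.2)|.
  by near: p; apply: HF; exact: divr_gt0.
have -> : e * `|(p.1 - p.2)| = e / 2 / C * (C * `|(p.1 - p.2)|) + B * (e / 2 / B * `|(p.1 - p.2)|).
  by field; rewrite !gt_eqF.
apply: (le_trans (ler_normD _ _)); apply: lerD.
  apply: (le_trans H1); apply: ler_wpM2l => //; by rewrite !divr_ge0// ltW.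
apply: (le_trans (dotp_le_l1norm _ _)); apply: ler_pM => //; first exact: l1norm_ge0.
by rewrite lerDl.
Unshelve. all: by end_near. Qed.

Definition fderiv f y g := forall e, 0 < e -> exists2 r, 0 < r &
  forall z, `|z - y| < r -> `|f z - f y - dotp g (z - y)| <= e * `|z - y|.

Lemma sderiv_fderiv f y g : sderiv f y g -> fderiv f y g.
Proof.
move=> H e e0; have [r r0 Hr] := sderiv_near H e0; exists r => // z zr.
by apply: Hr => //; rewrite subrr normr0.
Qed.

Lemma fderiv_derive f y g v : fderiv f y g -> derivable f y v /\ 'D_v f y = dotp g v.
Proof.
move=> H.
have Hc : (fun h : R => h^-1 *: ((f \o shift y) (h *: v) - f y)) @ 0^' --> dotp g v.
  apply/cvgrPdist_le => e e0.
  have [r r0 Hr] := H _ (divr_gt0 e0 (ltr_pwDl ltr01 (normr_ge0 v))).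
  near=> h.
  have h0 : h != 0 by near: h; exact: nbhs_dnbhs_neq.
  have hr : `|h *: v| < r.
    rewrite normrZ; apply: (@le_lt_trans _ _ (`|h| * (1 + `|v|))); first by rewrite ler_wpM2l// lerDr.
    rewrite -ltr_pdivlMr ?ltr_pwDl//; near: h; apply: dnbhs0_lt; by rewrite divr_gt0// ltr_pwDl.
  have := Hr (h *: v + y); rewrite addrK => /(_ hr) H1.
  rewrite distrC (_ : _ - _ = h^-1 * (f (h *: v + y) - f y - dotp g (h *: v))).
    rewrite normrM normfV ler_pdivrMl ?normr_gt0//; apply: (le_trans H1).
    rewrite normrZ mulrCA ler_wpM2l// -mulrA ler_piMr ?ltW//.
    by rewrite mulrC ltr_pdivrMr ?ltr_pwDl// mul1r ltrDr.
  by rewrite dotpZr /shift/= /GRing.scale/=; field.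
split; first by apply/cvg_ex; exists (dotp g v).
exact: cvg_lim Hc.
Unshelve. all: by end_near. Qed.

Lemma fderiv_grad f y g : fderiv f y g -> grad f y = g.
Proof.
move=> H; apply/rowP => i; rewrite mxE /partial.
by have [_ ->] := fderiv_derive (delta_mx 0 i) H; rewrite dotp_delta.
Qed.

Lemma sderiv_derive f y g v : sderiv f y g -> derivable f y v /\ 'D_v f y = dotp g v.
Proof. by move=> /sderiv_fderiv; exact: fderiv_derive. Qed.

Lemma sderiv_grad f y g : sderiv f y g -> grad f y = g.
Proof. by move=> /sderiv_fderiv; exact: fderiv_grad. Qed.

(* Telescoping along the coordinates and the mean value theorem. *)
Lemma Ck1_sderiv (U : set E) f y : open U -> Ck 1 U f -> U y -> sderiv f y (grad f y).
Proof.
move=> oU [_ Hf] Uy e e0; have n0 : 0 < n.+1%:R :> R by [].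
have : \forall z \near y, U z /\ forall i, `|partial i f y - partial i f z| <= e / n.+1%:R.
  apply: filterI; first exact: open_nbhs_nbhs.
  apply: (@filter_forall _ _ _ (nbhs y)) => i; have [_ [/(_ _ Uy) cp _]] := Hf i.
  by move/(@cvgrPdist_le _ _ _ (nbhs y)): cp; apply; exact: divr_gt0.
move=> /nbhs_ballP[r /= r0 Hr].
have HB z : `|z - y| < r -> U z /\ forall i, `|partial i f y - partial i f z| <= e / n.+1%:R.
  by move=> zr; apply: Hr; rewrite -ball_normE /ball_/= distrC.
apply/nbhs_ballP; exists r => // -[z w] [/= zr wr].
rewrite -ball_normE /ball_/= distrC in zr; rewrite -ball_normE /ball_/= distrC in wr.
pose x (k : nat) : E := \row_i (if (i < k)%N then z 0 i else w 0 i).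
have xr k : `|x k - y| < r.
  rewrite [X in X < _]mx_normrE; apply/bigmax_ltP; split => // -[i j] _ /=; rewrite ord1 !mxE.
  case: ifP => _; have := @norm_coord_le _ _ (z - y) j; have := @norm_coord_le _ _ (w - y) j.
    by rewrite !mxE => _ /le_lt_trans; apply.
  by rewrite !mxE => /le_lt_trans + _; apply.
have xS (i : 'I_n) : x i.+1 = x i + (z 0 i - w 0 i) *: delta_mx 0 i.
  apply/rowP => j; rewrite !mxE ltnS eqxx /= [j == i]eq_sym.
  case: (ltngtP j i) => [ji|ij|/val_inj ->].
  - by rewrite (_ : i == j = false) ?mulr0 ?addr0//; apply/negbTE; rewrite -val_eqE gtn_eqF.
  - by rewrite (_ : i == j = false) ?mulr0 ?addr0//; apply/negbTE; rewrite -val_eqE ltn_eqF.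
  - by rewrite eqxx mulr1 addrC subrK.
have step (i : 'I_n) : `|f (x i.+1) - f (x i) - partial i f y * (z 0 i - w 0 i)| <=
    e / n.+1%:R * `|z - w|.
  set a := z 0 i - w 0 i.
  have xt t : 0 <= t <= 1 -> `|x i + t *: (a *: delta_mx 0 i) - y| < r.
    move=> /andP[t0 t1].
    have -> : x i + t *: (a *: delta_mx 0 i) - y =
        (1 - t) *: (x i - y) + t *: (x i.+1 - y).
      rewrite xS -/a; apply/rowP => j; rewrite !mxE; ring.
    apply: (le_lt_trans (ler_normD _ _)); rewrite !normrZ !ger0_norm ?subr_ge0//.
    have mr : Num.max `|x i - y| `|x i.+1 - y| < r by rewrite gt_max !xr.
    apply: le_lt_trans mr; set m := Num.max _ _.
    have -> : m = (1 - t) * m + t * m by ring.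
    by apply: lerD; apply: ler_wpM2l; rewrite ?subr_ge0// /m le_max lexx ?orbT.
  have [t t01|t t01 E1] := @MVT_line _ _ f (x i) (a *: delta_mx 0 i)
      (fun t => a * partial i f (x i + t *: (a *: delta_mx 0 i))).
    have [Ut _] := HB _ (xt t t01); have [/(_ _ Ut) dfi _] := Hf i.
    have := @is_derive_line _ _ f (x i) (delta_mx 0 i) (t * a).
    rewrite -scalerA => /(_ dfi) dl.
    have -> : (fun s : R => f (x i + s *: (a *: delta_mx 0 i))) =
        (fun s : R => f (x i + s *: delta_mx 0 i)) \o (fun s : R => s * a).
      by apply/funext => s /=; rewrite scalerA.
    have da : is_derive t (1 : R) (fun s : R => s * a) a.
      by apply: is_derive_eq; rewrite scaler0 add0r /GRing.scale/= mulr1.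
    have := @is_derive1_comp _ (fun s : R => f (x i + s *: delta_mx 0 i)) (fun s : R => s * a) t _ _ dl da.
    by move=> dc; apply: is_derive_eq; rewrite /partial mulrC.
  have [_ Ht] := HB _ (xt t t01).
  rewrite xS -/a E1 [partial i f y * a]mulrC -mulrBr normrM mulrC distrC.
  apply: ler_pM => //; apply: le_trans (norm_coord_le _ i); by rewrite !mxE.
have -> : f z - f w = \sum_(i < n) (f (x i.+1) - f (x i)).
  have -> : z = x n by apply/rowP => i; rewrite mxE ltn_ord.
  have -> : w = x 0%N by apply/rowP => i; rewrite mxE.
  by rewrite -(big_mkord xpredT (fun i => f (x i.+1) - f (x i))) telescope_sumr.
rewrite /dotp -sumrB; apply: (le_trans (ler_norm_sum _ _ _)).
apply: (@le_trans _ _ (\sum_(i < n) e / n.+1%:R * `|z - w|)).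
  by apply: ler_sum => i _; rewrite !mxE; exact: step.
rewrite sumr_const card_ord -[leLHS]mulr_natl mulrA ler_wpM2r// mulrCA ler_piMr ?(ltW e0)// ltW//.
by rewrite ltr_pdivrMr// mul1r ltr_nat.
Qed.

End strict_derivative.

Section second_order.
Variables (R : realType) (n : nat).
Local Notation E := 'rV[R]_n.
Implicit Types (f : E -> R) (G : E -> E) (x z u v : E) (H : 'M[R]_n).

Lemma sderiv_line f x v (G : E -> E) (t : R) : sderiv f (x + t *: v) (G (x + t *: v)) ->
  is_derive t (1 : R) (fun s : R => f (x + s *: v)) (dotp (G (x + t *: v)) v).
Proof. by move=> /(sderiv_derive v)[d1 <-]; exact: is_derive_line. Qed.

Lemma dotp_small u v (w : E) (e : R) : `|u - w| <= e -> `|dotp u v - dotp w v| <= l1norm v * e.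
Proof.
move=> uw; rewrite -dotpBl dotpC; apply: (le_trans (dotp_le_l1norm _ _)).
by rewrite ler_wpM2l// l1norm_ge0.
Qed.

Lemma norm_seg x v (t r : R) : 0 <= t <= 1 -> `|v| < r -> `|x + t *: v - x| < r.
Proof.
move=> /andP[t0 t1] vr; rewrite addrAC subrr add0r normrZ ger0_norm//.
by apply: le_lt_trans vr; rewrite ler_piMl.
Qed.

(* Both orders of the second difference are computed by the mean value theorem. *)
Lemma hessian_sym f G x H (r : R) : 0 < r ->
  (forall z, `|z - x| < r -> sderiv f z (G z)) -> sjacobian G x H -> H^T = H.
Proof.
move=> r0 fG GH.
have key (e : R) u v : 0 < e -> exists2 t0, 0 < t0 & forall t, 0 < t < t0 ->
   `|f (x + t *: v + t *: u) - f (x + t *: u) - (f (x + t *: v) - f x) - t ^+ 2 * dotp (u *m H) v|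
     <= t ^+ 2 * (e * (`|u| * l1norm v)).
  move=> e0; have [r' r'0 Hr] := sjacobian_near GH e0.
  pose m := Num.min r r'; have m0 : 0 < m by rewrite lt_min r0.
  have m_le2 : m <= r' by rewrite ge_min lexx orbT.
  pose B := `|u| + `|v| + 1; have B0 : 0 < B by rewrite ltr_wpDl// addr_ge0.
  exists (m / B) => [|t /andP[t0 tm]]; first exact: divr_gt0.
  have small s : 0 <= s <= 1 -> `|x + s *: (t *: v) - x| < m /\ `|x + t *: u + s *: (t *: v) - x| < m.
    move=> /andP[s0 s1]; rewrite ltr_pdivlMr// in tm.
    have sv : `|s *: (t *: v)| <= t * `|v|.
      by rewrite !normrZ (ger0_norm s0) (gtr0_norm t0) ler_piMl// mulr_ge0// ltW.
    split.
      rewrite addrAC subrr add0r; apply: le_lt_trans tm; apply: (le_trans sv).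
      by rewrite ler_wpM2l ?(ltW t0)// /B; have := normr_ge0 u; lra.
    rewrite -[x + _ + _]addrA [x + _ - x]addrAC subrr add0r; apply: le_lt_trans tm.
    apply: (le_trans (ler_normD _ _)); rewrite [X in X + _]normrZ (gtr0_norm t0).
    by rewrite /B !mulrDr mulr1; have := sv; set a := `|_ *: _|; move: (normr_ge0 u); lra.
  pose h (y : E) := f (y + t *: u) - f y.
  have [|s s01 Es] := @MVT_line _ _ h x (t *: v)
     (fun s => dotp (G (x + t *: u + s *: (t *: v)) - G (x + s *: (t *: v))) (t *: v)).
    move=> s /small[s1 s2]; rewrite dotpBl.
    have E1 : (fun s0 : R => h (x + s0 *: (t *: v))) =
       (fun s0 : R => f (x + t *: u + s0 *: (t *: v))) - (fun s0 : R => f (x + s0 *: (t *: v))).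
      by apply/funext => s0; rewrite fctE /h -[in LHS]addrA [s0 *: _ + _]addrC addrA.
    rewrite E1; apply: is_deriveB; apply: sderiv_line; apply: fG.
      by apply: lt_le_trans s2 _; rewrite ge_min lexx.
    by apply: lt_le_trans s1 _; rewrite ge_min lexx.
  have [s1 s2] := small s s01.
  have := Hr _ _ (lt_le_trans s2 m_le2) (lt_le_trans s1 m_le2).
  rewrite (_ : x + t *: u + s *: (t *: v) - (x + s *: (t *: v)) = t *: u); last first.
    by rewrite opprD addrACA subrr addr0 addrAC subrr add0r.
  rewrite -scalemxAl => /(dotp_small (t *: v)).
  have -> : l1norm (t *: v) = t * l1norm v.
    rewrite /l1norm mulr_sumr; apply: eq_bigr => i _.
    by rewrite mxE normrM gtr0_norm.
  rewrite -Es /h dotpZl dotpZr normrZ gtr0_norm// mulrA -expr2.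
  move=> Hf; apply: le_trans (_ : t * l1norm v * (e * (t * `|u|)) <= _); last by rewrite le_eqVlt; apply/orP; left; apply/eqP; ring.
  by apply: le_trans Hf; rewrite le_eqVlt; apply/orP; left; apply/eqP; congr `|_ - _|; rewrite addrAC; ring.
apply/matrixP => i j; rewrite mxE.
have HE a b : H a b = dotp (delta_mx 0 a *m H) (delta_mx 0 b).
  by rewrite dotp_delta -rowE mxE.
rewrite !HE; apply/eqP; rewrite -subr_eq0 -normr_le0; apply/ler_addgt0Pr => e e0; rewrite add0r.
set u := delta_mx 0 j; set v := delta_mx 0 i.
pose K := `|u| * l1norm v + `|v| * l1norm u + 1.
have K0 : 0 < K by rewrite ltr_wpDl// addr_ge0// mulr_ge0// l1norm_ge0.
have [t1 t10 H1] := key (e / K) u v (divr_gt0 e0 K0).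
have [t2 t20 H2] := key (e / K) v u (divr_gt0 e0 K0).
pose t := Num.min t1 t2 / 2.
have t0 : 0 < t by rewrite divr_gt0// lt_min t10.
have tt1 : 0 < t < t1 by rewrite t0 /t ltr_pdivrMr// gt_min; apply/orP; left; lra.
have tt2 : 0 < t < t2 by rewrite t0 /t ltr_pdivrMr// gt_min; apply/orP; right; lra.
have {}H1 := H1 t tt1; have {}H2 := H2 t tt2.
have t2p : 0 < t ^+ 2 by rewrite exprn_gt0.
rewrite -(ler_pM2l t2p) -[X in X * `|_|](gtr0_norm t2p) -normrM.
have -> : t ^+ 2 * (dotp (u *m H) v - dotp (v *m H) u) =
  (f (x + t *: u + t *: v) - f (x + t *: v) - (f (x + t *: u) - f x) - t ^+ 2 * dotp (v *m H) u) -
  (f (x + t *: v + t *: u) - f (x + t *: u) - (f (x + t *: v) - f x) - t ^+ 2 * dotp (u *m H) v).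
  by rewrite [x + t *: v + _]addrAC; ring.
apply: (le_trans (ler_normB _ _)); apply: (le_trans (lerD H2 H1)).
rewrite -mulrDr -mulrDr ler_pM2l// -mulrA ler_piMr ?(ltW e0)//.
by rewrite mulrC ler_pdivrMr// mul1r /K addrC lerDl.
Qed.

(** Along the segment the remainder has derivative [dotp (G (x + t *: v) - G x - t *: v *m H) v],
    which is small by the strict derivative of [G]; the mean value theorem concludes. *)
Lemma taylor2 f G x H (r : R) : 0 < r ->
  (forall z, `|z - x| < r -> sderiv f z (G z)) -> sjacobian G x H ->
  forall e, 0 < e -> exists2 d, 0 < d & forall v, `|v| < d ->
  `|f (x + v) - f x - dotp (G x) v - 2^-1 * dotp (v *m H) v| <= e * `|v| ^+ 2.
Proof.
move=> r0 fG GH e e0; have n0 : 0 < n.+1%:R :> R by [].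
have [d d0 Hd] := sjacobian_near GH (divr_gt0 e0 n0).
exists (Num.min r d) => [|v]; first by rewrite lt_min r0.
rewrite lt_min => /andP[vr vd].
pose h (z : E) := f z - dotp (G x) z - 2^-1 * dotp ((z - x) *m H) (z - x).
have HS := hessian_sym r0 fG GH.
have [|t t01 Et] := @MVT_line _ _ h x v
   (fun t => dotp (G (x + t *: v) - G x - (t *: v) *m H) v).
  move=> t t01.
  pose F1 (s : R) := f (x + s *: v).
  pose F2 (s : R) := dotp (G x) x + dotp (G x) v * s + 2^-1 * dotp (v *m H) v * (s * s).
  have E1 : (fun s : R => h (x + s *: v)) = F1 - F2.
    apply/funext => s; rewrite /h [x + _ - x]addrAC subrr add0r -scalemxAl.
    rewrite dotpDr !dotpZr dotpZl.
    by change ((F1 - F2) s) with (F1 s - F2 s); rewrite /F1 /F2; ring.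
  rewrite E1.
  have -> : dotp (G (x + t *: v) - G x - t *: v *m H) v =
     dotp (G (x + t *: v)) v - (dotp (G x) v + dotp (v *m H) v * t).
    by rewrite !dotpBl -scalemxAl dotpZl; ring.
  apply: is_deriveB; first by apply: sderiv_line; apply: fG; exact: norm_seg.
  by apply: is_derive_eq; rewrite /GRing.scale/=; field.
have := Hd (x + t *: v) x (norm_seg x t01 vd).
rewrite subrr normr0 => /(_ d0); rewrite [x + _ - x]addrAC subrr add0r => H1.
have := dotp_small v (w := 0); rewrite dotp0l => /(_ (G (x + t *: v) - G x - t *: v *m H) (e / n.+1%:R * `|t *: v|)).
rewrite !subr0 -Et => /(_ H1) H2.
have -> : f (x + v) - f x - dotp (G x) v - 2^-1 * dotp (v *m H) v = h (x + v) - h x.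
  rewrite /h subrr mul0mx dotp0l [x + _ - x]addrAC subrr add0r dotpDr; ring.
apply: (le_trans H2); rewrite normrZ.
have /andP[t0 t1] := t01; rewrite (ger0_norm t0).
have nv : l1norm v <= n.+1%:R * `|v|.
  apply: (@le_trans _ _ (\sum_(i < n) `|v|)).
    by apply: ler_sum => i _; exact: norm_coord_le.
  by rewrite sumr_const card_ord -[leLHS]mulr_natl ler_wpM2r// ler_nat.
apply: (@le_trans _ _ (n.+1%:R * `|v| * (e / n.+1%:R * `|v|))).
  apply: ler_pM => //; first exact: l1norm_ge0.
    by rewrite !mulr_ge0 ?divr_ge0// ltW.
  by rewrite ler_wpM2l ?divr_ge0 ?(ltW e0)// ler_piMl.
by rewrite le_eqVlt; apply/orP; left; apply/eqP; field; rewrite gt_eqF.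
Qed.

End second_order.

(** * Gauges of convex bodies *)

Section convex_body.
Variables (R : realType) (n : nat).
Local Notation E := 'rV[R]_n.
Implicit Types (K : set E) (x y v p q : E).

Lemma l1norm_le x : l1norm x <= n.+1%:R * `|x|.
Proof.
apply: (@le_trans _ _ (\sum_(i < n) `|x|)).
  by apply: ler_sum => i _; exact: norm_coord_le.
by rewrite sumr_const card_ord -[leLHS]mulr_natl ler_wpM2r// ler_nat.
Qed.

Lemma dotp_continuous x : continuous (fun p : E => dotp p x).
Proof.
move=> p; apply: (@sderiv_continuous _ _ _ _ x) => e e0; near=> q.
by rewrite dotpBr !(dotpC x) subrr normr0 mulr_ge0// ltW.
Unshelve. all: by end_near. Qed.

Lemma continuous_row_dist (f : E -> R) x (e : R) : {for x, continuous f} -> 0 < e ->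
  exists2 r, 0 < r & forall z, `|z - x| < r -> `|f z - f x| < e.
Proof.
move=> /(@cvgrPdist_lt _ _ _ (nbhs x)) fx e0.
have /nbhs_ballP[r /= r0 Hr] := fx e e0; exists r => // z zx.
by rewrite distrC; apply: Hr; rewrite -ball_normE /ball_/= distrC.
Qed.

Lemma continuous_row_lt (f : E -> R) x c : {for x, continuous f} -> f x < c ->
  exists2 r, 0 < r & forall z, `|z - x| < r -> f z < c.
Proof.
move=> fx fc; have [||r r0 Hr] := @continuous_row_dist f x (c - f x) => //; first by rewrite subr_gt0.
by exists r => // z /Hr; rewrite ltr_norml => /andP[_]; rewrite ltrD2r.
Qed.

Definition convex_body K := [/\ compact K,
  (forall x y (t : R), K x -> K y -> 0 <= t <= 1 -> K ((1 - t) *: x + t *: y)) &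
  interior K 0].

Lemma convex_body0 K : convex_body K -> K 0.
Proof. by move=> [_ _]; exact: interior_subset. Qed.

Lemma convex_body_shrink K x (t : R) : convex_body K -> K x -> 0 <= t <= 1 -> K (t *: x).
Proof.
move=> bK Kx t01; have [_ cK _] := bK.
by have := cK _ _ _ (convex_body0 bK) Kx t01; rewrite scaler0 add0r.
Qed.

Lemma convex_body_ball K : convex_body K -> exists2 r, 0 < r & forall x, `|x| <= r -> K x.
Proof.
move=> [_ _ /nbhs_ballP[r /= r0 Hr]]; exists (r / 2); first by rewrite divr_gt0.
move=> x xr; apply: Hr; rewrite -ball_normE /ball_/= sub0r normrN.
by apply: (le_lt_trans xr); rewrite ltr_pdivrMr// ltr_pMr// ltr1n.
Qed.

Lemma compact_norm_bound K : compact K -> exists2 M, 0 < M & forall x, K x -> `|x| <= M.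
Proof. by move=> /compact_bounded /pinfty_ex_gt0[M M0 HM]; exists M. Qed.

Lemma gauge_ge0 K x : 0 <= gauge K x.
Proof.
rewrite /gauge; have [->|/set0P S0] := eqVneq [set t : R | 0 <= t /\ exists2 k, K k & x = t *: k] set0.
  by rewrite inf0.
by apply: lb_le_inf => // t [].
Qed.

(** As [K] is closed the infimum is attained: the points [s^-1 *: x] with [s > t] lie in [K] and
    converge to [t^-1 *: x]. *)
Lemma gauge_le K x t : convex_body K -> 0 < t -> gauge K x <= t <-> K (t^-1 *: x).
Proof.
move=> bK t0; have [cK _ _] := bK; split => [xt|Kx]; last first.
  apply: ge_inf; first by exists 0 => s [].
  split; first exact: ltW.
  by exists (t^-1 *: x) => //; rewrite scalerA divff ?scale1r// gt_eqF.
have [r r0 Hr] := convex_body_ball bK.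
have S0 : [set t : R | 0 <= t /\ exists2 k, K k & x = t *: k] !=set0.
  have [->|x0] := eqVneq x 0.
    by exists 0; split => //; exists 0; rewrite ?scaler0//; exact: convex_body0.
  exists (`|x| / r); split; first by rewrite divr_ge0// ltW.
  have xr : `|x| / r != 0 by rewrite mulf_neq0 ?normr_eq0// invr_eq0 gt_eqF.
  exists ((`|x| / r)^-1 *: x); last by rewrite scalerA divff ?scale1r.
  apply: Hr; rewrite normrZ normfV ger0_norm ?divr_ge0 ?(ltW r0)//.
  by rewrite invf_div divfK// normr_eq0.
have Ks s : t < s -> K (s^-1 *: x).
  move=> ts; have [u [u0 [k Kk ->]] us] : exists2 u, [set t : R | 0 <= t /\ exists2 k, K k & x = t *: k] u & u < s.
    apply: contrapT => nS; have : s <= gauge K x.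
      by apply: lb_le_inf => // u Su; rewrite leNgt; apply/negP => us; apply: nS; exists u.
    by rewrite leNgt (le_lt_trans xt ts).
  have s0 : 0 < s by exact: lt_trans ts.
  rewrite scalerA; apply: convex_body_shrink => //.
  by rewrite mulr_ge0 ?invr_ge0 ?(ltW s0)//= mulrC ler_pdivrMr// mul1r ltW.
have clK : closed K by apply: compact_closed => //; exact: norm_hausdorff.
apply: (@closed_cvg _ _ (t^'+) _ (fun s => s^-1 *: x) K clK).
  by near=> s; apply: Ks; near: s; exact: nbhs_right_gt.
apply: cvg_at_right_filter; apply: cvgZr_tmp; apply: cvgV; first by rewrite gt_eqF.
exact: cvg_id.
Unshelve. all: by end_near. Qed.

Lemma gauge_le1 K x : convex_body K -> gauge K x <= 1 <-> K x.
Proof. by move=> bK; have := gauge_le x bK ltr01; rewrite invr1 scale1r. Qed.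

Lemma gaugeZ K x (c : R) : convex_body K -> 0 < c -> gauge K (c *: x) = c * gauge K x.
Proof.
move=> bK; have le (d : R) y : 0 < d -> gauge K (d *: y) <= d * gauge K y.
  move=> d0; apply/ler_addgt0Pr => e e0.
  have s0 : 0 < gauge K y + e / d by rewrite ltr_wpDl ?gauge_ge0// divr_gt0.
  have -> : d * gauge K y + e = d * (gauge K y + e / d) by field; rewrite gt_eqF.
  apply/(gauge_le _ bK); first by rewrite mulr_gt0.
  rewrite invfM scalerA mulrAC mulVf ?mul1r ?gt_eqF//.
  by apply/(gauge_le _ bK) => //; rewrite lerDl divr_ge0// ltW.
move=> c0; apply/eqP; rewrite eq_le le//=.
rewrite -ler_pdivlMl//; have := le (c^-1) (c *: x); rewrite invr_gt0 => /(_ c0).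
by rewrite scalerA mulVf ?scale1r// gt_eqF.
Qed.

Lemma gauge0 K : convex_body K -> gauge K 0 = 0.
Proof.
move=> bK; apply/eqP; rewrite eq_le gauge_ge0 andbT; apply/ler_addgt0Pr => e e0.
by rewrite add0r; apply/(gauge_le _ bK) => //; rewrite scaler0; exact: convex_body0.
Qed.

Lemma gaugeD K x y : convex_body K -> gauge K (x + y) <= gauge K x + gauge K y.
Proof.
move=> bK; apply/ler_addgt0Pr => e e0.
pose s := gauge K x + e / 2; pose t := gauge K y + e / 2.
have s0 : 0 < s by rewrite ltr_wpDl ?gauge_ge0// divr_gt0.
have t0 : 0 < t by rewrite ltr_wpDl ?gauge_ge0// divr_gt0.
have st0 : 0 < s + t by rewrite addr_gt0.
have -> : gauge K x + gauge K y + e = s + t by rewrite /s /t; field.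
apply/(gauge_le _ bK) => //.
have -> : (s + t)^-1 *: (x + y) =
    (1 - t / (s + t)) *: (s^-1 *: x) + (t / (s + t)) *: (t^-1 *: y).
  rewrite scalerDr !scalerA; congr (_ *: _ + _ *: _); field;
    by rewrite ?(gt_eqF s0) ?(gt_eqF t0) (gt_eqF st0).
have [_ cK _] := bK; apply: cK.
- by apply/(gauge_le _ bK) => //; rewrite lerDl divr_ge0// ltW.
- by apply/(gauge_le _ bK) => //; rewrite lerDl divr_ge0// ltW.
- by rewrite divr_ge0 ?(ltW t0) ?(ltW st0)//= ler_pdivrMr// mul1r lerDr ltW.
Qed.

Lemma gauge_norm K : convex_body K -> exists C M, [/\ 0 < C, 0 < M &
  forall x, gauge K x <= C * `|x| /\ `|x| <= M * gauge K x].
Proof.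
move=> bK; have [r r0 Hr] := convex_body_ball bK; have [cK _ _] := bK.
have [M M0 HM] := compact_norm_bound cK.
exists r^-1, M; split; rewrite ?invr_gt0// => x; split.
  have [->|x0] := eqVneq x 0; first by rewrite gauge0// mulr_ge0// invr_ge0 ltW.
  have xr : 0 < r^-1 * `|x| by rewrite mulr_gt0 ?invr_gt0 ?normr_gt0.
  apply/(gauge_le _ bK) => //; apply: Hr.
  by rewrite normrZ normfV gtr0_norm// invfM invrK mulfVK// normr_eq0.
apply/ler_addgt0Pr => e e0.
have s0 : 0 < gauge K x + e / M by rewrite ltr_wpDl ?gauge_ge0// divr_gt0.
have -> : M * gauge K x + e = M * (gauge K x + e / M) by field; rewrite gt_eqF.
have : K ((gauge K x + e / M)^-1 *: x).
  by apply/(gauge_le _ bK) => //; rewrite lerDl divr_ge0// ltW.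
by move=> /HM; rewrite normrZ normfV gtr0_norm// ler_pdivrMl// mulrC.
Qed.

Lemma gauge_gt0 K x : convex_body K -> x != 0 -> 0 < gauge K x.
Proof.
move=> bK x0; have [C [M [C0 M0 /(_ x)[_ H]]]] := gauge_norm bK.
rewrite lt0r gauge_ge0 andbT; apply: contraNneq x0 => g0.
by rewrite -normr_le0; apply: le_trans H _; rewrite g0 mulr0.
Qed.

Lemma gauge_lip K : convex_body K -> exists2 L, 0 < L & forall x y,
  `|gauge K x - gauge K y| <= L * `|x - y|.
Proof.
move=> bK; have [C [M [C0 M0 H]]] := gauge_norm bK; exists C => // x y.
have le a b : gauge K a - gauge K b <= C * `|a - b|.
  rewrite lerBlDr; apply: le_trans (_ : gauge K (a - b) + gauge K b <= _).
    by rewrite -{1}(subrK b a) gaugeD.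
  by rewrite lerD2r; have [] := H (a - b).
by rewrite ler_norml le andbT lerNl opprB distrC le.
Qed.

Lemma gauge_continuous K : convex_body K -> continuous (gauge K).
Proof.
move=> bK x; have [L L0 HL] := gauge_lip bK.
apply/(@cvgrPdist_le _ _ _ (nbhs x)) => e e0; apply/nbhs_ballP.
exists (e / L) => /=; first exact: divr_gt0.
move=> z; rewrite -ball_normE /ball_/= ltr_pdivlMr// => xz.
by apply: (le_trans (HL _ _)); rewrite mulrC ltW.
Qed.

Lemma boundary_gauge K x : convex_body K -> gauge K x = 1 -> boundary K x.
Proof.
move=> bK x1; split; first by apply: subset_closure; apply/(gauge_le1 _ bK); rewrite x1.
move=> /nbhs_ballP[r /= r0 Hr].
have x0 : x != 0 by apply/eqP => x0; move: x1; rewrite x0 gauge0// => /esym/eqP; rewrite oner_eq0.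
pose t := r / (2 * `|x|); have xn : 0 < `|x| by rewrite normr_gt0.
have t0 : 0 < t by rewrite divr_gt0// mulr_gt0.
have : K ((1 + t) *: x).
  apply: Hr; rewrite -ball_normE /ball_/= scalerDl scale1r opprD addrA subrr add0r normrN normrZ.
  rewrite gtr0_norm// /t invfM mulrA divfK ?gt_eqF//.
  by rewrite ltr_pdivrMr// ltr_pMr// ltr1n.
move=> /(gauge_le1 _ bK); rewrite gaugeZ ?addr_gt0// x1 mulr1.
by rewrite gerDl leNgt t0.
Qed.

Lemma gauge_boundary K x : convex_body K -> boundary K x -> gauge K x = 1.
Proof.
move=> bK [clx nint]; have [cK _ _] := bK.
have clK : closed K by apply: compact_closed => //; exact: norm_hausdorff.
have Kx : K x by exact: clK.
apply/eqP; rewrite eq_le; apply/andP; split; first exact/(gauge_le1 _ bK).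
rewrite leNgt; apply/negP => gx; apply: nint.
have [r r0 Hr] := continuous_row_lt (gauge_continuous bK (x:=x)) gx.
apply/nbhs_ballP; exists r => // z; rewrite -ball_normE /ball_/= distrC => /Hr.
by move=> /ltW /(gauge_le1 _ bK).
Qed.

Lemma convex_body_polar K : convex_body K -> convex_body (polar K).
Proof.
move=> bK; have [cK _ _] := bK; have [r r0 Hr] := convex_body_ball bK.
have [M M0 HM] := compact_norm_bound cK.
split.
- apply: bounded_closed_compact.
    exists r^-1; split; [exact: num_real|move=> N rN p /= Hp].
    apply: le_trans (ltW rN); apply: norm_row_le => [|i]; first by rewrite invr_ge0 ltW.
    have nd (s : R) : `|s| = r -> K (s *: delta_mx 0 i).
      move=> sr; apply: Hr; rewrite normrZ sr ler_piMr ?(ltW r0)//.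
      by apply: norm_row_le => // j; rewrite mxE; case: (_ && _); rewrite ?normr1 ?normr0.
    have H1 := Hp _ (nd r (gtr0_norm r0)).
    have H2 := Hp _ (nd (- r) (etrans (normrN r) (gtr0_norm r0))).
    rewrite !dotpZr dotp_delta in H1 H2.
    by rewrite -[leRHS]div1r ler_pdivlMr// -[r in leLHS](gtr0_norm r0) -normrM ler_norml; lra.
  rewrite (_ : polar K = \bigcap_(x in K) [set p | dotp p x <= 1]); last by [].
  apply: closed_bigI => x Kx; apply: (@preimage_closed _ _ (fun p : E => dotp p x) [set t : R | t <= 1]).
    by move=> p _; exact: dotp_continuous.
  exact: closed_le.
- move=> x y t Px Py /andP[t0 t1] k Kk; rewrite dotpDl !dotpZl.
  rewrite [leRHS](_ : 1 = (1 - t) * 1 + t * 1); last by ring.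
  by apply: lerD; rewrite ler_wpM2l ?subr_ge0//; [exact: Px|exact: Py].
- apply/nbhs_ballP; exists ((n.+1%:R * M)^-1) => /=; first by rewrite invr_gt0 mulr_gt0.
  move=> p; rewrite -ball_normE /ball_/= sub0r normrN -[X in _ < X]div1r ltr_pdivlMr ?mulr_gt0// => pr k Kk.
  apply: le_trans (ltW pr); apply: (le_trans (ler_norm _)).
  apply: (le_trans (dotp_le_l1norm _ _)); rewrite mulrA.
  by apply: ler_pM => //; [exact: l1norm_ge0|rewrite mulrC; exact: l1norm_le|exact: HM].
Qed.

End convex_body.

Section strict_derivative_more.
Variables (R : realType) (n : nat).
Local Notation E := 'rV[R]_n.
Implicit Types (f h : E -> R) (F : E -> E) (y v g : E) (U A : set E).

Lemma row_continuousV (f : E -> R) x : f x != 0 -> {for x, continuous f} -> {for x, continuous (fun z => (f z)^-1)}.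
Proof. by move=> fx cf; exact: (@cvgV _ _ (nbhs x) _ f (f x) fx cf). Qed.
Lemma row_continuousZ (f : E -> R) (F : E -> E) x : {for x, continuous f} -> {for x, continuous F} -> {for x, continuous (fun z => f z *: F z)}.
Proof. by move=> cf cF; exact: (@cvgZ _ _ _ (nbhs x) _ f F _ _ cf cF). Qed.

Lemma sderiv_near_eq f h y g : (\forall z \near nbhs y, f z = h z) ->
  sderiv f y g -> sderiv h y g.
Proof.
move=> /nbhs_ballP[r /= r0 Hr] Hf e e0.
have [r' r'0 Hr'] := sderiv_near Hf e0.
apply/nbhs_ballP; exists (Num.min r r'); first by rewrite /= lt_min r0.
move=> [z w] [/= zr wr].
have B x : ball y (Num.min r r') x -> ball y r x /\ `|x - y| < r'.
  by rewrite -!ball_normE /ball_/= lt_min => /andP[-> yx]; rewrite distrC.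
have [zr1 zr2] := B _ zr; have [wr1 wr2] := B _ wr.
by rewrite -(Hr _ zr1) -(Hr _ wr1); exact: Hr'.
Qed.

Lemma sderivN f y g : sderiv f y g -> sderiv (fun z => - f z) y (- g).
Proof.
move=> Hf e e0; apply: filterS (Hf e e0) => p.
have -> : - f p.1 - - f p.2 - dotp (- g) (p.1 - p.2) = - (f p.1 - f p.2 - dotp g (p.1 - p.2)).
  by rewrite dotpNl; ring.
by rewrite normrN.
Qed.

Lemma sderiv_le f y g v (c d : R) : sderiv f y g -> 0 < d ->
  (forall t, 0 < t < d -> f (y + t *: v) <= f y + t * c) -> dotp g v <= c.
Proof.
move=> Hf d0 H; apply/ler_addgt0Pr => e e0.
have B0 : 0 < 1 + `|v| by rewrite ltr_pwDl.
have [r r0 Hr] := sderiv_near Hf (divr_gt0 e0 B0).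
pose t := Num.min d (r / (1 + `|v|)) / 2.
have m0 : 0 < Num.min d (r / (1 + `|v|)) by rewrite lt_min d0 divr_gt0.
have t0 : 0 < t by rewrite divr_gt0.
have tm : t < Num.min d (r / (1 + `|v|)) by rewrite ltr_pdivrMr// ltr_pMr// ltr1n.
have [td tr] : t < d /\ t < r / (1 + `|v|) by move: tm; rewrite lt_min => /andP.
have := Hr (y + t *: v) y; rewrite addrAC subrr add0r normr0 => /(_ _ r0).
rewrite normrZ gtr0_norm// => H1.
have {}H1 : `|f (y + t *: v) - f y - dotp g (t *: v)| <= e / (1 + `|v|) * (t * `|v|).
  apply: H1; apply: (@le_lt_trans _ _ (t * (1 + `|v|))); last by rewrite -ltr_pdivlMr.
  by rewrite ler_wpM2l ?(ltW t0)// lerDr.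
have H2 := H t; rewrite t0 td in H2; have {}H2 := H2 isT.
rewrite -(ler_pM2l t0); rewrite dotpZr in H1.
have H3 : e / (1 + `|v|) * (t * `|v|) <= t * e.
  rewrite mulrCA ler_wpM2l ?(ltW t0)// -mulrA ler_piMr ?(ltW e0)//.
  by rewrite mulrC ler_pdivrMr// mul1r lerDr.
by move: H1; rewrite ler_norml => /andP[H1 _]; rewrite mulrDr; lra.
Qed.

Lemma sderiv_eqv f y g v (c d : R) : sderiv f y g -> 0 < d ->
  (forall t, 0 < t < d -> f (y + t *: v) = f y + t * c) -> dotp g v = c.
Proof.
move=> Hf d0 H; apply/eqP; rewrite eq_le; apply/andP; split.
  by apply: (sderiv_le Hf d0) => t /H ->.
rewrite -lerN2 -dotpNl; apply: (sderiv_le (sderivN Hf) d0) => t /H ->.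
by rewrite mulrN opprD.
Qed.

Lemma sjacobian_ex F y : (forall j, exists g, sderiv (fun z => F z 0 j) y g) ->
  exists M, sjacobian F y M.
Proof.
move=> /choice[g Hg]; exists (\matrix_(i, j) g j 0 i); apply/sjacobianP => j.
by rewrite (_ : \row_i _ = g j)//; apply/rowP => i; rewrite !mxE.
Qed.

Lemma sderiv_dotp F y M v : sjacobian F y M -> sderiv (fun z => dotp (F z) v) y (v *m M^T).
Proof.
move=> HF; apply: (@sderiv_comp _ _ (fun z => dotp z v) F) => // e e0; near=> q.
by rewrite dotpBr !(dotpC v) subrr normr0 mulr_ge0// ltW.
Unshelve. all: by end_near. Qed.

Lemma Ck2_sjacobian U f y : open U -> Ck 2 U f -> U y ->
  sjacobian (grad f) y (\matrix_(i, j) partial i (partial j f) y).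
Proof.
move=> oU [_ Hf] Uy; apply/sjacobianP => j.
have [_ H] := Hf j; have := Ck1_sderiv oU H Uy.
have -> : (fun z => grad f z 0 j) = partial j f by apply/funext => z; rewrite mxE.
by have -> : \row_i (\matrix_(i, j) partial i (partial j f) y) i j = grad (partial j f) y
  by apply/rowP => i; rewrite !mxE.
Qed.

Lemma Ck2_Ck1 U f : Ck 2 U f -> Ck 1 U f.
Proof.
by move=> [cf Hf]; split => // i; have [d1 [c1 _]] := Hf i.
Qed.

Lemma defining_zero A U psi y : C2_defining A U psi -> U y -> boundary A y -> psi y = 0.
Proof.
move=> [_ _ _ H] Uy [cly nint]; have [Hi Hc] := H y Uy.
apply/eqP; rewrite eq_le; apply/andP; split; first exact/Hc.
by rewrite leNgt; apply/negP => /Hi.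
Qed.

Lemma open_row_ball U y : open U -> U y -> exists2 r, 0 < r & forall z, `|z - y| < r -> U z.
Proof.
move=> oU Uy; have /nbhs_ballP[r /= r0 Hr] : nbhs y U by exact: open_nbhs_nbhs.
by exists r => // z zr; apply: Hr; rewrite -ball_normE /ball_/= distrC.
Qed.

Lemma open_row_seg U y v : open U -> U y -> exists2 d, 0 < d & forall t, 0 < t < d -> U (y + t *: v).
Proof.
move=> oU Uy; have [r r0 Hr] := open_row_ball oU Uy.
have B0 : 0 < 1 + `|v| by rewrite ltr_pwDl.
exists (r / (1 + `|v|)) => [|t /andP[t0 tr]]; first exact: divr_gt0.
apply: Hr; rewrite addrAC subrr add0r normrZ gtr0_norm//.
apply: (@le_lt_trans _ _ (t * (1 + `|v|))); last by rewrite -ltr_pdivlMr.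
by rewrite ler_wpM2l ?(ltW t0)// lerDr.
Qed.

End strict_derivative_more.

Section gauge_regularity.
Variables (R : realType) (n : nat) (K : set 'rV[R]_n).
Local Notation E := 'rV[R]_n.
Local Notation rho := (gauge K).
Hypotheses (bK : convex_body K) (KC2 : C2_boundary K).
Implicit Types (x y v p q : E).

Let rad x : E := (rho x)^-1 *: x.

Lemma gauge_rad p : p != 0 -> boundary K (rad p).
Proof.
move=> p0; apply: boundary_gauge => //; have g0 := gauge_gt0 bK p0.
by rewrite gaugeZ ?invr_gt0// mulVf// gt_eqF.
Qed.

(** Convexity puts [K] on one side of its tangent hyperplane at [q]. Applied to a small multiple of
    the normal, which lies in [K] because 0 is interior, this gives the strict sign. *)
Lemma defining_outward U psi q : boundary K q -> U q -> C2_defining K U psi ->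
  0 < dotp (grad psi q) q.
Proof.
move=> bq Uq dpsi; have [oU C2 D0 Hpsi] := dpsi; set D := grad psi q.
have DK k : K k -> dotp D (k - q) <= 0.
  move=> Kk; have [d d0 Hd] := open_row_seg (k - q) oU Uq.
  apply: (@sderiv_le _ _ psi q D (k - q) 0 (Num.min d 1)).
  - exact: Ck1_sderiv oU (Ck2_Ck1 C2) Uq.
  - by rewrite lt_min d0 ltr01.
  - move=> t /andP[t0]; rewrite lt_min => /andP[td t1].
    rewrite (defining_zero dpsi Uq bq) mulr0 addr0.
    have Ut : U (q + t *: (k - q)) by apply: Hd; rewrite t0.
    have [_ Hc] := Hpsi _ Ut; apply/Hc; apply: subset_closure.
    have -> : q + t *: (k - q) = (1 - t) *: q + t *: k.
      by rewrite scalerBr scalerBl scale1r addrA addrAC.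
    have [cK cvK _] := bK; apply: cvK => //; last by rewrite !ltW.
    by apply/(gauge_le1 _ bK); rewrite gauge_boundary.
have [r r0 Hr] := convex_body_ball bK.
have Dn : 0 < `|D| by rewrite normr_gt0; exact: D0.
have := DK ((r / `|D|) *: D); rewrite dotpBr dotpZr subr_le0 => H.
apply: lt_le_trans (H _); first by rewrite mulr_gt0 ?divr_gt0// dotp_gt0//; exact: D0.
by apply: Hr; rewrite normrZ gtr0_norm ?divr_gt0// divfK// gt_eqF.
Qed.

Lemma rad_continuous p : p != 0 -> {for p, continuous rad}.
Proof.
move=> p0; apply: row_continuousZ; last exact: cvg_id.
by apply: row_continuousV; [rewrite gt_eqF// gauge_gt0|exact: gauge_continuous].
Qed.

(** The function [psi] vanishes at the radial projections of [z] and [w], so the product of [D] with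
    their difference is of higher order; by homogeneity, in the form of [id1], this becomes an
    expansion of [rho]. The scalar makes the product of the gradient with [rad p] equal to 1. *)
Lemma gauge_sderiv U psi p : p != 0 -> U (rad p) -> C2_defining K U psi ->
  sderiv rho p ((dotp (grad psi (rad p)) (rad p))^-1 *: grad psi (rad p)).
Proof.
move=> p0 Up dpsi; have [oU C2 D0 Hpsi] := dpsi; set D := grad psi _.
have c0 : 0 < dotp D (rad p) := defining_outward (gauge_rad p0) Up dpsi.
set c := dotp D _ in c0 *.
have [L L0 HL] := gauge_lip bK; have [_ [M [_ M0 /all_and2[_ HM]]]] := gauge_norm bK.
have r0 := gauge_gt0 bK p0.
move=> e e0.
pose C1 := ((rho p)^-1 + 1) * (1 + L * M).
have C10 : 0 < C1 by rewrite !mulr_gt0// addr_gt0 ?invr_gt0// mulr_gt0.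
have B0 : 0 < rho p + 1 by rewrite addr_gt0.
pose e1 := c * e / 2 / (C1 * (rho p + 1)).
have e10 : 0 < e1 by apply: divr_gt0; [apply: divr_gt0 => //|]; exact: mulr_gt0.
have psid := Ck1_sderiv oU (Ck2_Ck1 C2) Up.
have [r1 r10 Hr1] := sderiv_near psid e10.
have [r2 r20 Hr2] := open_row_ball oU Up.
have crad := rad_continuous p0.
have cr (s : R) : 0 < s -> exists2 r, 0 < r & forall z, `|z - p| < r -> `|rad z - rad p| < s.
  move=> s0; have /(@cvgrPdist_lt _ _ _ (nbhs p)) /(_ s s0)/nbhs_ballP[r /= r00 Hr] := crad.
  by exists r => // z zp; rewrite distrC; apply: Hr; rewrite -ball_normE /ball_/= distrC.
have [s1 s10 Hs1] := cr _ r10; have [s2 s20 Hs2] := cr _ r20.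
have e30 : 0 < c * e / 2 / L / (l1norm D + 1).
  by rewrite ?(divr_gt0, mulr_gt0)// ltr_wpDl// l1norm_ge0.
have [s3 s30 Hs3] := cr _ e30.
have [s4 s40 Hs4] := continuous_row_dist (gauge_continuous bK (x:=p)) ltr01.
have cinv : {for p, continuous (fun z => (rho z)^-1)}.
  by apply: row_continuousV; [rewrite gt_eqF|exact: gauge_continuous].
have [s5 s50 Hs5] := continuous_row_dist cinv ltr01.
have pn : 0 < `|p| by rewrite normr_gt0.
pose s := Num.min `|p| (Num.min s1 (Num.min s2 (Num.min s3 (Num.min s4 s5)))).
apply/nbhs_ballP; exists s; first by rewrite /= !lt_min pn s10 s20 s30 s40.
have loc z : ball p s z -> [/\ z != 0, `|rad z - rad p| < r1, psi (rad z) = 0,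
    `|rad z - rad p| < c * e / 2 / L / (l1norm D + 1) & rho z <= rho p + 1 /\ (rho z)^-1 <= (rho p)^-1 + 1].
  rewrite -ball_normE /ball_/= distrC !lt_min => /and5P[z0 z1 z2 z3 /andP[z4 z5]].
  have zn0 : z != 0 by apply: contraTneq z0 => ->; rewrite sub0r normrN ltxx.
  split => //; [exact: Hs1| |exact: Hs3|].
    by apply: (defining_zero dpsi); [apply: Hr2; exact: Hs2|exact: gauge_rad].
  have := Hs4 _ z4; have := Hs5 _ z5; rewrite !ltr_norml => /andP[_ h1] /andP[_ h2].
  by move: h1 h2; clear; split; lra.
move=> [z w] [/= /loc[zn z1 z2 z3 [z4 z5]] /loc[wn w1 w2 w3 _]].
have rz0 := gauge_gt0 bK zn; have rw0 := gauge_gt0 bK wn.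
have rad1 x : x != 0 -> rho x *: rad x = x.
  by move=> x0; rewrite /rad scalerA divff ?scale1r// gt_eqF// gauge_gt0.
have qzw : `|rad z - rad w| <= C1 * `|z - w|.
  have -> : rad z - rad w = (rho z)^-1 *: ((z - w) - (rho z - rho w) *: rad w).
    have rzn : rho z != 0 by rewrite gt_eqF.
    apply: (scalerI rzn); rewrite scalerA divff// scale1r scalerBr rad1//.
    by rewrite -{2}(rad1 w wn) scalerBl opprB addrA subrK.
  rewrite normrZ gtr0_norm ?invr_gt0// -mulrA; apply: ler_pM => //; first by rewrite invr_ge0 ltW.
  apply: (le_trans (ler_normB _ _)); rewrite mulrDl mul1r lerD2l normrZ.
  rewrite mulrAC; apply: ler_pM => //.
  by apply: (le_trans (HM _)); rewrite gauge_boundary; [rewrite mulr1|exact: bK|exact: gauge_rad].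
have id1 : c * (rho z - rho w) - dotp D (z - w) =
    dotp D (rad p - rad w) * (rho z - rho w) - rho z * dotp D (rad z - rad w).
  have Dr x : x != 0 -> dotp D x = rho x * dotp D (rad x) by move=> /rad1{1}<-; rewrite dotpZr.
  by rewrite !dotpBr (Dr z zn) (Dr w wn) -/c; ring.
have := Hr1 _ _ z1 w1; rewrite z2 w2 subrr sub0r normrN => H1.
rewrite dotpZl; have cn : c != 0 by rewrite gt_eqF.
rewrite -(ler_pM2l c0) -{1}(gtr0_norm c0) -normrM.
have -> : c * (rho z - rho w - c^-1 * dotp D (z - w)) = c * (rho z - rho w) - dotp D (z - w).
  by field.
rewrite id1; apply: (le_trans (ler_normB _ _)); rewrite !normrM.
have B1 : `|dotp D (rad p - rad w)| <= c * e / 2 / L.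
  apply: (le_trans (dotp_le_l1norm _ _)); rewrite distrC.
  apply: (@le_trans _ _ ((l1norm D + 1) * `|rad w - rad p|)); first by rewrite ler_wpM2r// lerDl.
  by rewrite mulrC -ler_pdivlMr ?ltr_wpDl ?l1norm_ge0// ltW.
have B2 : `|dotp D (rad z - rad w)| <= e1 * (C1 * `|z - w|).
  by apply: (le_trans H1); rewrite ler_wpM2l// ltW.
have -> : c * (e * `|z - w|) = c * e / 2 / L * (L * `|z - w|) + (rho p + 1) * (e1 * (C1 * `|z - w|)).
  by rewrite /e1; field; rewrite !gt_eqF.
apply: lerD; first by apply: ler_pM.
by rewrite gtr0_norm//; apply: ler_pM => //; exact: ltW.
Qed.

(* Near [p] the gradient is an explicit function of the defining function at [rad p]. *)
Lemma gauge_C2 p : p != 0 -> sderiv rho p (grad rho p) /\ exists P, sjacobian (grad rho) p P.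
Proof.
move=> p0; have [U [psi [Up dpsi]]] := KC2 (gauge_rad p0).
have [oU C2 D0 Hpsi] := dpsi; have g := gauge_sderiv p0 Up dpsi.
split; first by rewrite (sderiv_grad g).
pose Q z : E := (dotp (grad psi (rad z)) (rad z))^-1 *: grad psi (rad z).
have QR : \forall z \near nbhs p, forall j, Q z 0 j = grad rho z 0 j.
  have [r r0 Hr] := open_row_ball oU Up.
  have /(@cvgrPdist_lt _ _ _ (nbhs p)) /(_ r r0)/nbhs_ballP[s /= s0 Hs] := rad_continuous p0.
  apply/nbhs_ballP; exists (Num.min s `|p|); first by rewrite /= lt_min s0 normr_gt0.
  move=> z; rewrite -ball_normE /ball_/= lt_min => /andP[zs zp] j.
  have z0 : z != 0 by apply: contraTneq zp => ->; rewrite subr0 ltxx.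
  have Uz : U (rad z) by apply: Hr; rewrite distrC; apply: Hs; rewrite -ball_normE.
  by rewrite (sderiv_grad (gauge_sderiv z0 Uz dpsi)).
apply: sjacobian_ex => j.
suff [k Hk] : exists k, sderiv (fun z => Q z 0 j) p k.
  by exists k; apply: sderiv_near_eq Hk; apply: filterS QR.
have rV := sderivV g (lt0r_neq0 (gauge_gt0 bK p0)).
have Hrad i := sderivM rV (sderiv_coord i p).
have [M HM] : exists M, sjacobian rad p M.
  apply: sjacobian_ex => i; eexists; rewrite (_ : (fun z => rad z 0 i) = fun z => (rho z)^-1 * z 0 i).
    exact: Hrad.
  by apply/funext => z; rewrite mxE.
have HD i := sderiv_comp HM ((sjacobianP _ _ _).1 (Ck2_sjacobian oU C2 Up) i).
have Hr i := (sjacobianP _ _ _).1 HM i.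
have Hdot := sderiv_sum (index_enum 'I_n) (fun i => sderivM (HD i) (Hr i)).
have c0 : 0 < dotp (grad psi (rad p)) (rad p) := defining_outward (gauge_rad p0) Up dpsi.
have HV := sderivV Hdot (lt0r_neq0 c0).
have HQ := sderivM HV (HD j).
move: HQ; set kk := (X in sderiv _ _ X); set ff := (X in sderiv X _ _) => HQ.
by exists kk; rewrite (_ : (fun z => Q z 0 j) = ff)//; apply/funext => z; rewrite mxE.
Qed.

Local Notation Rg := (grad rho).

Lemma gauge_grad_le p q : p != 0 -> dotp (Rg p) q <= rho q.
Proof.
move=> p0; have [g _] := gauge_C2 p0; apply: (sderiv_le g ltr01) => t /andP[t0 _].
by apply: (le_trans (gaugeD _ _ bK)); rewrite gaugeZ.
Qed.

Lemma gauge_euler p : p != 0 -> dotp (Rg p) p = rho p.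
Proof.
move=> p0; have [g _] := gauge_C2 p0; apply: (sderiv_eqv g ltr01) => t /andP[t0 _].
by rewrite -{1}[p]scale1r -scalerDl gaugeZ ?addr_gt0// mulrDl mul1r.
Qed.

(** A linear form below [rho] that touches it at [p] is a subgradient, and [rho] is differentiable
    there. *)
Lemma gauge_grad_unique p v : p != 0 -> (forall q, dotp v q <= rho q) -> dotp v p = rho p ->
  v = Rg p.
Proof.
move=> p0 Hv vp; have [g _] := gauge_C2 p0.
have le q : dotp v q <= dotp (Rg p) q.
  rewrite -lerN2 -dotpNl; apply: (sderiv_le (sderivN g) ltr01) => t /andP[t0 _].
  by rewrite -vp mulrN -opprD lerN2 -dotpZr -dotpDr.
apply: dotp_inj => q; apply/eqP; rewrite eq_le le/=.
by have := le (- q); rewrite !dotpNr lerN2.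
Qed.

Lemma gauge_gradZ p (c : R) : p != 0 -> 0 < c -> Rg (c *: p) = Rg p.
Proof.
move=> p0 c0; have cp : c *: p != 0 by rewrite scaler_eq0 negb_or gt_eqF.
apply: gauge_grad_unique => // [q|]; first exact: gauge_grad_le.
apply: (mulfI (lt0r_neq0 c0)); rewrite -dotpZr gauge_euler// gaugeZ//.
Qed.

Lemma gauge_hess_sym p P : p != 0 -> sjacobian Rg p P -> P^T = P.
Proof.
move=> p0; apply: (@hessian_sym _ _ rho _ _ _ `|p|); first by rewrite normr_gt0.
move=> z zp; have z0 : z != 0 by apply: contraTneq zp => ->; rewrite sub0r normrN ltxx.
by have [] := gauge_C2 z0.
Qed.

Lemma gauge_hess_radial p P : p != 0 -> sjacobian Rg p P -> p *m P = 0.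
Proof.
move=> p0 HP; apply: dotp_inj => v; rewrite dotp0l dotp_mulmxl dotpC.
apply: (sderiv_eqv (sderiv_dotp v HP) ltr01) => t /andP[t0 _].
by rewrite mulr0 addr0 -{1}[p]scale1r -scalerDl gauge_gradZ// addr_gt0.
Qed.

(** This is the monotonicity of the gradient of a convex function, read off from [gauge_grad_le] at
    two points and Euler's identity. *)
Lemma gauge_hess_psd p P v : p != 0 -> sjacobian Rg p P -> 0 <= dotp (v *m P) v.
Proof.
move=> p0 HP; rewrite dotp_mulmxl dotpC -lerN2 oppr0 -dotpNl.
have [d d0 Hd] : exists2 d, 0 < d & forall t, 0 < t < d -> p + t *: v != 0.
  exists (`|p| / (1 + `|v|)); first by rewrite divr_gt0 ?normr_gt0// ltr_pwDl.
  move=> t /andP[t0]; rewrite ltr_pdivlMr ?ltr_pwDl// => tp.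
  apply: contraTneq tp => /eqP; rewrite addr_eq0 => /eqP ->.
  by rewrite normrN normrZ gtr0_norm// -leNgt ler_wpM2l ?(ltW t0)// lerDr.
apply: (sderiv_le (sderivN (sderiv_dotp v HP)) d0) => t td.
have p'0 := Hd t td; have /andP[t0 _] := td; set p' := p + _ in p'0 *.
rewrite mulr0 addr0 lerN2 -(ler_pM2l t0) -!dotpZr.
have -> : t *: v = p' - p by rewrite /p' addrAC subrr add0r.
rewrite !dotpBr gauge_euler// [dotp (Rg p') p']gauge_euler//.
by have := gauge_grad_le p' p0; have := gauge_grad_le p p'0; lra.
Qed.

End gauge_regularity.

(** * The distance from the boundary and the Cahn-Hoffman directions *)

Lemma lipschitz_row_continuous (R : realType) (n : nat) (f : 'rV[R]_n -> R) (L : R) : 0 < L ->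
  (forall x y, `|f x - f y| <= L * `|x - y|) -> continuous f.
Proof.
move=> L0 HL x; apply/(@cvgrPdist_le _ _ _ (nbhs x)) => e e0; apply/nbhs_ballP.
exists (e / L) => /=; first exact: divr_gt0.
move=> z; rewrite -ball_normE /ball_/= ltr_pdivlMr// => xz.
by apply: (le_trans (HL _ _)); rewrite mulrC ltW.
Qed.

Section duality.
Variables (R : realType) (n : nat) (K : set 'rV[R]_n).
Local Notation E := 'rV[R]_n.
Local Notation rho := (gauge K).
Local Notation sf := (gauge (polar K)).
Local Notation Rg := (grad rho).
Hypotheses (bK : convex_body K).
Let bP := convex_body_polar bK.
Implicit Types (x y v p q : E).

(** The Cauchy-Schwarz inequality of polar duality, [sf] being the support function of [K]. *)
Lemma dotp_le_gauge p v : dotp p v <= rho p * sf v.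
Proof.
have [->|p0] := eqVneq p 0; first by rewrite dotp0l gauge0// mul0r.
have [->|v0] := eqVneq v 0; first by rewrite dotp0r gauge0// mulr0.
have rp := gauge_gt0 bK p0; have sv := gauge_gt0 bP v0.
have Kp : K ((rho p)^-1 *: p) by apply/(gauge_le _ bK).
have Pv : polar K ((sf v)^-1 *: v) by apply/(gauge_le _ bP).
have := Pv _ Kp; rewrite dotpZl dotpZr dotpC mulrA -invfM mulrC ler_pdivrMr ?mulr_gt0//.
by rewrite mul1r mulrC.
Qed.

Lemma support_le v (c : R) : 0 <= c -> (forall k, K k -> dotp k v <= c) -> sf v <= c.
Proof.
move=> c0 H; apply/ler_addgt0Pr => e e0; have ce : 0 < c + e by rewrite ltr_wpDl.
apply/(gauge_le _ bP) => // k Kk; rewrite dotpZl dotpC mulrC ler_pdivrMr// mul1r.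
by apply: (le_trans (H _ Kk)); rewrite lerDl ltW.
Qed.

Hypothesis KC2 : C2_boundary K.

Lemma support_grad p : p != 0 -> sf (Rg p) = 1.
Proof.
move=> p0; apply/eqP; rewrite eq_le; apply/andP; split.
  apply: support_le => // k Kk; rewrite dotpC.
  by apply: (le_trans (gauge_grad_le bK KC2 _ p0)); apply/(gauge_le1 _ bK).
have rp := gauge_gt0 bK p0; rewrite -(ler_pM2l rp) mulr1.
by have := dotp_le_gauge p (Rg p); rewrite dotpC gauge_euler.
Qed.

(** The hypothesis amounts to equality in [dotp_le_gauge]; then [v] divided by [sf v] is a
    subgradient of [rho] at [p]. *)
Lemma dual_eq_grad p v : p != 0 -> 0 <= dotp p (v - sf v *: Rg p) -> v = sf v *: Rg p.
Proof.
move=> p0; have [->|v0] := eqVneq v 0; first by rewrite gauge0// scale0r.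
have sv := gauge_gt0 bP v0; rewrite dotpBr dotpZr [dotp p (Rg p)]dotpC gauge_euler// subr_ge0 => H.
have pv : dotp p v = rho p * sf v.
  by apply/eqP; rewrite eq_le dotp_le_gauge mulrC.
rewrite -(@gauge_grad_unique _ _ K bK KC2 p ((sf v)^-1 *: v))//.
- by rewrite scalerA divff ?scale1r// gt_eqF.
- move=> q; rewrite dotpZl dotpC mulrC ler_pdivrMr//; exact: dotp_le_gauge.
- by rewrite dotpZl dotpC pv mulrC mulfK// gt_eqF.
Qed.

End duality.

Section segment_crossing.
Variables (R : realType) (n : nat).
Local Notation E := 'rV[R]_n.

Lemma boundary_crossing (A : set E) (x w : E) : A x -> ~ A w ->
  exists2 t : R, 0 <= t <= 1 & boundary A (x + t *: (w - x)).
Proof.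
move=> Ax nAw; pose T := [set t : R | 0 <= t <= 1 /\ A (x + t *: (w - x))].
have T0 : T 0 by split; rewrite ?lexx ?ler01// scale0r addr0.
have sT : has_sup T by split; [exists 0|exists 1 => t [/andP[]]].
pose t := sup T.
have t0 : 0 <= t by apply: ub_le_sup; [exact: sT.2|].
have t1 : t <= 1 by apply: sup_le_ub; [exact: sT.1|move=> s [/andP[]]].
have B0 : 0 < 1 + `|w - x| by rewrite ltr_pwDl.
have near_t (r : R) : 0 < r -> forall s, `|s - t| < r / (1 + `|w - x|) ->
    ball (x + t *: (w - x)) r (x + s *: (w - x)).
  move=> r0 s st; rewrite -ball_normE /ball_/= opprD addrACA subrr add0r -scalerBl normrZ distrC.
  apply: (@le_lt_trans _ _ (`|s - t| * (1 + `|w - x|))); last by rewrite -ltr_pdivlMr.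
  by rewrite ler_wpM2l// lerDr.
exists t; first by rewrite t0 t1.
split.
  move=> B /nbhs_ballP[r /= r0 rB].
  have e0 : 0 < r / (1 + `|w - x|) by exact: divr_gt0.
  have [s [s01 As] ts] := sup_adherent e0 sT.
  exists (x + s *: (w - x)); split => //; apply: rB; apply: near_t => //.
  have st : s <= t by apply: ub_le_sup; [exact: sT.2|].
  by rewrite distrC ger0_norm ?subr_ge0// ltrBlDr addrC -ltrBlDr.
move=> /nbhs_ballP[r /= r0 rA].
have t_lt1 : t < 1.
  rewrite lt_neqAle t1 andbT; apply/eqP => tE; apply: nAw.
  have -> : w = x + t *: (w - x) by rewrite tE scale1r addrC subrK.
  by apply: rA; exact: ballxx.
have e0 : 0 < r / (1 + `|w - x|) by exact: divr_gt0.
pose s := t + Num.min (1 - t) (r / (1 + `|w - x|)) / 2.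
have m0 : 0 < Num.min (1 - t) (r / (1 + `|w - x|)) by rewrite lt_min subr_gt0 t_lt1.
have ts : t < s by rewrite ltrDl divr_gt0.
have sm : s - t < Num.min (1 - t) (r / (1 + `|w - x|)).
  by rewrite /s addrAC subrr add0r ltr_pdivrMr// ltr_pMr// ltr1n.
move: (sm); rewrite lt_min => /andP[s1 sr].
have : T s.
  split; first by rewrite (le_trans t0 (ltW ts))/=; lra.
  by apply: rA; apply: near_t => //; rewrite gtr0_norm// subr_gt0.
by move=> /(ub_le_sup sT.2); rewrite leNgt ts.
Qed.

End segment_crossing.

Section domain.
Variables (R : realType) (n : nat) (Omega K : set 'rV[R]_n).
Local Notation E := 'rV[R]_n.
Local Notation rho := (gauge K).
Local Notation sf := (gauge (polar K)).
Local Notation Rg := (grad rho).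
Local Notation S := (boundary Omega).
Local Notation d := (minkowski_dist Omega K).
Hypotheses (bK : convex_body K) (KC2 : C2_boundary K).
Hypotheses (O0 : Omega !=set0) (Ob : bounded_set Omega) (Oo : open Omega)
  (OC2 : C2_boundary Omega) (n0 : (0 < n)%N).
Let bP := convex_body_polar bK.
Implicit Types (x y z v w p q : E).

Lemma closure_compact : compact (closure Omega).
Proof.
apply: bounded_closed_compact; last exact: closed_closure.
have [M [Mr HM]] := Ob; exists M; split=> // N MN x clx; rewrite /=.
have cN : closed [set x : E | `|x| <= N].
  apply: (@preimage_closed _ _ (fun x : E => `|x|) [set t : R | t <= N]); last exact: closed_le.
  by move=> y _; exact: norm_continuous.
by apply: cN; apply: closure_subset clx => y Oy; exact: HM.
Qed.

Lemma boundaryE : S = closure Omega `\` Omega.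
Proof. by rewrite /boundary (interior_id _).1. Qed.

Lemma boundary_compact : compact S.
Proof.
rewrite boundaryE setDE; apply: compact_closedI; first exact: closure_compact.
exact: open_closedC.
Qed.

Lemma boundary_neq0 : S !=set0.
Proof.
have [x Ox] := O0; have [M [M0 HM]] := Ob.
pose w : E := const_mx (`|M| + 1).
have nw : ~ Omega w.
  move=> Ow; have := HM (`|M| + 1 / 2) _ w Ow.
  have -> : M < `|M| + 1 / 2 by have := ler_norm M; lra.
  move=> /(_ isT) H; have := le_trans (norm_coord_le w (Ordinal n0)) H.
  rewrite mxE ger0_norm; last by have := normr_ge0 M; lra.
  lra.
by have [t _ ?] := boundary_crossing Ox nw; exists (x + t *: (w - x)).
Qed.

Lemma dist_attained (A : set E) (f : E -> R) : compact A -> A !=set0 -> continuous f ->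
  exists2 y, A y & f y = inf [set f z | z in A] /\ forall z, A z -> f y <= f z.
Proof.
move=> cA A0 cf; have [y [Ay Hy]] := @EVT_min_rV _ _ f A A0 cA (continuous_subspaceT cf).
rewrite inE in Ay; have {}Hy z : A z -> f y <= f z by move=> Az; apply: Hy; rewrite inE.
exists y => //; split => //; apply/eqP; rewrite eq_le; apply/andP; split.
  by apply: lb_le_inf; [exists (f y), y|move=> _ [z Az <-]; exact: Hy].
by apply: ge_inf; [exists (f y) => _ [z Az <-]; exact: Hy|exists y].
Qed.

Lemma gauge_sub_continuous L x : convex_body L -> continuous (fun y : E => gauge L (x - y)).
Proof.
move=> bL; have [C C0 HC] := gauge_lip bL; apply: (lipschitz_row_continuous C0) => y z.
by apply: (le_trans (HC _ _)); rewrite opprB addrC subrKA distrC.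
Qed.

Lemma mdist_proj x : exists y, [/\ S y, sf (x - y) = d x & forall z, S z -> d x <= sf (x - z)].
Proof.
have [y Sy [dy Hy]] := dist_attained boundary_compact boundary_neq0
  (@gauge_sub_continuous (polar K) x bP).
by exists y; split => // z /Hy; rewrite dy.
Qed.

Lemma mdist_le x z : S z -> d x <= sf (x - z).
Proof. by have [y [_ _]] := mdist_proj x; apply. Qed.

Lemma mdist_nonneg x : 0 <= d x.
Proof. by have [y [_ <- _]] := mdist_proj x; exact: gauge_ge0. Qed.

Lemma mdist_lip x z : d x <= sf (x - z) + d z.
Proof.
have [y [Sy <- _]] := mdist_proj z; apply: (le_trans (mdist_le x Sy)).
by rewrite -[x - y](subrKA z) gaugeD.
Qed.

Lemma mdist0 x : S x -> d x = 0.
Proof.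
move=> Sx; apply/eqP; rewrite eq_le mdist_nonneg andbT.
by apply: (le_trans (mdist_le x Sx)); rewrite subrr gauge0.
Qed.

Lemma mdist_pos x : Omega x -> 0 < d x.
Proof.
move=> Ox; have [y [Sy <- _]] := mdist_proj x; apply: gauge_gt0 => //.
rewrite subr_eq0; apply: contraPneq Ox => ->.
by move: Sy; rewrite boundaryE => -[].
Qed.

(** Otherwise the segment from [x] to [w] meets the boundary, at a distance from [x] below [d x]
    unless it does so at [w] itself. *)
Lemma inner_ball x w : Omega x -> sf (x - w) <= d x -> closure Omega w.
Proof.
move=> Ox xw; have [Ow|nOw] := pselect (Omega w); first exact: subset_closure.
have [t /andP[t0 t1] St] := boundary_crossing Ox nOw.
have := mdist_le x St.
have -> : x - (x + t *: (w - x)) = t *: (x - w) by rewrite opprD addrA subrr add0r -scalerN opprB.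
have [->|tn0] := eqVneq t 0.
  by rewrite scale0r gauge0// leNgt mdist_pos.
have tp : 0 < t by rewrite lt0r tn0.
rewrite gaugeZ// => H.
have : d x * 1 <= d x * t by rewrite mulr1 mulrC; apply: le_trans H _; rewrite ler_wpM2l.
rewrite ler_pM2l ?mdist_pos// => t1'; move: St.
have -> : t = 1 by apply/eqP; rewrite eq_le t1.
by rewrite scale1r addrC subrK => -[].
Qed.

(** The ball of radius [d x] about [x] for [sf] lies in the closure of [Omega] and contains the
    segment from [y] to [x - u], as [u] and [v] have the same gauge. Hence [psi] does not increase
    along it at first order, which is equality in the duality between [rho] and [sf]. *)
Lemma proj_direction x y U psi : Omega x -> S y -> sf (x - y) = d x -> U y ->
  C2_defining Omega U psi -> x - y = d x *: Rg (- grad psi y).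
Proof.
move=> Ox Sy xy Uy dpsi; have [oU C2 D0 Hpsi] := dpsi.
have m0 : - grad psi y != 0 by rewrite oppr_eq0; exact: D0.
rewrite -xy; apply: dual_eq_grad => //; rewrite dotpNl -oppr0 lerN2.
set v := x - y; set u := sf v *: _.
have [e e0 He] := open_row_seg (v - u) oU Uy.
apply: (@sderiv_le _ _ psi y (grad psi y) (v - u) 0 (Num.min e 1)).
- exact: Ck1_sderiv oU (Ck2_Ck1 C2) Uy.
- by rewrite lt_min e0 ltr01.
- move=> t /andP[t0]; rewrite lt_min => /andP[te t1].
  rewrite (defining_zero dpsi Uy Sy) mulr0 addr0.
  have Ut : U (y + t *: (v - u)) by apply: He; rewrite t0.
  have [_ Hc] := Hpsi _ Ut; apply/Hc; apply: (inner_ball Ox).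
  have -> : x - (y + t *: (v - u)) = (1 - t) *: v + t *: u.
    by rewrite opprD addrA -/v scalerBr opprB scalerBl scale1r addrA addrAC.
  apply: (le_trans (gaugeD _ _ bP)); rewrite !gaugeZ ?subr_gt0//; last by rewrite /v xy mdist_pos.
  by rewrite support_grad// mulr1 -mulrDl subrK mul1r /v xy.
Qed.

Lemma outer_proj x : ~ closure Omega x -> exists z, [/\ S z, 0 < sf (z - x),
  sf (z - x) = inf [set sf (z - x) | z in closure Omega] &
  forall w, closure Omega w -> sf (z - x) <= sf (w - x)].
Proof.
move=> nx; have cl0 : closure Omega !=set0 by have [z Oz] := O0; exists z; exact: subset_closure.
have csf : continuous (fun y : E => sf (y - x)).
  have [C C0 HC] := gauge_lip bP; apply: (lipschitz_row_continuous C0) => y z.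
  by apply: (le_trans (HC _ _)); rewrite opprB [y - x + _]addrA subrK.
have [z clz [zE Hz]] := dist_attained closure_compact cl0 csf.
have pos w : closure Omega w -> 0 < sf (w - x).
  by move=> clw; apply: gauge_gt0 => //; rewrite subr_eq0; apply: contra_notN nx => /eqP <-.
exists z; split => //; last exact: pos.
rewrite boundaryE; split => // Oz.
have [e e0 He] := open_row_seg (x - z) Oo Oz.
pose t := Num.min e 1 / 2.
have m0 : 0 < Num.min e 1 by rewrite lt_min e0 ltr01.
have t0 : 0 < t by rewrite divr_gt0.
have : t < Num.min e 1 by rewrite ltr_pdivrMr// ltr_pMr// ltr1n.
rewrite lt_min => /andP[te t1].
have := Hz _ (subset_closure (He t _)); rewrite t0 te => /(_ isT).
have -> : z + t *: (x - z) - x = (1 - t) *: (z - x).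
  by rewrite scalerBl scale1r -[in RHS]scalerN opprB addrAC.
rewrite gaugeZ ?subr_gt0// mulrBl mul1r lerBrDr gerDl leNgt mulr_gt0//; exact: pos.
Qed.

(** The mirror image of [proj_direction]: the segment from [z] to [x + u] stays at most as far from
    [x] as [z] is. It avoids [Omega], since from a point of this open set one could still move
    nearer to [x]. *)
Lemma outer_proj_direction x z U psi : ~ closure Omega x -> S z -> 0 < sf (z - x) ->
  (forall w, closure Omega w -> sf (z - x) <= sf (w - x)) -> U z ->
  C2_defining Omega U psi -> z - x = sf (z - x) *: Rg (- grad psi z).
Proof.
move=> nx Sz zx Hz Uz dpsi; have [oU C2 D0 Hpsi] := dpsi.
have m0 : - grad psi z != 0 by rewrite oppr_eq0; exact: D0.
apply: dual_eq_grad => //; rewrite dotpNl -dotpNr -oppr0 -[leRHS]opprK lerN2 -dotpNl.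
set v := z - x; set u := sf v *: _.
have [e e0 He] := open_row_seg (- (v - u)) oU Uz.
apply: (@sderiv_le _ _ (fun y => - psi y) z (- grad psi z) (- (v - u)) 0 (Num.min e 1)).
- by apply: sderivN; exact: Ck1_sderiv oU (Ck2_Ck1 C2) Uz.
- by rewrite lt_min e0 ltr01.
- move=> t /andP[t0]; rewrite lt_min => /andP[te t1].
  rewrite (defining_zero dpsi Uz Sz) mulr0 addr0 lerN2.
  have Ut : U (z + t *: - (v - u)) by apply: He; rewrite t0.
  rewrite leNgt; apply/negP; have [Hi _] := Hpsi _ Ut => /Hi.
  rewrite (interior_id _).1// => Ow.
  set w := z + _ in Ow Ut.
  have wE : w - x = (1 - t) *: v + t *: u.
    by rewrite /w addrAC -/v scalerN scalerBr opprB scalerBl scale1r addrA addrAC.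
  have ws : sf (w - x) <= sf v.
    rewrite wE; apply: (le_trans (gaugeD _ _ bP)); rewrite !gaugeZ ?subr_gt0//.
    by rewrite support_grad// mulr1 -mulrDl subrK mul1r.
  have wpos : 0 < sf (w - x) by apply: lt_le_trans zx (Hz _ (subset_closure Ow)).
  have [e' e'0 He'] := open_row_seg (x - w) Oo Ow.
  pose s := Num.min e' 1 / 2.
  have m'0 : 0 < Num.min e' 1 by rewrite lt_min e'0 ltr01.
  have s0 : 0 < s by rewrite divr_gt0.
  have : s < Num.min e' 1 by rewrite ltr_pdivrMr// ltr_pMr// ltr1n.
  rewrite lt_min => /andP[se s1].
  have := Hz _ (subset_closure (He' s _)); rewrite s0 se => /(_ isT).
  have -> : w + s *: (x - w) - x = (1 - s) *: (w - x).
    by rewrite scalerBl scale1r -[in RHS]scalerN opprB addrAC.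
  rewrite gaugeZ ?subr_gt0// => H; have := le_trans H (ler_wpM2l _ ws).
  rewrite subr_ge0 (ltW s1) => /(_ isT).
  by rewrite mulrBl mul1r lerBrDr gerDl leNgt mulr_gt0.
Qed.

End domain.

Section matrix_bound.
Variables (R : realType) (n : nat).
Local Notation E := 'rV[R]_n.
Implicit Types (v : E) (M : 'M[R]_n).

Definition mxl1 M : R := 1 + \sum_i \sum_j `|M i j|.

Lemma mxl1_gt0 M : 0 < mxl1 M.
Proof. by rewrite ltr_wpDr// sumr_ge0// => i _; rewrite sumr_ge0. Qed.

Lemma mulmx_norm_le v M : `|v *m M| <= mxl1 M * `|v|.
Proof.
apply: norm_row_le => [|j]; first by rewrite mulr_ge0// ltW// mxl1_gt0.
rewrite mxE; apply: (le_trans (ler_norm_sum _ _ _)).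
apply: (@le_trans _ _ (\sum_i `|v| * `|M i j|)).
  by apply: ler_sum => i _; rewrite normrM ler_wpM2r// norm_coord_le.
rewrite -mulr_sumr mulrC ler_wpM2r// ler_wpDl//.
by apply: ler_sum => i _; rewrite (bigD1 j)//= lerDl sumr_ge0.
Qed.

Definition fjacobian (F : E -> E) x M := forall e, 0 < e -> exists2 r, 0 < r &
  forall z, `|z - x| < r -> `|F z - F x - (z - x) *m M| <= e * `|z - x|.

Lemma fjacobianE F x M : fjacobian F x M -> 'J F x = M.
Proof.
move=> HF; have dFE : 'd F x = mulmxr M :> (E -> E).
  apply: diff_unique => [y|].
    apply/(@cvgrPdist_le _ _ _ (nbhs y)) => e e0; apply/nbhs_ballP.
    exists (e / mxl1 M) => /=; first by rewrite divr_gt0// mxl1_gt0.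
    move=> z; rewrite -ball_normE /ball_/= ltr_pdivlMr ?mxl1_gt0// => xz.
    by rewrite -mulmxBl; apply: (le_trans (mulmx_norm_le _ _)); rewrite mulrC ltW.
  apply/eqaddoP => e e0; have [r r0 Hr] := HF e e0.
  apply/nbhs_ballP; exists r => // z; rewrite -ball_normE /ball_/= sub0r normrN => zr.
  have := Hr (z + x); rewrite addrK => /(_ zr); apply: le_trans.
  by rewrite le_eqVlt; apply/orP; left; apply/eqP; congr `|_|; rewrite /cst opprD addrA.
rewrite /jacobian; apply/row_matrixP => i.
by rewrite !rowE mul_rV_lin1 dFE.
Qed.

End matrix_bound.

(** * Inner normals and second order data of the boundary *)

Section boundary_normal.
Variables (R : realType) (n : nat) (Omega K : set 'rV[R]_n).
Local Notation E := 'rV[R]_n.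
Local Notation rho := (gauge K).
Local Notation sf := (gauge (polar K)).
Local Notation Rg := (grad rho).
Local Notation S := (boundary Omega).
Hypotheses (bK : convex_body K) (KC2 : C2_boundary K).
Hypotheses (O0 : Omega !=set0) (Ob : bounded_set Omega) (Oo : open Omega)
  (OC2 : C2_boundary Omega) (n0 : (0 < n)%N).
Let bP := convex_body_polar bK.
Implicit Types (x y z v w p q : E).

(** Gradients of different defining functions differ at [y] by positive factors, see
    [inner_normals_colinear]; hence [unit_bnormal] and [cahn_dir] do not depend on the element
    chosen by [bnormal]. *)
Definition inner_normals y : set E :=
  [set p | exists U psi, [/\ U y, C2_defining Omega U psi & p = - grad psi y]].

Definition bnormal y : E := xget 0 (inner_normals y).
Definition unit_bnormal y : E := (rho (bnormal y))^-1 *: bnormal y.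
Definition cahn_dir y : E := Rg (bnormal y).

Lemma inner_normals_neq0 y p : inner_normals y p -> p != 0.
Proof. by move=> [U [psi [Uy [_ _ D0 _] ->]]]; rewrite oppr_eq0; exact: D0. Qed.

(** A direction with positive product with [p] enters the interior of [Omega], where the other
    defining function is negative too. *)
Lemma inner_normals_lt y p q v : S y -> inner_normals y p -> inner_normals y q ->
  0 < dotp p v -> 0 <= dotp q v.
Proof.
move=> Sy [U [f [Uy df ->]]] [V [h [Vy dh ->]]]; have [oU fC2 _ Hf] := df.
have [oV hC2 _ Hh] := dh; rewrite !dotpNl oppr_gt0 oppr_ge0 => fv.
have [e1 e10 He1] := open_row_seg v oU Uy; have [e2 e20 He2] := open_row_seg v oV Vy.
have sf := Ck1_sderiv oU (Ck2_Ck1 fC2) Uy.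
have [e3 e30 He3] : exists2 e3, 0 < e3 & forall t, 0 < t < e3 -> f (y + t *: v) < 0.
  apply: contrapT => Hn; suff : 0 <= dotp (grad f y) v by rewrite leNgt fv.
  have B0 : 0 < 1 + `|v| by rewrite ltr_pwDl.
  have e0 : 0 < - dotp (grad f y) v / 2 / (1 + `|v|) by rewrite !divr_gt0// oppr_gt0.
  have [r r0 Hr] := sderiv_fderiv sf e0; exfalso; apply: Hn.
  exists (r / (1 + `|v|)) => [|t /andP[t0 tr]]; first exact: divr_gt0.
  have tv : `|t *: v| < r.
    rewrite normrZ gtr0_norm//; apply: (@le_lt_trans _ _ (t * (1 + `|v|))).
      by rewrite ler_wpM2l ?(ltW t0)// lerDr.
    by rewrite -ltr_pdivlMr.
  have := Hr (y + t *: v); rewrite addrAC subrr add0r => /(_ tv).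
  rewrite (defining_zero df Uy Sy) subr0 dotpZr normrZ (gtr0_norm t0) ler_norml => /andP[_].
  have : - dotp (grad f y) v / 2 / (1 + `|v|) * (t * `|v|) <= t * (- dotp (grad f y) v / 2).
    rewrite mulrCA; apply: ler_wpM2l; first exact: ltW.
    rewrite mulrAC ler_pdivrMr//; apply: ler_wpM2l; last by rewrite lerDr.
    by rewrite divr_ge0// oppr_ge0 ltW.
  have : 0 < t * (- dotp (grad f y) v / 2) by rewrite mulr_gt0// divr_gt0// oppr_gt0.
  lra.
apply: (@sderiv_le _ _ h y _ _ _ (Num.min e1 (Num.min e2 e3))).
- exact: Ck1_sderiv oV (Ck2_Ck1 hC2) Vy.
- by rewrite !lt_min e10 e20.
- move=> t /andP[t0]; rewrite !lt_min => /and3P[t1 t2 t3].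
  rewrite (defining_zero dh Vy Sy) mulr0 addr0; apply: ltW.
  have Ut : U (y + t *: v) by apply: He1; rewrite t0.
  have Vt : V (y + t *: v) by apply: He2; rewrite t0.
  by have [Hi _] := Hh _ Vt; apply/Hi; have [Hi' _] := Hf _ Ut; apply/Hi'; apply: He3; rewrite t0.
Qed.

(** The closed half-space of [p] is contained in that of [q]. Tested with minus the component of [q]
    orthogonal to [p], this shows that the component vanishes. *)
Lemma inner_normals_colinear y p q : S y -> inner_normals y p -> inner_normals y q ->
  exists2 c, 0 < c & q = c *: p.
Proof.
move=> Sy Hp Hq; have p0 := inner_normals_neq0 Hp; have q0 := inner_normals_neq0 Hq.
have pp := dotp_gt0 p0.
have le v : 0 <= dotp p v -> 0 <= dotp q v.
  move=> pv; rewrite leNgt; apply/negP => qv.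
  pose e := - dotp q v / 2 / (1 + `|dotp q p|).
  have e0 : 0 < e by rewrite !divr_gt0 ?oppr_gt0// ltr_pwDl.
  have : 0 <= dotp q (v + e *: p).
    apply: (inner_normals_lt Sy Hp Hq); rewrite dotpDr dotpZr ltr_wpDl// mulr_gt0//.
  rewrite dotpDr dotpZr.
  have : e * dotp q p <= - dotp q v / 2.
    apply: (@le_trans _ _ (e * (1 + `|dotp q p|))); last by rewrite divfK// gt_eqF// ltr_pwDl.
    by rewrite ler_wpM2l ?(ltW e0)//; have := ler_norm (dotp q p); lra.
  lra.
pose c := dotp p q / dotp p p; pose v := c *: p - q.
have pv : dotp p v = 0 by rewrite dotpBr dotpZr divfK ?subrr// gt_eqF.
have v0 : v = 0.
  apply/eqP; rewrite -dotp_eq0 eq_le dotp_ge0 andbT.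
  rewrite {1}/v dotpBl dotpZl pv mulr0 sub0r oppr_le0; apply: le; by rewrite pv.
have qE : q = c *: p by apply/esym/eqP; rewrite -subr_eq0 -/v v0.
exists c => //; rewrite lt0r; apply/andP; split.
  by apply: contraNneq q0 => c0; rewrite qE c0 scale0r.
by rewrite divr_ge0 ?dotp_ge0// dotpC; apply: le; exact: dotp_ge0.
Qed.

Lemma bnormalP y : S y -> inner_normals y (bnormal y).
Proof.
move=> Sy; apply: xgetPex; have [U [psi [Uy dpsi]]] := OC2 Sy.
by exists (- grad psi y), U, psi.
Qed.

Lemma bnormal_neq0 y : S y -> bnormal y != 0.
Proof. by move=> /bnormalP; exact: inner_normals_neq0. Qed.

Lemma cahn_dirE y p : S y -> inner_normals y p -> cahn_dir y = Rg p.
Proof.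
move=> Sy Hp; have [c c0 E1] := inner_normals_colinear Sy Hp (bnormalP Sy).
by rewrite /cahn_dir E1 gauge_gradZ//; exact: inner_normals_neq0 Hp.
Qed.

Lemma unit_bnormalE y p : S y -> inner_normals y p -> unit_bnormal y = (rho p)^-1 *: p.
Proof.
move=> Sy Hp; have [c c0 E1] := inner_normals_colinear Sy Hp (bnormalP Sy).
rewrite /unit_bnormal E1 gaugeZ// scalerA invfM mulrAC mulVf ?mul1r// gt_eqF//.
Qed.

Lemma gauge_unit_bnormal y : S y -> rho (unit_bnormal y) = 1.
Proof.
move=> Sy; have r0 := gauge_gt0 bK (bnormal_neq0 Sy).
by rewrite gaugeZ ?invr_gt0// mulVf// gt_eqF.
Qed.

Lemma unit_bnormal_neq0 y : S y -> unit_bnormal y != 0.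
Proof.
move=> Sy; apply/eqP => N0; have := gauge_unit_bnormal Sy.
by rewrite N0 gauge0// => /esym/eqP; rewrite oner_eq0.
Qed.

Lemma Rg_unit_bnormal y : S y -> Rg (unit_bnormal y) = cahn_dir y.
Proof.
move=> Sy; rewrite gauge_gradZ//; first exact: bnormal_neq0.
by rewrite invr_gt0 gauge_gt0//; exact: bnormal_neq0.
Qed.

Lemma support_cahn_dir y : S y -> sf (cahn_dir y) = 1.
Proof. by move=> Sy; apply: support_grad => //; exact: bnormal_neq0. Qed.

Lemma dotp_cahn_dir y : S y -> dotp (unit_bnormal y) (cahn_dir y) = 1.
Proof.
move=> Sy; rewrite -Rg_unit_bnormal// dotpC gauge_euler// ?gauge_unit_bnormal//.
exact: unit_bnormal_neq0.
Qed.

(** The projection onto the tangent space along the Cahn-Hoffman direction, acting on row vectors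
    from the right. *)
Definition oblique_proj y : 'M[R]_n := 1%:M - (unit_bnormal y)^T *m cahn_dir y.

Lemma oblique_projE y w : w *m oblique_proj y = w - dotp (unit_bnormal y) w *: cahn_dir y.
Proof.
rewrite mulmxBr mulmx1 mulmxA; congr (_ - _).
rewrite (_ : w *m _ = (dotp (unit_bnormal y) w)%:M) ?mul_scalar_mx//.
by rewrite dotpC; apply/matrixP => i j; rewrite !ord1 !mxE eqxx mulr1n; apply: eq_bigr => k _; rewrite mxE.
Qed.

(* The second order data of the boundary at [y]: [Q] is the derivative of the
   Cahn-Hoffman direction along the boundary, extended by 0 in this direction. *)
Definition boundary_data y (Q : 'M[R]_n) := [/\ cahn_dir y *m Q = 0,
  (forall w, dotp (unit_bnormal y) (w *m Q) = 0) &
  forall e, 0 < e -> exists2 r, 0 < r & forall y1 y2, S y1 -> S y2 ->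
    `|y1 - y| < r -> `|y2 - y| < r ->
    `|dotp (unit_bnormal y) (y1 - y2)| <= e * `|y1 - y2| /\
    `|cahn_dir y1 - cahn_dir y2 - (y1 - y2) *m Q| <= e * `|y1 - y2|].

(** As [psi] vanishes at both points, [y1 - y2] is tangent up to a higher order error, so inserting
    [oblique_proj] in the chain rule for [Rg (- grad psi)] costs no more than that. Of the two
    annihilation properties one comes from this projection, the other from [P] being symmetric with
    radial kernel. *)
Lemma boundary_data_ex y U psi P : S y -> U y -> C2_defining Omega U psi ->
  sjacobian Rg (- grad psi y) P ->
  boundary_data y (- (oblique_proj y *m (\matrix_(i, j) partial i (partial j psi) y) *m P)).
Proof.
move=> Sy Uy dpsi HP; have [oU C2 D0 Hpsi] := dpsi.
set H := \matrix_(i, j) _; set m := - grad psi y in HP *.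
have nm : inner_normals y m by exists U, psi.
have m0 := inner_normals_neq0 nm.
have NE := unit_bnormalE Sy nm; have vE := cahn_dirE Sy nm.
have rm := gauge_gt0 bK m0.
split.
- rewrite mulmxN !mulmxA oblique_projE dotp_cahn_dir// scale1r subrr.
  by rewrite !mul0mx oppr0.
- move=> w; rewrite mulmxN dotpNr !mulmxA dotpC dotp_mulmxl (gauge_hess_sym bK KC2 m0 HP).
  by rewrite NE -scalemxAl (gauge_hess_radial bK KC2 m0 HP) scaler0 dotp0r oppr0.
- move=> e e0.
  have gN := Ck2_sjacobian oU C2 Uy; rewrite -/H in gN.
  have gN' : sjacobian (fun z => - grad psi z) y (- H).
    move=> e1 e10; apply: filterS (gN e1 e10) => p.
    rewrite -normrN; congr (`|_| <= _); rewrite mulmxN !opprD !opprK//.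
  have HR : sjacobian (fun z => Rg (- grad psi z)) y (- H *m P).
    apply/sjacobianP => j.
    have := sderiv_comp gN' ((sjacobianP _ _ _).1 HP j).
    congr (sderiv _ _ _); apply/rowP => i; rewrite !mxE; apply: eq_bigr => k _.
    by rewrite !mxE mulrC.
  have HD := Ck1_sderiv oU (Ck2_Ck1 C2) Uy.
  pose c := `|cahn_dir y *m (H *m P)| + 1; have c0 : 0 < c by rewrite ltr_wpDl.
  have e20 : 0 < e / 2 by rewrite divr_gt0.
  pose e1 := Num.min e (e / 2 / c) * rho m.
  have e10 : 0 < e1 by rewrite mulr_gt0// lt_min e0 divr_gt0.
  have [r1 r10 H1] := sderiv_near HD e10.
  have [r2 r20 H2] := sjacobian_near HR e20.
  have [r3 r30 H3] := open_row_ball oU Uy.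
  exists (Num.min r1 (Num.min r2 r3)) => [|y1 y2 S1 S2]; first by rewrite !lt_min r10 r20.
  rewrite !lt_min => /and3P[y11 y12 y13] /and3P[y21 y22 y23].
  have U1 := H3 _ y13; have U2 := H3 _ y23.
  have B2 : `|dotp (unit_bnormal y) (y1 - y2)| <= Num.min e (e / 2 / c) * `|y1 - y2|.
    have := H1 _ _ y11 y21.
    rewrite (defining_zero dpsi U1 S1) (defining_zero dpsi U2 S2) subrr sub0r normrN.
    rewrite NE dotpZl dotpNl mulrN normrN normrM normfV (gtr0_norm rm) => Hd.
    by rewrite mulrC ler_pdivrMr// mulrAC.
  split; first by apply: (le_trans B2); rewrite ler_wpM2r// ge_min lexx.
  rewrite (cahn_dirE S1 (p := - grad psi y1)); last by exists U, psi.
  rewrite (cahn_dirE S2 (p := - grad psi y2)); last by exists U, psi.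
  have -> : Rg (- grad psi y1) - Rg (- grad psi y2) - (y1 - y2) *m - (oblique_proj y *m H *m P) =
     (Rg (- grad psi y1) - Rg (- grad psi y2) - (y1 - y2) *m (- H *m P)) -
     dotp (unit_bnormal y) (y1 - y2) *: (cahn_dir y *m (H *m P)).
    have HE : (y1 - y2) *m (oblique_proj y *m H *m P) = (y1 - y2) *m (H *m P) -
        dotp (unit_bnormal y) (y1 - y2) *: (cahn_dir y *m (H *m P)).
      by rewrite -[oblique_proj y *m H *m P]mulmxA [LHS]mulmxA oblique_projE mulmxBl -scalemxAl.
    by rewrite mulmxN mulNmx mulmxN HE !opprK addrA.
  rewrite [e in leRHS]splitr mulrDl; apply: (le_trans (ler_normB _ _)); apply: lerD; first exact: H2.
  rewrite normrZ; apply: (@le_trans _ _ (e / 2 / c * `|y1 - y2| * c)).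
    apply: ler_pM => //; last by rewrite lerDl.
    by apply: (le_trans B2); rewrite ler_wpM2r// ge_min lexx orbT.
  by rewrite mulrAC divfK// gt_eqF.
Qed.

Lemma boundary_data_exists y : S y -> exists Q, boundary_data y Q.
Proof.
move=> Sy; have [U [psi [Uy dpsi]]] := OC2 Sy; have [oU C2 D0 Hpsi] := dpsi.
have m0 : - grad psi y != 0 by rewrite oppr_eq0; exact: D0.
have [_ [P HP]] := gauge_C2 bK KC2 m0.
by eexists; exact: boundary_data_ex Sy Uy dpsi HP.
Qed.

Lemma oblique_proj_data y Q : boundary_data y Q -> oblique_proj y *m Q = Q.
Proof.
move=> [vQ _ _]; apply/row_matrixP => i; rewrite !rowE mulmxA oblique_projE.
by rewrite mulmxBl -scalemxAl vQ scaler0 subr0.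
Qed.

Lemma tube_algebra (y1 y2 c1 c2 v w : E) (s0 s1 s2 : R) :
  y1 + s1 *: c1 - (y2 + s2 *: c2) = y1 - y2 + s0 *: w + (s1 - s2) *: v +
    ((s1 - s0) *: (c1 - c2) + s0 *: (c1 - c2 - w) + (s1 - s2) *: (c2 - v)).
Proof. by apply/rowP => j; rewrite !mxE; ring. Qed.

Lemma tube_algebra_proj (x v u : E) (s c : R) :
  x - (x + s *: v + u - c *: v) = (c - s) *: v - u.
Proof. by apply/rowP => j; rewrite !mxE; ring. Qed.

Lemma half_absorb (a b k p : R) : a <= k * b + p -> p <= 1 / 2 * (a + b) ->
  a + b <= (2 * k + 2) * b.
Proof. by move=> *; lra. Qed.

(* Writing [h = y1 + s1 nu1 - (y2 + s2 nu2)] and [a = y1 - y2], one has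
   [h = a (1 + s0 Q) + (s1 - s2) nu + o(|a| + |h|)], which is solved for [a]. *)
Lemma tube_diff y0 (Q : 'M[R]_n) (s0 C : R) : S y0 -> boundary_data y0 Q ->
  1%:M + s0 *: Q \in unitmx -> 0 < C -> forall e, 0 < e -> exists2 r, 0 < r &
  forall y1 y2 s1 s2 h, S y1 -> S y2 -> `|y1 - y0| < r -> `|y2 - y0| < r ->
    `|s1 - s0| < r -> `|s2 - s0| < r ->
    h = y1 + s1 *: cahn_dir y1 - (y2 + s2 *: cahn_dir y2) -> `|s1 - s2| <= C * `|h| ->
    `|y1 - y2 - h *m (oblique_proj y0 *m invmx (1%:M + s0 *: Q))| <= e * `|h| /\
    `|s1 - s2 - dotp (unit_bnormal y0) h| <= e * `|h|.
Proof.
move=> Sy0 bQ uA C0 e e0; have [vQ NQ Hd] := bQ.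
set A := 1%:M + _ in uA *; set N := unit_bnormal y0 in NQ Hd *.
set v := cahn_dir y0 in vQ *; set PI := oblique_proj y0.
pose cQ := mxl1 Q; have cQ0 : 0 < cQ := mxl1_gt0 Q.
pose B := mxl1 (invmx A); have B0 : 0 < B := mxl1_gt0 _.
pose K1 := (cQ + 1) * (1 + C) + `|s0|.
have K10 : 0 < K1 by rewrite ltr_wpDr// mulr_gt0// addr_gt0.
pose K2 := 1 + l1norm N * K1.
have K20 : 0 < K2 by rewrite ltr_wpDr// mulr_ge0 ?l1norm_ge0// ltW.
pose K3 := B * (K2 * `|v| + K1).
have K30 : 0 < K3 by rewrite mulr_gt0// ltr_wpDl// mulr_ge0// ltW.
pose K4 := mxl1 (PI *m invmx A); have K40 : 0 < K4 := mxl1_gt0 _.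
pose L := K2 + K3; have L0 : 0 < L by rewrite addr_gt0.
(* The bound [1 / (2 * L)] lets the part of the error proportional to the norm of [a] be absorbed,
   see [half_absorb]; the last bound brings the remaining error below [e]. *)
pose e1 := Num.min 1 (Num.min (1 / (2 * L)) (e / (L * (2 * K4 + 2)))).
have D0 : 0 < L * (2 * K4 + 2) by rewrite mulr_gt0// addr_gt0// mulr_gt0.
have e10 : 0 < e1 by rewrite !lt_min ltr01 !divr_gt0// mulr_gt0.
have e1_1 : e1 <= 1 by rewrite ge_min lexx.
have e1L : e1 * L <= 1 / 2.
  have : e1 <= 1 / (2 * L) by rewrite !ge_min lexx orbT.
  by rewrite ler_pdivlMr ?mulr_gt0// => H; lra.
have e1e : e1 * (L * (2 * K4 + 2)) <= e by rewrite -ler_pdivlMr// !ge_min lexx !orbT.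
have [r' r'0 Hr] := Hd e1 e10.
exists (Num.min r' e1) => [|y1 y2 s1 s2 h S1 S2]; first by rewrite lt_min r'0.
have lt1 (t : R) : t < Num.min r' e1 -> t < r' /\ t < e1 by rewrite lt_min => /andP.
move=> /lt1[y1r y1e] /lt1[y2r y2e] /lt1[_ s1e] /lt1[_ s2e] hE sC.
set a := y1 - y2; set sg := s1 - s2 in sC *.
have [aN ad] := Hr _ _ S1 S2 y1r y2r; rewrite -/a in aN ad.
have y00 : `|y0 - y0| < r' by rewrite subrr normr0.
have [_ bd2] := Hr _ _ S2 Sy0 y2r y00; rewrite -/v in bd2.
set dn := cahn_dir y1 - cahn_dir y2 in ad.
have dn_le : `|dn| <= (cQ + 1) * `|a|.
  rewrite -[dn](subrK (a *m Q)) addrC mulrDl mul1r; apply: (le_trans (ler_normD _ _)).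
  apply: lerD; first exact: mulmx_norm_le.
  by apply: (le_trans ad); rewrite ler_piMl.
have n2_le : `|cahn_dir y2 - v| <= (cQ + 1) * e1.
  apply: (@le_trans _ _ ((cQ + 1) * `|y2 - y0|)); last by apply: ler_wpM2l; [rewrite addr_ge0// ltW|exact: ltW].
  rewrite -[X in `|X|](subrK ((y2 - y0) *m Q)) addrC mulrDl mul1r; apply: (le_trans (ler_normD _ _)).
  apply: lerD; first exact: mulmx_norm_le.
  by apply: (le_trans bd2); rewrite ler_piMl.
pose Er := (s1 - s0) *: dn + s0 *: (dn - a *m Q) + sg *: (cahn_dir y2 - v).
have hA : h = a *m A + sg *: v + Er.
  by rewrite hE /Er /A mulmxDr mulmx1 -scalemxAr; exact: tube_algebra.
set T := `|a| + `|h|.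
have T0 : 0 <= T by rewrite addr_ge0.
have aT : `|a| <= T by rewrite lerDl.
have hT : `|h| <= T by rewrite lerDr.
have ErT : `|Er| <= e1 * K1 * T.
  apply: (le_trans (ler_normD _ _)).
  have -> : e1 * K1 * T = (e1 * ((cQ + 1) * T) + `|s0| * (e1 * T)) + C * T * ((cQ + 1) * e1).
    by rewrite /K1; ring.
  apply: lerD; [apply: (le_trans (ler_normD _ _)); apply: lerD|]; rewrite normrZ; apply: ler_pM => //.
  - exact: ltW.
  - by apply: (le_trans dn_le); rewrite ler_wpM2l// addr_ge0// ltW.
  - by apply: (le_trans ad); rewrite ler_wpM2l// ltW.
  - by apply: (le_trans sC); rewrite ler_wpM2l// ltW.
have aA : a *m A = a + s0 *: (a *m Q) by rewrite /A mulmxDr mulmx1 -scalemxAr.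
clearbody Er dn sg a A.
have Nh : dotp N h = dotp N a + sg + dotp N Er.
  rewrite hA aA dotpDr; congr (_ + _); rewrite dotpDr; congr (_ + _).
    by rewrite dotpDr dotpZr NQ mulr0 addr0.
  by rewrite dotpZr dotp_cahn_dir// mulr1.
have sgT : `|sg - dotp N h| <= e1 * K2 * T.
  rewrite (_ : sg - dotp N h = - (dotp N a + dotp N Er)) ?normrN; last by rewrite Nh; ring.
  have -> : e1 * K2 * T = e1 * T + e1 * (l1norm N * K1) * T by rewrite /K2; ring.
  apply: (le_trans (ler_normD _ _)); apply: lerD.
    by apply: (le_trans aN); rewrite ler_wpM2l// ltW.
  apply: (le_trans (dotp_le_l1norm _ _)).
  have -> : e1 * (l1norm N * K1) * T = l1norm N * (e1 * K1 * T) by ring.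
  by rewrite ler_wpM2l// l1norm_ge0.
have aE : a - h *m (PI *m invmx A) = ((dotp N h - sg) *: v - Er) *m invmx A.
  rewrite mulmxA -{1}[a](mulmxK uA) -mulmxBl; congr (_ *m _).
  by rewrite oblique_projE -/N -/v {1}hA tube_algebra_proj.
have aT' : `|a - h *m (PI *m invmx A)| <= e1 * K3 * T.
  rewrite aE; apply: (le_trans (mulmx_norm_le _ _)).
  have -> : e1 * K3 * T = B * (e1 * K2 * T * `|v| + e1 * K1 * T) by rewrite /K3; ring.
  rewrite ler_wpM2l ?(ltW B0)//; apply: (le_trans (ler_normB _ _)); apply: lerD => //.
  by rewrite normrZ distrC ler_wpM2r.
have aK4 : `|a| <= K4 * `|h| + e1 * K3 * T.
  rewrite -{1}[a](subrK (h *m (PI *m invmx A))) addrC; apply: (le_trans (ler_normD _ _)).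
  by apply: lerD => //; exact: mulmx_norm_le.
have K3L : e1 * K3 * T <= 1 / 2 * T.
  rewrite ler_wpM2r//; apply: le_trans e1L; rewrite ler_wpM2l ?(ltW e10)//.
  by rewrite /L lerDr ltW.
have Th : T <= (2 * K4 + 2) * `|h| := half_absorb aK4 K3L.
have fin k : 0 < k -> k <= L -> e1 * k * T <= e * `|h|.
  move=> k0 kL; apply: (@le_trans _ _ (e1 * (L * (2 * K4 + 2)) * `|h|)); last by rewrite ler_wpM2r.
  have -> : e1 * (L * (2 * K4 + 2)) * `|h| = e1 * L * ((2 * K4 + 2) * `|h|) by ring.
  apply: ler_pM => //; first by rewrite mulr_ge0// ltW.
  by rewrite ler_wpM2l// ltW.
split; first by apply: (le_trans aT'); apply: fin; rewrite // /L lerDr ltW.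
by apply: (le_trans sgT); apply: fin; rewrite // /L lerDl ltW.
Qed.

End boundary_normal.

(** * The signed distance and the Cahn-Hoffman field near the boundary *)

Section signed_distance.
Variables (R : realType) (n : nat) (Omega K : set 'rV[R]_n).
Local Notation E := 'rV[R]_n.
Local Notation rho := (gauge K).
Local Notation sf := (gauge (polar K)).
Local Notation Rg := (grad rho).
Local Notation S := (boundary Omega).
Local Notation d := (minkowski_dist Omega K).
Local Notation ds := (signed_dist Omega K).
Local Notation cahn := (cahn_dir Omega K).
Local Notation Nu := (unit_bnormal Omega K).
Local Notation PI := (oblique_proj Omega K).
Hypotheses (bK : convex_body K) (KC2 : C2_boundary K).
Hypotheses (O0 : Omega !=set0) (Ob : bounded_set Omega) (Oo : open Omega)
  (OC2 : C2_boundary Omega) (n0 : (0 < n)%N).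
Let bP := convex_body_polar bK.
Implicit Types (x y z v w p q : E).

Lemma cahnE y U psi : S y -> U y -> C2_defining Omega U psi -> Rg (- grad psi y) = cahn y.
Proof. by move=> Sy Uy dpsi; rewrite (cahn_dirE bK KC2 OC2 Sy (p := - grad psi y))//; exists U, psi. Qed.

Lemma proj_cahn x y : Omega x -> S y -> sf (x - y) = d x -> x = y + d x *: cahn y.
Proof.
move=> Ox Sy xy; have [U [psi [Uy dpsi]]] := OC2 Sy.
have := proj_direction bK KC2 O0 Ob Oo n0 Ox Sy xy Uy dpsi.
by rewrite (cahnE Sy Uy dpsi) => <-; rewrite addrC subrK.
Qed.

Lemma signed_dist_in x : closure Omega x -> ds x = d x.
Proof. by move=> clx; rewrite /signed_dist mem_set. Qed.

Lemma signed_dist_out x z : ~ closure Omega x ->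
  sf (z - x) = inf [set sf (z - x) | z in closure Omega] -> ds x = - sf (z - x).
Proof. by move=> nx zE; rewrite /signed_dist memNset// zE. Qed.

Lemma signed_proj x : exists y, [/\ S y, x = y + ds x *: cahn y & Omega x -> sf (x - y) = d x].
Proof.
have [clx|nx] := pselect (closure Omega x).
  rewrite signed_dist_in//; have [Ox|nOx] := pselect (Omega x).
    have [y [Sy xy _]] := mdist_proj bK O0 Ob Oo n0 x.
    by exists y; split => //; exact: proj_cahn.
  have Sx : S x by rewrite boundaryE.
  by exists x; split => //; rewrite (mdist0 bK O0 Ob Oo n0 Sx) scale0r addr0.
have [z [Sz z0 zE Hz]] := outer_proj bK O0 Ob Oo nx.
exists z; rewrite (signed_dist_out nx zE); split => //; last first.
  by move=> Ox; exfalso; apply: nx; exact: subset_closure.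
have [U [psi [Uz dpsi]]] := OC2 Sz.
have zx := outer_proj_direction bK KC2 Oo nx Sz z0 Hz Uz dpsi.
by rewrite (cahnE Sz Uz dpsi) in zx; rewrite scaleNr -zx opprB addrC subrK.
Qed.

Lemma signed_dist_abs : exists2 C, 0 < C & forall x c, S c -> `|ds x| <= C * `|x - c|.
Proof.
have [C [M [C0 M0 HC]]] := gauge_norm bP; exists C => // x c Sc.
have [clx|nx] := pselect (closure Omega x).
  rewrite signed_dist_in//; have dx0 := mdist_nonneg bK O0 Ob Oo n0 x; rewrite (ger0_norm dx0).
  by apply: le_trans (HC _).1; exact: (mdist_le bK O0 Ob Oo n0).
have [z [Sz z0 zE Hz]] := outer_proj bK O0 Ob Oo nx.
rewrite (signed_dist_out nx zE) normrN gtr0_norm//.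
apply: (le_trans (Hz c _)); first by case: Sc.
by rewrite distrC; exact: (HC _).1.
Qed.

(** A segment from the closure to its complement meets the boundary; by [signed_dist_abs] both ends
    are compared with that boundary point. *)
Lemma signed_dist_lip : exists2 C, 0 < C & forall x z, `|ds x - ds z| <= C * `|x - z|.
Proof.
have [C1 C10 H1] := signed_dist_abs; have [C [M [C0 M0 HC]]] := gauge_norm bP.
exists (C + 2 * C1) => [|x z]; first by rewrite addr_gt0// mulr_gt0.
have weak a b : a <= C * b \/ a <= 2 * C1 * b -> 0 <= b -> a <= (C + 2 * C1) * b.
  move=> H b0; rewrite mulrDl; have h1 : 0 <= C * b by rewrite mulr_ge0// ltW.
  have h2 : 0 <= 2 * C1 * b by rewrite !mulr_ge0// ltW.
  by case: H; lra.
have mixed a b : closure Omega a -> ~ closure Omega b -> `|ds a - ds b| <= 2 * C1 * `|a - b|.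
  move=> cla nb; have [t /andP[t0 t1] [cl ni]] := boundary_crossing cla nb.
  set c := a + _ in cl ni.
  have Sc : S c.
    rewrite boundaryE//; split; first by rewrite ((closure_id (closure Omega)).1 (@closed_closure _ Omega)).
    move=> Oc; apply: ni; apply: filterS (@subset_closure _ Omega) _.
    exact: open_nbhs_nbhs.
  have ac : `|a - c| <= `|a - b|.
    by rewrite /c opprD addrA subrr add0r normrN normrZ ger0_norm// distrC ler_piMl.
  have bc : `|b - c| <= `|a - b|.
    have -> : b - c = (1 - t) *: (b - a).
      by rewrite /c scalerBl scale1r opprD addrA.
    by rewrite normrZ ger0_norm ?subr_ge0// distrC ler_piMl// gerBl.
  apply: (le_trans (ler_normB _ _)); rewrite -mulrA mulr_natl mulr2n; apply: lerD.
    by apply: (le_trans (H1 a c Sc)); rewrite ler_wpM2l// ltW.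
  by apply: (le_trans (H1 b c Sc)); rewrite ler_wpM2l// ltW.
have [clx|nx] := pselect (closure Omega x); have [clz|nz] := pselect (closure Omega z);
  apply: weak => //.
- left; rewrite !signed_dist_in// ler_norml; have := mdist_lip bK O0 Ob Oo n0 x z.
  have := mdist_lip bK O0 Ob Oo n0 z x; have := (HC (x - z)).1; have := (HC (z - x)).1.
  by rewrite [`|z - x|]distrC; lra.
- by right; exact: mixed.
- by right; rewrite distrC [`|x - z|]distrC; exact: mixed.
- left; have [a [Sa a0 aE Ha]] := outer_proj bK O0 Ob Oo nx.
  have [b [Sb b0 bE Hb]] := outer_proj bK O0 Ob Oo nz.
  rewrite (signed_dist_out nx aE) (signed_dist_out nz bE) ler_norml.
  have h1 := Ha b Sb.1; have h2 := Hb a Sa.1.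
  have h3 := gaugeD (b - z) (z - x) bP; have h4 := gaugeD (a - x) (x - z) bP.
  rewrite subrKA in h3; rewrite subrKA in h4.
  have := (HC (x - z)).1; have := (HC (z - x)).1.
  by rewrite [`|z - x|]distrC; lra.
Qed.

Lemma cahn_bound : exists2 M, 0 < M & forall y, S y -> `|cahn y| <= M.
Proof.
have [C [M [C0 M0 HC]]] := gauge_norm bP; exists M => // y Sy.
by apply: (le_trans (HC _).2); rewrite (support_cahn_dir bK KC2 OC2 Sy) mulr1.
Qed.

Lemma signed_proj_near : exists2 C, 0 < C & forall x y y0, S y0 -> S y ->
  x = y + ds x *: cahn y -> `|y - y0| <= C * `|x - y0|.
Proof.
have [C C0 H] := signed_dist_abs; have [M M0 HM] := cahn_bound.
exists (1 + C * M) => [|x y y0 S0 Sy xE]; first by rewrite addr_gt0// mulr_gt0.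
have -> : y - y0 = (x - y0) - ds x *: cahn y by rewrite {1}xE addrAC addrK.
rewrite mulrDl mul1r; apply: (le_trans (ler_normB _ _)); rewrite lerD2l normrZ.
by rewrite mulrAC; apply: ler_pM => //; [exact: H|exact: HM].
Qed.

(** The case of depth 0 in [tube_diff], where the matrix to invert is the identity. *)
Lemma boundary_tube y0 Q e : S y0 -> boundary_data Omega K y0 Q -> 0 < e -> exists2 r, 0 < r &
  forall x1 x2 y1 y2, `|x1 - y0| < r -> `|x2 - y0| < r -> S y1 -> S y2 ->
    x1 = y1 + ds x1 *: cahn y1 -> x2 = y2 + ds x2 *: cahn y2 ->
    `|y1 - y2 - (x1 - x2) *m PI y0| <= e * `|x1 - x2| /\
    `|ds x1 - ds x2 - dotp (Nu y0) (x1 - x2)| <= e * `|x1 - x2|.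
Proof.
move=> S0 bQ e0; have [C C0 HC] := signed_dist_lip.
have u1 : 1%:M + 0 *: Q \in unitmx by rewrite scale0r addr0 unitmx1.
have [r r0 Hr] := tube_diff bK KC2 OC2 S0 bQ u1 C0 e0.
have [C1 C10 H1] := signed_proj_near; have [C2 C20 H2] := signed_dist_abs.
pose m := C1 + C2; have m0 : 0 < m by rewrite addr_gt0.
exists (r / m) => [|x1 x2 y1 y2]; first exact: divr_gt0.
rewrite !ltr_pdivlMr// => xr1 xr2 S1 S2 E1 E2.
have near x y : `|x - y0| * m < r -> S y -> x = y + ds x *: cahn y -> `|y - y0| < r /\ `|ds x - 0| < r.
  move=> xr Sy xE; rewrite subr0; split; apply: le_lt_trans xr.
    by apply: (le_trans (H1 _ _ _ S0 Sy xE)); rewrite mulrC ler_wpM2l// lerDl ltW.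
  by apply: (le_trans (H2 _ _ S0)); rewrite mulrC ler_wpM2l// lerDr ltW.
have [n1 d1] := near _ _ xr1 S1 E1; have [n2 d2] := near _ _ xr2 S2 E2.
have := Hr y1 y2 (ds x1) (ds x2) (x1 - x2) S1 S2 n1 n2 d1 d2.
rewrite scale0r addr0 invmx1 mulmx1; apply; last exact: HC.
by rewrite {1}E1 {1}E2.
Qed.

Lemma tube_algebra_diff (y1 y2 c1 c2 w : E) (s1 s2 : R) :
  y1 + s1 *: c1 - (y2 + s2 *: c2) =
  y1 - y2 + s1 *: (c1 - c2 - w) + s1 *: w + (s1 - s2) *: c2.
Proof. by apply/rowP => j; rewrite !mxE; ring. Qed.

(** The feet of points near [y0] vary in a Lipschitz way, so the second order data at the foot [y]
    of [x] can be inserted. Pairing with [Nu y] isolates the variation of the distance: this normal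
    has product 1 with [cahn y], annihilates the range of [Q] and is orthogonal to boundary
    increments up to higher order. *)
Lemma signed_dist_fderiv y0 : S y0 -> exists2 r, 0 < r & forall x y, `|x - y0| < r ->
  S y -> x = y + ds x *: cahn y -> fderiv ds x (Nu y).
Proof.
move=> S0; have [Q0 bQ0] := boundary_data_exists bK KC2 OC2 S0.
have [r r0 Hr] := boundary_tube S0 bQ0 ltr01.
exists r => // x y xr Sy xE e e0.
have [Q bQ] := boundary_data_exists bK KC2 OC2 Sy; have [vQ NQ Hd] := bQ.
pose L := 1 + mxl1 (PI y0); have L0 : 0 < L by rewrite addr_gt0 ?mxl1_gt0.
pose B := 1 + (`|ds x| + 1) * l1norm (Nu y).
have B0 : 0 < B by rewrite ltr_pwDl// mulr_ge0 ?l1norm_ge0// addr_ge0.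
have e10 : 0 < e / L / B by rewrite !divr_gt0.
have [r1 r10 H1] := Hd _ e10; have [C C0 HC] := signed_dist_lip.
pose m := Num.min (r - `|x - y0|) (Num.min (r1 / L) (1 / C)).
exists m => [|x' xm]; first by rewrite !lt_min subr_gt0 xr !divr_gt0.
have [x1 x2 x3] : [/\ `|x' - x| < r - `|x - y0|, `|x' - x| < r1 / L & `|x' - x| < 1 / C].
  by move: xm; rewrite !lt_min => /and3P.
have x'r : `|x' - y0| < r.
  rewrite -[x'](subrK x) -addrA; apply: (le_lt_trans (ler_normD _ _)).
  by rewrite -ltrBrDr.
have [y' [Sy' xE' _]] := signed_proj x'.
have [Hy _] := Hr _ _ _ _ x'r xr Sy' Sy xE' xE.
have ay : `|y' - y| <= L * `|x' - x|.
  rewrite -[y' - y](subrK ((x' - x) *m PI y0)) mulrDl; apply: (le_trans (ler_normD _ _)).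
  by apply: lerD => //; exact: mulmx_norm_le.
have y'r : `|y' - y| < r1 by apply: (le_lt_trans ay); rewrite mulrC -ltr_pdivlMr.
have yy : `|y - y| < r1 by rewrite subrr normr0.
have [Na Da] := H1 _ _ Sy' Sy y'r yy.
have ds1 : `|ds x'| <= `|ds x| + 1.
  rewrite -[ds x'](subrK (ds x)) addrC; apply: (le_trans (ler_normD _ _)); rewrite lerD2l.
  by apply: (le_trans (HC _ _)); rewrite mulrC -ler_pdivlMr// ltW.
have -> : ds x' - ds x - dotp (Nu y) (x' - x) =
   - (dotp (Nu y) (y' - y) + ds x' * dotp (Nu y) (cahn y' - cahn y - (y' - y) *m Q)).
  have -> : x' - x = y' + ds x' *: cahn y' - (y + ds x *: cahn y) by rewrite -xE' -xE.
  set a := y' - y.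
  have -> : y' + ds x' *: cahn y' - (y + ds x *: cahn y) =
     a + ds x' *: (cahn y' - cahn y - a *m Q) + ds x' *: (a *m Q) + (ds x' - ds x) *: cahn y.
    exact: tube_algebra_diff.
  rewrite 3!dotpDr !dotpZr NQ (dotp_cahn_dir bK KC2 OC2 Sy).
  move: (dotp _ _) (dotp _ _) (ds x) (ds x') => a1 a2 a3 a4; ring.
rewrite normrN; apply: (le_trans (ler_normD _ _)).
apply: (@le_trans _ _ (e / L / B * `|y' - y| * B)); last first.
  rewrite mulrAC divfK ?gt_eqF//.
  by apply: (@le_trans _ _ (e / L * (L * `|x' - x|))); [rewrite ler_wpM2l// divr_ge0// ltW|rewrite mulrA divfK// gt_eqF].
rewrite {2}/B mulrDr mulr1; apply: lerD => //; rewrite normrM.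
rewrite mulrC -!mulrA [_ * l1norm _]mulrC !mulrA; apply: ler_pM => //.
apply: (le_trans (dotp_le_l1norm _ _)); by rewrite [leRHS]mulrC ler_wpM2l// l1norm_ge0.
Qed.

Lemma cahn_hoffmanE y0 : S y0 -> exists2 r, 0 < r & forall x y, `|x - y0| < r ->
  S y -> x = y + ds x *: cahn y -> cahn_hoffman Omega K x = - cahn y.
Proof.
move=> S0; have [r r0 Hr] := signed_dist_fderiv S0; exists r; first exact: r0.
move=> x y xr Sy xE; rewrite /cahn_hoffman (fderiv_grad (Hr x y xr Sy xE)).
by rewrite (Rg_unit_bnormal bK KC2 OC2 Sy).
Qed.

Lemma boundary_proj y : S y -> ds y = 0.
Proof.
by move=> Sy; rewrite signed_dist_in ?(mdist0 bK O0 Ob Oo n0 Sy)//; case: Sy.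
Qed.

Lemma cahn_algebra (c c0 a b : E) (P Q : 'M[R]_n) : P *m Q = Q ->
  - c - - c0 - b *m - Q = - (c - c0 - a *m Q + (a - b *m P) *m Q).
Proof.
move=> PQ; rewrite mulmxBl -mulmxA PQ mulmxN !opprK addrA subrK opprB opprB.
by move: (b *m Q) => w; apply/rowP => j; rewrite !mxE; ring.
Qed.

(** Near the boundary the field is minus the direction at the foot, and the foot has derivative
    [PI y0] at [y0]; since [PI y0 *m Q = Q], only [Q] is left. *)
Lemma cahn_hoffman_fjacobian y0 Q : S y0 -> boundary_data Omega K y0 Q ->
  fjacobian (cahn_hoffman Omega K) y0 (- Q).
Proof.
move=> S0 bQ e e0; have [vQ NQ Hd] := bQ.
have [r1 r10 H1] := cahn_hoffmanE S0.
pose L := 1 + mxl1 (PI y0); have L0 : 0 < L by rewrite addr_gt0 ?mxl1_gt0.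
have e20 : 0 < e / 2 by rewrite divr_gt0.
have [r2 r20 H2] := boundary_tube S0 bQ ltr01.
have e30 : 0 < e / 2 / mxl1 Q by rewrite !divr_gt0 ?mxl1_gt0.
have [r3 r30 H3] := boundary_tube S0 bQ e30.
have e40 : 0 < e / 2 / L by rewrite divr_gt0.
have [r4 r40 H4] := Hd _ e40.
exists (Num.min r1 (Num.min r2 (Num.min r3 (r4 / L)))) => [|x].
  by rewrite !lt_min r10 r20 r30 divr_gt0.
rewrite !lt_min => /and4P[x1 x2 x3 x4].
have [y [Sy xE _]] := signed_proj x.
have E0 : y0 = y0 + ds y0 *: cahn y0 by rewrite (boundary_proj S0) scale0r addr0.
have zr (s : R) : 0 < s -> `|y0 - y0| < s by rewrite subrr normr0.
rewrite (H1 _ _ x1 Sy xE) (H1 _ _ (zr _ r10) S0 E0).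
have [h2 _] := H2 _ _ _ _ x2 (zr _ r20) Sy S0 xE E0.
have [h3 _] := H3 _ _ _ _ x3 (zr _ r30) Sy S0 xE E0.
have ay : `|y - y0| <= L * `|x - y0|.
  rewrite -[y - y0](subrK ((x - y0) *m PI y0)) mulrDl; apply: (le_trans (ler_normD _ _)).
  by apply: lerD => //; exact: mulmx_norm_le.
have yr : `|y - y0| < r4 by apply: (le_lt_trans ay); rewrite mulrC -ltr_pdivlMr.
have [_ h4] := H4 _ _ Sy S0 yr (zr _ r40).
have -> : - cahn y - - cahn y0 - (x - y0) *m - Q =
   - ((cahn y - cahn y0 - (y - y0) *m Q) + (y - y0 - (x - y0) *m PI y0) *m Q).
  exact/cahn_algebra/(oblique_proj_data bQ).
rewrite normrN [e in leRHS]splitr mulrDl; apply: (le_trans (ler_normD _ _)); apply: lerD.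
  apply: (le_trans h4); apply: (@le_trans _ _ (e / 2 / L * (L * `|x - y0|))).
    by rewrite ler_wpM2l// ltW.
  by rewrite mulrA divfK// gt_eqF.
apply: (le_trans (mulmx_norm_le _ _)).
apply: (@le_trans _ _ (mxl1 Q * (e / 2 / mxl1 Q * `|x - y0|))).
  by rewrite ler_wpM2l// ltW// mxl1_gt0.
by rewrite mulrC -!mulrA [_ * mxl1 Q]mulrC (mulKf (lt0r_neq0 (mxl1_gt0 Q))).
Qed.

Lemma cahn_hoffman_jacobian y0 Q : S y0 -> boundary_data Omega K y0 Q ->
  'J (cahn_hoffman Omega K) y0 = - Q.
Proof. by move=> S0 bQ; apply: fjacobianE; exact: cahn_hoffman_fjacobian. Qed.

(** A common constant near [y0], by which the Jacobians at all nearby boundary points are bounded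
    together. *)
Lemma cahn_hoffman_lip y0 : S y0 -> exists2 C, 0 < C & exists2 r, 0 < r &
  forall x1 x2, `|x1 - y0| < r -> `|x2 - y0| < r ->
  `|cahn_hoffman Omega K x1 - cahn_hoffman Omega K x2| <= C * `|x1 - x2|.
Proof.
move=> S0; have [Q bQ] := boundary_data_exists bK KC2 OC2 S0; have [vQ NQ Hd] := bQ.
have [r1 r10 H1] := cahn_hoffmanE S0; have [r2 r20 H2] := boundary_tube S0 bQ ltr01.
have [r3 r30 H3] := Hd _ ltr01.
pose L := 1 + mxl1 (PI y0); have L0 : 0 < L by rewrite addr_gt0 ?mxl1_gt0.
have M0 : 0 < 1 + mxl1 Q by rewrite addr_gt0 ?mxl1_gt0.
have [C C0 HC] := signed_proj_near.
exists ((1 + mxl1 Q) * L); first by rewrite mulr_gt0.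
exists (Num.min r1 (Num.min r2 (r3 / C))); first by rewrite !lt_min r10 r20 divr_gt0.
move=> x1 x2; rewrite !lt_min => /and3P[a1 a2 a3] /and3P[b1 b2 b3].
have [y1 [S1 E1 _]] := signed_proj x1; have [y2 [S2 E2 _]] := signed_proj x2.
rewrite (H1 _ _ a1 S1 E1) (H1 _ _ b1 S2 E2) -opprD normrN.
have [h2 _] := H2 _ _ _ _ a2 b2 S1 S2 E1 E2.
have yr x y : `|x - y0| < r3 / C -> S y -> x = y + ds x *: cahn y -> `|y - y0| < r3.
  by move=> xr Sy xE; apply: (le_lt_trans (HC _ _ _ S0 Sy xE)); rewrite mulrC -ltr_pdivlMr.
have [_ h3] := H3 _ _ S1 S2 (yr _ _ a3 S1 E1) (yr _ _ b3 S2 E2).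
have addl u v M : `|u - v *m M| <= 1 * `|v| -> `|u| <= (1 + mxl1 M) * `|v|.
  move=> uv; rewrite -[u](subrK (v *m M)) mulrDl; apply: (le_trans (ler_normD _ _)).
  by apply: lerD => //; exact: mulmx_norm_le.
apply: (le_trans (addl _ _ _ h3)); rewrite -mulrA ler_wpM2l ?(ltW M0)//.
exact: addl h2.
Qed.

Lemma is_derive_rowP (g : R -> E) v :
  is_derive (0 : R) (1 : R) g v <-> forall e, 0 < e -> exists2 r, 0 < r &
    forall t, 0 < `|t| < r -> `|g t - g 0 - t *: v| <= e * `|t|.
Proof.
have E1 : (fun h : R => h^-1 *: ((g \o shift 0) (h *: (1 : R)) - g 0)) =
   (fun h : R => h^-1 *: (g h - g 0)).
  by apply/funext => h; rewrite /= /shift/= addr0 [h *: 1]mulr1.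
split.
  move=> [dg <-] e e0; have : (fun h : R => h^-1 *: (g h - g 0)) @ 0^' --> 'D_1 g 0.
    by rewrite /derive E1; move: dg; rewrite /derivable E1.
  move=> /cvgrPdist_le /(_ e e0) [r /= r0 Hr]; exists r => // t /andP[t0 tr].
  have tn0 : t != 0 by rewrite -normr_gt0.
  have := Hr t; rewrite /ball_ /= sub0r normrN => /(_ tr tn0).
  move=> H.
  have -> : g t - g 0 - t *: 'D_1 g 0 = - (t *: ('D_1 g 0 - t^-1 *: (g t - g 0))).
    by rewrite scalerBr scalerA divff// scale1r opprB.
  by rewrite normrN normrZ mulrC ler_wpM2r.
move=> H.
have Hc : (fun h : R => h^-1 *: (g h - g 0)) @ 0^' --> v.
  apply/cvgrPdist_le => e e0; have [r r0 Hr] := H e e0.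
  exists r => // t; rewrite /ball_ /= sub0r normrN => tr tn0.
  have t0 : 0 < `|t| by rewrite normr_gt0.
  have -> : v - t^-1 *: (g t - g 0) = - (t^-1 *: (g t - g 0 - t *: v)).
    by rewrite [in RHS]scalerBr [t^-1 *: (t *: v)]scalerA mulVf// scale1r opprB.
  by rewrite normrN normrZ normfV ler_pdivrMl// mulrC; apply: Hr; rewrite t0.
apply: DeriveDef; first by rewrite /derivable E1; apply/cvg_ex; exists v.
by rewrite /derive E1; exact: cvg_lim Hc.
Qed.

Lemma tangentP y v : S y -> tangent S y v <-> dotp (Nu y) v = 0.
Proof.
move=> Sy; have [Q bQ] := boundary_data_exists bK KC2 OC2 Sy; have [vQ NQ Hd] := bQ.
have yy (s : R) : 0 < s -> `|y - y| < s by rewrite subrr normr0.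
split => [[g [g0 /nbhs_ballP[r1 /= r10 H1] /is_derive_rowP Hg]]|Nv].
  apply/eqP; rewrite -normr_le0; apply/ler_addgt0Pr => e e0; rewrite add0r.
  pose B := `|v| + 1 + l1norm (Nu y); have B0 : 0 < B by rewrite ltr_pwDl ?l1norm_ge0// ltr_wpDl.
  have eB : 0 < Num.min 1 (e / B) by rewrite lt_min ltr01 divr_gt0.
  set e1 := Num.min _ _ in eB.
  have [r2 r20 H2] := Hd _ eB; have [r3 r30 H3] := Hg _ eB.
  pose m := Num.min r1 (Num.min r3 (r2 / (`|v| + 1))).
  have v10 : 0 < `|v| + 1 by rewrite ltr_wpDl.
  have m0 : 0 < m by rewrite !lt_min r10 r30 divr_gt0.
  pose t := m / 2; have t0 : 0 < t by rewrite divr_gt0.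
  have : t < m by rewrite ltr_pdivrMr// ltr_pMr// ltr1n.
  rewrite !lt_min => /and3P[t1 t3 t2].
  have nt : `|t| = t by rewrite gtr0_norm.
  have St : S (g t) by apply: H1; rewrite /ball /= sub0r normrN nt.
  have := H3 t; rewrite nt t0 t3 g0 => /(_ isT) D3.
  have e11 : e1 <= 1 by rewrite ge_min lexx.
  have gty : `|g t - y| <= t * (`|v| + 1).
    rewrite -[g t - y](subrK (t *: v)) addrC mulrDr mulr1; apply: (le_trans (ler_normD _ _)).
    by rewrite normrZ nt lerD2l; apply: (le_trans D3); rewrite ler_piMl// ltW.
  have gr : `|g t - y| < r2 by apply: (le_lt_trans gty); rewrite -ltr_pdivlMr.
  have [Na _] := H2 _ _ St Sy gr (yy _ r20).
  rewrite -(ler_pM2l t0) -{1}nt -normrM -dotpZr.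
  have -> : t *: v = (g t - y) - (g t - y - t *: v) by rewrite subKr.
  rewrite dotpBr; apply: (le_trans (ler_normB _ _)).
  apply: (@le_trans _ _ (e1 * (t * (`|v| + 1)) + l1norm (Nu y) * (e1 * t))).
    apply: lerD; first by apply: (le_trans Na); rewrite ler_wpM2l// ltW.
    by apply: (le_trans (dotp_le_l1norm _ _)); rewrite ler_wpM2l// l1norm_ge0.
  have -> : e1 * (t * (`|v| + 1)) + l1norm (Nu y) * (e1 * t) = t * (e1 * B) by rewrite /B; ring.
  by rewrite ler_wpM2l ?(ltW t0)// -ler_pdivlMr// ge_min lexx orbT.
(* The curve follows the feet of [y + t *: v]; its derivative at 0 is [v *m PI y], which is [v] when
   [v] is orthogonal to [Nu y]. *)
have /choice[pr Hpr] := signed_proj.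
exists (fun t => pr (y + t *: v)); split.
- have [Sp pE _] := Hpr y; rewrite scale0r addr0.
  by move: pE; rewrite boundary_proj// scale0r addr0 => <-.
- by apply/nbhs_ballP; exists 1; rewrite /= ?ltr01// => t _; have [] := Hpr (y + t *: v).
- apply/is_derive_rowP => e e0; rewrite scale0r addr0.
  have vB : 0 < `|v| + 1 by rewrite ltr_wpDl.
  have [r r0 Hr] := boundary_tube Sy bQ (divr_gt0 e0 vB).
  exists (r / (`|v| + 1)) => [|t /andP[t0 tr]]; first exact: divr_gt0.
  have [S1 E1 _] := Hpr (y + t *: v); have [S2 E2 _] := Hpr y.
  have tv : `|y + t *: v - y| < r.
    rewrite addrAC subrr add0r normrZ; rewrite ltr_pdivlMr// in tr.
    by apply: le_lt_trans tr; rewrite ler_wpM2l// lerDl.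
  have [H _] := Hr _ _ _ _ tv (yy _ r0) S1 S2 E1 E2.
  move: H; rewrite [y + t *: v - y]addrAC subrr add0r -scalemxAl oblique_projE Nv scale0r subr0.
  move/le_trans; apply; rewrite normrZ mulrCA mulrC ler_wpM2r//.
  by rewrite mulrAC ler_pdivrMr// ler_wpM2l ?(ltW e0)// lerDl.
Qed.

End signed_distance.

(** * Principal rho-curvatures *)

Section linear_algebra.
Variable R : realType.

(* For symmetric [P], minimise the quadratic form along [q - e *: (q *m P)]. *)
Lemma psd_kernel (n : nat) (P : 'M[R]_n) (q : 'rV[R]_n) : P^T = P ->
  (forall v, 0 <= dotp (v *m P) v) -> dotp (q *m P) q = 0 -> q *m P = 0.
Proof.
move=> sP psd q0; apply/eqP; rewrite -dotp_eq0; set u := q *m P.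
set a := dotp u u; set b := dotp (u *m P) u.
have b0 : 0 <= b := psd u.
have a0 : 0 <= a := dotp_ge0 u.
have key (e : R) : 0 <= - 2 * e * a + e ^+ 2 * b.
  have := psd (q - e *: u); rewrite mulmxBl -scalemxAl dotpBl !dotpBr !dotpZl !dotpZr.
  rewrite -/u [dotp u q]q0 (_ : dotp (u *m P) q = a); last by rewrite dotp_mulmxl sP.
  by rewrite -/a -/b; lra.
have b1 : 0 < b + 1 by rewrite ltr_wpDl.
have := key (b + 1)^-1; rewrite -(pmulr_rge0 _ (exprn_gt0 2 b1)).
have -> : (b + 1) ^+ 2 * (- 2 * (b + 1)^-1 * a + (b + 1)^-1 ^+ 2 * b) = b - 2 * (b + 1) * a.
  by field; rewrite gt_eqF.
move=> H1; have := key (a / (b + 1)); rewrite -(pmulr_rge0 _ (exprn_gt0 2 b1)).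
have -> : (b + 1) ^+ 2 * (- 2 * (a / (b + 1)) * a + (a / (b + 1)) ^+ 2 * b) = a ^+ 2 * (- b - 2).
  by field; rewrite gt_eqF.
move=> H2; apply/eqP; have := sqr_ge0 a; nra.
Qed.

(** The same block matrix is reduced by two different block eliminations. *)
Lemma sylvester_det (m n : nat) (X : 'M[R]_(n, m)) (B : 'M[R]_(m, n)) :
  \det (1%:M + X *m B) = \det (1%:M + B *m X).
Proof.
pose M := block_mx 1%:M (- X) B 1%:M.
have E1 : block_mx 1%:M 0 (- B) 1%:M *m M = block_mx 1%:M (- X) 0 (1%:M + B *m X).
  rewrite /M mulmx_block !mul1mx !mul0mx !mulmx1 !addr0 mulNmx mulmxN opprK.
  by rewrite addNr addrC.
have E2 : block_mx 1%:M X 0 1%:M *m M = block_mx (1%:M + X *m B) 0 B 1%:M.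
  by rewrite /M mulmx_block !mul1mx !mul0mx !mulmx1 !add0r addNr.
have := congr1 determinant E1; have := congr1 determinant E2.
rewrite !det_mulmx !det_ublock !det_lblock !det1 !mul1r mulr1.
by move=> -> ->.
Qed.

(** For nonzero [t] the characteristic polynomial is evaluated at [t^-1]. *)
Lemma det_split (m : nat) (C : 'M[R]_m) (ks : seq R) (t : R) :
  char_poly C = \prod_(k <- ks) ('X - k%:P) ->
  \det (1%:M - t *: C) = \prod_(k <- ks) (1 - t * k).
Proof.
move=> CE; have sz : size ks = m.
  by have := size_char_poly C; rewrite CE size_prod_XsubC => -[].
have [->|t0] := eqVneq t 0.
  by rewrite scale0r subr0 det1 big1// => k _; rewrite mul0r subr0.
have := congr1 (fun p => p.[t^-1]) CE; rewrite /char_poly.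
rewrite -[X in X = _ -> _]/(horner_eval t^-1 _) -det_map_mx.
have -> : map_mx (horner_eval t^-1) (char_poly_mx C) = t^-1 *: (1%:M - t *: C).
  rewrite /char_poly_mx; apply/matrixP => i j; rewrite !mxE /horner_eval.
  by rewrite !hornerE; case: (i == j); rewrite ?mulr1n ?mulr0n ?hornerE; field.
rewrite detZ horner_prod => E1.
have tm : t ^+ m != 0 by rewrite expf_neq0.
have -> : \det (1%:M - t *: C) = t ^+ m * (t^-1 ^+ m * \det (1%:M - t *: C)).
  by rewrite mulrA -exprMn divff// expr1n mul1r.
rewrite E1 -sz; elim: (ks) => [|k l IH]; first by rewrite !big_nil mulr1.
rewrite !big_cons -IH [size _]/= exprS hornerXsubC; move: (\prod_(i <- l) _) => P; field.
exact: t0.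
Qed.

Lemma hyperplane_basis (n : nat) (N : 'rV[R]_n) : N != 0 -> exists B : 'M[R]_(n.-1, n),
  row_free B /\ forall v, (v <= B)%MS <-> dotp N v = 0.
Proof.
move=> N0; have rE : \rank (kermx N^T) = n.-1.
  rewrite mxrank_ker mxrank_tr; have -> : \rank N = 1%N; last by rewrite subn1.
  by rewrite rank_rV N0.
rewrite -rE; exists (row_base (kermx N^T)); split; first exact: row_base_free.
move=> v; rewrite eq_row_base; split => [/sub_kermxP|Nv].
  by move=> /matrixP/(_ 0 0); rewrite dotpC dotpE !mxE.
by apply/sub_kermxP/matrixP => i j; rewrite !ord1 -dotpE dotpC Nv mxE.
Qed.

Import complex.
(** Over the complex numbers the polynomial splits. The hypothesis is the eigenvector equation for
    the eigenvalue [al + i be], written for the real part [a] and the imaginary part [b]; it forces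
    every root to be real. *)
Lemma char_poly_real_split (m : nat) (C : 'M[R]_m) :
  (forall (al be : R) (a b : 'rV[R]_m), a *m C = al *: a - be *: b ->
     b *m C = be *: a + al *: b -> (a != 0) || (b != 0) -> be = 0) ->
  exists ks, char_poly C = \prod_(k <- ks) ('X - k%:P).
Proof.
move=> H; pose toC : {rmorphism R -> complex R} := real_complex R.
have [s sE] := closed_field_poly_normal (char_poly (map_mx toC C)).
rewrite (monicP (char_poly_monic _)) scale1r in sE.
have re (z : complex R) : z \in s -> exists k : R, z = toC k.
  move=> zs; have : root (char_poly (map_mx toC C)) z by rewrite sE root_prod_XsubC.
  rewrite -eigenvalue_root_char => /eigenvalueP[w wC w0].
  pose a := map_mx (@Re R) w; pose b := map_mx (@Im R) w.
  have wab i j : w i j = Complex (a i j) (b i j) by rewrite !mxE; case: (w i j).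
  have sumC (I : finType) (F G : I -> R) :
    \sum_i Complex (F i) (G i) = Complex (\sum_i F i) (\sum_i G i).
    by elim/big_ind3: _ => // x1 x2 x3 y1 y2 y3 -> ->.
  have wCj i j : Complex ((a *m C) i j) ((b *m C) i j) = z * w i j.
    move/matrixP/(_ i j): wC; rewrite !mxE => <-; rewrite -sumC.
    by apply: eq_bigr => k _; rewrite wab !mxE /= /GRing.mul/= !mulr0 subr0 add0r.
  case: z wCj {zs wC} => al be wCj.
  exists al; rewrite (H al be a b) //.
  - apply/matrixP => i j; have := wCj i j; rewrite wab => -[/= h _]; rewrite h.
    by rewrite !mxE.
  - apply/matrixP => i j; have := wCj i j; rewrite wab => -[/= _ h]; rewrite h.
    by rewrite !mxE addrC.
  - rewrite -negb_and; apply: contra w0 => /andP[/eqP a0 /eqP b0].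
    by apply/eqP/matrixP => i j; rewrite wab a0 b0 !mxE.
exists (map (@Re R) s).
apply: (map_poly_inj toC); rewrite map_char_poly sE rmorph_prod big_map.
rewrite [LHS]big_seq [RHS]big_seq; apply: eq_bigr => z /re [k ->].
by rewrite rmorphB /= map_polyX map_polyC.
Qed.

Lemma split_size (m : nat) (C : 'M[R]_m) (ks : seq R) :
  char_poly C = \prod_(k <- ks) ('X - k%:P) -> size ks = m.
Proof. by move=> CE; have := size_char_poly C; rewrite CE size_prod_XsubC => -[]. Qed.

Lemma split_trace (m : nat) (C : 'M[R]_m) (ks : seq R) : (0 < m)%N ->
  char_poly C = \prod_(k <- ks) ('X - k%:P) -> \sum_(k <- ks) k = \tr C.
Proof.
move=> m0 CE; have sz := split_size CE; have := char_poly_trace C m0.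
by rewrite CE -{1}sz coefPn_prod_XsubC ?sz -?lt0n// => /oppr_inj.
Qed.

Lemma split_eigenvalue (m : nat) (C : 'M[R]_m) (ks : seq R) k :
  char_poly C = \prod_(k <- ks) ('X - k%:P) -> k \in ks -> eigenvalue C k.
Proof. by move=> CE kks; rewrite eigenvalue_root_char CE root_prod_XsubC. Qed.

(** The product of 1 - s k and 1 - t k exceeds 1 - (s + t) k by s t k^2, whatever the sign of k. The
    quotient is thus at most the product of the 1 - t k, to which the inequality between the means
    applies. *)
Lemma curvature_AGM (ks : seq R) (s t H : R) : (0 < size ks)%N -> 0 <= s -> 0 <= t ->
  (forall k, k \in ks -> 0 < 1 - s * k) ->
  (forall k, k \in ks -> 0 < 1 - (s + t) * k) ->
  H * (size ks)%:R <= \sum_(k <- ks) k ->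
  \prod_(k <- ks) (1 - (s + t) * k) / \prod_(k <- ks) (1 - s * k) <= (1 - t * H) ^+ size ks.
Proof.
move=> m0 s0 t0 Hs Ht HH; have mR : 0 < (size ks)%:R :> R by rewrite ltr0n.
have st k : k \in ks -> 1 - (s + t) * k <= (1 - t * k) * (1 - s * k).
  by move=> _; have := mulr_ge0 (mulr_ge0 s0 t0) (sqr_ge0 k); rewrite expr2; lra.
have k1 k : k \in ks -> 0 <= 1 - t * k.
  move=> kks; rewrite -(pmulr_lge0 _ (Hs k kks)); apply: le_trans (st k kks).
  exact: ltW (Ht k kks).
have p0 : 0 < \prod_(k <- ks) (1 - s * k).
  by rewrite big_seq; apply: prodr_gt0.
rewrite ler_pdivrMr//.
apply: (@le_trans _ _ (\prod_(k <- ks) (1 - t * k) * \prod_(k <- ks) (1 - s * k))).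
  rewrite -big_split/= !big_seq; apply: ler_prod => k kks.
  by rewrite (ltW (Ht k kks)) st.
rewrite ler_wpM2r ?(ltW p0)//.
pose E (i : 'I_(size ks)) := 1 - t * nth 0 ks i.
have E0 : {in predT, forall i, 0 <= E i} by move=> i _; apply: k1; exact: mem_nth.
have [AG _] := leif_AGM E0.
have -> : \prod_(k <- ks) (1 - t * k) = \prod_(i in predT) E i.
  by rewrite (big_nth 0) big_mkord; apply: eq_bigl => i; rewrite inE.
apply: (le_trans AG); rewrite card_ord.
have -> : \sum_(i in predT) E i = (size ks)%:R - t * \sum_(k <- ks) k.
  rewrite (big_nth 0) big_mkord mulr_sumr /E sumrB; congr (_ - _).
  by rewrite sumr_const card_ord.
have sum0 : 0 <= (size ks)%:R - t * \sum_(k <- ks) k.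
  have -> : (size ks)%:R - t * \sum_(k <- ks) k = \sum_(k <- ks) (1 - t * k).
    by rewrite sumrB mulr_sumr big_const_seq count_predT iter_addr_0.
  by rewrite big_seq sumr_ge0.
rewrite lerXn2r// ?nnegrE ?divr_ge0//.
  have : 0 <= ((size ks)%:R - t * \sum_(k <- ks) k) / (size ks)%:R by rewrite divr_ge0.
  move/le_trans; apply; rewrite ler_pdivrMr// mulrBl mul1r lerD2l lerN2 -mulrA ler_wpM2l//.
rewrite ler_pdivrMr// mulrBl mul1r lerD2l lerN2 -mulrA ler_wpM2l//.
Qed.

End linear_algebra.

Section rho_curvature.
Variables (R : realType) (n : nat) (Omega K : set 'rV[R]_n).
Local Notation E := 'rV[R]_n.
Local Notation rho := (gauge K).
Local Notation sf := (gauge (polar K)).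
Local Notation Rg := (grad rho).
Local Notation S := (boundary Omega).
Local Notation d := (minkowski_dist Omega K).
Local Notation Nu := (unit_bnormal Omega K).
Local Notation PI := (oblique_proj Omega K).
Local Notation curv := (rho_curvatures Omega K).
Hypotheses (bK : convex_body K) (KC2 : C2_boundary K).
Hypotheses (O0 : Omega !=set0) (Ob : bounded_set Omega) (Oo : open Omega)
  (OC2 : C2_boundary Omega) (n2 : (2 <= n)%N).
Let bP := convex_body_polar bK.
Let n0 : (0 < n)%N := ltnW n2.
Implicit Types (x y z v w p q : E).

Lemma quad_lip (H : 'M[R]_n) p : exists2 C, 0 < C & forall z, `|z - p| <= 1 ->
  `|dotp (z *m H) z - dotp (p *m H) p| <= C * `|z - p|.
Proof.
pose C := l1norm (p *m H) + l1norm (p *m H^T) + l1norm p + (mxl1 H) * n.+1%:R + 1.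
have m0 := mxl1_gt0 H.
have C0 : 0 < C.
  by rewrite ltr_wpDl// !addr_ge0 ?l1norm_ge0// mulr_ge0// ltW.
exists C => // z z1; set e := z - p in z1 *.
have -> : dotp (z *m H) z - dotp (p *m H) p =
   dotp (p *m H) e + dotp (p *m H^T) e + dotp (e *m H) e.
  have -> : z = p + e by rewrite /e addrC subrK.
  clearbody e; rewrite mulmxDl !dotpDl !dotpDr (dotp_mulmxl e p H) [dotp e (p *m _)]dotpC.
  by ring.
apply: (le_trans (ler_normD _ _)).
apply: (@le_trans _ _ ((l1norm (p *m H) + l1norm (p *m H^T)) * `|e| + mxl1 H * n.+1%:R * `|e|)).
  apply: lerD.
    by apply: (le_trans (ler_normD _ _)); rewrite mulrDl; apply: lerD; exact: dotp_le_l1norm.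
  apply: (le_trans (dotp_le_l1norm _ _)); rewrite ler_wpM2r//.
  have := l1norm_le (e *m H); have := mulmx_norm_le e H => h1 h2.
  apply: (le_trans h2); rewrite mulrC ler_wpM2r ?ler0n//; apply: (le_trans h1).
  by rewrite ler_piMr// ltW.
by rewrite -mulrDl ler_wpM2r// /C; have := l1norm_ge0 p; lra.
Qed.

(* The point [x - d x *: Rg (m + t *: q)] stays in the closure of [Omega], as
   [x] has distance [d x] to the boundary; expand to second order in [t]. *)
Lemma second_order x y U psi P q H : Omega x -> S y -> sf (x - y) = d x ->
  U y -> C2_defining Omega U psi -> sjacobian Rg (- grad psi y) P ->
  H = \matrix_(i, j) partial i (partial j psi) y ->
  d x * dotp (q *m P *m H) (q *m P) <= dotp (q *m P) q.
Proof.
move=> Ox Sy xy Uy dpsi HP HE; have [oU C2 D0 Hpsi] := dpsi.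
set m := - grad psi y in HP *; have m0 : m != 0 by rewrite oppr_eq0; exact: D0.
set r := d x; have r0 : 0 < r by exact: (mdist_pos bK O0 Ob Oo n0 Ox).
have xE := proj_direction bK KC2 O0 Ob Oo n0 Ox Sy xy Uy dpsi.
rewrite -/m -/r in xE.
set p := q *m P; set X := dotp _ _; set Y := dotp p q.
pose c1 := `|q| ^+ 2 + l1norm q * `|q|.
have [C C0 HC] := quad_lip H p.
pose B := 2 * c1 + r * C * `|q| + 2 * r * (`|p| + 1) ^+ 2 + 1.
have c10 : 0 <= c1 by rewrite addr_ge0 ?sqr_ge0// mulr_ge0// l1norm_ge0.
have B0 : 0 < B.
  by rewrite ltr_wpDl// !addr_ge0// !mulr_ge0 ?sqr_ge0// ?(ltW r0)// ltW.
apply/ler_addgt0Pr => e0 e00.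
(* The first bound absorbs the accumulated errors, whose total factor is at most [B]; the second
   keeps [z] within distance 1 of [p], the range of [quad_lip]. *)
pose e := Num.min (e0 / B) (1 + `|q|)^-1.
have q1 : 0 < 1 + `|q| by rewrite ltr_pwDl.
have ee : 0 < e by rewrite lt_min divr_gt0//= invr_gt0.
have eB : e * B <= e0 by rewrite -ler_pdivlMr// ge_min lexx.
have eq1 : e * `|q| <= 1.
  apply: (@le_trans _ _ (e * (1 + `|q|))); first by rewrite ler_wpM2l ?(ltW ee)// lerDr.
  by rewrite -ler_pdivlMr// mul1r ge_min lexx orbT.
have [r1 r10 H1] := sjacobian_near HP ee.
have [rU rU0 HU] := open_row_ball oU Uy.
have [r2 r20 H2] : exists2 d, 0 < d & forall v, `|v| < d ->
  `|psi (y + v) - psi y - dotp (grad psi y) v - 2^-1 * dotp (v *m H) v| <= e * `|v| ^+ 2.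
  apply: (@taylor2 _ _ psi (grad psi) y H rU rU0 _ _ e ee).
    by move=> z zr; apply: Ck1_sderiv oU (Ck2_Ck1 C2) (HU z zr).
  by rewrite HE; exact: Ck2_sjacobian oU C2 Uy.
have [r3 r30 H3] : exists2 d, 0 < d & forall v, `|v| < d ->
  `|rho (m + v) - rho m - dotp (Rg m) v - 2^-1 * dotp (v *m P) v| <= e * `|v| ^+ 2.
  apply: (@taylor2 _ _ rho Rg m P `|m| _ _ HP e ee); first by rewrite normr_gt0.
  move=> z zr; have z0 : z != 0 by apply: contraTneq zr => ->; rewrite sub0r normrN ltxx.
  by have [] := gauge_C2 bK KC2 z0.
pose rp := r * (`|p| + 1); have rp0 : 0 < rp by rewrite mulr_gt0// ltr_wpDl.
pose t := Num.min (Num.min (r1 / (1 + `|q|)) (r3 / (1 + `|q|)))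
   (Num.min (Num.min (rU / rp) (r2 / rp)) (`|m| / (1 + `|q|))) / 2.
have t0 : 0 < t by rewrite !divr_gt0// !lt_min !divr_gt0// normr_gt0.
have tlt a b : 0 < b -> t * 2 <= a / b -> t * b < a.
  by move=> b0; rewrite ler_pdivlMr//; have := mulr_gt0 t0 b0; lra.
have [t1 t3 tU t2 tm] : [/\ t * (1 + `|q|) < r1, t * (1 + `|q|) < r3, t * rp < rU,
   t * rp < r2 & t * (1 + `|q|) < `|m|].
  by split; apply: tlt => //; rewrite /t divfK// !ge_min lexx ?orbT.
clearbody t.
have tq : `|t *: q| <= t * (1 + `|q|) by rewrite normrZ gtr0_norm// ler_wpM2l ?(ltW t0)// lerDr.
have mtq0 : m + t *: q != 0.
  apply/eqP => E1; have : `|m| <= `|t *: q| by rewrite -(normrN (t *: q)) -[m]addr0 -(subrr (t *: q)) addrA E1 sub0r.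
  by move/le_trans => /(_ _ tq); rewrite leNgt tm.
(* The difference quotient of [Rg] in the direction [q], close to [p]; the point to be tested is
   [y - u] with [u = (r * t) *: z]. *)
pose z := t^-1 *: (Rg (m + t *: q) - Rg m).
have zp : `|z - p| <= e * `|q|.
  have := H1 (m + t *: q) m; rewrite addrAC subrr add0r normr0 => /(_ (le_lt_trans tq t1) r10).
  have -> : z - p = t^-1 *: (Rg (m + t *: q) - Rg m - (t *: q) *m P).
    by rewrite /z [in RHS]scalerBr -scalemxAl [t^-1 *: (t *: _)]scalerA mulVf ?gt_eqF// scale1r.
  by rewrite [`|t^-1 *: _|]normrZ normfV normrZ gtr0_norm// ler_pdivrMl// mulrCA.
have z1 : `|z| <= `|p| + 1.
  rewrite -[z](subrK p) addrC; apply: (le_trans (ler_normD _ _)); rewrite lerD2l.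
  exact: le_trans zp eq1.
have RE : Rg (m + t *: q) = Rg m + t *: z.
  by rewrite /z scalerA divff ?gt_eqF// scale1r [RHS]addrC subrK.
clearbody z; pose u := (r * t) *: z.
have nu : `|u| <= t * rp.
  have rt0 : 0 < r * t by rewrite mulr_gt0.
  have -> : `|u| = r * t * `|z| by rewrite /u normrZ gtr0_norm.
  by rewrite /rp mulrA [t * r]mulrC ler_wpM2l// ltW.
have wE : y + - u = x - r *: Rg (m + t *: q).
  by rewrite RE scalerDr -xE scalerA /u opprD opprB addrA [x + _]addrC subrK.
have psiw : psi (y + - u) <= 0.
  have Uw : U (y + - u) by apply: HU; rewrite addrAC subrr add0r normrN; exact: le_lt_trans nu tU.
  apply/(Hpsi _ Uw).2; rewrite wE; apply: (inner_ball bK O0 Ob Oo n0 Ox).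
  by rewrite subKr gaugeZ// support_grad// mulr1.
have psi0 : psi y = 0 by exact: (defining_zero dpsi Uy Sy).
have := H2 (- u); rewrite normrN => /(_ (le_lt_trans nu t2)).
have EN : dotp (- u *m H) (- u) = dotp (u *m H) u by rewrite mulNmx dotpNl dotpNr opprK.
have EM : dotp (grad psi y) (- u) = dotp m u by rewrite dotpNr -dotpNl.
rewrite psi0 subr0 EN EM ler_norml => /andP[A1 _].
have uH : dotp (u *m H) u = (r * t) ^+ 2 * dotp (z *m H) z.
  by rewrite /u -scalemxAl dotpZl dotpZr mulrA expr2.
have nu2 : `|u| ^+ 2 = (r * t) ^+ 2 * `|z| ^+ 2 by rewrite normrZ gtr0_norm ?mulr_gt0// exprMn.
rewrite uH nu2 in A1.
(* Euler's identity at [m + t *: q] and at [m] expresses the first order term through values of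
   [rho], to which the second order expansion [H3] applies. *)
have mu : dotp m u = r * (rho (m + t *: q) - t * dotp q (Rg m) - t ^+ 2 * dotp q z - rho m).
  have Eu1 := gauge_euler bK KC2 mtq0; have Eu2 := gauge_euler bK KC2 m0.
  rewrite RE !dotpDr !dotpDl !dotpZl !dotpZr Eu2 in Eu1.
  by rewrite /u dotpZr -Eu1 ?[dotp z m]dotpC ?[dotp z q]dotpC [dotp q (Rg m)]dotpC; ring.
have := H3 (t *: q) (le_lt_trans tq t3).
rewrite -scalemxAl -/p !dotpZl !dotpZr -/Y normrZ gtr0_norm// ler_norml => /andP[A2 _].
have qz : dotp q z <= Y + e * (l1norm q * `|q|).
  have -> : dotp q z = Y + dotp q (z - p) by rewrite dotpBr /Y [dotp p q]dotpC addrC subrK.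
  rewrite lerD2l; apply: (le_trans (ler_norm _)); apply: (le_trans (dotp_le_l1norm _ _)).
  by rewrite mulrCA ler_wpM2l// l1norm_ge0.
have := HC z (le_trans zp eq1); rewrite ler_norml => /andP[A3 _].
have A4 : X - C * (e * `|q|) <= dotp (z *m H) z.
  apply: (@le_trans _ _ (X - C * `|z - p|)); first by rewrite lerD2l lerN2 ler_wpM2l ?(ltW C0).
  by rewrite addrC -lerBrDr.
have zz : `|z| ^+ 2 <= (`|p| + 1) ^+ 2 by rewrite lerXn2r// nnegrE.
rewrite mu in A1; have c1E : c1 = `|q| ^+ 2 + l1norm q * `|q| by [].
have BE : B = 2 * c1 + r * C * `|q| + 2 * r * (`|p| + 1) ^+ 2 + 1 by [].
clearbody c1 B e X Y rp r.
have t20 : 0 < t ^+ 2 by rewrite exprn_gt0.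
have A5 : rho (m + t *: q) - t * dotp q (Rg m) - t ^+ 2 * dotp q z - rho m >=
   t ^+ 2 * (- 2^-1 * Y - e * c1).
  have h := ler_wpM2l (ltW t20) qz; rewrite exprMn in A2; rewrite [dotp (Rg m) q]dotpC in A2.
  rewrite c1E; move: (rho _) (rho _) (dotp _ _) (dotp _ _) A2 h => g1 g2 g3 g4 A2 h.
  move: (`|q|) (l1norm q) A2 h => a1 a2 A2 h.
  have -> : t ^+ 2 * (- 2^-1 * Y - e * (a1 ^+ 2 + a2 * a1)) =
    2^-1 * (t * (t * Y)) - e * (t ^+ 2 * a1 ^+ 2) - t ^+ 2 * (Y + e * (a2 * a1)) by field.
  have W := lerB A2 h; rewrite -subr_ge0 in W; rewrite -subr_ge0; apply: (le_trans W); rewrite le_eqVlt; apply/orP; left; apply/eqP; ring.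
have A6 : r * (- 2^-1 * Y - e * c1) + 2^-1 * r ^+ 2 * dotp (z *m H) z <= e * r ^+ 2 * `|z| ^+ 2.
  rewrite -(ler_pM2l t20); have h := ler_wpM2l (ltW r0) A5;
  move: A1 h psiw; move: (rho (m + t *: q) - t * dotp q (Rg m) - t ^+ 2 * dotp q z - rho m) => W.
  move: (dotp (z *m H) z) (psi (y - u)) (`|z|) => g5 g7 g6 A1 h psiw.
  have -> : t ^+ 2 * (r * (- 2^-1 * Y - e * c1) + 2^-1 * r ^+ 2 * g5) =
    r * (t ^+ 2 * (- 2^-1 * Y - e * c1)) + 2^-1 * ((r * t) ^+ 2 * g5) by field.
  have -> : t ^+ 2 * (e * r ^+ 2 * g6 ^+ 2) = e * ((r * t) ^+ 2 * g6 ^+ 2) by ring.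
  have V := lerD (lerD A1 h) psiw; rewrite -subr_ge0 in V; rewrite -subr_ge0; apply: (le_trans V).
  by rewrite le_eqVlt; apply/orP; left; apply/eqP; ring.
have A7 : r * X <= Y + e * (2 * c1 + r * C * `|q| + 2 * r * (`|p| + 1) ^+ 2).
  have h1 : e * r ^+ 2 * `|z| ^+ 2 <= e * r ^+ 2 * (`|p| + 1) ^+ 2.
    by rewrite ler_wpM2l// mulr_ge0 ?sqr_ge0// ltW.
  have h2 : 2^-1 * r ^+ 2 * (X - C * (e * `|q|)) <= 2^-1 * r ^+ 2 * dotp (z *m H) z.
    by rewrite ler_wpM2l// mulr_ge0 ?sqr_ge0// ltW.
  rewrite -(ler_pM2l r0); move: h1 h2 A6.
  move: (dotp (z *m H) z) (`|z|) (`|q|) ((`|p| + 1) ^+ 2) => g1 g2 g3 g4 h1 h2 A6.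
  rewrite -subr_ge0.
  have -> : r * (Y + e * (2 * c1 + r * C * g3 + 2 * r * g4)) - r * (r * X) =
     2 * (e * r ^+ 2 * g4 - 2^-1 * r ^+ 2 * (X - C * (e * g3)) - r * (- 2^-1 * Y - e * c1)) by field.
  apply: mulr_ge0 => //; have V := lerD (lerD h1 h2) A6; rewrite -subr_ge0 in V; apply: (le_trans V).
  by rewrite le_eqVlt; apply/orP; left; apply/eqP; ring.
apply: (le_trans A7); rewrite lerD2l; apply: le_trans eB; rewrite ler_wpM2l ?(ltW ee)//.
by rewrite BE lerDl.
Qed.

(** The product [H *m P] is symmetric for the form of [P], which may be degenerate. A nonzero
    imaginary part makes the squared [P]-lengths of [a *m H] and [b *m H] add up to 0, so both lie
    in the kernel of [P] by [psd_kernel], and the eigenvalue equations leave [a = b = 0]. *)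
Lemma symmetric_pair_real (H P : 'M[R]_n) (al be : R) (a b : E) : H^T = H -> P^T = P ->
  (forall v, 0 <= dotp (v *m P) v) ->
  a *m H *m P = al *: a - be *: b -> b *m H *m P = be *: a + al *: b ->
  (a != 0) || (b != 0) -> be = 0.
Proof.
move=> sH sP psd Ea Eb ab0; apply/eqP; apply: contraTT ab0 => be0.
set q1 := a *m H in Ea; set q2 := b *m H in Eb.
have ab : dotp a q2 = dotp b q1 by rewrite /q2 -{1}sH -dotp_mulmxl dotpC.
have sym : dotp (q1 *m P) q2 = dotp (q2 *m P) q1 by rewrite dotp_mulmxl sP dotpC.
rewrite Ea Eb dotpBl dotpDl !dotpZl ab in sym.
have s0 : dotp a q1 + dotp b q2 = 0.
  by apply: (mulfI be0); rewrite mulr0 mulrDr; move: sym; lra.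
have p1 := psd q1; have p2 := psd q2.
have z12 : dotp (q1 *m P) q1 + dotp (q2 *m P) q2 = 0.
  rewrite Ea Eb dotpBl dotpDl !dotpZl ab.
  have -> : al * dotp a q1 - be * dotp b q1 + (be * dotp b q1 + al * dotp b q2) =
    al * (dotp a q1 + dotp b q2) by ring.
  by rewrite s0 mulr0.
have z1 : q1 *m P = 0 by apply: psd_kernel => //; lra.
have z2 : q2 *m P = 0 by apply: psd_kernel => //; lra.
rewrite z1 in Ea; rewrite z2 in Eb.
have c0 : al ^+ 2 + be ^+ 2 != 0.
  by rewrite gt_eqF// ltr_wpDl ?sqr_ge0// exprn_even_gt0.
have a0 : a = 0.
  apply: (scalerI c0); rewrite scaler0.
  transitivity (al *: (al *: a - be *: b) + be *: (be *: a + al *: b)).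
    by apply/rowP => i; rewrite !mxE; ring.
  by rewrite -Ea -Eb !scaler0 addr0.
rewrite a0 scaler0 sub0r in Ea.
have b0 : b = 0 by apply: (scalerI be0); rewrite scaler0 -[LHS]opprK -Ea oppr0.
by rewrite a0 b0 eqxx.
Qed.

Lemma tangent_basis_ex y : S y -> exists B, tangent_basis S y B.
Proof.
move=> Sy; have [B [fB HB]] := hyperplane_basis (unit_bnormal_neq0 bK OC2 Sy).
exists B; split => // v; split.
  by move/(tangentP bK KC2 O0 Ob Oo OC2 n0 v Sy)/(HB v).2.
by move/(HB v).1/(tangentP bK KC2 O0 Ob Oo OC2 n0 v Sy).2.
Qed.

Lemma tangent_basisP y B : S y -> tangent_basis S y B ->
  forall v, (v <= B)%MS <-> dotp (Nu y) v = 0.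
Proof.
move=> Sy [fB HB] v; split.
  by move/(HB v).2/(tangentP bK KC2 O0 Ob Oo OC2 n0 v Sy).1.
by move/(tangentP bK KC2 O0 Ob Oo OC2 n0 v Sy).2/(HB v).1.
Qed.

Lemma image_sub (N : E) (m k : nat) (B : 'M[R]_(m, n)) (A : 'M[R]_(k, n)) (Q : 'M[R]_n) :
  (forall v, (v <= B)%MS <-> dotp N v = 0) -> (forall w, dotp N (w *m Q) = 0) ->
  (A *m Q <= B)%MS.
Proof.
move=> HB HN; apply/row_subP => i; rewrite row_mul; apply/HB; exact: HN.
Qed.

Lemma conj_eigen (m : nat) (B : 'M[R]_(m, n)) (M : 'M[R]_n) (a b : 'rV[R]_m) :
  stablemx B M -> a *m conjmx B M = b -> a *m B *m M = b *m B.
Proof.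
move=> sB <-; by rewrite /conjmx -[a *m (_ *m _) *m B]mulmxA mulmxKpV// mulmxA.
Qed.

(** The default value in [rho_curvatures] is thus never taken on the boundary. On tangent vectors
    the Jacobian acts as a Hessian times a semidefinite matrix, whose characteristic polynomial
    splits by [symmetric_pair_real]. *)
Lemma rho_curvaturesP y : S y -> is_rho_curvatures Omega K y (curv y).
Proof.
move=> Sy; apply: xgetPex; have [U [psi [Uy dpsi]]] := OC2 Sy; have [oU C2 D0 Hpsi] := dpsi.
have m0 : - grad psi y != 0 by rewrite oppr_eq0; exact: D0.
have [_ [P HP]] := gauge_C2 bK KC2 m0.
have bQ := boundary_data_ex bK KC2 OC2 Sy Uy dpsi HP; have [vQ NQ _] := bQ.
have JE := cahn_hoffman_jacobian bK KC2 O0 Ob Oo OC2 n0 Sy bQ.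
have [B tB] := tangent_basis_ex Sy; have HB := tangent_basisP Sy tB.
have sB : stablemx B ('J (cahn_hoffman Omega K) y).
  rewrite JE; apply: (image_sub _ HB) => w.
  by rewrite mulmxN dotpNr NQ oppr0.
suff [ks Hks] : exists ks, char_poly (conjmx B ('J (cahn_hoffman Omega K) y)) =
    \prod_(k <- ks) ('X - k%:P) by exists ks, B.
apply: char_poly_real_split => al be a b Ha Hb ab0.
have Ha' := conj_eigen sB Ha; have Hb' := conj_eigen sB Hb.
have pB (c : 'rV[R]_n.-1) : c *m B *m PI y = c *m B.
  by rewrite oblique_projE (HB _).1 ?submxMl// scale0r subr0.
rewrite JE opprK !mulmxA !pB mulmxBl -!scalemxAl in Ha'.
rewrite JE opprK !mulmxA !pB mulmxDl -!scalemxAl in Hb'.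
have [rU rU0 HU] := open_row_ball oU Uy.
apply: (symmetric_pair_real _ (gauge_hess_sym bK KC2 m0 HP) _ Ha' Hb').
- apply: (@hessian_sym _ _ psi (grad psi) y _ rU rU0); last exact: Ck2_sjacobian oU C2 Uy.
  by move=> z zr; apply: Ck1_sderiv oU (Ck2_Ck1 C2) (HU z zr).
- by move=> v; exact: (gauge_hess_psd bK KC2 v m0 HP).
- have [fB _] := tB; have inj c : (c *m B == 0) = (c == 0).
    apply/eqP/eqP => [c0|->]; last by rewrite mul0mx.
    by rewrite -(mulmxKp fB c) c0 mul0mx.
  by rewrite !inj.
Qed.

(** The matrix [Q] factors through a tangent basis as [X *m B], so determinants and traces on the
    whole space are those of [B *m X] on the tangent space. The signs come from the Jacobian of the
    Cahn-Hoffman field being [- Q]. *)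
Lemma rho_curvatures_det y Q : S y -> boundary_data Omega K y Q ->
  [/\ size (curv y) = n.-1, \sum_(k <- curv y) k = - \tr Q &
    forall t : R, \det (1%:M + t *: Q) = \prod_(k <- curv y) (1 - t * k)].
Proof.
move=> Sy bQ; have [B [tB sB CE]] := rho_curvaturesP Sy; have [vQ NQ _] := bQ.
have JE := cahn_hoffman_jacobian bK KC2 O0 Ob Oo OC2 n0 Sy bQ.
have HB := tangent_basisP Sy tB; rewrite JE in sB CE.
pose X := Q *m pinvmx B.
have QX : Q = X *m B.
  by rewrite /X mulmxKpV// -[Q]mul1mx; apply: (image_sub _ HB) => w; exact: NQ.
have CX : conjmx B (- Q) = - (B *m X) by rewrite /conjmx /X mulmxN mulNmx mulmxA.
split; first exact: split_size CE.
  rewrite (split_trace _ CE) ?CX; last by rewrite -ltnS prednK.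
  by rewrite raddfN /= mxtrace_mulC -QX.
move=> t; rewrite -(det_split t CE) CX scalerN opprK {1}QX scalemxAl sylvester_det.
by rewrite -scalemxAr.
Qed.

(** For an eigenvector [a], [second_order] with [q = a *m H] bounds [d x * k] times [k * g] by
    [k * g], which is nonnegative. If [k * g] vanishes, then [q] is in the kernel of [P] and
    [k = 0]. *)
Lemma curvature_reach x y k : Omega x -> S y -> sf (x - y) = d x -> k \in curv y -> d x * k <= 1.
Proof.
move=> Ox Sy xy kks; have [B [tB sB CE]] := rho_curvaturesP Sy.
have [U [psi [Uy dpsi]]] := OC2 Sy; have [oU C2 D0 Hpsi] := dpsi.
have m0 : - grad psi y != 0 by rewrite oppr_eq0; exact: D0.
have [_ [P HP]] := gauge_C2 bK KC2 m0.
have bQ := boundary_data_ex bK KC2 OC2 Sy Uy dpsi HP.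
have JE := cahn_hoffman_jacobian bK KC2 O0 Ob Oo OC2 n0 Sy bQ.
have HB := tangent_basisP Sy tB.
have /eigenvalueP[z zC z0] := split_eigenvalue CE kks.
have := conj_eigen sB zC; rewrite JE opprK !mulmxA oblique_projE (HB _).1 ?submxMl//.
rewrite scale0r subr0 -scalemxAl; set a := z *m B; set H := \matrix_(i, j) _.
set q := a *m H => qP.
have a0 : a != 0.
  apply: contra z0 => /eqP a0; have [fB _] := tB.
  by rewrite -(mulmxKp fB z) -/a a0 mul0mx.
have := second_order q Ox Sy xy Uy dpsi HP erefl; rewrite -/H qP -!scalemxAl !dotpZl !dotpZr.
rewrite -/q [dotp a q]dotpC; set g := dotp q a => h.
have kg0 : 0 <= k * g.
  by have := gauge_hess_psd bK KC2 q m0 HP; rewrite qP dotpZl dotpC.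
have [kg|kg] := eqVneq (k * g) 0; last first.
  by rewrite -(ler_pM2r (_ : 0 < k * g)) ?lt_neqAle 1?eq_sym ?kg// mul1r -mulrA.
have : k *: a = 0.
  rewrite -qP; apply: psd_kernel (gauge_hess_sym bK KC2 m0 HP) _ _.
    by move=> v; exact: (gauge_hess_psd bK KC2 v m0 HP).
  by rewrite qP dotpZl dotpC.
by move/eqP; rewrite scaler_eq0 (negPf a0) orbF => /eqP ->; rewrite mulr0 ler01.
Qed.

Lemma fjacobian_lip_bound (F : E -> E) y (M : 'M[R]_n) (C r : R) : fjacobian F y M -> 0 < r ->
  (forall x, `|x - y| < r -> `|F x - F y| <= C * `|x - y|) -> forall w, `|w *m M| <= C * `|w|.
Proof.
move=> HF r0 HC w; apply/ler_addgt0Pr => e e0.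
have w1 : 0 < 1 + `|w| by rewrite ltr_pwDl.
have [r1 r10 H1] := HF _ (divr_gt0 e0 w1).
pose t := Num.min (r / (1 + `|w|)) (r1 / (1 + `|w|)) / 2.
have t0 : 0 < t by rewrite divr_gt0// lt_min !divr_gt0.
have tlt a : 0 < a -> t * 2 <= a / (1 + `|w|) -> `|y + t *: w - y| < a.
  move=> a0; rewrite ler_pdivlMr// addrAC subrr add0r normrZ gtr0_norm// => h.
  have h1 := mulr_gt0 t0 w1; have : t * `|w| <= t * (1 + `|w|) by rewrite ler_wpM2l ?(ltW t0)// lerDr.
  lra.
have A1 : `|y + t *: w - y| < r by apply: tlt => //; rewrite /t divfK// ge_min lexx.
have A2 : `|y + t *: w - y| < r1 by apply: tlt => //; rewrite /t divfK// ge_min lexx orbT.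
have := HC _ A1; have := H1 _ A2.
rewrite [y + t *: w - y]addrAC subrr add0r -scalemxAl => h1 h2.
rewrite -(ler_pM2l t0) -{1}(gtr0_norm t0) -normrZ.
rewrite -[t *: (w *m M)](subKr (F (y + t *: w) - F y)); apply: (le_trans (ler_normB _ _)).
apply: (le_trans (lerD h2 h1)); rewrite normrZ gtr0_norm// mulrDr mulrCA lerD2l mulrCA.
by rewrite ler_wpM2l ?(ltW t0)// mulrAC ler_pdivrMr// ler_wpM2l ?(ltW e0)// lerDr.
Qed.

(** Makes the infimum in [min_mean_rho_curvature] a true lower bound. Near each boundary point the
    Lipschitz constant of the Cahn-Hoffman field bounds the traces, and compactness makes the bound
    uniform. *)
Lemma mean_rho_curvature_bound : exists C, forall y, S y -> C <= mean_rho_curvature Omega K y.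
Proof.
have tr_bound (M : 'M[R]_n) (C : R) : (forall w, `|w *m M| <= C * `|w|) -> 0 <= C ->
    `|\tr M| <= n%:R * C.
  move=> HM C0; rewrite /mxtrace; apply: (le_trans (ler_norm_sum _ _ _)).
  apply: (@le_trans _ _ (\sum_(i < n) C)); last by rewrite sumr_const card_ord mulr_natl.
  apply: ler_sum => i _; have := HM (delta_mx 0 i); rewrite -rowE => h.
  have -> : M i i = row i M 0 i by rewrite mxE.
  apply: (le_trans (norm_coord_le _ _)); apply: (le_trans h).
  rewrite -[leRHS]mulr1 ler_wpM2l//; apply: norm_row_le => // j.
  by rewrite mxE eqxx /=; case: (_ == _); rewrite ?normr1 ?normr0.
have local y0 : S y0 -> exists2 C, 0 < C & exists2 r, 0 < r & forall y, S y -> `|y - y0| < r ->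
    - C <= mean_rho_curvature Omega K y.
  move=> S0; have [C C0 [r r0 HC]] := cahn_hoffman_lip bK KC2 O0 Ob Oo OC2 n0 S0.
  have nR : 0 < n.-1%:R :> R by rewrite ltr0n -ltnS prednK.
  exists (n.-1%:R^-1 * (n%:R * C)); first by rewrite !mulr_gt0 ?invr_gt0// ltr0n.
  exists r => // y Sy yr; have [Q bQ] := boundary_data_exists bK KC2 OC2 Sy.
  have [_ sE _] := rho_curvatures_det Sy bQ.
  rewrite /mean_rho_curvature sE -mulrN ler_pM2l ?invr_gt0// -(raddfN (@mxtrace R n)).
  have ry : 0 < r - `|y - y0| by rewrite subr_gt0.
  have HQ := fjacobian_lip_bound (cahn_hoffman_fjacobian bK KC2 O0 Ob Oo OC2 n0 Sy bQ) ry.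
  have {}HQ w : `|w *m (- Q)| <= C * `|w|.
    apply: HQ => x xr; apply: HC => //; rewrite -[x](subrK y) -addrA.
    by apply: (le_lt_trans (ler_normD _ _)); rewrite -ltrBrDr.
  by have := tr_bound _ _ HQ (ltW C0); rewrite ler_norml => /andP[].
have /compact_near_coveringP cS := boundary_compact Ob Oo.
have : \forall C \near +oo, S `<=` (fun y => S y -> - C <= mean_rho_curvature Omega K y).
  apply: (cS R (+oo)%R (fun C y => S y -> - C <= mean_rho_curvature Omega K y)) => y0 S0.
  have [C C0 [r r0 HC]] := local y0 S0.
  exists ([set y | `|y - y0| < r], [set C' | C < C']) => [|[y C'] [/= yr CC'] Sy].
    split => /=; last by apply: nbhs_pinfty_gt; exact: num_real.
    by apply/nbhs_ballP; exists r => //= y; rewrite -ball_normE /ball_/= distrC.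
  by apply: le_trans (HC y Sy yr); rewrite lerN2 ltW.
move=> H; have [C HC] := @filter_ex _ _ _ _ H.
by exists (- C) => z Hz; exact: (HC z Hz Hz).
Qed.

(** At depths strictly below [d x] all factors [1 - a * k] are positive by [curvature_reach], so the
    determinants are positive products and [curvature_AGM] applies to the [n.-1] curvatures. *)
Lemma transport_det x y Q (s t Hs : R) : Omega x -> S y -> sf (x - y) = d x ->
  boundary_data Omega K y Q -> 0 <= s -> 0 <= t -> s + t < d x ->
  Hs <= min_mean_rho_curvature Omega K ->
  [/\ 1%:M + s *: Q \in unitmx, 1%:M + (s + t) *: Q \in unitmx, 0 <= 1 - t * Hs &
   `|\det (1%:M + (s + t) *: Q)| <= (1 - t * Hs) ^+ n.-1 * `|\det (1%:M + s *: Q)|].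
Proof.
move=> Ox Sy xy bQ s0 t0 st HHs; have [sz _ dE] := rho_curvatures_det Sy bQ.
have d0 : 0 < d x by exact: (mdist_pos bK O0 Ob Oo n0 Ox).
have pos (a : R) k : 0 <= a -> a < d x -> k \in curv y -> 0 < 1 - a * k.
  move=> a0 ad kks; have := curvature_reach Ox Sy xy kks; rewrite subr_gt0.
  have [k0|k0] := leP k 0; first by move=> _; apply: (@le_lt_trans _ _ 0) => //; rewrite mulr_ge0_le0.
  by apply: lt_le_trans; rewrite ltr_pM2r.
have sd : s < d x by apply: le_lt_trans st; rewrite lerDl.
have prod_gt0 (a : R) : 0 <= a -> a < d x -> 0 < \prod_(k <- curv y) (1 - a * k).
  by move=> a0 ad; rewrite big_seq; apply: prodr_gt0 => k; exact: pos.
have p1 := prod_gt0 s s0 sd; have p2 := prod_gt0 (s + t) (addr_ge0 s0 t0) st.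
have n10 : (0 < n.-1)%N by rewrite -ltnS prednK.
have mean : Hs * n.-1%:R <= \sum_(k <- curv y) k.
  have [C HC] := mean_rho_curvature_bound.
  have : Hs <= mean_rho_curvature Omega K y.
    apply: (le_trans HHs); apply: ge_inf; last by exists y.
    by exists C => _ [z Sz <-]; exact: HC.
  by rewrite /mean_rho_curvature mulrC ler_pdivlMr ?ltr0n.
have td : t < d x by apply: le_lt_trans st; rewrite lerDr.
split; rewrite ?unitmxE ?dE ?unitfE ?gt_eqF//.
  rewrite -(pmulr_lge0 _ (_ : 0 < n.-1%:R)) ?ltr0n// mulrBl mul1r -mulrA.
  have h := ler_wpM2l t0 mean; apply: (@le_trans _ _ (\sum_(k <- curv y) (1 - t * k))).
    by rewrite big_seq sumr_ge0// => k kks; apply: ltW; exact: pos.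
  by rewrite sumrB -mulr_sumr big_const_seq count_predT iter_addr_0 sz lerD2l lerN2.
rewrite !gtr0_norm// -ler_pdivrMr// -sz; apply: curvature_AGM => //; rewrite ?sz//.
- by move=> k; exact: pos.
- by move=> k; apply: pos => //; exact: addr_ge0.
Qed.

End rho_curvature.

(** * Boundary points of the convex body are extreme *)

Section strict_convexity.
Variables (R : realType) (n : nat).
Local Notation E := 'rV[R]_n.
Implicit Types (x y z v w p q : E).

Lemma sderiv_sqrt (f : E -> R) y g : sderiv f y g -> 0 < f y ->
  sderiv (fun z => Num.sqrt (f z)) y ((2 * Num.sqrt (f y))^-1 *: g).
Proof.
move=> Hf f0 e e0; set s0 := Num.sqrt (f y); have s00 : 0 < s0 by rewrite sqrtr_gt0.
have cf := sderiv_continuous Hf.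
pose B := 1 + l1norm g; have B0 : 0 < B by rewrite ltr_pwDl ?l1norm_ge0.
pose eta := Num.min (1 / 2) (e * s0 / B).
have eta0 : 0 < eta by rewrite lt_min !divr_gt0// mulr_gt0.
have etaB : eta * B <= e * s0 by rewrite -ler_pdivlMr// ge_min lexx orbT.
have eta1 : eta <= 1 / 2 by rewrite ge_min lexx.
clearbody eta.
have [r r0 Hr] := sderiv_near Hf eta0.
have ff : \forall z \near nbhs y, `|f z - f y| < Num.min (f y) (s0 ^+ 2 * eta).
  have m0 : 0 < Num.min (f y) (s0 ^+ 2 * eta) by rewrite lt_min f0 mulr_gt0 ?exprn_gt0.
  by move/(@cvgrPdist_lt _ _ _ (nbhs y))/(_ _ m0): cf; apply: filterS => z; rewrite distrC.
have /nbhs_ballP[r1 /= r10 H1] := ff.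
have key z : `|z - y| < r1 -> 0 <= f z /\ `|Num.sqrt (f z) - s0| <= s0 * eta.
  move=> zr; have := H1 z; rewrite -ball_normE /ball_/= distrC => /(_ zr).
  rewrite lt_min => /andP[h1 h2]; have fz : 0 <= f z by move: h1; rewrite ltr_norml; lra.
  split => //; have sz := sqrtr_ge0 (f z); have p0 : 0 < Num.sqrt (f z) + s0 by rewrite ltr_wpDl.
  rewrite -(ler_pM2r p0) -{1}(gtr0_norm p0) -normrM.
  have -> : (Num.sqrt (f z) - s0) * (Num.sqrt (f z) + s0) = f z - f y.
    by rewrite -subr_sqr sqr_sqrtr// sqr_sqrtr// ltW.
  apply: (le_trans (ltW h2)); have := mulr_ge0 (mulr_ge0 (ltW s00) (ltW eta0)) sz.
  by rewrite expr2; lra.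
apply/nbhs_ballP; exists (Num.min r r1) => /=; first by rewrite lt_min r0.
move=> [z w] [/=]; rewrite -!ball_normE /ball_/= !lt_min ![`|y - _|]distrC.
move=> /andP[zr zr1] /andP[wr wr1].
have [fz kz] := key z zr1; have [fw kw] := key w wr1; have D := Hr z w zr wr.
set a := Num.sqrt (f z) in kz *; set b := Num.sqrt (f w) in kw *.
have s0h : s0 * eta <= s0 * (1 / 2) by rewrite ler_wpM2l// ltW.
have p0 : s0 <= a + b by move: kz kw; rewrite !ler_norml => /andP[? _] /andP[? _]; lra.
have ab0 : 0 < a + b by apply: lt_le_trans p0.
rewrite -(ler_pM2r ab0) -{1}(gtr0_norm ab0) -normrM dotpZl.
set G := dotp g (z - w) in D *; set h := `|z - w| in D *.
have Gh : `|G| <= l1norm g * h by exact: dotp_le_l1norm.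
have h0 : 0 <= h by exact: normr_ge0.
have abE : (a - b) * (a + b) = f z - f w by rewrite -subr_sqr !sqr_sqrtr.
have -> : (a - b - (2 * s0)^-1 * G) * (a + b) = (f z - f w - G) + G * ((2 * s0 - a - b) / (2 * s0)).
  by rewrite -abE; field; rewrite gt_eqF.
have c1 : `|(2 * s0 - a - b) / (2 * s0)| <= eta.
  have s20 : 0 < 2 * s0 by rewrite mulr_gt0.
  rewrite normrM normfV (gtr0_norm s20) ler_pdivrMr//.
  rewrite (_ : 2 * s0 - a - b = (s0 - a) + (s0 - b)); last by ring.
  rewrite (_ : eta * (2 * s0) = s0 * eta + s0 * eta); last by ring.
  by apply: (le_trans (ler_normD _ _)); apply: lerD; rewrite distrC.
apply: (le_trans (ler_normD _ _)); apply: (@le_trans _ _ (eta * h + l1norm g * h * eta)).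
  by apply: lerD => //; rewrite normrM; apply: ler_pM.
apply: (@le_trans _ _ (eta * B * h)); first by rewrite (_ : eta * B * h = eta * h + l1norm g * h * eta)// /B; ring.
apply: (@le_trans _ _ (e * s0 * h)); first by rewrite ler_wpM2r.
by rewrite -mulrA [s0 * h]mulrC mulrA ler_wpM2l// mulr_ge0// ltW.
Qed.

Lemma fderiv_curve (f : E -> R) y g (gamma : R -> E) v : fderiv f y g -> gamma 0 = y ->
  (\forall t \near (0 : R), f (gamma t) = f y) -> is_derive (0 : R) (1 : R) gamma v ->
  dotp g v = 0.
Proof.
move=> Hf g0 /nbhs_ballP[r1 /= r10 H1] /is_derive_rowP Hg.
apply/eqP; rewrite -normr_le0; apply/ler_addgt0Pr => e e0; rewrite add0r.
pose B := `|v| + 1 + l1norm g; have B0 : 0 < B by rewrite ltr_pwDl ?l1norm_ge0// ltr_wpDl.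
have eB : 0 < Num.min 1 (e / B) by rewrite lt_min ltr01 divr_gt0.
set e1 := Num.min _ _ in eB.
have [r2 r20 H2] := Hf _ eB; have [r3 r30 H3] := Hg _ eB.
pose m := Num.min r1 (Num.min r3 (r2 / (`|v| + 1))).
have v10 : 0 < `|v| + 1 by rewrite ltr_wpDl.
have m0 : 0 < m by rewrite !lt_min r10 r30 divr_gt0.
pose t := m / 2; have t0 : 0 < t by rewrite divr_gt0.
have : t < m by rewrite ltr_pdivrMr// ltr_pMr// ltr1n.
rewrite !lt_min => /and3P[t1 t3 t2]; clearbody t m.
have nt : `|t| = t by rewrite gtr0_norm.
have St : f (gamma t) = f y by apply: H1; rewrite /ball /= sub0r normrN nt.
have := H3 t; rewrite nt t0 t3 g0 => /(_ isT) D3.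
have e11 : e1 <= 1 by rewrite ge_min lexx.
have gty : `|gamma t - y| <= t * (`|v| + 1).
  rewrite -[gamma t - y](subrK (t *: v)) addrC mulrDr mulr1; apply: (le_trans (ler_normD _ _)).
  by rewrite normrZ nt lerD2l; apply: (le_trans D3); rewrite ler_piMl// ltW.
have gr : `|gamma t - y| < r2 by apply: (le_lt_trans gty); rewrite -ltr_pdivlMr.
have := H2 _ gr; rewrite St subrr sub0r normrN => Na.
rewrite -(ler_pM2l t0) -{1}nt -normrM -dotpZr.
have -> : t *: v = (gamma t - y) - (gamma t - y - t *: v) by rewrite subKr.
rewrite dotpBr; apply: (le_trans (ler_normB _ _)).
apply: (@le_trans _ _ (e1 * (t * (`|v| + 1)) + l1norm g * (e1 * t))).
  apply: lerD; first by apply: (le_trans Na); rewrite ler_wpM2l// ltW.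
  by apply: (le_trans (dotp_le_l1norm _ _)); rewrite ler_wpM2l// l1norm_ge0.
have -> : e1 * (t * (`|v| + 1)) + l1norm g * (e1 * t) = t * (e1 * B) by rewrite /B; ring.
by rewrite ler_wpM2l ?(ltW t0)// -ler_pdivlMr// ge_min lexx orbT.
Qed.

Variable K : set E.
Hypotheses (bK : convex_body K) (KC2 : C2_boundary K).
Local Notation rho := (gauge K).
Local Notation Rg := (grad rho).

(** A direction annihilated by the gradient is realised by the radial projection of [k + t *: v] to
    the boundary. *)
Lemma gauge_tangent k v : rho k = 1 -> tangent (boundary K) k v <-> dotp (Rg k) v = 0.
Proof.
move=> k1; have k0 : k != 0.
  by apply/eqP => k0; move/eqP: k1; rewrite k0 gauge0// eq_sym oner_eq0.
have [dk _] := gauge_C2 bK KC2 k0; split => [[g [g0 gS gd]]|kv].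
  apply: (fderiv_curve (sderiv_fderiv dk) g0 _ gd); apply: filterS gS => t gt.
  by rewrite k1; exact: gauge_boundary.
pose g (t : R) := (rho (k + t *: v))^-1 *: (k + t *: v).
have [r r0 Hr] := sderiv_fderiv dk ltr01.
have v10 : 0 < 1 + `|v| by rewrite ltr_pwDl.
pose m := Num.min r (1 / 2) / (1 + `|v|).
have m0 : 0 < m by rewrite divr_gt0// lt_min r0 divr_gt0.
have tv t : `|t| < m -> `|t *: v| < Num.min r (1 / 2).
  rewrite ltr_pdivlMr// normrZ; apply: le_lt_trans; rewrite ler_wpM2l// lerDr//.
have ge t : `|t| < m -> 1 / 2 <= rho (k + t *: v).
  move=> /tv; rewrite lt_min => /andP[t1 t2]; have := Hr (k + t *: v).
  rewrite addrAC subrr add0r => /(_ t1); rewrite dotpZr kv mulr0 subr0 k1 mul1r ler_norml; lra.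
exists g; split.
- by rewrite /g scale0r addr0 k1 invr1 scale1r.
- apply/nbhs_ballP; exists m => //= t; rewrite -ball_normE /ball_/= sub0r normrN => /ge t1.
  have a0 : 0 < rho (k + t *: v) by apply: lt_le_trans t1; rewrite divr_gt0.
  by apply: boundary_gauge => //; rewrite /g gaugeZ ?invr_gt0// mulVf// gt_eqF.
- apply/is_derive_rowP => e e0; pose G := 2 * (`|k| + 1) * (1 + `|v|).
  have k10 : 0 < `|k| + 1 by rewrite ltr_wpDl.
  have G0 : 0 < G by rewrite !mulr_gt0.
  have [r1 r10 Hr1] := sderiv_fderiv dk (divr_gt0 e0 G0).
  exists (Num.min m (r1 / (1 + `|v|))) => [|t /andP[_]]; first by rewrite lt_min m0 divr_gt0.
  rewrite lt_min => /andP[tm tr1]; have a2 := ge t tm; have := tv t tm.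
  rewrite lt_min => /andP[_ tv1].
  have tv2 : `|t *: v| < r1.
    by rewrite normrZ; rewrite ltr_pdivlMr// in tr1; apply: le_lt_trans tr1; rewrite ler_wpM2l// lerDr.
  have := Hr1 (k + t *: v); rewrite addrAC subrr add0r => /(_ tv2).
  rewrite dotpZr kv mulr0 subr0 k1 => Ha.
  rewrite /g scale0r addr0 k1 invr1 scale1r; set a := rho _ in a2 Ha *.
  have a0 : 0 < a by apply: lt_le_trans a2; rewrite divr_gt0.
  have -> : a^-1 *: (k + t *: v) - k - t *: v = (a^-1 * (1 - a)) *: (k + t *: v).
    rewrite mulrBr mulr1 mulVf ?gt_eqF// scalerBl scale1r; apply/rowP => i; rewrite !mxE; ring.
  rewrite normrZ normrM distrC normfV (gtr0_norm a0).
  apply: (@le_trans _ _ ((2 * (e / G * `|t *: v|)) * (`|k| + 1))).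
    apply: ler_pM => //; first by rewrite mulr_ge0// invr_ge0 ltW.
      apply: ler_pM => //; first by rewrite invr_ge0 ltW.
      by rewrite -[leRHS]invrK lef_pV2 ?posrE ?invr_gt0// -div1r.
    by apply: (le_trans (ler_normD _ _)); rewrite lerD2l; lra.
  have -> : 2 * (e / G * `|t *: v|) * (`|k| + 1) = e * `|t| * (`|v| / (1 + `|v|)).
    by rewrite normrZ /G; field; rewrite !gt_eqF.
  by rewrite ler_piMr ?mulr_ge0// ?(ltW e0)// ler_pdivrMr// mul1r lerDr.
Qed.

(** For [G = grad psi] this is [unit_normal psi]. *)
Definition normalize (G : E -> E) z : E := (enorm (G z))^-1 *: G z.

Lemma normalizeZ (G1 G2 : E -> E) z w (c : R) : 0 < c -> G1 z = c *: G2 w ->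
  normalize G1 z = normalize G2 w.
Proof.
move=> c0 GE; rewrite /normalize /enorm GE dotpZl dotpZr mulrA -expr2 sqrtrM ?sqr_ge0//.
rewrite sqrtr_sqr (gtr0_norm c0) invfM scalerA mulrAC mulVf ?mul1r// gt_eqF//.
Qed.

Lemma sjacobian_normalize (G : E -> E) k P : G k != 0 -> sjacobian G k P ->
  exists J, sjacobian (normalize G) k J.
Proof.
move=> k0 HP; have Rk := dotp_gt0 k0.
have HR j : sderiv (fun z => G z 0 j) k (\row_i P i j) by move/sjacobianP: HP.
have Hd : sderiv (fun z => dotp (G z) (G z)) k
    (\sum_i (G k 0 i *: \row_j P j i + G k 0 i *: \row_j P j i)).
  by rewrite /dotp; apply: sderiv_sum => i; exact: sderivM.
have e0 : Num.sqrt (dotp (G k) (G k)) != 0 by rewrite gt_eqF// sqrtr_gt0.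
have Hi := sderivV (sderiv_sqrt Hd Rk) e0.
have /choice[g Hg] : forall j, exists g, sderiv (fun z => normalize G z 0 j) k g.
  move=> j; rewrite (_ : (fun z => _) = (fun z => (Num.sqrt (dotp (G z) (G z)))^-1 * G z 0 j)).
    by eexists; exact: sderivM Hi (HR j).
  by apply/funext => z; rewrite /normalize mxE.
exists (\matrix_(i, j) g j 0 i); apply/sjacobianP => j.
by rewrite (_ : \row_i _ = g j)//; apply/rowP => i; rewrite !mxE.
Qed.

Lemma normalize_orth (G : E -> E) k J w : (\forall z \near nbhs k, G z != 0) ->
  sjacobian (normalize G) k J -> dotp (normalize G k) (w *m J) = 0.
Proof.
set F := normalize G => G0 HJ.
have HR j : sderiv (fun z => F z 0 j) k (\row_i J i j) by move/sjacobianP: HJ.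
have Hd : sderiv (fun z => dotp (F z) (F z)) k
    (\sum_i (F k 0 i *: \row_j J j i + F k 0 i *: \row_j J j i)).
  by rewrite /dotp; apply: sderiv_sum => i; exact: sderivM.
have Hc : sderiv (fun z => dotp (F z) (F z)) k 0.
  apply: (@sderiv_near_eq _ _ (cst 1)); last exact: sderiv_cst.
  apply: filterS G0 => z /dotp_gt0 z0; rewrite /F /normalize dotpZl dotpZr mulrA -invfM -expr2.
  by rewrite sqr_sqrtr ?ltW// mulVf// gt_eqF.
have := sderiv_grad Hd; rewrite (sderiv_grad Hc) => /esym/(congr1 (dotp w)).
rewrite dotp0r => H0.
have -> : dotp (F k) (w *m J) = 2^-1 * dotp w (\sum_i (F k 0 i *: \row_j J j i + F k 0 i *: \row_j J j i)).
  rewrite /dotp [in RHS](eq_bigr (fun j => \sum_i 2 * (F k 0 i * (w 0 j * J j i)))); last first.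
    by move=> j _; rewrite summxE mulr_sumr; apply: eq_bigr => i _; rewrite !mxE; ring.
  rewrite exchange_big mulr_sumr; apply: eq_bigr => i _.
  by rewrite !mxE !mulr_sumr; apply: eq_bigr => j _; rewrite [RHS]mulrA mulVf ?mul1r// pnatr_eq0.
by rewrite H0 mulr0.
Qed.

(* Otherwise [Rg] is constant along a segment of the boundary through [k], so
   that [0] is a principal curvature at [k]. *)
Lemma boundary_extreme k v : (forall y c, boundary K y -> principal_curvature K y c -> 0 < c) ->
  rho k = 1 -> rho (k + v) <= 1 -> rho (k - v) <= 1 -> v = 0.
Proof.
move=> Hc k1 kv1 kv2; apply/eqP; apply: contraT => v0.
have knz p : rho p = 1 -> p != 0.
  by move=> p1; apply/eqP => k0; move/eqP: p1; rewrite k0 gauge0// eq_sym oner_eq0.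
have k0 := knz k k1; have kk := gauge_euler bK KC2 k0; rewrite k1 in kk.
have kv : dotp (Rg k) v = 0.
  have h1 := le_trans (gauge_grad_le bK KC2 (k + v) k0) kv1.
  have h2 := le_trans (gauge_grad_le bK KC2 (k - v) k0) kv2.
  by rewrite dotpDr dotpNr kk in h2; rewrite dotpDr kk in h1; lra.
have seg s : 0 <= s <= 1 -> rho (k + s *: v) = 1 /\ Rg (k + s *: v) = Rg k.
  move=> /andP[s0 s1].
  have r1 : rho (k + s *: v) = 1.
    apply/eqP; rewrite eq_le; apply/andP; split.
      have -> : k + s *: v = (1 - s) *: k + s *: (k + v).
        by apply/rowP => i; rewrite !mxE; ring.
      apply/(gauge_le1 _ bK); have [_ cK _] := bK.
      by apply: cK; [apply/(gauge_le1 _ bK); rewrite k1|exact/(gauge_le1 _ bK)|exact/andP].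
    by have := gauge_grad_le bK KC2 (k + s *: v) k0; rewrite dotpDr dotpZr kv kk mulr0 addr0.
  split => //; apply/esym; apply: (gauge_grad_unique bK KC2 (knz _ r1)).
    by move=> q; exact: gauge_grad_le.
  by rewrite r1 dotpDr dotpZr kv kk mulr0 addr0.
have Sk := boundary_gauge bK k1; have [U [psi [Uk dpsi]]] := KC2 Sk.
have [oU C2 D0 Hpsi] := dpsi.
have DE p : U p -> rho p = 1 -> exists2 c, 0 < c & grad psi p = c *: Rg p.
  move=> Up p1; have p0 := knz p p1; have rp : (rho p)^-1 *: p = p.
    by rewrite p1 invr1 scale1r.
  have Up' : U ((rho p)^-1 *: p) by rewrite rp.
  have g := gauge_sderiv bK p0 Up' dpsi; rewrite rp in g.
  have c0 : 0 < dotp (grad psi p) p.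
    by have := defining_outward bK (gauge_rad bK p0) Up' dpsi; rewrite rp.
  exists (dotp (grad psi p) p) => //.
  by rewrite (sderiv_grad g) scalerA divff ?scale1r// gt_eqF.
have [c c0 Dk] := DE k Uk k1.
have HH := Ck2_sjacobian oU C2 Uk; have gk0 := D0 k Uk.
have [J HJ] := sjacobian_normalize gk0 HH.
have JE : 'J (unit_normal psi) k = J.
  apply: fjacobianE => e e0; have [r r0 Hr] := sjacobian_near HJ e0.
  by exists r => // z zr; apply: Hr => //; rewrite subrr normr0.
have gn : \forall z \near nbhs k, grad psi z != 0.
  by apply: filterS D0 _; exact: open_nbhs_nbhs.
have Rk0 : Rg k != 0.
  by apply/eqP => R0; move: kk; rewrite R0 dotp0l => /esym/eqP; rewrite oner_eq0.
have cR0 : 0 < enorm (c *: Rg k).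
  by rewrite /enorm sqrtr_gt0; apply: dotp_gt0; rewrite scaler_eq0 negb_or (gt_eqF c0) Rk0.
have RkN w : dotp (Rg k) (w *m J) = 0.
  have := normalize_orth w gn HJ; rewrite /normalize Dk scalerA dotpZl => /eqP.
  by rewrite mulf_eq0 => /orP[|/eqP//]; rewrite mulf_eq0 invr_eq0 (gt_eqF c0) orbF (gt_eqF cR0).
have vJ : v *m J = 0.
  apply/eqP; rewrite -normr_le0; apply/ler_addgt0Pr => e e0; rewrite add0r.
  have v10 : 0 < 1 + `|v| by rewrite ltr_pwDl.
  have [r r0 Hr] := sjacobian_near HJ (divr_gt0 e0 v10).
  have [r1 r10 Hr1] := open_row_ball oU Uk.
  pose s := Num.min 1 (Num.min (r / (1 + `|v|)) (r1 / (1 + `|v|))) / 2.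
  have s0 : 0 < s by rewrite divr_gt0// !lt_min ltr01 !divr_gt0.
  have s2 : s * 2 <= 1 by rewrite /s divfK// ge_min lexx.
  have slt a : 0 < a -> s * 2 <= a / (1 + `|v|) -> `|k + s *: v - k| < a.
    move=> a0; rewrite ler_pdivlMr// addrAC subrr add0r normrZ gtr0_norm// => h.
    have h1 := mulr_gt0 s0 v10; have : s * `|v| <= s * (1 + `|v|) by rewrite ler_wpM2l ?(ltW s0)// lerDr.
    by lra.
  have sr : `|k + s *: v - k| < r by apply: slt => //; rewrite /s divfK// !ge_min lexx orbT.
  have sr1 : `|k + s *: v - k| < r1 by apply: slt => //; rewrite /s divfK// !ge_min lexx !orbT.
  clearbody s; have s01 : 0 <= s <= 1 by rewrite (ltW s0)/=; lra.
  have [rs Rs] := seg s s01; have [cs cs0 Ds] := DE _ (Hr1 _ sr1) rs.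
  have nE : normalize (grad psi) (k + s *: v) = normalize (grad psi) k.
    apply: (@normalizeZ _ _ _ _ (cs / c)); first by rewrite divr_gt0.
    by rewrite Ds Rs Dk scalerA divfK// gt_eqF.
  have := Hr _ k sr; rewrite subrr normr0 nE subrr sub0r normrN addrAC subrr add0r => /(_ r0).
  rewrite -scalemxAl !normrZ gtr0_norm// mulrCA ler_pM2l//; move/le_trans; apply.
  by rewrite mulrAC ler_pdivrMr// ler_wpM2l ?(ltW e0)// lerDr.
have [B [fB HB]] := hyperplane_basis Rk0.
suff : principal_curvature K k 0 by move/(Hc k 0 Sk); rewrite ltxx.
exists U, psi; split => //; exists B; rewrite JE; split.
- split => // w; split; first by move/(gauge_tangent w k1).1/(HB w).2.
  by move/(HB w).1/(gauge_tangent w k1).2.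
- by apply/row_subP => i; rewrite row_mul; apply/HB; exact: RkN.
- have vB : (v <= B)%MS by apply/HB.
  have [D vE] := submxP vB; apply/eigenvalueP; exists D.
    by rewrite scale0r /conjmx !mulmxA -vE vJ !mul0mx.
  by apply: contraNneq v0 => D0'; rewrite vE D0' mul0mx.
Qed.

End strict_convexity.

Section hull.
Variables (R : realType) (n : nat) (K Z : set 'rV[R]_n).
Local Notation rho := (gauge K).
Hypotheses (KE : K = convex_hull Z) (Kc : compact K) (Ki : interior K 0)
  (KC2 : C2_boundary K)
  (Hc : forall y c, boundary K y -> principal_curvature K y c -> 0 < c).

Lemma convex_setP (A : set 'rV[R]_n) : convex_set A <->
  forall x y (t : R), A x -> A y -> 0 <= t <= 1 -> A ((1 - t) *: x + t *: y).
Proof.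
split=> [cA x y t Ax Ay /andP[t0 t1]|cA x y l /set_mem Ax /set_mem Ay].
  have t10 : 0 <= 1 - t by rewrite subr_ge0.
  have t11 : 1 - t <= 1 by rewrite gerBl.
  have := cA x y (Itv01 t10 t11) (mem_set Ax) (mem_set Ay) => /set_mem.
  by rewrite /conv/= /unstable.onem subKr.
apply/mem_set; rewrite /conv/= /unstable.onem.
have l0 : 0 <= l%:num by exact: ge0.
have l1 : l%:num <= 1 by exact: le1.
have := cA x y (1 - l%:num) Ax Ay; rewrite subKr; apply; lra.
Qed.

Lemma hull_convex_body : convex_body K.
Proof.
split => // x y t Kx Ky t01; rewrite KE => C [cC ZC].
have xC : C x by move: Kx; rewrite KE; apply.
have yC : C y by move: Ky; rewrite KE; apply.
exact: ((convex_setP C).1 cC).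
Qed.

(** Removing an extreme point from [K] leaves a convex set. Were [k] outside [Z], this smaller set
    would still contain [Z], against the definition of the hull. *)
Lemma hull_boundary k : boundary K k -> Z k.
Proof.
move=> Sk; apply: contrapT => nZ; have bK := hull_convex_body; have [_ cK _] := bK.
have k1 := gauge_boundary bK Sk.
have Kk : K k by apply/(gauge_le1 _ bK); rewrite k1.
have : ([set x | K x /\ x != k]) k; last by case; rewrite eqxx.
move: (Kk); rewrite {1}KE; apply; split; last first.
  move=> z Zz /=; split; last by apply/eqP => zk; apply: nZ; rewrite -zk.
  by rewrite KE => C [_]; apply.
apply/convex_setP => x y t [Kx xk] [Ky yk] t01; split; first exact: cK.
have [t0 t1] := andP t01.
apply/eqP => E1; have [t00|t00] := eqVneq t 0.
  by move: E1 xk; rewrite t00 subr0 scale1r scale0r addr0 => ->; rewrite eqxx.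
have [t11|t11] := eqVneq t 1.
  by move: E1 yk; rewrite t11 subrr scale1r scale0r add0r => ->; rewrite eqxx.
pose m := Num.min t (1 - t).
have m0 : 0 < m by rewrite lt_min subr_gt0 !lt_neqAle t0 t1 t11 eq_sym t00.
have mt : m <= t by rewrite ge_min lexx.
have mt1 : m <= 1 - t by rewrite ge_min lexx orbT.
have inK s : - m <= s <= m -> rho (k + s *: (y - x)) <= 1.
  move=> /andP[s1 s2]; apply/(gauge_le1 _ bK).
  have -> : k + s *: (y - x) = (1 - (t + s)) *: x + (t + s) *: y.
    by rewrite -E1; apply/rowP => i; rewrite !mxE; ring.
  by apply: cK => //; apply/andP; split; lra.
have /eqP : m *: (y - x) = 0.
  apply: (boundary_extreme bK KC2 Hc k1); first by apply: inK; lra.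
  by rewrite -scaleNr; apply: inK; lra.
rewrite scaler_eq0 (gt_eqF m0)/= subr_eq0 => /eqP yx.
by move: E1 xk; rewrite yx -scalerDl subrK scale1r => ->; rewrite eqxx.
Qed.

End hull.

(** * Transport along the rays *)

Section small_drop.
Variable R : realType.

(** A monotone function has a point of continuity, found by nested intervals: of the two middle
    quarters of an interval, at least one carries no more than half of the drop. Discarding the
    outer quarters keeps [t] strictly inside every interval. *)
Lemma monotone_small_drop (F : R -> R) (a b : R) : a < b ->
  (forall s t, a <= s -> s <= t -> t <= b -> F t <= F s) ->
  exists2 t, a < t < b & forall e, 0 < e -> exists t1 t2,
    [/\ a <= t1, t1 < t, t < t2, t2 <= b & F t1 - F t2 <= e].
Proof.
move=> ab mF; pose ok (p : R * R) := [/\ a <= p.1, p.1 < p.2 & p.2 <= b].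
have /choice[f Hf] : forall p : R * R, exists q : R * R, ok p ->
    [/\ p.1 < q.1, q.1 < q.2, q.2 < p.2 & F q.1 - F q.2 <= (F p.1 - F p.2) / 2].
  move=> [c e]; pose h := (e - c) / 4.
  have [H|H] := leP (F (c + h) - F (c + 2 * h)) ((F c - F e) / 2).
    exists (c + h, c + 2 * h) => -[/= ac ce eb]; have h0 : 0 < h by rewrite divr_gt0// subr_gt0.
    have hE : h * 4 = e - c by rewrite divfK.
    by split => //; lra.
  exists (c + 2 * h, c + 3 * h) => -[/= ac ce eb]; have h0 : 0 < h by rewrite divr_gt0// subr_gt0.
  have hE : h * 4 = e - c by rewrite divfK.
  have h1 : F (c + h) <= F c by apply: mF; lra.
  have h2 : F e <= F (c + 3 * h) by apply: mF; lra.
  by split => //; lra.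
pose p k := iter k f (a, b).
have okp k : ok (p k).
  elim: k => [|k IH]; first by split => /=.
  by have [h1 h2 h3 _] := Hf _ IH; case: IH => i1 i2 i3; split => //=; lra.
have step k : [/\ (p k).1 < (p k.+1).1, (p k.+1).2 < (p k).2 &
    F (p k.+1).1 - F (p k.+1).2 <= (F (p k).1 - F (p k).2) / 2].
  by have [] := Hf _ (okp k).
have lo k j : (p k).1 <= (p (k + j)%N).1.
  elim: j => [|j IH]; first by rewrite addn0.
  by rewrite addnS; have [h _ _] := step (k + j)%N; lra.
have hi k j : (p (k + j)%N).2 <= (p k).2.
  elim: j => [|j IH]; first by rewrite addn0.
  by rewrite addnS; have [_ h _] := step (k + j)%N; lra.
have cross k j : (p k).1 < (p j).2.
  have [kj|jk] := leqP k j.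
    have := lo k (j - k)%N; rewrite subnKC//; have [_ h _] := okp j; lra.
  have := hi j (k - j)%N; rewrite (subnKC (ltnW jk)); have [_ h _] := okp k; lra.
pose t := sup (range (fun k => (p k).1)).
have hs : has_sup (range (fun k => (p k).1)).
  split; first by exists (p 0%N).1, 0%N.
  by exists (p 0%N).2 => _ [k _ <-]; exact: ltW (cross k 0%N).
have t1 k : (p k).1 < t.
  have [h _ _] := step k; apply: (lt_le_trans h); by apply: sup_upper_bound => //; exists k.+1.
have t2 k : t < (p k).2.
  have [_ h _] := step k; apply: le_lt_trans h; apply: ge_sup => //; first by case: hs.
  by move=> _ [j _ <-]; exact: ltW (cross j k.+1).
exists t; first by rewrite (t1 0%N) (t2 0%N).
move=> e e0; have drop k : F (p k).1 - F (p k).2 <= (F a - F b) / 2 ^+ k.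
  elim: k => [|k IH]; first by rewrite expr0 divr1.
  have [_ _ h] := step k; apply: (le_trans h); rewrite exprSr invfM mulrA.
  by rewrite ler_pM2r ?invr_gt0.
have [k kE] : exists k : nat, (F a - F b) / 2 ^+ k <= e.
  pose N := Num.bound ((F a - F b) / e); exists N.
  have F0 : 0 <= F a - F b by rewrite subr_ge0; apply: mF => //; exact: ltW.
  rewrite ler_pdivrMr ?exprn_gt0// -ler_pdivrMl// mulrC.
  have := archi_boundP (divr_ge0 F0 (ltW e0)) => h; apply: (le_trans (ltW h)).
  by rewrite -natrX ler_nat ltnW// ltn_expl.
exists (p k).1, (p k).2; have [k1 _ k2] := okp k; split => //.
exact: le_trans (drop k) kE.
Qed.
End small_drop.

Section rays.
Variables (R : realType) (n : nat) (Omega K : set 'rV[R]_n).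
Local Notation E := 'rV[R]_n.
Local Notation mu := (@leb R n).
Local Notation rho := (gauge K).
Local Notation sf := (gauge (polar K)).
Local Notation S := (boundary Omega).
Local Notation d := (minkowski_dist Omega K).
Local Notation cahn := (cahn_dir Omega K).
Local Notation Nu := (unit_bnormal Omega K).
Local Notation PI := (oblique_proj Omega K).
Hypotheses (bK : convex_body K) (KC2 : C2_boundary K).
Hypotheses (O0 : Omega !=set0) (Ob : bounded_set Omega) (Oo : open Omega)
  (OC2 : C2_boundary Omega) (n2 : (2 <= n)%N).
Let bP := convex_body_polar bK.
Let n0 : (0 < n)%N := ltnW n2.
Implicit Types (x y z v w p q : E).

(** A nearest boundary point, chosen arbitrarily where there are several. *)
Definition mproj x : E := xget 0 [set y | S y /\ sf (x - y) = d x].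
Local Notation pr := mproj.

Lemma mprojP x : S (pr x) /\ sf (x - pr x) = d x.
Proof.
apply: (@xgetPex _ 0 [set y | S y /\ sf (x - y) = d x]).
by have [y [Sy xy _]] := mdist_proj bK O0 Ob Oo n0 x; exists y.
Qed.

Lemma proj_ray x y : Omega x -> S y -> sf (x - y) = d x -> x = y + d x *: cahn y.
Proof. exact: proj_cahn. Qed.

Lemma sf_ray y (s : R) : S y -> 0 < s -> sf (s *: cahn y) = s.
Proof. by move=> Sy s0; rewrite gaugeZ// (support_cahn_dir bK KC2 OC2 Sy) mulr1. Qed.

(** The foot bounds the distance of [z] from above, the triangle inequality through [x] bounds it
    from below, and [inner_ball] at [x] keeps [z] in the closure. *)
Lemma ray_dist x y (s : R) : Omega x -> S y -> sf (x - y) = d x -> 0 < s -> s <= d x ->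
  [/\ Omega (y + s *: cahn y), d (y + s *: cahn y) = s & sf (y + s *: cahn y - y) = s].
Proof.
move=> Ox Sy xy s0 sd; have xE := proj_ray Ox Sy xy; set z := y + _.
have zy : sf (z - y) = s by rewrite /z addrAC subrr add0r sf_ray.
have xz : sf (x - z) = d x - s.
  have -> : x - z = (d x - s) *: cahn y by rewrite {1}xE /z opprD addrACA subrr add0r scalerBl.
  have [->|ds] := eqVneq (d x) s; first by rewrite subrr scale0r gauge0.
  by rewrite sf_ray// subr_gt0 lt_neqAle sd andbT eq_sym.
have dz : d z = s.
  apply/eqP; rewrite eq_le; apply/andP; split; first by rewrite -zy; exact: mdist_le.
  by have := mdist_lip bK O0 Ob Oo n0 x z; rewrite xz; lra.
split => //; have clz : closure Omega z.
  by apply: (inner_ball bK O0 Ob Oo n0 Ox); rewrite xz; lra.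
apply: contrapT => nOz; have : S z by rewrite boundaryE.
by move/(mdist0 bK O0 Ob Oo n0); rewrite dz => sE; rewrite sE ltxx in s0.
Qed.

(** The ray from the foot through [x] remains minimising for more than the length [t] beyond [x].
    For [t = 0] this says that [x] is not the end point of its ray. *)
Definition reaches (t : R) x : Prop := Omega x /\
  exists x', [/\ Omega x', sf (x' - pr x) = d x' & d x + t < d x'].

(** For another nearest point [z], the triangle inequality shows that [z] is nearest to [x'] as
    well. Both rays then contain [x] and [x'], so they have the same direction, and the same
    foot. *)
Lemma inner_proj_unique x x' y : Omega x -> S y -> Omega x' -> sf (x' - y) = d x' -> d x < d x' ->
  x = y + d x *: cahn y -> forall z, S z -> sf (x - z) = d x -> z = y.
Proof.
move=> Ox Sy Ox' x'y dd xE z Sz xz; have x'E := proj_ray Ox' Sy x'y.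
have dx0 := mdist_pos bK O0 Ob Oo n0 Ox.
have dl : 0 < d x' - d x by rewrite subr_gt0.
have x'x : x' - x = (d x' - d x) *: cahn y.
  by rewrite {1}x'E {1}xE opprD addrACA subrr add0r scalerBl.
have x'z : sf (x' - z) = d x'.
  apply/eqP; rewrite eq_le; apply/andP; split; last exact: mdist_le.
  have -> : x' - z = (x' - x) + (x - z) by rewrite addrA subrK.
  by apply: (le_trans (gaugeD _ _ bP)); rewrite xz x'x sf_ray//; lra.
have x'Ez := proj_ray Ox' Sz x'z; have xEz := proj_ray Ox Sz xz.
have cE : cahn z = cahn y.
  have x'xz : x' - x = (d x' - d x) *: cahn z.
    by rewrite {1}x'Ez {1}xEz opprD addrACA subrr add0r scalerBl.
  by apply: (scalerI (lt0r_neq0 dl)); rewrite -[LHS]x'xz -[RHS]x'x.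
by move: xEz; rewrite {1}xE cE => /addIr.
Qed.

Lemma pr_eq x x' y : Omega x -> S y -> Omega x' -> sf (x' - y) = d x' -> d x < d x' ->
  x = y + d x *: cahn y -> pr x = y.
Proof.
move=> Ox Sy Ox' x'y dd xE; have [Sp xp] := mprojP x.
exact: inner_proj_unique Ox Sy Ox' x'y dd xE _ Sp xp.
Qed.

Lemma pr_ray x : Omega x -> x = pr x + d x *: cahn (pr x).
Proof. by move=> Ox; have [Sp xp] := mprojP x; exact: proj_ray. Qed.

Lemma reaches_le (s t : R) x : s <= t -> reaches t x -> reaches s x.
Proof. by move=> st [Ox [x' [a b c]]]; split => //; exists x'; split => //; lra. Qed.

Definition flow (t : R) x : E := x + t *: cahn (pr x).

Lemma reaches_flow (t : R) x : 0 <= t -> reaches t x ->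
  [/\ reaches 0 (flow t x), d (flow t x) = d x + t & pr (flow t x) = pr x].
Proof.
move=> t0 [Ox [x' [Ox' x'p dd]]]; have [Sp xp] := mprojP x.
have dx0 := mdist_pos bK O0 Ob Oo n0 Ox.
have fE : flow t x = pr x + (d x + t) *: cahn (pr x).
  by rewrite /flow {1}(pr_ray Ox) -addrA -scalerDl.
have [|Of df fp] := @ray_dist x' (pr x) (d x + t) Ox' Sp x'p _ (ltW dd); first lra.
rewrite -fE in Of df fp; have pE : pr (flow t x) = pr x.
  by apply: (pr_eq Of Sp Ox' x'p); rewrite df// -fE.
by split => //; split => //; exists x'; rewrite pE df addr0.
Qed.

Lemma flow_inv (t : R) x : 0 <= t -> t < d x -> reaches 0 x ->
  reaches t (x - t *: cahn (pr x)) /\ flow t (x - t *: cahn (pr x)) = x.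
Proof.
move=> t0 td [Ox [x' [Ox' x'p dd]]]; have [Sp xp] := mprojP x; set z := x - _.
have zE : z = pr x + (d x - t) *: cahn (pr x).
  by rewrite /z {1}(pr_ray Ox) scalerBl addrA.
have s1 : 0 < d x - t by rewrite subr_gt0.
have s2 : d x - t <= d x by rewrite gerBl.
have [Oz dz zp] := ray_dist Ox Sp xp s1 s2.
rewrite -zE in Oz dz zp; rewrite addr0 in dd; have pE : pr z = pr x.
  by apply: (pr_eq Oz Sp Ox' x'p); rewrite dz// -?zE//; lra.
split; last by rewrite /flow pE /z subrK.
by split => //; exists x'; rewrite pE dz; split => //; lra.
Qed.

(** By uniqueness of the foot and compactness, the boundary points at distance at least [e] from the
    foot exceed the distance [d x] by a positive amount, which persists for points near [x]. *)
Lemma proj_near x : reaches 0 x -> forall e, 0 < e -> exists2 r, 0 < r &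
  forall z, `|z - x| < r -> `|pr z - pr x| < e.
Proof.
move=> [Ox [x' [Ox' x'p dd]]] e e0; rewrite addr0 in dd; have [Sp xp] := mprojP x.
pose A := S `&` [set w | e <= `|w - pr x|].
have cA : compact A.
  apply: (@subclosed_compact _ _ S); last 2 first.
  - exact: boundary_compact Ob Oo.
  - by move=> w [].
  have cS : closed S.
    apply: compact_closed; [exact: norm_hausdorff|exact: boundary_compact Ob Oo].
  apply: closedI cS _; rewrite (_ : [set w | _] = ~` [set w | `|w - pr x| < e]).
    apply: open_closedC; rewrite (_ : [set w | _] = ball (pr x) e); first exact: ball_open.
    by apply/seteqP; split => w; rewrite -ball_normE /ball_/= distrC.
  by apply/seteqP; split => w /=; rewrite leNgt => /negP.
have [A0|/set0P A0] := eqVneq A set0.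
  exists 1 => // z _; rewrite ltNge; apply/negP => pz.
  have [Sz _] := mprojP z; have Az : A (pr z) := conj Sz pz.
  by move: Az; rewrite A0.
have [w [Sw wp] [_ Hw]] := dist_attained cA A0 (@gauge_sub_continuous R n (polar K) x bP).
have lt : d x < sf (x - w).
  rewrite lt_neqAle mdist_le// andbT eq_sym; apply/eqP => xw.
  have := inner_proj_unique Ox Sp Ox' x'p dd (pr_ray Ox) Sw xw => wE.
  by move: wp; rewrite /= wE subrr normr0 leNgt e0.
have [C [M [C0 M0 HC]]] := gauge_norm bP.
exists ((sf (x - w) - d x) / (2 * C)) => [|z zr]; first by rewrite divr_gt0 ?subr_gt0// mulr_gt0.
rewrite ltNge; apply/negP => pz; have [Sz zp] := mprojP z.
have h1 := Hw (pr z) (conj Sz pz).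
have h2 := gaugeD (x - z) (z - pr z) bP; rewrite addrA subrK zp in h2.
have h3 := mdist_lip bK O0 Ob Oo n0 z x.
have h4 := (HC (x - z)).1; have h5 := (HC (z - x)).1; rewrite distrC in h4.
have : `|z - x| * (2 * C) < sf (x - w) - d x by rewrite -ltr_pdivlMr// mulr_gt0.
move: h1 h2 h3 h4 h5; clear; move: (sf _) (sf _) (sf _) (sf _) (d _) (d _) `|_| => *; lra.
Qed.

Lemma mdist_lip_norm : exists2 C, 0 < C & forall x z, `|d x - d z| <= C * `|x - z|.
Proof.
have [C [M [C0 M0 HC]]] := gauge_norm bP; exists C => // x z.
rewrite ler_norml; have := mdist_lip bK O0 Ob Oo n0 x z.
have := mdist_lip bK O0 Ob Oo n0 z x; have := (HC (x - z)).1; have := (HC (z - x)).1.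
by rewrite [`|z - x|]distrC; lra.
Qed.

(** Invertibility comes from [transport_det] at the farther point [x'] of the ray, for which [d x]
    is still an admissible depth. *)
Lemma reach_data x : reaches 0 x -> exists Q, boundary_data Omega K (pr x) Q /\
  1%:M + d x *: Q \in unitmx.
Proof.
move=> [Ox [x' [Ox' x'p dd]]]; have [Sp xp] := mprojP x.
have [Q bQ] := boundary_data_exists bK KC2 OC2 Sp; exists Q; split => //.
have dx0 := mdist_pos bK O0 Ob Oo n0 Ox.
by have [] := transport_det bK KC2 O0 Ob Oo OC2 n2 Ox' Sp x'p bQ (ltW dx0) (lexx 0) dd (lexx _).
Qed.

(** The points [z1] and [z2] may themselves be end points of rays: their chosen feet are close to
    that of [x] by [proj_near], and [tube_diff] asks for no more. *)
Lemma reach_diff x Q : reaches 0 x -> boundary_data Omega K (pr x) Q ->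
  1%:M + d x *: Q \in unitmx -> forall e, 0 < e -> exists2 r, 0 < r &
  forall z1 z2, `|z1 - x| < r -> `|z2 - x| < r ->
   `|pr z1 - pr z2 - (z1 - z2) *m (PI (pr x) *m invmx (1%:M + d x *: Q))| <= e * `|z1 - z2| /\
   `|d z1 - d z2 - dotp (Nu (pr x)) (z1 - z2)| <= e * `|z1 - z2|.
Proof.
move=> rx bQ uQ e e0; have [Ox _] := rx; have [Sp xp] := mprojP x.
have [C C0 HC] := mdist_lip_norm.
have [r r0 Hr] := tube_diff bK KC2 OC2 Sp bQ uQ C0 e0.
have [r1 r10 H1] := proj_near rx r0; have [rO rO0 HO] := open_row_ball Oo Ox.
exists (Num.min r1 (Num.min rO (r / C))); first by rewrite !lt_min r10 rO0 divr_gt0.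
move=> z1 z2; rewrite !lt_min => /and3P[a1 a2 a3] /and3P[b1 b2 b3].
have dn z : `|z - x| < r / C -> `|d z - d x| < r.
  by move=> h; apply: (le_lt_trans (HC _ _)); rewrite mulrC -ltr_pdivlMr.
have [S1 _] := mprojP z1; have [S2 _] := mprojP z2.
apply: Hr => //; [exact: H1|exact: H1|exact: dn|exact: dn|].
by rewrite -(pr_ray (HO _ a2)) -(pr_ray (HO _ b2)).
Qed.

Lemma reach_sderiv x : reaches 0 x -> sderiv d x (Nu (pr x)).
Proof.
move=> rx e e0; have [Q [bQ uQ]] := reach_data rx; have [r r0 Hr] := reach_diff rx bQ uQ e0.
apply/nbhs_ballP; exists r => //= -[z w] [/=]; rewrite -!ball_normE /ball_/= ![`|x - _|]distrC.
by move=> zr wr; have [] := Hr z w zr wr.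
Qed.

Lemma cahn_sjacobian x Q : reaches 0 x -> boundary_data Omega K (pr x) Q ->
  1%:M + d x *: Q \in unitmx ->
  sjacobian (fun z => cahn (pr z)) x (invmx (1%:M + d x *: Q) *m Q).
Proof.
move=> rx bQ uQ e e0; have [vQ NQ Hd] := bQ; have [Sp xp] := mprojP x.
set A := 1%:M + _ in uQ *.
have comm : PI (pr x) *m invmx A *m Q = invmx A *m Q.
  have AQ : A *m Q = Q *m A by rewrite /A mulmxDl mulmxDr mul1mx mulmx1 -scalemxAl -scalemxAr.
  have iQ : invmx A *m Q = Q *m invmx A.
    by rewrite -[in LHS](mulmxK uQ Q) mulmxA -AQ (mulKmx uQ).
  by rewrite -mulmxA iQ mulmxA (oblique_proj_data bQ).
pose B := PI (pr x) *m invmx A; pose L := 1 + mxl1 B; have L0 : 0 < L by rewrite addr_gt0 ?mxl1_gt0.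
have e20 : 0 < e / 2 / L by rewrite !divr_gt0.
have [r1 r10 H1] := Hd _ e20; have [r2 r20 H2] := proj_near rx r10.
have e30 : 0 < e / 2 / mxl1 Q by rewrite !divr_gt0 ?mxl1_gt0.
have [r3 r30 H3] := reach_diff rx bQ uQ ltr01.
have [r4 r40 H4] := reach_diff rx bQ uQ e30.
apply/nbhs_ballP; exists (Num.min r2 (Num.min r3 r4)) => /=; first by rewrite !lt_min r20 r30.
move=> [z w] [/=]; rewrite -!ball_normE /ball_/= ![`|x - _|]distrC !lt_min.
move=> /and3P[z2 z3 z4] /and3P[w2 w3 w4].
have [S1 _] := mprojP z; have [S2 _] := mprojP w.
have [h3 _] := H3 z w z3 w3; have [h4 _] := H4 z w z4 w4.
have [_ h1] := H1 _ _ S1 S2 (H2 _ z2) (H2 _ w2).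
rewrite -comm; rewrite -/A -/B in h3 h4 *.
have ay : `|pr z - pr w| <= L * `|z - w|.
  rewrite -[pr z - pr w](subrK ((z - w) *m B)) mulrDl; apply: (le_trans (ler_normD _ _)).
  by apply: lerD => //; exact: mulmx_norm_le.
have -> : cahn (pr z) - cahn (pr w) - (z - w) *m (B *m Q) =
  (cahn (pr z) - cahn (pr w) - (pr z - pr w) *m Q) + (pr z - pr w - (z - w) *m B) *m Q.
  by rewrite [in RHS](mulmxBl (pr z - pr w)) addrA subrK mulmxA.
rewrite [e in leRHS]splitr mulrDl; apply: (le_trans (ler_normD _ _)); apply: lerD.
  apply: (le_trans h1); apply: (@le_trans _ _ (e / 2 / L * (L * `|z - w|))).
    by rewrite ler_wpM2l// ltW.
  by rewrite mulrA divfK// gt_eqF.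
apply: (le_trans (mulmx_norm_le _ _)).
apply: (@le_trans _ _ (mxl1 Q * (e / 2 / mxl1 Q * `|z - w|))).
  by rewrite ler_wpM2l// ltW// mxl1_gt0.
by rewrite mulrC -!mulrA [_ * mxl1 Q]mulrC (mulKf (lt0r_neq0 (mxl1_gt0 Q))).
Qed.

(** At depth [s] the map [y + s *: cahn y] has derivative [1%:M + s *: Q] along the boundary; the
    flow goes from depth [d x] to [d x + t]. *)
Lemma flow_sjacobian x Q (t : R) : reaches 0 x -> boundary_data Omega K (pr x) Q ->
  1%:M + d x *: Q \in unitmx ->
  sjacobian (flow t) x (invmx (1%:M + d x *: Q) *m (1%:M + (d x + t) *: Q)).
Proof.
move=> rx bQ uQ e e0; set A := 1%:M + _ in uQ *.
have t1 : 0 < 1 + `|t| by rewrite ltr_pwDl.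
have := cahn_sjacobian rx bQ uQ (divr_gt0 e0 t1); apply: filterS => -[z w] /=.
rewrite -/A => H; have -> : invmx A *m (1%:M + (d x + t) *: Q) = 1%:M + t *: (invmx A *m Q).
  by rewrite scalerDl addrA mulmxDr -/A (mulVmx uQ) scalemxAr.
rewrite mulmxDr mulmx1 -scalemxAr /flow.
have -> : z + t *: cahn (pr z) - (w + t *: cahn (pr w)) - (z - w + t *: ((z - w) *m (invmx A *m Q)))
   = t *: (cahn (pr z) - cahn (pr w) - (z - w) *m (invmx A *m Q)).
  move: (_ *m (_ *m Q)) (cahn (pr z)) (cahn (pr w)) => W c1 c2.
  by apply/rowP => i; rewrite !mxE; ring.
rewrite normrZ; apply: (le_trans (ler_wpM2l (normr_ge0 t) H)).
by rewrite mulrCA mulrA ler_wpM2r// mulrAC ler_pdivrMr// ler_wpM2l ?(ltW e0)// lerDr.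
Qed.

(** The Jacobian determinant of the flow is the quotient of the two determinants compared in
    [transport_det]. *)
Lemma transport_measure (t Hs : R) (B : set E) : 0 <= t -> Hs <= min_mean_rho_curvature Omega K ->
  (mu (flow t @` (reaches t `&` B)) <= ((1 - t * Hs) ^+ n.-1)%:E * mu (reaches t `&` B))%E.
Proof.
move=> t0 HHs; apply: outer_C1_image => x [rx Bx].
have rx0 := reaches_le t0 rx; have [Ox [x' [Ox' x'p dd]]] := rx; have [Sp xp] := mprojP x.
have [Q [bQ uQ]] := reach_data rx0; have dx0 := mdist_pos bK O0 Ob Oo n0 Ox.
have [u1 u2 h0 hd] := transport_det bK KC2 O0 Ob Oo OC2 n2 Ox' Sp x'p bQ (ltW dx0) t0 dd HHs.
exists (invmx (1%:M + d x *: Q) *m (1%:M + (d x + t) *: Q)); split.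
- by rewrite unitmx_mul unitmx_inv u1.
- rewrite det_mulmx det_inv normrM normfV mulrC ler_pdivrMr//.
  by rewrite normr_gt0 -unitfE -unitmxE.
- move=> e e0; have [r r0 Hr] := sjacobian_near (flow_sjacobian t rx0 bQ uQ) e0.
  by exists r => // z w _ _; exact: Hr.
Qed.

End rays.

(** * Integrals compared through superlevel sets *)

Section measure_lemmas.
Variables (R : realType) (n : nat).
Local Notation E := 'rV[R]_n.
Local Notation T := (lebesgueRn R n).
Local Notation mu := (@leb R n).

Lemma measurable_within (D : set E) (f : E -> R) : measurable (D : set T) ->
  (forall x, D x -> {for x, continuous f}) -> measurable_fun (D : set T) f.
Proof.
move=> mD cf; apply: (measurability _ (RGenInftyO.measurableE R)) => _ [_ [c ->] <-].
have -> : D `&` f @^-1` `]-oo, c[ = D `&` interior [set x | f x < c].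
  apply/seteqP; split => x [Dx] /=; rewrite in_itv/= => fx; split => //.
    have h := @cvgr_lt _ _ (nbhs x) _ f (f x) (cf x Dx) c fx; exact: h.
  exact: (interior_subset fx).
by apply: measurableI => //; apply: open_measurableRn; exact: open_interior.
Qed.

Lemma level_sum (a eta : R) (J : nat) : 0 < eta -> eta * J%:R < a ->
  \sum_(j < J) eta * ((eta * j%:R < a)%R)%:R = eta * J%:R.
Proof.
move=> e0 Ja; rewrite (eq_bigr (fun=> eta)) => [|i _].
  by rewrite sumr_const card_ord mulr_natr.
rewrite (_ : _ < _ = true) ?mulr1//; apply: le_lt_trans Ja.
by rewrite ler_pM2l// ler_nat ltnW.
Qed.

Lemma level_sum_ge (a eta : R) (J : nat) : 0 < eta -> a <= eta * J%:R ->
  a <= \sum_(j < J) eta * ((eta * j%:R < a)%R)%:R.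
Proof.
move=> e0; elim: J => [|j IH]; first by rewrite mulr0 big_ord0.
rewrite big_ord_recr/= => aj; have [lt|le] := ltP (eta * j%:R) a; last first.
  by rewrite mulr0 addr0; exact: IH.
by rewrite level_sum// mulr1 -[X in _ + X]mulr1 -mulrDr natr1.
Qed.

Lemma level_sum_le (a eta : R) (J : nat) : 0 < eta -> 0 <= a ->
  \sum_(j < J) eta * ((eta * j%:R < a)%R)%:R <= a + eta.
Proof.
move=> e0 a0; elim: J => [|j IH]; first by rewrite big_ord0 addr_ge0// ltW.
rewrite big_ord_recr/=; have [lt|le] := ltP (eta * j%:R) a; last first.
  by rewrite mulr0 addr0; exact: IH.
by rewrite level_sum// mulr1 lerD2r ltW.
Qed.

(* Both sides are compared with sums over the levels [eta * j]. *)
Lemma layer_le (X Z : set E) (g k : E -> R) (M phi : R) :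
  measurable (X : set T) -> measurable (Z : set T) -> (mu Z < +oo)%E ->
  measurable_fun (X : set T) g -> measurable_fun (Z : set T) k ->
  (forall x, X x -> 0 <= g x <= M) -> (forall x, Z x -> 0 <= k x) -> 0 <= phi ->
  (forall c : R, 0 <= c -> (mu (X `&` [set x | (c < g x)%R]) <= phi%:E * mu (Z `&` [set x | (c < k x)%R]))%E) ->
  (\int[mu]_(x in X) (g x)%:E <= phi%:E * \int[mu]_(x in Z) (k x)%:E)%E.
Proof.
move=> mX mZ Zoo mg mk gM k0 phi0 H.
have mgc c : measurable (X `&` [set x | c < g x] : set T).
  have -> : X `&` [set x | c < g x] = X `&` g @^-1` `]c, +oo[.
    by apply/seteqP; split => x [Xx]; rewrite /= in_itv/= andbT.
  exact: mg.
have mkc c : measurable (Z `&` [set x | c < k x] : set T).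
  have -> : Z `&` [set x | c < k x] = Z `&` k @^-1` `]c, +oo[.
    by apply/seteqP; split => x [Xx]; rewrite /= in_itv/= andbT.
  exact: mk.
have key (eta : R) : 0 < eta -> (\int[mu]_(x in X) (g x)%:E <=
    phi%:E * (\int[mu]_(x in Z) (k x)%:E + eta%:E * mu Z))%E.
  move=> eta0; pose J := Num.bound (`|M| / eta).
  pose ch (A : set E) (h : E -> R) (j : nat) (x : T) := (eta%:E * (\1_(A `&` [set x | eta * j%:R < h x]) x)%:E)%E.
  have ch0 A h j x : (0 <= ch A h j x)%E by rewrite mule_ge0// lee_fin ltW.
  have mch (A D : set E) h j : measurable (A `&` [set x | eta * j%:R < h x] : set T) ->
      measurable_fun (D : set T) (ch A h j).
    move=> mA; apply: measurable_funeM; apply/measurable_EFinP.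
    exact: measurable_indic.
  have chE A h x : A x -> (\sum_(j < J) ch A h j x)%E = (\sum_(j < J) eta * ((eta * j%:R < h x)%R)%:R)%:E.
    move=> Ax; rewrite -sumEFin; apply: eq_bigr => j _; rewrite /ch -EFinM indicE.
    congr (_ * _)%:E; congr (_%:R); rewrite in_setI (mem_set Ax)/=.
    by case: (boolP (_ < h x)) => lt; [rewrite mem_set|rewrite memNset//; exact/negP].
  have intch A h (j : nat) : measurable (A : set T) -> measurable (A `&` [set x | eta * j%:R < h x] : set T) ->
      (\int[mu]_(x in A) ch A h j x = eta%:E * mu (A `&` [set x | (eta * j%:R < h x)%R]))%E.
    move=> mA mAh; rewrite /ch ge0_integralZl_EFin; [|exact: mA|by move=> x _; rewrite lee_fin| |exact: ltW].
    - by rewrite integral_indic// setIAC setIid.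
    - by apply/measurable_EFinP; exact: measurable_indic.
  have gJ a : a <= M -> a <= eta * J%:R.
    have := archi_boundP (divr_ge0 (normr_ge0 M) (ltW eta0)); rewrite ltr_pdivrMr//.
    by rewrite mulrC -/J; have := ler_norm M; lra.
  clearbody J; clearbody ch.
  apply: (@le_trans _ _ (\int[mu]_(x in X) (\sum_(j < J) ch X g j x)%E)%E).
    apply: ge0_le_integral; [exact: mX| | | |].
    - by move=> x /gM /andP[]; rewrite lee_fin.
    - exact/measurable_EFinP.
    - by apply: emeasurable_sum => j; exact: mch.
    - move=> x Xx; have [g0 gMx] := andP (gM x Xx).
      rewrite chE// lee_fin; apply: level_sum_ge => //; exact: gJ.
  rewrite (ge0_integral_sum mu mX (fun j : 'I_J => mch X X g j (mgc _)) (fun (j : 'I_J) x _ => ch0 X g j x)).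
  apply: (@le_trans _ _ (\sum_(j < J) phi%:E * \int[mu]_(x in Z) ch Z k j x)%E).
    apply: lee_sum => j _; rewrite !intch// muleCA lee_wpmul2l ?lee_fin ?(ltW eta0)//.
    by apply: H; rewrite mulr_ge0// ltW.
  rewrite -ge0_sume_distrr; last by move=> j _; apply: integral_ge0.
  rewrite -(ge0_integral_sum mu mZ (fun j : 'I_J => mch Z Z k j (mkc _)) (fun (j : 'I_J) x _ => ch0 Z k j x)).
  apply: lee_wpmul2l; first by rewrite lee_fin.
  have k0E x : Z x -> (0 <= (k x)%:E)%E by move=> Zx; rewrite lee_fin k0.
  have kmE : measurable_fun (Z : set T) (fun x : T => (k x)%:E) by exact/measurable_EFinP.
  have e0E (x : T) : Z x -> (0 <= cst eta%:E x)%E by move=> _; rewrite lee_fin ltW.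
  rewrite -integral_cst// -(ge0_integralD mu mZ k0E kmE e0E)//.
  apply: ge0_le_integral; [exact: mZ| | | |].
  - by move=> x Zx; apply: sume_ge0.
  - by apply: emeasurable_sum => j; exact: mch.
  - exact: emeasurable_funD.
  - by move=> x Zx; rewrite chE// -EFinD lee_fin; apply: level_sum_le => //; exact: k0.
apply/lee_addgt0Pr => e e0.
have mZ0 : 0 <= fine (mu Z) by rewrite fine_ge0.
have mZf : mu Z \is a fin_num by rewrite ge0_fin_numE.
pose eta := e / ((phi + 1) * (fine (mu Z) + 1)).
have p1 : 0 < phi + 1 by rewrite ltr_wpDl.
have m1 : 0 < fine (mu Z) + 1 by rewrite ltr_wpDl.
have eta0 : 0 < eta by rewrite divr_gt0// mulr_gt0.
apply: (le_trans (key eta eta0)); rewrite ge0_muleDr; last 2 first.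
- by apply: integral_ge0 => x Zx; rewrite lee_fin k0.
- by rewrite mule_ge0// lee_fin ltW.
rewrite leeD2l// -(fineK mZf) -!EFinM lee_fin.
have -> : phi * (eta * fine (mu Z)) = e * ((phi / (phi + 1)) * (fine (mu Z) / (fine (mu Z) + 1))).
  by rewrite /eta; field; rewrite !gt_eqF.
rewrite ler_piMr ?(ltW e0)// mulr_ile1 ?divr_ge0// ?(ltW p1) ?(ltW m1)// ler_pdivrMr// mul1r lerDl//.
Qed.

End measure_lemmas.

(** * Monotonicity and Riemann sums for the function c *)

Section cfun_lemmas.
Variables (R : realType) (n : nat).
Hypothesis n0 : (0 < n)%N.
Implicit Types (H a b : R).

(** A form without division by [H], common to the two branches of [cfun], from which monotonicity
    and the step estimate are read off. *)
Lemma cfun_diff H a b : n%:R * (cfun n H b - cfun n H a) =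
  (b - a) * \sum_(i < n) (1 - H * a) ^+ (n.-1 - i) * (1 - H * b) ^+ i.
Proof.
have nR : n%:R != 0 :> R by rewrite pnatr_eq0 -lt0n.
rewrite /cfun; have [->|H0] := eqVneq H 0.
  rewrite (eq_bigr (fun=> 1)) => [|i _]; last by rewrite !mul0r subr0 !expr1n mulr1.
  by rewrite sumr_const card_ord mulrC.
have := subrXX (1 - H * a) (1 - H * b) n; set Sg := \sum_(i < n) _ => E1.
have -> : (b - a) * Sg = ((1 - H * a) ^+ n - (1 - H * b) ^+ n) / H.
  by rewrite E1; field.
by field; rewrite H0 nR.
Qed.

Lemma cfun0 H : cfun n H 0 = 0.
Proof. by rewrite /cfun mulr0 subr0 expr1n subrr mul0r; case: eqP. Qed.

Lemma cfun_le H a b : a <= b -> 0 <= 1 - H * a -> 0 <= 1 - H * b -> cfun n H a <= cfun n H b.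
Proof.
move=> ab A0 B0; have nR : 0 < n%:R :> R by rewrite ltr0n.
rewrite -subr_ge0 -(pmulr_rge0 _ nR) cfun_diff mulr_ge0 ?subr_ge0// sumr_ge0// => i _.
by rewrite mulr_ge0 ?exprn_ge0.
Qed.

Lemma cfun_lt H a b : a < b -> 0 < 1 - H * a -> 0 <= 1 - H * b -> cfun n H a < cfun n H b.
Proof.
move=> ab A0 B0; have nR : 0 < n%:R :> R by rewrite ltr0n.
rewrite -subr_gt0 -(pmulr_rgt0 _ nR) cfun_diff mulr_gt0 ?subr_gt0//.
rewrite (bigD1 (Ordinal n0))//= subn0 expr0 mulr1 ltr_pwDl ?exprn_gt0// sumr_ge0// => i _.
by rewrite mulr_ge0 ?exprn_ge0// ltW.
Qed.

Lemma pow_lip (A B M : R) (i : nat) : 0 <= A <= M -> 0 <= B <= M -> 1 <= M ->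
  A ^+ i - B ^+ i <= i%:R * M ^+ i * `|A - B|.
Proof.
move=> /andP[A0 AM] /andP[B0 BM] M1; have M0 : 0 <= M := le_trans ler01 M1.
elim: i => [|i IH]; first by rewrite !expr0 subrr !mul0r.
have -> : A ^+ i.+1 - B ^+ i.+1 = A * (A ^+ i - B ^+ i) + (A - B) * B ^+ i.
  by rewrite !exprS; ring.
have h1 : A * (A ^+ i - B ^+ i) <= M * (i%:R * M ^+ i * `|A - B|).
  apply: (@le_trans _ _ (A * (i%:R * M ^+ i * `|A - B|))); first by rewrite ler_wpM2l.
  by rewrite ler_wpM2r// !mulr_ge0 ?exprn_ge0.
have h2 : (A - B) * B ^+ i <= `|A - B| * M ^+ i.+1.
  apply: (@le_trans _ _ (`|A - B| * B ^+ i)).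
    by rewrite ler_wpM2r ?exprn_ge0// ler_norm.
  rewrite ler_wpM2l// exprS; apply: (@le_trans _ _ (M ^+ i)); first by rewrite lerXn2r// nnegrE.
  by rewrite ler_peMl// exprn_ge0.
apply: (le_trans (lerD h1 h2)); rewrite -addn1 natrD exprD expr1.
by rewrite le_eqVlt; apply/orP; left; apply/eqP; ring.
Qed.

(** One step of a Riemann sum for the derivative [(1 - H * a) ^+ n.-1] of [cfun], with quadratic
    error. *)
Lemma cfun_step H a (e M : R) : 0 <= e -> 0 <= 1 - H * a <= M -> 0 <= 1 - H * (a + e) <= M -> 1 <= M ->
  e * (1 - H * a) ^+ n.-1 <= cfun n H (a + e) - cfun n H a + e ^+ 2 * (n%:R * M ^+ n.*2 * `|H|).
Proof.
move=> e0 A0 B0 M1; have nR : 0 < n%:R :> R by rewrite ltr0n.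
have M0 : 0 <= M := le_trans ler01 M1.
set L := n%:R * M ^+ n.*2 * `|H|.
rewrite -(ler_pM2l nR) mulrDr cfun_diff addrAC subrr add0r.
have -> : n%:R * (e * (1 - H * a) ^+ n.-1) = e * \sum_(i < n) (1 - H * a) ^+ n.-1.
  by rewrite sumr_const card_ord -[in RHS]mulr_natl; ring.
have -> : n%:R * (e ^+ 2 * L) = e * \sum_(i < n) e * L.
  by rewrite sumr_const card_ord -mulr_natl expr2; ring.
rewrite -mulrDr ler_wpM2l// -big_split/= ler_sum// => i _.
have := A0 => /andP[A00 AM].
have iE : (n.-1 = (n.-1 - i) + i)%N by rewrite subnK// -ltnS prednK.
rewrite [X in _ ^+ X <= _]iE exprD -lerBlDl -mulrBr.
have h := pow_lip i A0 B0 M1.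
have hd : `|1 - H * a - (1 - H * (a + e))| = e * `|H|.
  have -> : 1 - H * a - (1 - H * (a + e)) = e * H by ring.
  by rewrite normrM ger0_norm.
rewrite hd in h; have p0 : 0 <= (1 - H * a) ^+ (n.-1 - i) by rewrite exprn_ge0.
apply: (le_trans (ler_wpM2l p0 h)).
have p1 : (1 - H * a) ^+ (n.-1 - i) <= M ^+ n.
  apply: (@le_trans _ _ (M ^+ (n.-1 - i))); first by rewrite lerXn2r// nnegrE.
  by rewrite ler_weXn2l// (leq_trans (leq_subr _ _))// leq_pred.
have p2 : i%:R * M ^+ i <= n%:R * M ^+ n.
  by apply: ler_pM; rewrite ?exprn_ge0// ?ler_nat ?ler_weXn2l// ltnW.
have eH : 0 <= e * `|H| by rewrite mulr_ge0.
apply: (@le_trans _ _ (M ^+ n * (n%:R * M ^+ n * (e * `|H|)))).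
  by apply: ler_pM => //; rewrite ?mulr_ge0 ?exprn_ge0// ler_wpM2r.
by rewrite /L -addnn exprD le_eqVlt; apply/orP; left; apply/eqP; ring.
Qed.

(** The full steps before [a] telescope with a total error of order [e]; the step that passes [a] is
    simply bounded by [e * M ^+ n]. *)
Lemma cfun_riemann H r a (e M : R) (N : nat) : 0 < e -> 0 < a -> a <= r -> (forall t, 0 <= t <= r -> 0 <= 1 - H * t) ->
  M = 1 + `|H| * r ->
  \sum_(k < N) (if k%:R * e < a then e * (1 - H * (k%:R * e)) ^+ n.-1 else 0) <=
    cfun n H a + e * (r * (n%:R * M ^+ n.*2 * `|H|) + M ^+ n).
Proof.
move=> e0 a0 ar HH ME; set L := n%:R * M ^+ n.*2 * `|H|.
have r0 : 0 <= r by lra.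
have M1 : 1 <= M by rewrite ME lerDl mulr_ge0.
have M0 : 0 <= M := le_trans ler01 M1.
have L0 : 0 <= L by rewrite !mulr_ge0 ?exprn_ge0.
have bd t : 0 <= t <= r -> 0 <= 1 - H * t <= M.
  move=> /andP[t0 tr]; rewrite HH ?t0//= ME lerD2l; apply: (@le_trans _ _ (`|H| * t)).
    by rewrite -mulNr ler_wpM2r// -normrN ler_norm.
  by rewrite ler_wpM2l.
pose Sg N := \sum_(k < N) (if k%:R * e < a then e * (1 - H * (k%:R * e)) ^+ n.-1 else 0).
have key : (N%:R * e < a -> Sg N <= cfun n H (N%:R * e) + e * (N%:R * e * L)) /\
    (a <= N%:R * e -> Sg N <= cfun n H a + e * (r * L + M ^+ n)).
  elim: N => [|N [IH1 IH2]].
    by rewrite /Sg big_ord0 mul0r cfun0; split => [_|]; [rewrite mul0r mulr0 addr0|lra].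
  have SE : Sg N.+1 = Sg N + (if N%:R * e < a then e * (1 - H * (N%:R * e)) ^+ n.-1 else 0).
    by rewrite /Sg big_ord_recr.
  have Ne0 : 0 <= N%:R * e by rewrite mulr_ge0// ltW.
  have NS : N.+1%:R * e = N%:R * e + e by rewrite -addn1 natrD mulrDl mul1r.
  split => Nea.
    have Na : N%:R * e < a by move: Nea; rewrite NS; apply: lt_trans; rewrite ltrDl.
    rewrite SE Na NS; rewrite NS in Nea.
    have b1 : 0 <= 1 - H * (N%:R * e) <= M by apply: bd; rewrite Ne0 (le_trans (ltW Na) ar).
    have b2 : 0 <= 1 - H * (N%:R * e + e) <= M by apply: bd; rewrite addr_ge0 ?(ltW e0)//= (le_trans (ltW Nea) ar).
    have := cfun_step (ltW e0) b1 b2 M1; rewrite -/L; have := IH1 Na.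
    by rewrite expr2; lra.
  rewrite SE; have [Na|aN] := ltP (N%:R * e) a; last by rewrite addr0; exact: IH2.
  have b1 : 0 <= 1 - H * (N%:R * e) <= M by apply: bd; rewrite Ne0 (le_trans (ltW Na) ar).
  have [b10 b1M] := andP b1.
  have h1 : cfun n H (N%:R * e) <= cfun n H a.
    by apply: cfun_le; [exact: ltW|exact: b10|by apply: HH; rewrite (ltW a0)].
  have h2 : (1 - H * (N%:R * e)) ^+ n.-1 <= M ^+ n.
    apply: (@le_trans _ _ (M ^+ n.-1)); first by rewrite lerXn2r// nnegrE.
    by rewrite ler_weXn2l// leq_pred.
  have h3 := ler_wpM2l (ltW e0) h2.
  have h4 : N%:R * e * L <= r * L by rewrite ler_wpM2r// (le_trans (ltW Na) ar).
  have h5 := ler_wpM2l (ltW e0) h4.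
  have := IH1 Na; lra.
have [Na|aN] := ltP (N%:R * e) a; last exact: key.2.
apply: (le_trans (key.1 Na)); rewrite -/L.
have Ne0 : 0 <= N%:R * e by rewrite mulr_ge0// ltW.
have h1 : cfun n H (N%:R * e) <= cfun n H a.
  apply: cfun_le; [exact: ltW| |]; apply: HH; first by rewrite Ne0 (le_trans (ltW Na) ar).
  by rewrite (ltW a0).
have h4 : N%:R * e * L <= r * L by rewrite ler_wpM2r// (le_trans (ltW Na) ar).
have h5 := ler_wpM2l (ltW e0) h4.
have h6 : 0 <= e * M ^+ n by rewrite mulr_ge0 ?exprn_ge0// ltW.
lra.
Qed.

End cfun_lemmas.

(** * The null set of end points and the transport of integrals *)

Section transport.
Variables (R : realType) (n : nat) (Omega K : set 'rV[R]_n).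
Local Notation E := 'rV[R]_n.
Local Notation T := (lebesgueRn R n).
Local Notation mu := (@leb R n).
Local Notation sf := (gauge (polar K)).
Local Notation d := (minkowski_dist Omega K).
Local Notation r := (inradius Omega K).
Local Notation cahn := (cahn_dir Omega K).
Local Notation pr := (mproj Omega K).
Local Notation reaches := (reaches Omega K).
Local Notation flow := (flow Omega K).
Hypotheses (bK : convex_body K) (KC2 : C2_boundary K).
Hypotheses (O0 : Omega !=set0) (Ob : bounded_set Omega) (Oo : open Omega)
  (OC2 : C2_boundary Omega) (n2 : (2 <= n)%N).
Let bP := convex_body_polar bK.
Let n0 : (0 < n)%N := ltnW n2.
Implicit Types (x y z v w p q : E).

Lemma measurable_Omega : measurable (Omega : set T).
Proof. exact: open_measurableRn. Qed.

Lemma measure_Omega_lty : (mu Omega < +oo)%E.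
Proof. exact: leb_bounded_lty. Qed.

(** Reaching at least [t], stated without the chosen foot: this condition is closed in [Omega],
    hence measurable. As [d] grows at most by the gauge of a displacement, a gain of [t] forces
    equality, so that the foot of [x] is also a foot of the new point. *)
Definition reach_ge (t : R) : set E :=
  Omega `&` [set x | exists2 w, sf w <= t & d x + t <= d (x + w)].

Lemma gauge_ball_compact (t : R) : 0 < t -> compact [set w | sf w <= t].
Proof.
move=> t0; have [C [M [C0 M0 HC]]] := gauge_norm bP.
apply: bounded_closed_compact.
  exists (M * t); split; first exact: num_real.
  by move=> N tN w /= wt; apply: le_trans (ltW tN); apply: (le_trans (HC w).2); rewrite ler_wpM2l// ltW.
rewrite (_ : [set w | _] = sf @^-1` [set s | s <= t])//.
by apply: closed_comp => [w _|]; [exact: gauge_continuous|exact: closed_le].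
Qed.

Lemma mdist_continuous : continuous d.
Proof.
by have [C C0 HC] := mdist_lip_norm bK O0 Ob Oo n2; exact: lipschitz_row_continuous C0 HC.
Qed.

Lemma measurable_reach_ge (t : R) : 0 < t -> measurable (reach_ge t : set T).
Proof.
move=> t0; apply: measurableI; first exact: measurable_Omega.
apply: closed_measurableRn; rewrite -[X in closed X]setCK; apply: open_closedC.
have [C C0 HC] := mdist_lip_norm bK O0 Ob Oo n2.
rewrite openE => x /= nx.
have B0 : [set w | sf w <= t] !=set0 by exists 0; rewrite /= gauge0// ltW.
have cB := gauge_ball_compact t0.
have cf : continuous (fun w => - d (x + w)).
  apply: (@lipschitz_row_continuous _ _ _ C C0) => a b.
  have -> : - d (x + a) - - d (x + b) = d (x + b) - d (x + a).
    by move: (d (x + a)) (d (x + b)) => u v; rewrite opprK addrC.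
  by apply: (le_trans (HC _ _)); rewrite opprD addrACA subrr add0r distrC.
have [w wt [_ Hw]] := dist_attained cB B0 cf.
have dw : d (x + w) < d x + t by rewrite ltNge; apply/negP => h; apply: nx; exists w.
pose e := d x + t - d (x + w); have e0 : 0 < e by rewrite subr_gt0.
apply/nbhs_ballP; exists (e / (2 * C)); first by rewrite /= divr_gt0// mulr_gt0.
move=> z; rewrite -ball_normE /ball_/= => xz [v vt dv].
have := Hw v vt; have := HC (z + v) (x + v); have := HC x z.
have -> : z + v - (x + v) = z - x by rewrite opprD addrACA subrr addr0.
rewrite [`|z - x|]distrC; move: xz; rewrite ltr_pdivlMr ?mulr_gt0//.
rewrite /e !ler_norml => h1 /andP[h2 h3] /andP[h4 h5]; move: h1 h2 h3 h4 h5 dv.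
move: (d x) (d z) (d (z + v)) (d (x + v)) (d (x + w)) (`|x - z|); clear => *; lra.
Qed.

(** The triangle inequalities are equalities, so the foot of [x] is nearest to [x + w] as well. A
    boundary point on the segment would be closer to [x + w] than [d x + t]. *)
Lemma reach_geP (t : R) x : 0 < t -> reach_ge t x -> exists x',
  [/\ Omega x', sf (x' - pr x) = d x' & d x' = d x + t].
Proof.
move=> t0 [Ox [w wt dw]]; have [Sp xp] := mprojP bK O0 Ob Oo n2 x.
have dx0 := mdist_pos bK O0 Ob Oo n0 Ox.
have h1 := mdist_lip bK O0 Ob Oo n0 (x + w) x; rewrite addrAC subrr add0r in h1.
have h2 := mdist_le bK O0 Ob Oo n0 (x + w) Sp.
have h3 := gaugeD w (x - pr x) bP; rewrite addrCA addrA xp in h3.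
have dE : d (x + w) = d x + t by lra.
exists (x + w); split => //; last by lra.
apply: contrapT => nOw.
have [th /andP[th0 th1] Sz] := boundary_crossing Ox nOw.
have := mdist_le bK O0 Ob Oo n0 (x + w) Sz.
have -> : x + w - (x + th *: (x + w - x)) = (1 - th) *: w.
  by apply/rowP => i; rewrite !mxE; ring.
have [->|th1'] := eqVneq th 1; first by rewrite subrr scale0r gauge0//; lra.
have th2 : 0 < 1 - th by rewrite subr_gt0 lt_neqAle th1'.
rewrite gaugeZ// => h4; have : (1 - th) * sf w <= 1 * t.
  by apply: ler_pM => //; [exact: ltW|exact: gauge_ge0|lra].
by lra.
Qed.

Lemma reach_ge_reaches (s t : R) x : s < t -> 0 < t -> reach_ge t x -> reaches s x.
Proof.
move=> st t0 rx; have [x' [Ox' x'p dE]] := reach_geP t0 rx; case: rx => Ox _.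
by split => //; exists x'; split => //; rewrite dE ltrD2l.
Qed.

Lemma reaches_reach_ge (s : R) x : 0 < s -> reaches s x -> reach_ge s x.
Proof.
move=> s0 rx; have [Sp _] := mprojP bK O0 Ob Oo n2 x.
have [_ df _] := reaches_flow bK KC2 O0 Ob Oo OC2 n2 (ltW s0) rx.
case: rx => Ox _; split => //; exists (s *: cahn (pr x)).
  by rewrite (sf_ray bK KC2 OC2 Sp).
by rewrite -[x + _]/(flow s x) df.
Qed.

(** Going back by [t] along the ray of an end point leads to a point from which the ray continues
    for the length [t] and no more. *)
Lemma nonreach_flow (t : R) x : 0 < t -> Omega x -> ~ reaches 0 x -> t < d x ->
  exists z, [/\ reach_ge t z, flow t z = x & forall s, t < s -> ~ reach_ge s z].
Proof.
move=> t0 Ox nx td; have [Sp xp] := mprojP bK O0 Ob Oo n2 x.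
have s1 : 0 < d x - t by rewrite subr_gt0.
have s2 : d x - t < d x by rewrite gtrBl.
have [Oz dz zp] := ray_dist bK KC2 O0 Ob Oo OC2 n2 Ox Sp xp s1 (ltW s2).
set z := pr x + _ in Oz dz zp.
have xE := pr_ray bK KC2 O0 Ob Oo OC2 n2 Ox.
have zE : z = x - t *: cahn (pr x) by rewrite /z scalerBl addrA -xE.
have pE : pr z = pr x.
  by apply: (pr_eq bK KC2 O0 Ob Oo OC2 n2 Oz Sp Ox xp); rewrite dz.
have fE : flow t z = x by rewrite /flow pE zE subrK.
exists z; split => //.
  split => //; exists (t *: cahn (pr x)); first by rewrite (sf_ray bK KC2 OC2 Sp).
  by rewrite -pE -[z + _]/(flow t z) fE dz subrK.
move=> s ts rs; apply: nx; rewrite -fE.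
have rt := reach_ge_reaches ts (lt_trans t0 ts) rs.
by have [] := reaches_flow bK KC2 O0 Ob Oo OC2 n2 (ltW t0) rt.
Qed.

(* The level sets [reach_ge t `\` \bigcup_(s > t) reach_ge s] are disjoint, hence
   one of them is null; the unreached points are its image by the flow. *)
Lemma nonreach_null : mu (Omega `\` reaches 0) = 0%E.
Proof.
have Ooo := measure_Omega_lty.
have null_tau (tau : R) : 0 < tau -> mu ((Omega `\` reaches 0) `&` [set x | tau < d x]) = 0%E.
  move=> tau0; pose F t := fine (mu (reach_ge t)).
  have sub s t : 0 < s -> s <= t -> reach_ge t `<=` reach_ge s.
    move=> s0 st; have [->//|ne] := eqVneq s t.
    have lt : s < t by rewrite lt_neqAle ne.
    by move=> x /(reach_ge_reaches lt (lt_le_trans s0 st)); exact: reaches_reach_ge.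
  have fin t : 0 < t -> mu (reach_ge t) \is a fin_num.
    move=> t0; rewrite ge0_fin_numE//; apply: le_lt_trans Ooo.
    by apply: le_outer_measure => x [].
  have th : tau / 2 < tau by rewrite ltr_pdivrMr// ltr_pMr// ltr1n.
  have th0 : 0 < tau / 2 by rewrite divr_gt0.
  (* At a continuity point of the monotone function [F] the set of points reaching exactly [t] is
     null, being contained in differences [reach_ge a] minus [reach_ge b] of small measure. As [t]
     is below [tau], every end point at depth above [tau] can be moved back by [t]. *)
  have [|t /andP[t1 t2] Ht] := @monotone_small_drop R F _ _ th.
    move=> s t s1 st t1; have s0 : 0 < s by lra.
    by rewrite fine_le ?fin//; [lra|apply: le_outer_measure; exact: sub].
  have t0 : 0 < t by lra.
  pose N := [set z | [/\ reach_ge t z, reaches 0 z & forall s, t < s -> ~ reach_ge s z]].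
  have N0 : mu N = 0%E.
    apply/eqP; rewrite eq_le outer_measure_ge0 andbT; apply/lee_addgt0Pr => e e0; rewrite add0e.
    have [a [b [ta at_ tb _ Fab]]] := Ht e e0.
    have a0 : 0 < a by lra.
    have b0 : 0 < b by lra.
    apply: (@le_trans _ _ (mu (reach_ge a `\` reach_ge b))).
      apply: le_outer_measure => z [z1 z2 z3]; split; last exact: z3.
      exact: (sub a t a0 (ltW at_)).
    rewrite measureD; [|exact: measurable_reach_ge|exact: measurable_reach_ge|]; last first.
      by rewrite -ge0_fin_numE// fin.
    have -> : reach_ge a `&` reach_ge b = reach_ge b.
      by apply/setIidr; apply: sub => //; lra.
    by move: Fab; rewrite -lee_fin EFinB /F !fineK ?fin.
  apply/eqP; rewrite eq_le outer_measure_ge0 andbT.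
  have <- : mu (flow t @` N) = 0%E.
    apply: outer_null_image N0 => z [_ rz _].
    have [Q [bQ uQ]] := reach_data bK KC2 O0 Ob Oo OC2 n2 rz.
    have [r1 r10 H1] := sjacobian_near (flow_sjacobian bK KC2 O0 Ob Oo OC2 n2 t rz bQ uQ) ltr01.
    set L := _ *m _ in H1; exists (1 + mxl1 L), r1; split => //; first by rewrite addr_gt0 ?mxl1_gt0.
    move=> x y _ _ xr yr; rewrite -[flow t x - _](subrK ((x - y) *m L)) mulrDl.
    apply: (le_trans (ler_normD _ _)); apply: lerD; first exact: H1.
    exact: mulmx_norm_le.
  apply: le_outer_measure => x [[Ox nx] /= xd].
  have [|z [z1 z2 z3]] := nonreach_flow t0 Ox nx; first lra.
  exists z => //; split => //.
  exact: (reach_ge_reaches t0 t0 z1).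
have -> : Omega `\` reaches 0 = \bigcup_k ((Omega `\` reaches 0) `&` [set x | k.+1%:R^-1 < d x]).
  apply/seteqP; split => [x [Ox nx]|x [k _ []//]].
  have dx0 := mdist_pos bK O0 Ob Oo n0 Ox.
  have [k kd] : exists k : nat, k.+1%:R^-1 < d x.
    exists (Num.bound (d x)^-1); rewrite invf_plt ?posrE//.
    apply: (lt_le_trans (archi_boundP _)); first by rewrite invr_ge0 ltW.
    by rewrite ler_nat.
  by exists k.
apply/eqP; rewrite eq_le outer_measure_ge0 andbT.
apply: (le_trans (outer_measure_sigma_subadditive _ _)).
by rewrite eseries0// => k _ _; apply: null_tau; rewrite invr_gt0.
Qed.

Lemma measurable_reaches : measurable (reaches 0 : set T).
Proof.
have -> : reaches 0 = Omega `\` (Omega `\` reaches 0).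
  by rewrite setDD; apply/esym/setIidr => x [].
apply: measurableD; first exact: measurable_Omega.
by apply: null_measurableRn; exact: nonreach_null.
Qed.

Lemma mdist_bounded : exists2 M, 0 < M & forall x, Omega x -> d x <= M.
Proof.
have [y Sy] := boundary_neq0 O0 Ob n0; have [C [M [C0 M0 HC]]] := gauge_norm bP.
have /pinfty_ex_gt0[B B0 HB] := Ob.
exists (C * (B + `|y|)) => [|x Ox]; first by rewrite mulr_gt0// ltr_pwDl.
apply: (le_trans (mdist_le bK O0 Ob Oo n0 x Sy)); apply: (le_trans (HC _).1).
rewrite ler_wpM2l ?(ltW C0)//; apply: (le_trans (ler_normB _ _)); rewrite lerD2r.
exact: HB.
Qed.

Lemma inradius_has_sup : has_sup [set d x | x in Omega].
Proof.
have [x Ox] := O0; have [M M0 HM] := mdist_bounded; split; first by exists (d x), x.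
by exists M => _ [z Oz <-]; exact: HM.
Qed.

Lemma mdist_le_inradius x : Omega x -> d x <= r.
Proof. by move=> Ox; apply: sup_upper_bound; [exact: inradius_has_sup|exists x]. Qed.

Lemma inradius_gt0 : 0 < r.
Proof.
have [x Ox] := O0; apply: lt_le_trans (mdist_le_inradius Ox).
exact: (mdist_pos bK O0 Ob Oo n0 Ox).
Qed.

Variable Hs : R.
Hypothesis HHs : Hs <= min_mean_rho_curvature Omega K.

Lemma curvature_inradius (t : R) : 0 <= t <= r -> 0 <= 1 - Hs * t.
Proof.
have lt_case s : 0 <= s -> s < r -> 0 <= 1 - Hs * s.
  move=> s0 sr; have := sr; rewrite -subr_gt0 => e0.
  have [_ [x Ox <-]] := sup_adherent e0 inradius_has_sup.
  rewrite -/r opprB addrC subrK => sd; have [Sp xp] := mprojP bK O0 Ob Oo n2 x.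
  have [Q bQ] := boundary_data_exists bK KC2 OC2 Sp.
  have s0d : 0 + s < d x by rewrite add0r.
  have [_ _ h _] := transport_det bK KC2 O0 Ob Oo OC2 n2 Ox Sp xp bQ (lexx 0) s0 s0d HHs.
  by rewrite mulrC.
move=> /andP[t0 tr]; have [->|ne] := eqVneq t r; last by apply: lt_case; rewrite // lt_neqAle ne.
have r0 := inradius_gt0; rewrite subr_ge0 leNgt; apply/negP => h.
have H0 : 0 < Hs by rewrite -(pmulr_lgt0 _ r0); lra.
(* The midpoint of [Hs^-1] and [r] is a depth below [r] at which the factor would already be
   negative. *)
have hr : Hs^-1 < r by rewrite -(ltr_pM2l H0) mulfV ?gt_eqF.
have := lt_case ((Hs^-1 + r) / 2); rewrite ltr_pdivrMr//.
have i0 : 0 < Hs^-1 by rewrite invr_gt0.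
have -> : Hs * ((Hs^-1 + r) / 2) = (1 + Hs * r) / 2 by field; rewrite gt_eqF.
move=> /(_ _ _) X; have : 0 <= 1 - (1 + Hs * r) / 2 by apply: X; lra.
by lra.
Qed.

(** A reached point at depth above [t] is the image by the flow of a point at depth below [r - t].
    Thus [transport_measure] compares the superlevel sets of the two functions, and [layer_le] their
    integrals. *)
Lemma transport_integral (t M : R) (G : E -> R) : 0 <= t -> t <= r -> continuous G ->
  (forall x, 0 <= G x <= M) ->
  (\int[mu]_(x in reaches 0 `&` [set x | (t < d x)%R]) (G (flow (- t) x))%:E <=
   ((1 - Hs * t) ^+ n.-1)%:E * \int[mu]_(x in Omega `&` [set x | (d x < r - t)%R]) (G x)%:E)%E.
Proof.
move=> t0 tr cG GM; have h0 := curvature_inradius (introT andP (conj t0 tr)).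
have mO := measurable_Omega.
have md c : measurable ([set x | c < d x] : set T).
  apply: open_measurableRn; rewrite (_ : [set x | _] = d @^-1` [set s | c < s])//.
  by apply: open_comp => [x _|]; [exact: mdist_continuous|exact: open_gt].
have md' c : measurable ([set x | d x < c] : set T).
  apply: open_measurableRn; rewrite (_ : [set x | _] = d @^-1` [set s | s < c])//.
  by apply: open_comp => [x _|]; [exact: mdist_continuous|exact: open_lt].
apply: (@layer_le _ _ _ _ _ _ M); [| | | | | | |exact: exprn_ge0|].
- by apply: measurableI => //; exact: measurable_reaches.
- exact: measurableI.
- by apply: le_lt_trans measure_Omega_lty; apply: le_outer_measure => x [].
- apply: measurable_within; first by apply: measurableI => //; exact: measurable_reaches.
  move=> x [rx _]; have [Q [bQ uQ]] := reach_data bK KC2 O0 Ob Oo OC2 n2 rx.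
  apply: continuous_comp; last exact: cG.
  exact: sjacobian_continuous (flow_sjacobian bK KC2 O0 Ob Oo OC2 n2 (- t) rx bQ uQ).
- apply: measurable_within; first exact: measurableI.
  by move=> x _; exact: cG.
- by move=> x _; exact: GM.
- by move=> x _; have /andP[] := GM x.
move=> c c0; have := transport_measure bK KC2 O0 Ob Oo OC2 n2 [set x | c < G x] t0 HHs.
rewrite [t * Hs]mulrC => h; apply: le_trans (le_trans h _).
  apply: le_outer_measure => x [[rx /= td] Gx].
  have [r1 r2] := flow_inv bK KC2 O0 Ob Oo OC2 n2 t0 td rx.
  exists (x - t *: cahn (pr x)) => //; split => //=.
  by move: Gx; rewrite /flow scaleNr.
rewrite lee_wpmul2l ?lee_fin ?exprn_ge0//; apply: le_outer_measure => x [[Ox [x' [Ox' _ dd]]] Gx].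
by split => //; split => //=; have := mdist_le_inradius Ox'; lra.
Qed.

End transport.

(** * The inequality for test functions *)

Section affine_integral.
Variables (R : realType) (n : nat).
Local Notation T := (lebesgueRn R n).
Local Notation mu := (@leb R n).
Variables (D : set T) (G : T -> R).
Hypotheses (mD : measurable D) (mG : measurable_fun D G) (G0 : forall x, D x -> 0 <= G x).

Lemma integral_scale (a : R) : 0 <= a ->
  (\int[mu]_(x in D) (a * G x)%:E = a%:E * \int[mu]_(x in D) (G x)%:E)%E.
Proof.
have mE : measurable_fun D (fun x => (G x)%:E) by exact/measurable_EFinP.
by move=> a0; have := @ge0_integralZl_EFin _ _ _ mu D mD (fun x => (G x)%:E) G0 mE a a0.
Qed.

Lemma integral_add_cst (e : R) : 0 <= e ->
  (\int[mu]_(x in D) (G x + e)%:E = \int[mu]_(x in D) (G x)%:E + e%:E * mu D)%E.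
Proof.
have mE : measurable_fun D (fun x => (G x)%:E) by exact/measurable_EFinP.
move=> e0; rewrite -(integral_cst mu mD).
by have := @ge0_integralD _ _ _ mu D mD (fun x => (G x)%:E) (cst e%:E) G0 mE (fun _ _ => e0) (measurable_cst _).
Qed.

End affine_integral.

Section test_functions.
Variables (R : realType) (n : nat).
Local Notation E := 'rV[R]_n.
Implicit Types (x y z v w p q : E).

Lemma uniform_cont (f : E -> R) (C : set E) (e : R) : compact C -> continuous f ->
  (forall x, ~ C x -> f x = 0) -> 0 < e ->
  exists2 r, 0 < r & forall a b, `|a - b| < r -> `|f a - f b| <= e.
Proof.
move=> /compact_near_coveringP cC cf f0 e0.
have e20 : 0 < e / 2 by rewrite divr_gt0.
pose P (m : R) (x : E) := forall z, `|z - x| < m^-1 -> `|f z - f x| <= e.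
have : \forall m \near +oo, C `<=` P m.
  apply: (cC R (+oo)%R P) => x Cx.
  have /(@cvgrPdist_le _ _ _ (nbhs x))/(_ _ e20)/nbhs_ballP[r /= r0 Hr] := cf x.
  exists (ball x (r / 2), [set m | 2 / r < m]) => /=.
    split; first by apply: nbhsx_ballx; rewrite divr_gt0.
    by apply: nbhs_pinfty_gt; exact: num_real.
  move=> [x' m] [/= x'r mr] z zx'.
  have m0 : 0 < m by apply: lt_trans mr; rewrite divr_gt0.
  have m2 : m^-1 < r / 2 by rewrite -[r / 2]invrK ltf_pV2 ?posrE ?invr_gt0 ?divr_gt0// invf_div.
  have bx' : ball x r x'.
    by move: x'r; rewrite -!ball_normE /ball_/=; lra.
  have bz : ball x r z.
    move: x'r; rewrite -!ball_normE /ball_/= => x'r.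
    rewrite -[x - z](subrKA x'); apply: (le_lt_trans (ler_normD _ _)).
    by rewrite [`|x' - z|]distrC; lra.
  have h1 := Hr _ bx'; have h2 := Hr _ bz.
  rewrite -[f z - f x'](subrKA (f x)); apply: (le_trans (ler_normD _ _)).
  by rewrite [`|f z - f x|]distrC; have := lerD h1 h2; rewrite addrC; lra.
move=> H; have [m [m0 HC]] : exists m : R, 0 < m /\ C `<=` P m.
  have [m []] := @filter_ex _ _ _ _ (filterI H (nbhs_pinfty_gt (num_real (0 : R)))).
  by exists m.
exists m^-1 => [|a b ab]; first by rewrite invr_gt0.
have [Ca|nCa] := pselect (C a).
  by rewrite distrC; apply: (HC a Ca b); rewrite distrC.
have [Cb|nCb] := pselect (C b); first exact: (HC b Cb a ab).
by rewrite !f0// subrr normr0 ltW.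
Qed.

Lemma compact_support_bound (f : E -> R) (C : set E) : compact C -> continuous f ->
  (forall x, ~ C x -> f x = 0) -> exists2 M, 0 < M & forall x, `|f x| <= M.
Proof.
move=> cC cf f0; have [C0|/set0P C0] := eqVneq C set0.
  by exists 1 => // x; rewrite f0 ?C0// normr0.
have cf' : continuous (fun x => - `|f x|).
  move=> x; apply: (@continuous_comp _ _ _ f (fun s : R => - `|s|)); first exact: cf.
  by apply: cvgN; apply: cvg_norm; exact: cvg_id.
have [y Cy [_ Hy]] := dist_attained cC C0 cf'.
exists (`|f y| + 1) => [|x]; first by rewrite ltr_wpDl.
have [Cx|nCx] := pselect (C x); last by rewrite f0// normr0 addr_ge0.
by have := Hy x Cx; rewrite lerN2 => h; apply: (le_trans h); rewrite lerDl.
Qed.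

Lemma continuous_subr (f g : E -> R) x : {for x, continuous f} -> {for x, continuous g} ->
  {for x, continuous (fun z => f z - g z)}.
Proof. by move=> cf cg; exact: (@cvgB R R _ (nbhs x) _ f g _ _ cf cg). Qed.

Variable Omega : set E.

Lemma test_Ck2 (u : E -> R) : test_function Omega u -> Ck 2 setT u.
Proof. by case. Qed.

Lemma test_sderiv (u : E -> R) x : test_function Omega u -> sderiv u x (grad u x).
Proof. by move=> [Hu _]; exact: Ck1_sderiv openT (Hu 1%N) I. Qed.

Lemma test_continuous (u : E -> R) : test_function Omega u -> continuous u.
Proof. by move=> tu x; exact: sderiv_continuous (test_sderiv x tu). Qed.

Lemma test_grad_continuous (u : E -> R) : test_function Omega u -> continuous (grad u).
Proof. by move=> tu x; exact: sjacobian_continuous (Ck2_sjacobian openT (test_Ck2 tu) I). Qed.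

Lemma test_support (u : E -> R) : test_function Omega u -> exists2 C, compact C &
  [/\ C `<=` Omega, forall x, ~ C x -> u x = 0 & forall x, ~ C x -> grad u x = 0].
Proof.
move=> tu; have [_ [C [cC CO u0]]] := tu; exists C => //; split => // x nC.
apply: fderiv_grad; apply: sderiv_fderiv.
apply: (@sderiv_near_eq _ _ (cst 0)); last exact: sderiv_cst.
have oC : open (~` C) by apply: closed_openC; apply: compact_closed => //; exact: norm_hausdorff.
by apply: filterS (open_nbhs_nbhs (conj oC nC)) => z nz; rewrite u0.
Qed.

End test_functions.

Section key_inequality.
Variables (R : realType) (n : nat) (Omega K : set 'rV[R]_n).
Local Notation E := 'rV[R]_n.
Local Notation T := (lebesgueRn R n).
Local Notation mu := (@leb R n).
Local Notation rho := (gauge K).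
Local Notation S := (boundary Omega).
Local Notation d := (minkowski_dist Omega K).
Local Notation r := (inradius Omega K).
Local Notation cahn := (cahn_dir Omega K).
Local Notation pr := (mproj Omega K).
Local Notation reaches := (reaches Omega K).
Local Notation flow := (flow Omega K).
Hypotheses (bK : convex_body K) (KC2 : C2_boundary K).
Hypotheses (O0 : Omega !=set0) (Ob : bounded_set Omega) (Oo : open Omega)
  (OC2 : C2_boundary Omega) (n2 : (2 <= n)%N).
Variable Hs : R.
Hypothesis HHs : Hs <= min_mean_rho_curvature Omega K.
Let bP := convex_body_polar bK.
Let n0 : (0 < n)%N := ltnW n2.
Implicit Types (x y z v w p q : E).

Definition excess p : R := Num.max 0 (rho p - 1).

Lemma excess_ge0 p : 0 <= excess p. Proof. by rewrite le_max lexx. Qed.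

Lemma gauge_excess p : rho p <= 1 + excess p.
Proof. by rewrite -lerBlDl le_max lexx orbT. Qed.

Lemma pos_lip (a b : R) : `|Num.max 0 a - Num.max 0 b| <= `|a - b|.
Proof.
rewrite !maxEle; case: (leP 0 a) => a0; case: (leP 0 b) => b0 //.
- by rewrite subr0 ger0_norm// ger0_norm; lra.
- by rewrite sub0r normrN ger0_norm// ler0_norm; lra.
- by rewrite subrr normr0.
Qed.

Lemma excess_lip : exists2 C, 0 < C & forall p q, `|excess p - excess q| <= C * `|p - q|.
Proof.
have [C [M [C0 M0 HC]]] := gauge_norm bK; exists C => // p q.
apply: (le_trans (pos_lip _ _)); rewrite opprB addrA subrK.
rewrite ler_norml; have h1 := gaugeD (p - q) q bK; have h2 := gaugeD (q - p) p bK.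
rewrite subrK in h1; rewrite subrK in h2.
have := (HC (p - q)).1; have := (HC (q - p)).1; rewrite [`|q - p|]distrC.
move: (rho _) (rho _) (rho _) (rho _) h1 h2 => a1 a2 a3 a4 h1 h2 h3 h4; lra.
Qed.

Lemma excess_continuous : continuous excess.
Proof. by have [C C0 HC] := excess_lip; exact: lipschitz_row_continuous C0 HC. Qed.

Section test.
Variable u : E -> R.
Hypothesis tu : test_function Omega u.
Let G x : R := excess (grad u x).

Let G_ge0 x : 0 <= G x. Proof. exact: excess_ge0. Qed.

Let G_continuous : continuous G.
Proof.
by move=> x; apply: (@continuous_comp _ _ _ (grad u) excess); [exact: (test_grad_continuous tu)|exact: excess_continuous].
Qed.

Let G_support : exists2 C, compact C & forall x, ~ C x -> G x = 0.
Proof.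
have [C cC [_ _ H]] := test_support tu; exists C => // x nC.
by rewrite /G H// /excess gauge0// sub0r max_l// lerN10.
Qed.

(* The mean value theorem on the successive segments of length [delta]. *)
Lemma ray_sum (M delta e : R) (N : nat) x : (forall y, S y -> `|cahn y| <= M) -> 0 < delta -> 0 <= e ->
  (forall a b, `|a - b| <= delta * M -> `|G a - G b| <= e) -> Omega x ->
  u x - u (x - Num.min (N%:R * delta) (d x) *: cahn (pr x)) - Num.min (N%:R * delta) (d x) <=
  \sum_(k < N) (if k%:R * delta < d x then delta * (G (flow (- (k%:R * delta)) x) + e) else 0).
Proof.
move=> HM de0 e0 Ge Ox; have [Sp xp] := mprojP bK O0 Ob Oo n2 x.
have dx0 := mdist_pos bK O0 Ob Oo n0 Ox; set s := d x in dx0 *; set nu := cahn (pr x).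
have nuM : `|nu| <= M := HM _ Sp.
elim: N => [|N IH].
  by rewrite mul0r min_l ?(ltW dx0)// scale0r !subr0 subrr big_ord0.
rewrite big_ord_recr/=; have [Ns|sN] := ltP (N%:R * delta) s; last first.
  have sN1 : s <= N.+1%:R * delta by apply: (le_trans sN); rewrite ler_wpM2r ?(ltW de0)// ler_nat.
  by rewrite min_r// addr0; move: IH; rewrite min_r.
rewrite min_l in IH; last exact: ltW.
set m := Num.min _ _; pose l := m - N%:R * delta.
have mE : N.+1%:R * delta = N%:R * delta + delta by rewrite -addn1 natrD mulrDl mul1r.
have l0 : 0 <= l by rewrite subr_ge0 /m le_min mE (ltW Ns) lerDl ltW.
have ld : l <= delta by rewrite lerBlDl -mE /m ge_min lexx.
set a := x - (N%:R * delta) *: nu in IH *; pose a' := x - m *: nu.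
have aE : a = a' + l *: nu by rewrite /a /a' /l scalerBl addrA subrK.
have [t /andP[t0 t1]] := @MVT_line R n u a' (l *: nu) (fun s => dotp (grad u (a' + s *: (l *: nu))) (l *: nu))
  (fun s _ => @sderiv_line R n u a' (l *: nu) (grad u) s (test_sderiv _ tu)).
rewrite -aE dotpZr; set xi := a' + _ => uE.
have xia : `|xi - a| <= delta * M.
  have -> : xi - a = - (((1 - t) * l) *: nu).
    by rewrite aE /xi; apply/rowP => i; rewrite !mxE; ring.
  rewrite normrN normrZ; apply: ler_pM => //.
  have t10 : 0 <= 1 - t by rewrite subr_ge0.
  rewrite ger0_norm; last exact: mulr_ge0.
  by apply: le_trans ld; rewrite ler_piMl// gerBl.
have h1 : dotp (grad u xi) nu <= 1 + (G a + e).
  apply: (le_trans (dotp_le_gauge bK _ _)); rewrite (support_cahn_dir bK KC2 OC2 Sp) mulr1.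
  apply: (le_trans (gauge_excess _)); rewrite lerD2l.
  by have := Ge xi a xia; rewrite ler_norml -/(G xi) => /andP[_]; rewrite lerBlDl.
have h2 := ler_wpM2l l0 h1; have Ga : 0 <= G a + e by rewrite addr_ge0.
have h3 := ler_wpM2r Ga ld.
have fE : flow (- (N%:R * delta)) x = a by rewrite /flow /a scaleNr.
rewrite fE; rewrite -/a' in uE *; move: IH uE h2 h3; rewrite /l.
move: (u x) (u a) (u a') (\sum_(i < N) _) (G a) (dotp _ _) => *; lra.
Qed.

Lemma measurable_mdist_lt (c : R) : measurable ([set x | c < d x] : set T).
Proof.
apply: open_measurableRn; rewrite (_ : [set x | _] = d @^-1` [set s | c < s])//.
by apply: open_comp => [x _|]; [exact: mdist_continuous|exact: open_gt].
Qed.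

Lemma measurable_mdist_gt (c : R) : measurable ([set x | d x < c] : set T).
Proof.
apply: open_measurableRn; rewrite (_ : [set x | _] = d @^-1` [set s | s < c])//.
by apply: open_comp => [x _|]; [exact: mdist_continuous|exact: open_lt].
Qed.

Lemma pos_continuous : continuous (fun a : R => Num.max 0 a).
Proof.
move=> a; apply/(@cvgrPdist_le _ _ _ (nbhs a)) => e e0; exists e => //= b.
by rewrite /ball_/= => ab; apply: (le_trans (pos_lip _ _)); exact: ltW.
Qed.

Lemma cfun_continuous : continuous (cfun n Hs).
Proof.
rewrite /cfun; case: eqP => _ a; first exact: cvg_id.
apply: (@continuous_comp _ _ _ (fun b : R => 1 - (1 - Hs * b) ^+ n) (fun b => b / (n%:R * Hs))).
  apply: cvgB; first exact: cvg_cst.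
  apply: (@continuous_comp _ _ _ (fun b : R => 1 - Hs * b) (fun b => b ^+ n)); last exact: exprn_continuous.
  by apply: cvgB; [exact: cvg_cst|apply: cvgMr; exact: cvg_id].
by apply: cvgMl; exact: cvg_id.
Qed.

Lemma measurable_cfun : measurable_fun (Omega : set T) (fun x : T => cfun n Hs (r - d x)).
Proof.
apply: measurable_within; first exact: measurable_Omega.
move=> x _; apply: (@continuous_comp _ _ _ (fun z => r - d z) (cfun n Hs)); last exact: cfun_continuous.
apply: continuous_subr; first exact: cst_continuous.
exact: mdist_continuous.
Qed.

(** Every ray is divided into steps of length [delta]. The k-th step contributes at depths above
    [k * delta]; transport moves it to depths below [r - k * delta] with the factor
    [(1 - Hs * (k * delta)) ^+ n.-1]. At a given [x] the sum of these factors is a Riemann sum for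
    [cfun] at [r - d x]. *)
Lemma pos_diff_riemann_le (e delta M B : R) (N : nat) : 0 < e -> (0 < N)%N -> delta = r / N%:R ->
  (forall y, S y -> `|cahn y| <= M) ->
  (forall a b, `|a - b| <= delta * M -> `|G a - G b| <= e) -> B = 1 + `|Hs| * r ->
  (\int[mu]_(x in Omega) (Num.max 0 (u x - d x))%:E <=
   \int[mu]_(x in Omega) (G x * (cfun n Hs (r - d x) + delta * (r * (n%:R * B ^+ n.*2 * `|Hs|) + B ^+ n)))%:E
   + (r * e)%:E * mu Omega)%E.
Proof.
move=> e0 N0 deE HM Ge BE; set L := (r * _ + _)%R.
have r0 := inradius_gt0 bK O0 Ob Oo n2.
have NR : 0 < N%:R :> R by rewrite ltr0n.
have de0 : 0 < delta by rewrite deE divr_gt0.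
have Nde : N%:R * delta = r by rewrite deE mulrC divfK// gt_eqF.
have mO : measurable (Omega : set T) := measurable_Omega Oo.
have mR := measurable_reaches bK KC2 O0 Ob Oo OC2 n2.
have NO := nonreach_null bK KC2 O0 Ob Oo OC2 n2.
have cd := mdist_continuous bK O0 Ob Oo n2.
have [C cC C0] := G_support.
have [MG MG0 HMG] := compact_support_bound cC G_continuous C0.
have GM x : 0 <= G x <= MG by rewrite G_ge0/= (le_trans (ler_norm _)).
have mpos (D : set E) : measurable (D : set T) -> measurable_fun (D : set T) (fun x : T => (Num.max 0 (u x - d x))%:E).
  move=> mD; apply/measurable_EFinP; apply: measurable_within => // x _.
  apply: (@continuous_comp _ _ _ (fun z => u z - d z) (Num.max 0)); last exact: pos_continuous.
  by apply: continuous_subr; [exact: (test_continuous tu)|exact: cd].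
have pos0 x : (0 <= (Num.max 0 (u x - d x))%:E)%E by rewrite lee_fin le_max lexx.
rewrite (ge0_negligible_integral (measurableD mO mR) mO (mpos _ mO) _ NO)//.
have -> : Omega `\` (Omega `\` reaches 0) = reaches 0.
  by rewrite setDD; apply/setIidr => x [].
pose t (k : nat) := k%:R * delta.
have t0 k : 0 <= t k by rewrite mulr_ge0// ltW.
pose f (k : nat) (x : T) := (delta * (G (flow (- t k) x) + e))%:E.
pose D k : set T := [set x | t k < d x].
have mD k : measurable (D k) := measurable_mdist_lt (t k).
have f0 k x : (0 <= f k x)%E by rewrite lee_fin mulr_ge0 ?(ltW de0)// addr_ge0// ltW.
have mGf k : measurable_fun (reaches 0 : set T) (fun x : T => G (flow (- t k) x)).
  apply: measurable_within => // x rx; have [Q [bQ uQ]] := reach_data bK KC2 O0 Ob Oo OC2 n2 rx.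
  apply: (@continuous_comp _ _ _ (flow (- t k)) G); last exact: G_continuous.
  exact: sjacobian_continuous (flow_sjacobian bK KC2 O0 Ob Oo OC2 n2 (- t k) rx bQ uQ).
have mf k : measurable_fun (reaches 0 : set T) (f k).
  apply/measurable_EFinP; apply: measurable_funM; first exact: measurable_cst.
  by apply: measurable_funD; [exact: mGf|exact: measurable_cst].
have mfD k : measurable_fun (reaches 0 : set T) (f k \_ (D k : set T)).
  apply/(measurable_restrict _ (mD k) mR).1.
  by apply: measurable_funS (mf k) => // x [].
have fD0 k x : (0 <= (f k \_ (D k : set T)) x)%E by rewrite patchE; case: ifP.
apply: (@le_trans _ _ (\int[mu]_(x in reaches 0) (\sum_(k < N) (f k \_ (D k : set T)) x)%E)%E).
  apply: ge0_le_integral; [exact: mR|by []|exact: mpos| |].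
    by apply: emeasurable_sum => k; exact: mfD.
  move=> x rx; have [Ox _] := rx; have [Sp xp] := mprojP bK O0 Ob Oo n2 x.
  have dr := mdist_le_inradius bK O0 Ob Oo n2 Ox.
  have := ray_sum N HM de0 (ltW e0) Ge Ox; rewrite Nde min_r//.
  (* The ray has been followed down to its foot, where a test function vanishes. *)
  have -> : u (x - d x *: cahn (pr x)) = 0.
    have [C1 _ [CO u0 _]] := test_support tu; apply: u0.
    rewrite {1}(pr_ray bK KC2 O0 Ob Oo OC2 n2 Ox) addrK => /CO Op.
    by move: Sp; rewrite boundaryE// => -[].
  rewrite subr0 => Hsum.
  have -> : (\sum_(k < N) (f k \_ (D k : set T)) x)%E =
      (\sum_(k < N) (if k%:R * delta < d x then delta * (G (flow (- (k%:R * delta)) x) + e) else 0))%:E.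
    rewrite -sumEFin; apply: eq_bigr => k _; rewrite patchE /D.
    by case: (boolP (k%:R * delta < d x)) => h; [rewrite mem_set|rewrite memNset//; exact/negP].
  rewrite lee_fin ge_max Hsum andbT; apply: sumr_ge0 => k _; case: ifP => // _.
  by rewrite mulr_ge0 ?(ltW de0)// addr_ge0// ltW.
rewrite (ge0_integral_sum mu mR (fun k : 'I_N => mfD k) (fun (k : 'I_N) x _ => fD0 k x)).
pose phi k := (1 - Hs * t k) ^+ n.-1.
have tr (k : 'I_N) : t k <= r by rewrite -Nde /t ler_wpM2r ?(ltW de0)// ler_nat ltnW.
have phi0 (k : 'I_N) : 0 <= phi k.
  by rewrite exprn_ge0// (curvature_inradius bK KC2 O0 Ob Oo OC2 n2 HHs)// t0 tr.
pose g (k : nat) (x : T) := (delta * phi k * G x)%:E.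
pose D' k : set T := [set x | d x < r - t k].
have mD' k : measurable (D' k) := measurable_mdist_gt (r - t k).
have mG : measurable_fun (Omega : set T) G.
  by apply: measurable_within => // x _; exact: G_continuous.
have mg (k : nat) : measurable_fun (Omega : set T) (g k).
  by apply/measurable_EFinP; apply: measurable_funM => //; exact: measurable_cst.
have mgD k : measurable_fun (Omega : set T) (g k \_ (D' k : set T)).
  apply/(measurable_restrict _ (mD' k) mO).1.
  by apply: measurable_funS (mg k) => // x [].
have g0 (k : 'I_N) x : (0 <= g k x)%E by rewrite lee_fin !mulr_ge0// ltW.
have gD0 (k : 'I_N) x : (0 <= (g k \_ (D' k : set T)) x)%E by rewrite patchE; case: ifP.
have Ooo := measure_Omega_lty Ob.
have Ofin : mu Omega \is a fin_num by rewrite ge0_fin_numE.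
have term (k : 'I_N) : (\int[mu]_(x in reaches 0) (f k \_ (D k : set T)) x <=
   \int[mu]_(x in Omega) (g k \_ (D' k : set T)) x + (delta * e)%:E * mu Omega)%E.
  rewrite -!integral_mkcondr.
  have mRD : measurable ((reaches 0 `&` D k) : set T) by exact: measurableI.
  have mGfD : measurable_fun (reaches 0 `&` D k : set T) (fun x : T => (G (flow (- t k) x))%:E).
    by apply/measurable_EFinP; apply: measurable_funS (mGf k) => // x [].
  have -> : (\int[mu]_(x in reaches 0 `&` D k) f k x)%E =
    (delta%:E * (\int[mu]_(x in reaches 0 `&` D k) (G (flow (- t k) x))%:E + e%:E * mu (reaches 0 `&` D k)))%E.
    rewrite (integral_scale mRD _ _ (ltW de0)); last 2 first.
    - by apply: measurable_funD; [exact/measurable_EFinP|exact: measurable_cst].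
    - by move=> x _; rewrite addr_ge0// ltW.
    congr (_ * _)%E; apply: (integral_add_cst mRD _ _ (ltW e0)); last by [].
    exact/measurable_EFinP.
  have -> : (\int[mu]_(x in Omega `&` D' k) g k x)%E =
    (delta%:E * ((phi k)%:E * \int[mu]_(x in Omega `&` D' k) (G x)%:E))%E.
    rewrite muleA -EFinM (integral_scale (G := G))//.
    - exact: measurableI.
    - by apply: measurable_funS mG => // x [].
    - by rewrite mulr_ge0// ltW.
  have -> : ((delta * e)%:E * mu Omega = delta%:E * (e%:E * mu Omega))%E by rewrite muleA EFinM.
  rewrite -ge0_muleDr; last 2 first.
  - by rewrite mule_ge0 ?lee_fin// integral_ge0// => x _; rewrite lee_fin.
  - by rewrite mule_ge0 ?lee_fin// ltW.
  apply: lee_wpmul2l; first by rewrite lee_fin ltW.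
  apply: leeD.
    exact: (transport_integral bK KC2 O0 Ob Oo OC2 n2 HHs (t0 k) (tr k) G_continuous GM).
  apply: lee_wpmul2l; first by rewrite lee_fin ltW.
  by apply: le_outer_measure => x [[]].
apply: (@le_trans _ _ (\sum_(k < N) (\int[mu]_(x in Omega) (g k \_ (D' k : set T)) x + (delta * e)%:E * mu Omega))%E).
  by apply: lee_sum => k _; exact: term.
rewrite big_split/=; apply: leeD; last first.
  rewrite -(fineK Ofin) -EFinM sumEFin lee_fin sumr_const card_ord -mulr_natl.
  by rewrite !mulrA Nde.
rewrite -(ge0_integral_sum mu mO (fun k : 'I_N => mgD k) (fun (k : 'I_N) x _ => gD0 k x)).
apply: ge0_le_integral; [exact: mO|by move=> x _; exact: sume_ge0| | |].
- by apply: emeasurable_sum => k; exact: mgD.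
- apply/measurable_EFinP; apply: (measurable_funM mG); apply: (measurable_funD measurable_cfun).
  exact: measurable_cst.
move=> x Ox; have dr := mdist_le_inradius bK O0 Ob Oo n2 Ox.
have -> : (\sum_(k < N) (g k \_ (D' k : set T)) x)%E =
    (G x * \sum_(k < N) (if k%:R * delta < r - d x then delta * (1 - Hs * (k%:R * delta)) ^+ n.-1 else 0))%:E.
  rewrite mulr_sumr -sumEFin; apply: eq_bigr => k _; rewrite patchE /D'.
  case: (boolP (k%:R * delta < r - d x)) => h.
    by rewrite mem_set/=; [rewrite /g /phi /t [G x * _]mulrC|rewrite /t; lra].
  rewrite memNset ?mulr0//=; apply/negP; rewrite -leNgt; rewrite -leNgt in h; rewrite /t; lra.
rewrite lee_fin ler_wpM2l//.
have cH s : 0 <= s <= r -> 0 <= 1 - Hs * s by exact: (curvature_inradius bK KC2 O0 Ob Oo OC2 n2 HHs).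
have B0 : 0 <= B by rewrite BE addr_ge0// mulr_ge0// ltW.
have L0 : 0 <= L by rewrite addr_ge0 ?exprn_ge0// !mulr_ge0 ?exprn_ge0// ltW.
have [dE|dne] := eqVneq (d x) r.
  rewrite dE subrr big1 => [|k _]; last by rewrite ltNge t0.
  by rewrite cfun0 add0r mulr_ge0// ltW.
have dx0 := mdist_nonneg bK O0 Ob Oo n0 x.
have a0 : 0 < r - d x by rewrite subr_gt0 lt_neqAle dne.
apply: (cfun_riemann n0 N de0 a0 _ cH BE); first by rewrite gerBl.
Qed.

Lemma cahn_bounded : exists2 M, 0 < M & forall y, S y -> `|cahn y| <= M.
Proof. exact: cahn_bound. Qed.

Lemma integral_pos_diff_le :
  (\int[mu]_(x in Omega) (Num.max 0 (u x - d x))%:E <=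
   \int[mu]_(x in Omega) (G x * cfun n Hs (r - d x))%:E)%E.
Proof.
have r0 := inradius_gt0 bK O0 Ob Oo n2.
have mO : measurable (Omega : set T) := measurable_Omega Oo.
have [C cC C0] := G_support; have [M M0 HM] := cahn_bounded.
have cd := mdist_continuous bK O0 Ob Oo n2.
have Ooo := measure_Omega_lty Ob.
have Ofin : mu Omega \is a fin_num by rewrite ge0_fin_numE.
have [MG MG0 HMG] := compact_support_bound cC G_continuous C0.
pose B := 1 + `|Hs| * r; pose L := r * (n%:R * B ^+ n.*2 * `|Hs|) + B ^+ n.
have B0 : 0 <= B by rewrite addr_ge0// mulr_ge0// ltW.
have L0 : 0 <= L by rewrite addr_ge0 ?exprn_ge0// !mulr_ge0 ?exprn_ge0// ltW.
have cH s : 0 <= s <= r -> 0 <= 1 - Hs * s by exact: (curvature_inradius bK KC2 O0 Ob Oo OC2 n2 HHs).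
have c0 x : Omega x -> 0 <= cfun n Hs (r - d x).
  move=> Ox; have dr := mdist_le_inradius bK O0 Ob Oo n2 Ox.
  have dx0 := mdist_nonneg bK O0 Ob Oo n0 x.
  have r1 : 0 <= r - d x by rewrite subr_ge0.
  by rewrite -(cfun0 n Hs) cfun_le// cH// ?lexx ?(ltW r0)// r1 gerBl.
have mG : measurable_fun (Omega : set T) G.
  by apply: measurable_within => // x _; exact: G_continuous.
have mc := measurable_cfun.
apply/lee_addgt0Pr => e e0.
have m0 : 0 <= fine (mu Omega) by rewrite fine_ge0.
pose e1 := e / 2 / (r * (fine (mu Omega) + 1)).
have m1 : 0 < fine (mu Omega) + 1 by rewrite ltr_wpDl.
have e10 : 0 < e1 by rewrite !divr_gt0// mulr_gt0.
have [de1 de10 Hde] := uniform_cont cC G_continuous C0 e10.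
(* The first term of [W] makes the steps finer than the modulus of continuity of [G]; the second
   brings the Riemann error [delta * L], once integrated against [G], below [e / 2]. *)
pose W := r * (M + 1) / de1 + r * L * MG * (fine (mu Omega) + 1) * 2 / e + 1.
pose N := (Num.bound W).+1; pose delta := r / N%:R.
have W1 : 0 <= r * (M + 1) / de1 by rewrite divr_ge0 ?mulr_ge0 ?addr_ge0// ltW.
have W2 : 0 <= r * L * MG * (fine (mu Omega) + 1) * 2 / e by rewrite divr_ge0 ?mulr_ge0// ltW.
have WN : W < N%:R.
  apply: (lt_le_trans (archi_boundP _)); first by rewrite !addr_ge0.
  by rewrite ler_nat.
have NR : 0 < N%:R :> R by rewrite ltr0n.
have de0 : 0 < delta by rewrite divr_gt0.
have Ge a b : `|a - b| <= delta * M -> `|G a - G b| <= e1.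
  move=> ab; apply: Hde; apply: (le_lt_trans ab).
  apply: (@lt_trans _ _ (delta * (M + 1))); first by rewrite ltr_pM2l// ltrDl.
  have h : r * (M + 1) < N%:R * de1.
    by rewrite -ltr_pdivrMr//; apply: le_lt_trans WN; rewrite /W; lra.
  by rewrite /delta mulrAC ltr_pdivrMr// [de1 * _]mulrC.
have := pos_diff_riemann_le e10 (ltn0Sn _) erefl HM Ge (erefl B); rewrite -/delta -/L.
move/le_trans; apply.
have -> : (\int[mu]_(x in Omega) (G x * (cfun n Hs (r - d x) + delta * L))%:E =
  \int[mu]_(x in Omega) (G x * cfun n Hs (r - d x))%:E + \int[mu]_(x in Omega) (delta * L * G x)%:E)%E.
  rewrite -(ge0_integralD mu mO); first by apply: eq_integral => x _; rewrite -EFinD; congr (_%:E); ring.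
  - by move=> x Ox; rewrite lee_fin mulr_ge0// c0.
  - by apply/measurable_EFinP; exact: (measurable_funM mG mc).
  - by move=> x Ox; rewrite lee_fin mulr_ge0// mulr_ge0// ltW.
  - by apply/measurable_EFinP; exact: (measurable_funM (measurable_cst _) mG).
rewrite -addeA leeD2l// [e]splitr EFinD; apply: leeD.
  apply: (@le_trans _ _ (\int[mu]_(x in Omega) (cst (delta * L * MG)%:E x))%E).
    have dL : 0 <= delta * L by rewrite mulr_ge0// ltW.
    apply: ge0_le_integral; [exact: mO| | |exact: measurable_cst|].
    - by move=> x Ox; rewrite lee_fin mulr_ge0.
    - by apply/measurable_EFinP; exact: (measurable_funM (measurable_cst _) mG).
    - move=> x Ox; rewrite lee_fin; apply: (ler_wpM2l dL).
      exact: le_trans (ler_norm _) (HMG x).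
  have -> : (\int[mu]_(x in Omega) (cst (delta * L * MG)%:E x) = (delta * L * MG * fine (mu Omega))%:E)%E.
    by rewrite (integral_cst mu mO) [RHS]EFinM fineK.
  rewrite lee_fin.
  rewrite /delta; apply: (@le_trans _ _ (r * L * MG * (fine (mu Omega) + 1) / N%:R)).
    have -> : r / N%:R * L * MG * fine (mu Omega) = r * L * MG * fine (mu Omega) / N%:R by ring.
    by rewrite ler_wpM2r ?invr_ge0 ?(ltW NR)// ler_wpM2l ?lerDl// !mulr_ge0// ltW.
  rewrite ler_pdivrMr// -ler_pdivrMl ?divr_gt0// invf_div.
  apply: le_trans (ltW WN); rewrite /W; lra.
rewrite -(fineK Ofin) -EFinM lee_fin /e1.
have -> : r * (e / 2 / (r * (fine (mu Omega) + 1))) * fine (mu Omega) =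
   e / 2 * (fine (mu Omega) / (fine (mu Omega) + 1)) by field; rewrite !gt_eqF.
by rewrite ler_piMr ?divr_ge0 ?(ltW e0)// ler_pdivrMr// mul1r lerDl.
Qed.

End test.
End key_inequality.

(** * Smooth kernels and mollification *)

Section smooth.
Variables (R : realType) (n : nat).
Local Notation E := 'rV[R]_n.
Implicit Types (f g : E -> R) (x v : E).

Lemma continuous_addr f g x : {for x, continuous f} -> {for x, continuous g} ->
  {for x, continuous (fun z => f z + g z)}.
Proof. by move=> cf cg; exact: (@cvgD R R _ (nbhs x) _ f g _ _ cf cg). Qed.

Lemma continuous_mulr f g x : {for x, continuous f} -> {for x, continuous g} ->
  {for x, continuous (fun z => f z * g z)}.
Proof. by move=> cf cg; exact: (@cvgM R _ (nbhs x) _ f g _ _ cf cg). Qed.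

Lemma Ck_pred k f : Ck k.+1 setT f -> Ck k setT f.
Proof.
elim: k f => [|k IH] f [cf Hf]; split => // i.
by have [df Hi] := Hf i; split => //; exact: IH.
Qed.

Lemma Ck_cst k (c : R) : Ck k setT (fun _ : E => c).
Proof.
elim: k c => [|k IH] c; (split => [x _|]; first exact: cst_continuous) => //= i.
split => [x _|]; first exact: derivable_cst.
by rewrite (_ : partial i _ = fun=> 0) //; apply/funext => x; exact: derive_cst.
Qed.

Lemma Ck_add k f g : Ck k setT f -> Ck k setT g -> Ck k setT (fun x => f x + g x).
Proof.
elim: k f g => [|k IH] f g [cf Hf] [cg Hg].
  by split => // x _; apply: continuous_addr; [exact: cf|exact: cg].
split => [x _|i]; first by apply: continuous_addr; [exact: cf|exact: cg].
have [df Ff] := Hf i; have [dg Fg] := Hg i; split => [x _|].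
  by apply: derivableD; [exact: df|exact: dg].
rewrite (_ : partial i _ = fun x => partial i f x + partial i g x); first exact: IH.
by apply/funext => x; rewrite /partial (deriveD (df x I) (dg x I)).
Qed.

Lemma Ck_mul k f g : Ck k setT f -> Ck k setT g -> Ck k setT (fun x => f x * g x).
Proof.
elim: k f g => [|k IH] f g Cf Cg; have [cf Hf] := Cf; have [cg Hg] := Cg.
  by split => // x _; apply: continuous_mulr; [exact: cf|exact: cg].
split => [x _|i]; first by apply: continuous_mulr; [exact: cf|exact: cg].
have [df Ff] := Hf i; have [dg Fg] := Hg i; split => [x _|].
  by apply: derivableM; [exact: df|exact: dg].
rewrite (_ : partial i _ = fun x => f x * partial i g x + g x * partial i f x).
  by apply: Ck_add; apply: IH => //; exact: Ck_pred.
by apply/funext => x; rewrite /partial (deriveM (df x I) (dg x I)).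
Qed.

Lemma Ck_scale k (c : R) f : Ck k setT f -> Ck k setT (fun x => c * f x).
Proof. exact: Ck_mul (Ck_cst k c). Qed.

Lemma Ck_prod k (I : Type) (s : seq I) (f : I -> E -> R) : (forall i, Ck k setT (f i)) ->
  Ck k setT (fun x => \prod_(i <- s) f i x).
Proof.
move=> Hf; elim: s => [|i s IH].
  by rewrite (_ : (fun x => _) = fun=> 1); [exact: Ck_cst|apply/funext => x; rewrite big_nil].
rewrite (_ : (fun x => _) = fun x => f i x * \prod_(j <- s) f j x); first exact: Ck_mul.
by apply/funext => x; rewrite big_cons.
Qed.

Definition der1 (phi : R -> R) (t c : R) := forall e, 0 < e -> exists2 r, 0 < r &
  forall u, `|u| < r -> `|phi (t + u) - phi t - c * u| <= e * `|u|.

Lemma is_derive_der1 (phi : R -> R) (t c : R) : is_derive t (1 : R) phi c -> der1 phi t c.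
Proof.
move=> [dg <-] e e0; have : (fun h : R => h^-1 *: ((phi \o shift t) (h *: (1 : R)) - phi t)) @ 0^' --> 'D_1 phi t.
  exact: dg.
move=> /cvgrPdist_le /(_ e e0) [r /= r0 Hr]; exists r => // u ur.
have [->|un0] := eqVneq u 0; first by rewrite addr0 subrr mulr0 subr0 normr0 mulr0.
have := Hr u; rewrite /ball_ /= sub0r normrN => /(_ ur un0).
rewrite /shift/= [u *: 1]mulr1 [u + t]addrC => H.
have -> : phi (t + u) - phi t - 'D_1 phi t * u = - (u * ('D_1 phi t - u^-1 * (phi (t + u) - phi t))).
  by field.
by rewrite normrN normrM mulrC ler_wpM2r.
Qed.

Lemma der1_continuous (phi : R -> R) (t c : R) : der1 phi t c -> {for t, continuous phi}.
Proof.
move=> /(_ 1 ltr01) [r r0 Hr]; apply/(@cvgrPdist_le _ _ _ (nbhs t)) => e e0.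
have c0 : 0 < 1 + `|c| by rewrite ltr_pwDl.
exists (Num.min r (e / (1 + `|c|))) => /=; first by rewrite lt_min r0 divr_gt0.
move=> s; rewrite /ball_/= lt_min distrC => /andP[sr se].
have := Hr (s - t) sr; rewrite (addrC t) subrK mul1r => H.
rewrite distrC -[phi s - phi t](subrK (c * (s - t))); apply: (le_trans (ler_normD _ _)).
rewrite ltr_pdivlMr// mulrDr mulr1 in se; rewrite normrM.
by rewrite mulrC in se *; move: H se; rewrite [`|c| * _]mulrC; lra.
Qed.

Lemma der1_fderiv (phi : R -> R) (a s c : R) (i : 'I_n) x : der1 phi (a + s * x 0 i) c ->
  fderiv (fun z => phi (a + s * z 0 i)) x ((c * s) *: delta_mx 0 i).
Proof.
move=> H e e0; have s1 : 0 < 1 + `|s| by rewrite ltr_pwDl.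
have [r r0 Hr] := H _ (divr_gt0 e0 s1); exists (r / (1 + `|s|)) => [|z]; first exact: divr_gt0.
rewrite ltr_pdivlMr// => zr; set u := s * (z 0 i - x 0 i).
have zi : `|z 0 i - x 0 i| <= `|z - x| by have := norm_coord_le (z - x) i; rewrite !mxE.
have uz : `|u| <= `|z - x| * (1 + `|s|).
  by rewrite normrM mulrC; apply: ler_pM => //; rewrite lerDr.
have := Hr u (le_lt_trans uz zr).
have -> : a + s * x 0 i + u = a + s * z 0 i by rewrite /u; ring.
rewrite dotpZl dotpC dotp_delta !mxE -mulrA -/u => h; apply: (le_trans h).
by rewrite mulrAC ler_pdivrMr// -mulrA ler_wpM2l// ltW.
Qed.

(** The functions t^-k exp(-1/t), extended by 0, have derivatives that are linear combinations of
    functions of the same family, see [flat_der1]; smoothness of every order follows by one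
    induction. *)
Definition flat (k : nat) (t : R) : R := if 0 < t then t^-1 ^+ k * expR (- t^-1) else 0.

Lemma flat_ge0 k t : 0 <= flat k t.
Proof.
rewrite /flat; case: ifP => // t0; rewrite mulr_ge0 ?expR_ge0// exprn_ge0// invr_ge0.
exact: ltW.
Qed.

Lemma flat_le k t : `|flat k t| <= k.+2%:R ^+ k.+2 * t ^+ 2.
Proof.
rewrite ger0_norm ?flat_ge0// /flat; case: ifP => t0; last first.
  by apply: mulr_ge0; [exact: exprn_ge0|exact: sqr_ge0].
have s0 : 0 < t^-1 by rewrite invr_gt0.
have kR : 0 < k.+2%:R :> R by rewrite ltr0n.
(* Since exp(s) is at least (s/m)^m with s = 1/t and m = k + 2, two powers of [t] are left over;
   they make the derivative at 0 vanish. *)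
have h1 : (t^-1 / k.+2%:R) ^+ k.+2 <= expR t^-1.
  have -> : expR t^-1 = expR (t^-1 / k.+2%:R) ^+ k.+2.
    by rewrite -expRM_natl mulrC divfK// gt_eqF.
  rewrite lerXn2r// ?nnegrE ?expR_ge0// ?divr_ge0 ?(ltW s0)//.
  by apply: le_trans (expR_ge1Dx _); rewrite lerDr.
rewrite expRN ler_pdivrMr ?expR_gt0//.
apply: (@le_trans _ _ (k.+2%:R ^+ k.+2 * t ^+ 2 * (t^-1 / k.+2%:R) ^+ k.+2)); last first.
  apply: ler_wpM2l => //; apply: mulr_ge0; [exact: exprn_ge0|exact: sqr_ge0].
move: (k.+2%:R : R) kR => c c0.
have E1 : c ^+ k.+2 * c^-1 ^+ k.+2 = 1 by rewrite -exprMn divff ?expr1n ?gt_eqF.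
have E2 : t ^+ 2 * t^-1 ^+ k.+2 = t^-1 ^+ k.
  have -> : t^-1 ^+ k.+2 = t^-1 ^+ 2 * t^-1 ^+ k by rewrite -exprD.
  by rewrite mulrA -exprMn divff ?expr1n ?mul1r ?gt_eqF.
have -> : c ^+ k.+2 * t ^+ 2 * (t^-1 / c) ^+ k.+2 = (c ^+ k.+2 * c^-1 ^+ k.+2) * (t ^+ 2 * t^-1 ^+ k.+2).
  by rewrite exprMn [_ * c^-1 ^+ _]mulrC mulrACA.
by rewrite E1 E2 mul1r.
Qed.

Lemma flat_der1 k t : der1 (flat k) t (flat k.+2 t - k%:R * flat k.+1 t).
Proof.
have [t0|t0] := ltP 0 t.
  apply: is_derive_der1.
  pose g (s : R) := s^-1 ^+ k * expR (- s^-1).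
  apply: (@near_eq_is_derive _ _ _ g).
    exists t => //= s; rewrite /ball_/= => st; rewrite /flat ifT//.
    by have := ler_norm (t - s); lra.
  have dV : is_derive t (1 : R) (fun s : R => s^-1) (- t ^- 2).
    by have := @is_deriveV R id t 1 1 (lt0r_neq0 t0) _; rewrite /GRing.scale/= mulr1; apply; exact: is_derive_id.
  have := is_deriveX k dV; rewrite exprfctE => dX.
  have dN : is_derive t (1 : R) (fun s : R => - s^-1) (t ^- 2).
    by have := is_deriveN dV; rewrite opprK.
  have dE := @is_derive1_comp R expR (fun s : R => - s^-1) t _ _ (is_derive_expR (- t^-1)) dN.
  refine (@is_derive_eq R R R g t 1 _ _ (is_deriveM dX dE) _).
  rewrite /flat t0 /GRing.scale/=.
  case: k {g dX} => [|k]; first by rewrite !expr0 -exprVn; ring.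
  by rewrite /= -exprVn !exprS; ring.
have -> : flat k.+2 t - k%:R * flat k.+1 t = 0 by rewrite /flat !ltNge t0/= mulr0 subr0.
have ft : flat k t = 0 by rewrite /flat ltNge t0.
move=> e e0; set c : R := k.+2%:R ^+ k.+2; have c0 : 0 < c by rewrite exprn_gt0.
exists (e / c) => [|u]; first exact: divr_gt0.
rewrite ltr_pdivlMr// => ue; rewrite ft mul0r !subr0.
have [tu|tu] := ltP 0 (t + u); last by rewrite /flat ltNge tu normr0 mulr_ge0// ltW.
apply: (le_trans (flat_le _ _)); rewrite -/c.
have u0 : 0 < u by lra.
rewrite (gtr0_norm u0) in ue *.
apply: (@le_trans _ _ (c * u ^+ 2)); first by rewrite ler_pM2l// lerXn2r// ?nnegrE; lra.
by rewrite expr2 mulrA [c * u]mulrC ler_wpM2r ?(ltW u0)// ltW.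
Qed.

Lemma flat_continuous k (a s : R) (i : 'I_n) x : {for x, continuous (fun x : E => flat k (a + s * x 0 i))}.
Proof.
apply: (@continuous_comp _ _ _ (fun x : E => a + s * x 0 i) (flat k)).
  apply: continuous_addr; first exact: cst_continuous.
  apply: continuous_mulr; first exact: cst_continuous.
  exact: sderiv_continuous (sderiv_coord i x).
exact: der1_continuous (flat_der1 k _).
Qed.

Lemma flat_Ck m k (a s : R) (i : 'I_n) : Ck m setT (fun x : E => flat k (a + s * x 0 i)).
Proof.
elim: m k => [|m IH] k.
  by split => // x _; exact: flat_continuous.
have der x := der1_fderiv (flat_der1 k (a + s * x 0 i)).
split => [x _|j]; first exact: flat_continuous.
split => [x _|]; first by have [] := fderiv_derive (delta_mx 0 j) (der x).
rewrite (_ : partial j _ = fun x : E => (s * (i == j)%:R) *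
   (flat k.+2 (a + s * x 0 i) + - k%:R * flat k.+1 (a + s * x 0 i))).
  by apply: Ck_scale; apply: Ck_add => //; exact: Ck_scale.
apply/funext => x; rewrite /partial (fderiv_derive (delta_mx 0 j) (der x)).2.
by rewrite dotpZl dotp_delta !mxE eqxx/= eq_sym; ring.
Qed.

(** For positive [r], a product of one-variable bumps that is positive exactly on the open cube of
    radius [r]. The coefficients 1 and -1 are kept to match [flat_Ck]. *)
Definition cutoff (r : R) (x : E) : R := \prod_i (flat 0 (r + 1 * x 0 i) * flat 0 (r + (-1) * x 0 i)).

Lemma cutoff_Ck k r : Ck k setT (cutoff r).
Proof. by apply: Ck_prod => i; apply: Ck_mul; exact: flat_Ck. Qed.

Lemma cutoff_ge0 r x : 0 <= cutoff r x.
Proof. by apply: prodr_ge0 => i _; rewrite mulr_ge0 ?flat_ge0. Qed.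

Lemma cutoff_gt0 r x : 0 < r -> `|x| < r -> 0 < cutoff r x.
Proof.
move=> r0 xr; apply: prodr_gt0 => i _; have := le_lt_trans (norm_coord_le x i) xr.
rewrite ltr_norml => /andP[x1 x2]; rewrite mulr_gt0// /flat ifT ?expr0 ?mul1r ?expR_gt0//; lra.
Qed.

Lemma cutoff_out r x : 0 < r -> r <= `|x| -> cutoff r x = 0.
Proof.
move=> r0 xr; apply/eqP; apply: contraT => nz.
have [i xi] : exists i, r <= `|x 0 i|.
  apply: contrapT => H; move: xr; rewrite leNgt => /negP; apply.
  rewrite [ltLHS]mx_normrE; apply: bigmax_lt => //= -[j l] _ /=; rewrite ord1 ltNge.
  by apply/negP => xl; apply: H; exists l.
move: nz; rewrite /cutoff (bigD1 i)//= mulf_eq0 negb_or => /andP[].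
rewrite mulf_eq0 negb_or /flat.
by case: ifP; rewrite ?eqxx//; case: ifP; rewrite ?eqxx ?andbF// => h1 h2; move: xi; rewrite ler_normr; lra.
Qed.

End smooth.

Section mollification.
Variables (R : realType) (n : nat).
Local Notation E := 'rV[R]_n.
Local Notation T := (lebesgueRn R n).
Local Notation mu := (@leb R n).
Implicit Types (x y z v w : E) (f g eta phi psi : E -> R) (i : 'I_n).

Local Notation int f := (mu.-integrable [set: T] (EFin \o (f : T -> R))).

Lemma eps_derive f x v (c : R) : (forall e, 0 < e -> exists2 r, 0 < r &
    forall t : R, `|t| < r -> `|f (x + t *: v) - f x - t * c| <= e * `|t|) ->
  derivable f x v /\ 'D_v f x = c.
Proof.
move=> H.
have Hc : (fun h : R => h^-1 *: ((f \o shift x) (h *: v) - f x)) @ 0^' --> c.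
  apply/cvgrPdist_le => e /H[r r0 Hr]; near=> h.
  have h0 : h != 0 by near: h; exact: nbhs_dnbhs_neq.
  have /Hr hr : `|h| < r by near: h; exact: dnbhs0_lt.
  rewrite distrC (_ : _ - _ = h^-1 * (f (x + h *: v) - f x - h * c)).
    by rewrite normrM normfV ler_pdivrMl ?normr_gt0// [`|h| * _]mulrC.
  by rewrite /shift/= [_ + x]addrC /GRing.scale/=; field.
split; first by apply/cvg_ex; exists c.
exact: cvg_lim Hc.
Unshelve. all: by end_near. Qed.

Lemma norm_delta_le i : `|delta_mx 0 i : E| <= 1.
Proof.
by apply: norm_row_le => // j; rewrite mxE eqxx/=; case: eqP => _; rewrite ?normr1 ?normr0.
Qed.

Lemma grad0_outside f (N : R) x : (forall x, N <= `|x| -> f x = 0) -> N + 1 <= `|x| -> grad f x = 0.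
Proof.
move=> fN Nx; apply: sderiv_grad; apply: (@sderiv_near_eq _ _ (cst 0)); last exact: sderiv_cst.
apply/nbhs_ballP; exists 1 => //= z; rewrite -ball_normE /ball_/= => xz.
rewrite fN//; have := ler_normD (x - z) z; rewrite subrK; lra.
Qed.

Definition bsupp f := exists2 N : R, 0 < N & forall x, N <= `|x| -> f x = 0.
Definition cc f := continuous f /\ bsupp f.

Lemma int_bounded f (M N : R) : measurable_fun [set: T] f -> (forall x, `|f x| <= M) ->
  (forall x, N <= `|x| -> f x = 0) -> int f.
Proof.
move=> mf fM fN; pose B : set E := [set x | `|x| < N].
have mB : measurable (B : set T).
  apply: open_measurableRn; rewrite (_ : B = ball (0 : E) N); first exact: ball_open.
  by rewrite -ball_normE; apply/seteqP; split => x /=; rewrite sub0r normrN.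
have -> : EFin \o f = ((EFin \o f) \_ (B : set T)).
  apply/funext => x; rewrite patchE/=; case: ifPn => // /negP nB.
  by rewrite fN// leNgt; apply/negP => xN; apply: nB; rewrite inE.
apply: (integrable_mkcond _ mB).1.
apply: measurable_bounded_integrable => //.
- apply: leb_bounded_lty; exists N; split; first exact: num_real.
  by move=> s Ns x /= xN; apply: ltW; exact: lt_trans Ns.
- exact: measurable_funTS.
- exists M; split; first exact: num_real.
  by move=> s Ms x _ /=; apply: (le_trans (fM x)); exact: ltW.
Qed.

Lemma cc_compact f : cc f -> exists2 C, compact C & forall x, ~ C x -> f x = 0.
Proof.
move=> [_ [N N0 fN]]; exists [set x | `|x| <= N]; last first.
  by move=> x /negP; rewrite -ltNge => /ltW/fN.
apply: bounded_closed_compact.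
  exists N; split; first exact: num_real.
  by move=> s Ns x /= xN; apply: (le_trans xN); exact: ltW.
rewrite (_ : [set x | _] = (fun x : E => `|x|) @^-1` [set s | s <= N])//.
by apply: closed_comp => [x _|]; [exact: norm_continuous|exact: closed_le].
Qed.

Lemma cc_bound f : cc f -> exists2 M, 0 < M & forall x, `|f x| <= M.
Proof. by move=> Hf; have [C cC fC] := cc_compact Hf; exact: compact_support_bound cC Hf.1 fC. Qed.

Lemma cc_uniform f (e : R) : cc f -> 0 < e ->
  exists2 r, 0 < r & forall a b, `|a - b| < r -> `|f a - f b| <= e.
Proof. by move=> Hf; have [C cC fC] := cc_compact Hf; exact: uniform_cont cC Hf.1 fC. Qed.

Lemma cc_int f : cc f -> int f.
Proof.
move=> Hf; have [M _ fM] := cc_bound Hf; have [cf [N _ fN]] := Hf.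
by apply: int_bounded fM fN; exact: continuous_measurableRn.
Qed.

Lemma cc_mul f g : cc f -> continuous g -> cc (fun x => f x * g x).
Proof.
move=> [cf [N N0 fN]] cg; split; first by move=> x; apply: continuous_mulr; [exact: cf|exact: cg].
by exists N => // x /fN ->; rewrite mul0r.
Qed.

Lemma cst_for (a : R) x : {for x, continuous (fun _ : E => a)}.
Proof. exact: cst_continuous. Qed.

Lemma cc_lin f g (a b : R) : cc f -> cc g -> cc (fun x => a * f x + b * g x).
Proof.
move=> [cf [N N0 fN]] [cg [M M0 gM]]; split.
  by move=> x; apply: continuous_addr; apply: continuous_mulr; [exact: cst_for|exact: cf|exact: cst_for|exact: cg].
exists (N + M) => [|x NM]; first exact: addr_gt0.
by rewrite fN ?gM ?mulr0 ?addr0//; apply: le_trans NM; rewrite ?lerDl ?lerDr ltW.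
Qed.

Lemma shift_continuous f a : continuous f -> continuous (fun x => f (a + x)).
Proof.
move=> cf x; apply: (@continuous_comp _ _ _ (fun x => a + x) f); last exact: cf.
exact: (@cvgD R E E (nbhs x) _ (fun=> a) id a x (cvg_cst a) cvg_id).
Qed.

Lemma cc_shift f a : cc f -> cc (fun x => f (a + x)).
Proof.
move=> [cf [N N0 fN]]; split; first exact: shift_continuous.
exists (N + `|a|) => [|x Nx]; first by rewrite ltr_wpDr.
by apply: fN; have := ler_normB (a + x) a; rewrite [a + x]addrC addrK; lra.
Qed.

Lemma cc_norm f : cc f -> cc (fun x => `|f x|).
Proof.
move=> [cf [N N0 fN]]; split; last by exists N => // x /fN ->; rewrite normr0.
by move=> x; apply: (@continuous_comp _ _ _ f (fun s => `|s|)); [exact: cf|exact: norm_continuous].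
Qed.

Lemma int_lin f g (a b : R) : int f -> int g -> int (fun x => a * f x + b * g x) /\
  \int[mu]_x (a * f x + b * g x) = a * \int[mu]_x f x + b * \int[mu]_x g x.
Proof.
move=> If Ig.
have Iaf : int (fun x => a * f x) by have := integrableZl measurableT a If.
have Ibg : int (fun x => b * g x) by have := integrableZl measurableT b Ig.
by split; [have := integrableD measurableT Iaf Ibg|rewrite (RintegralD measurableT Iaf Ibg) !RintegralZl].
Qed.

Lemma int_abs f : int f -> int (fun x => `|f x|).
Proof. exact: integrable_norm. Qed.

Lemma Rint_abs_le f g : int f -> int g -> (forall x, `|f x| <= g x) ->
  `|\int[mu]_x f x| <= \int[mu]_x g x.
Proof.
move=> If Ig fg; apply: (le_trans (le_normr_Rintegral measurableT If)).
by apply: le_Rintegral => //; exact: int_abs.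
Qed.

Lemma Rint_shift f a : int f -> \int[mu]_x f (a + x) = \int[mu]_x f x.
Proof. by move=> If; rewrite /Rintegral (integral_shift a If). Qed.

Lemma int_shift f a : int f -> int (fun x => f (a + x)).
Proof. by move=> If; exact: (integrable_shift a If). Qed.

Definition smooth_cc f := (forall k, Ck k setT f) /\ bsupp f.

Lemma smooth_continuous f : (forall k, Ck k setT f) -> continuous f.
Proof. by move=> Hf x; have [cf _] := Hf 0%N; exact: cf. Qed.

Lemma smooth_cc_cc f : smooth_cc f -> cc f.
Proof. by move=> [Hf bf]; split => //; exact: smooth_continuous. Qed.

Lemma smooth_sderiv f x : (forall k, Ck k setT f) -> sderiv f x (grad f x).
Proof. by move=> Hf; exact: Ck1_sderiv openT (Hf 1%N) I. Qed.

Lemma smooth_partial f i : smooth_cc f -> smooth_cc (partial i f).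
Proof.
move=> [Hf [N N0 fN]]; split => [k|]; first by have [_ /(_ i)[]] := Hf k.+1.
exists (N + 1) => [|x Nx]; first by rewrite ltr_wpDr.
have /rowP/(_ i) := grad0_outside fN Nx; by rewrite !mxE.
Qed.

Lemma smooth_uniform_derive f i (e : R) : smooth_cc f -> 0 < e -> exists2 r, 0 < r &
  forall x (t : R), `|t| < r -> `|f (x + t *: delta_mx 0 i) - f x - t * partial i f x| <= e * `|t|.
Proof.
move=> Hf e0; have [r r0 Hr] := cc_uniform (smooth_cc_cc (smooth_partial i Hf)) e0.
exists r => // x t tr; set v := t *: delta_mx 0 i.
have [|s /andP[s0 s1] ->] := @MVT_line _ _ f x v (fun s => dotp (grad f (x + s *: v)) v).
  by move=> s _; apply: sderiv_line; exact: smooth_sderiv Hf.1.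
rewrite dotpZr dotp_delta mxE -mulrBr normrM mulrC ler_wpM2r//; apply: Hr.
rewrite addrC addKr /v scalerA normrZ; apply: le_lt_trans tr.
apply: (@le_trans _ _ (`|t| * 1)); last by rewrite mulr1.
rewrite normrM -mulrA [`|s| * _]mulrC -mulrA ler_wpM2l//.
rewrite -[leRHS]mul1r ler_pM//; last by rewrite ger0_norm.
exact: norm_delta_le.
Qed.

(** The kernel is evaluated at [y - x], so derivatives fall on it with a minus sign. *)
Definition mollify f eta x : R := \int[mu]_y (f y * eta (y - x)).

Lemma mollify_int f eta x : cc f -> continuous eta -> int (fun y => f y * eta (y - x)).
Proof.
move=> cf ce; apply: cc_int; apply: (cc_mul cf).
by rewrite (_ : (fun y => _) = fun y => eta (- x + y)); [exact: shift_continuous|apply/funext => y; rewrite addrC].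
Qed.

Lemma mollify_bound f eta (a : E -> R) (e : R) : cc f -> int (fun y => f y * a y) ->
  (forall y, `|a y| <= e) -> `|\int[mu]_y (f y * a y)| <= e * \int[mu]_y `|f y|.
Proof.
move=> cf Ia ae; have If := cc_int (cc_norm cf).
rewrite -(RintegralZl _ measurableT If); apply: Rint_abs_le => //.
  by have := integrableZl measurableT e If.
by move=> x; rewrite normrM mulrC ler_wpM2r.
Qed.

Lemma mollify_continuous f eta : cc f -> cc eta -> continuous (mollify f eta).
Proof.
move=> cf ce x; apply/(@cvgrPdist_le _ _ _ (nbhs x)) => e e0.
set I := \int[mu]_y `|f y|.
have I0 : 0 <= I by exact: Rintegral_ge0.
have I1 : 0 < I + 1 by rewrite ltr_wpDl.
have [r r0 Hr] := cc_uniform ce (divr_gt0 e0 I1).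
apply/nbhs_ballP; exists r => //= z; rewrite -ball_normE /ball_/= => xz.
have [Ib Eb] := int_lin 1 (-1) (mollify_int x cf ce.1) (mollify_int z cf ce.1).
have E1 : mollify f eta x - mollify f eta z = \int[mu]_y (f y * (eta (y - x) - eta (y - z))).
  rewrite /mollify -[X in X - _]mul1r -mulN1r -Eb; congr Rintegral; apply/funext => y.
  by ring.
rewrite E1; apply: (@le_trans _ _ (e / (I + 1) * I)); last first.
  by rewrite mulrAC ler_pdivrMr// ler_pM2l//; lra.
apply: mollify_bound => // [|y].
  by rewrite (_ : (fun y => _) = fun y => 1 * (f y * eta (y - x)) + -1 * (f y * eta (y - z)))//; apply/funext => y; ring.
by apply: Hr; rewrite opprB addrC addrA subrK distrC.
Qed.

Lemma mollify_derive f eta i x : cc f -> smooth_cc eta ->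
  derivable (mollify f eta) x (delta_mx 0 i) /\
  partial i (mollify f eta) x = - mollify f (partial i eta) x.
Proof.
move=> cf se; have ce := smooth_cc_cc se; have cde := smooth_cc_cc (smooth_partial i se).
apply: eps_derive => e e0.
set I := \int[mu]_y `|f y|.
have I0 : 0 <= I by exact: Rintegral_ge0.
have I1 : 0 < I + 1 by rewrite ltr_wpDl.
have [r r0 Hr] := smooth_uniform_derive i se (divr_gt0 e0 I1).
exists r => // t tr; set z := x + _.
have [Ib Eb] := int_lin 1 (-1) (mollify_int z cf ce.1) (mollify_int x cf ce.1).
have [Ic Ec] := int_lin 1 t Ib (mollify_int x cf cde.1).
pose a y := eta (y - z) - eta (y - x) + t * partial i eta (y - x).
have aE : (fun y => 1 * (1 * (f y * eta (y - z)) + -1 * (f y * eta (y - x))) +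
             t * (f y * partial i eta (y - x))) = fun y => f y * a y.
  by apply/funext => y; rewrite /a; ring.
rewrite aE in Ic Ec.
have -> : mollify f eta z - mollify f eta x - t * - mollify f (partial i eta) x = \int[mu]_y (f y * a y).
  by rewrite Ec Eb /mollify; ring.
apply: (@le_trans _ _ (e / (I + 1) * `|t| * I)); last first.
  by rewrite mulrAC ler_wpM2r// mulrAC ler_pdivrMr// ler_pM2l//; lra.
apply: mollify_bound => // y; have := Hr (y - x) (- t); rewrite normrN => /(_ tr).
by rewrite /a scaleNr mulNr opprK /z opprD addrA.
Qed.

Lemma mollify_Ck k f eta : cc f -> smooth_cc eta -> Ck k setT (mollify f eta).
Proof.
move=> cf; elim: k eta => [|k IH] eta se.
  by split => // x _; exact: mollify_continuous (smooth_cc_cc se) x.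
split => [x _|i]; first exact: mollify_continuous (smooth_cc_cc se) x.
split => [x _|]; first by have [] := mollify_derive i x cf se.
rewrite (_ : partial i _ = fun x => -1 * mollify f (partial i eta) x).
  by apply: Ck_scale; apply: IH; exact: smooth_partial.
by apply/funext => x; rewrite (mollify_derive i x cf se).2 mulN1r.
Qed.

Lemma mollifyE f eta x : cc f -> continuous eta -> mollify f eta x = \int[mu]_z (f (x + z) * eta z).
Proof.
move=> cf ce; rewrite /mollify -(Rint_shift x (mollify_int x cf ce)).
by congr Rintegral; apply/funext => z; rewrite [in X in eta X]addrC addKr.
Qed.

End mollification.

(** * Integration by parts and kernels of integral one *)

Section kernels.
Variables (R : realType) (n : nat).
Local Notation E := 'rV[R]_n.
Local Notation T := (lebesgueRn R n).
Local Notation mu := (@leb R n).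
Implicit Types (x y z v w : E) (f g eta phi psi : E -> R) (i : 'I_n).
Local Notation int f := (mu.-integrable [set: T] (EFin \o (f : T -> R))).

Lemma fine_Rint f : int f -> (\int[mu]_x (f x)%:E = (\int[mu]_x f x)%:E)%E.
Proof. by move=> If; rewrite /Rintegral fineK//; exact: integrable_fin_num. Qed.

Lemma partial_bound f x i (g e r : R) : sderiv f x (grad f x) -> 0 < r ->
  (forall t : R, `|t| < r -> `|f (x + t *: delta_mx 0 i) - f x - t * g| <= e * `|t|) ->
  `|partial i f x - g| <= e.
Proof.
move=> df r0 H; apply/ler_addgt0Pr => e' e'0.
have [s s0 Hs] := sderiv_near df e'0.
pose t := Num.min r s / 2; have m0 : 0 < Num.min r s by rewrite lt_min r0.
have t0 : 0 < t by rewrite divr_gt0.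
have tm : t < Num.min r s by rewrite /t; lra.
move: tm; rewrite lt_min => /andP[tr ts].
have nt : `|t *: (delta_mx 0 i : E)| <= t.
  rewrite normrZ gtr0_norm// -[leRHS]mulr1 ler_pM2l//.
  exact: norm_delta_le.
have := Hs (x + t *: delta_mx 0 i) x; rewrite [x + _]addrC addrK subrr normr0 => /(_ (le_lt_trans nt ts) s0).
rewrite dotpZr dotp_delta mxE [_ + x]addrC => h1.
have := H t; rewrite gtr0_norm// => /(_ tr) h2.
have h3 : e' * `|t *: (delta_mx 0 i : E)| <= e' * t by rewrite ler_pM2l.
rewrite -(ler_pM2l t0) -{1}(gtr0_norm t0) -normrM.
rewrite (_ : t * (partial i f x - g) = (f (x + t *: delta_mx 0 i) - f x - t * g) -
   (f (x + t *: delta_mx 0 i) - f x - t * partial i f x)); last by ring.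
apply: (le_trans (ler_normB _ _)); rewrite mulrDr.
by apply: lerD; [rewrite [X in _ <= X]mulrC|rewrite [X in _ <= X]mulrC; exact: le_trans h1 h3].
Qed.

(** By translation invariance the difference quotients have integral 0. They converge uniformly with
    supports in a common ball, whose indicator [chi] makes the error integrable. *)
Lemma smooth_partial_int0 f i : smooth_cc f -> \int[mu]_x partial i f x = 0.
Proof.
move=> sf; have cf := smooth_cc_cc sf; have cp := smooth_cc_cc (smooth_partial i sf).
have [_ [N N0 fN]] := cf; have [_ [N' N'0 pN]] := cp.
pose B : set E := [set x | `|x| < N + N' + 1].
have mB : measurable (B : set T).
  apply: open_measurableRn; rewrite (_ : B = ball (0 : E) (N + N' + 1)); first exact: ball_open.
  by rewrite -ball_normE; apply/seteqP; split => x /=; rewrite sub0r normrN.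
pose chi (x : E) : R := \1_B x.
have Ic : int chi.
  apply: (@int_bounded _ _ _ 1 (N + N' + 1)) => [|x|x Bx]; first exact: measurable_indic.
    by rewrite /chi indicE; case: (_ \in _); rewrite ?normr1 ?normr0.
  by rewrite /chi indicE memNset// /B/=; apply/negP; rewrite -leNgt.
set c := \int[mu]_x chi x.
have c0 : 0 <= c by apply: Rintegral_ge0 => x _; rewrite /chi indicE ler0n.
apply/eqP; rewrite -normr_le0; apply/ler_addgt0Pr => e e0; rewrite add0r.
have e1 : 0 < e / (c + 1) by rewrite divr_gt0// ltr_wpDl.
have [r r0 Hr] := smooth_uniform_derive i sf e1.
pose t := Num.min r 1 / 2; have m0 : 0 < Num.min r 1 by rewrite lt_min r0/=.
have t0 : 0 < t by rewrite divr_gt0.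
have : t < Num.min r 1 by rewrite /t; lra.
rewrite lt_min => /andP[tr t1]; pose v : E := t *: delta_mx 0 i.
have If := cc_int cf; have Ifs := int_shift v If; have Ip := cc_int cp.
have [I1 E1] := int_lin 1 (-1) Ifs If; have [I2 E2] := int_lin 1 (- t) I1 Ip.
rewrite -(ler_pM2l t0) -{1}(gtr0_norm t0) -normrM -normrN -mulNr.
rewrite E1 Rint_shift// !mul1r mulN1r subrr add0r in E2.
rewrite -E2 (_ : t * e = (e / (c + 1) * t) * (c + 1)); last first.
  by field; rewrite gt_eqF// ltr_wpDl.
apply: (@le_trans _ _ (e / (c + 1) * t * c)); last first.
  by apply: ler_wpM2l; [rewrite ltW// mulr_gt0|rewrite lerDl].
rewrite /c -(RintegralZl _ measurableT Ic); apply: Rint_abs_le => //.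
  by have := integrableZl measurableT (e / (c + 1) * t) Ic.
move=> x; rewrite !mul1r mulN1r mulNr.
have vt : `|v| <= t.
  rewrite normrZ gtr0_norm// -[leRHS]mulr1 ler_pM2l//.
  exact: norm_delta_le.
have [Bx|nB] := pselect (B x).
  rewrite /chi indicE mem_set//= mulr1; have := Hr x t; rewrite gtr0_norm// => /(_ tr).
  by rewrite [x + _]addrC.
have Nx : N + N' + 1 <= `|x| by rewrite leNgt; apply/negP.
have := ler_normB (v + x) v; rewrite [v + x]addrC addrK => h1.
rewrite [x + v]addrC in h1 *.
rewrite (fN x); last by move: N'0 Nx; clear; lra.
rewrite (fN (v + x)); last by move: h1 vt t1 N'0 Nx; clear; lra.
rewrite (pN x); last by move: N0 Nx; clear; lra.
rewrite /chi indicE memNset//.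
by rewrite mulr0n mulr0 subrr mulr0 subrr normr0.
Qed.

Lemma smooth_mul f g : smooth_cc f -> (forall k, Ck k setT g) -> smooth_cc (fun x => f x * g x).
Proof.
move=> [Hf [N N0 fN]] Hg; split => [k|]; first exact: Ck_mul.
by exists N => // x /fN ->; rewrite mul0r.
Qed.

Lemma partial_mul f g i x : (forall k, Ck k setT f) -> (forall k, Ck k setT g) ->
  partial i (fun x => f x * g x) x = f x * partial i g x + partial i f x * g x.
Proof.
move=> Hf Hg; have [_ /(_ i)[/(_ x I) df _]] := Hf 1%N; have [_ /(_ i)[/(_ x I) dg _]] := Hg 1%N.
by rewrite /partial (deriveM df dg) [g x *: _]mulrC.
Qed.

Lemma smooth_ibp f g i : smooth_cc f -> smooth_cc g ->
  \int[mu]_x (f x * partial i g x) = - \int[mu]_x (partial i f x * g x).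
Proof.
move=> sf sg; have := smooth_partial_int0 i (smooth_mul sf sg.1).
have I1 : int (fun x => f x * partial i g x).
  by apply: cc_int; apply: cc_mul (smooth_cc_cc sf) (smooth_cc_cc (smooth_partial i sg)).1.
have I2 : int (fun x => partial i f x * g x).
  by apply: cc_int; apply: cc_mul (smooth_cc_cc (smooth_partial i sf)) (smooth_cc_cc sg).1.
rewrite (_ : partial i _ = fun x => f x * partial i g x + partial i f x * g x).
  by rewrite (RintegralD measurableT I1 I2) => /eqP; rewrite addr_eq0 => /eqP.
by apply/funext => x; exact: partial_mul sf.1 sg.1.
Qed.

Hypothesis mu0 : mu [set: T] <> 0%E.

(** Were a ball null, its translates would be null too, and countably many rational cells contained
    in translates cover the space. *)
Lemma leb_ball_gt0 (r : R) : 0 < r -> (0 < mu [set x : E | (`|x| < r)%R])%E.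
Proof.
move=> r0; rewrite lt0e measure_ge0 andbT; apply/eqP => B0; apply: mu0.
pose F k : set T := if unpickle k is Some p then
  (if pselect (mu (ratcell p : set E) = 0%E) then (ratcell p : set E) else set0) else set0.
have Fn : mu.-negligible (\bigcup_k F k).
  apply: negligible_bigcup => k; rewrite /F; case: unpickle => [p|]; last exact: negligible_set0.
  case: pselect => [p0|?]; last exact: negligible_set0.
  by exists (ratcell p); split => //; exact: measurable_ratcell.
have [A [mA A0 sA]] := Fn.
apply/eqP; rewrite eq_le measure_ge0 andbT -A0; apply: outer_le; apply: subset_trans sA => z _.
have [p pz pr] := ratcell_small z r0; exists (pickle p) => //; rewrite /F pickleK.
case: pselect => // np; exfalso; apply: np; apply/eqP; rewrite eq_le measure_ge0 andbT.
rewrite -B0 -[leRHS](leb_shift_image z); apply: outer_le => x /pr xz.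
by exists (x - z) => //; rewrite addrC subrK.
Qed.

Lemma cutoff_smooth (r : R) : 0 < r -> smooth_cc (cutoff r : E -> R).
Proof. by move=> r0; split => [k|]; [exact: cutoff_Ck|exists r => // x; exact: cutoff_out]. Qed.

Lemma cutoff_int_gt0 (r : R) : 0 < r -> 0 < \int[mu]_x cutoff r (x : E).
Proof.
move=> r0; rewrite lt0r Rintegral_ge0 ?andbT; last by move=> x _; exact: cutoff_ge0.
apply/eqP => I0; have Ib := cc_int (smooth_cc_cc (cutoff_smooth r0)).
have : ae_eq mu setT (EFin \o (cutoff r : T -> R)) (cst 0%E).
  apply: (ae_eq_integral_abs mu measurableT (measurable_int mu Ib)).1.
  rewrite -[RHS]/(0%:E) -I0 -fine_Rint//; apply: eq_integral => x _ /=.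
  by rewrite ger0_norm ?cutoff_ge0.
move=> -[A [mA A0 sA]]; have := leb_ball_gt0 r0; rewrite lt0e => /andP[/negP + _]; apply.
rewrite eq_le measure_ge0 andbT -A0; apply: outer_le => x /= xr; apply: sA => /(_ I)/=.
by case => b0; have := cutoff_gt0 r0 xr; rewrite b0 ltxx.
Qed.

Definition kern (r : R) (x : E) : R := (\int[mu]_x cutoff r (x : E))^-1 * cutoff r x.

Lemma kern_smooth r : 0 < r -> smooth_cc (kern r).
Proof.
move=> r0; split => [k|]; first by apply: Ck_scale; exact: cutoff_Ck.
by exists r => // x rx; rewrite /kern cutoff_out// mulr0.
Qed.

Lemma kern_cc r : 0 < r -> cc (kern r).
Proof. by move=> r0; apply: smooth_cc_cc; exact: kern_smooth. Qed.

Lemma kern_ge0 r x : 0 < r -> 0 <= kern r x.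
Proof. by move=> r0; rewrite mulr_ge0 ?cutoff_ge0// invr_ge0 ltW// cutoff_int_gt0. Qed.

Lemma kern_out r x : 0 < r -> r <= `|x| -> kern r x = 0.
Proof. by move=> r0 rx; rewrite /kern cutoff_out// mulr0. Qed.

Lemma kern_int1 r : 0 < r -> \int[mu]_x kern r x = 1.
Proof.
move=> r0; rewrite /kern (RintegralZl _ measurableT); last exact: cc_int (smooth_cc_cc (cutoff_smooth r0)).
by rewrite mulVf// gt_eqF// cutoff_int_gt0.
Qed.

Lemma kern_avg g r (c e : R) : 0 < r -> continuous g -> (forall z, `|z| < r -> `|g z - c| <= e) ->
  `|\int[mu]_z (g z * kern r z) - c| <= e.
Proof.
move=> r0 cg H; have Ik := cc_int (kern_cc r0).
have Ig : int (fun z => g z * kern r z).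
  by apply: cc_int; rewrite (_ : (fun z => _) = fun z => kern r z * g z);
     [exact: cc_mul (kern_cc r0) cg|apply/funext => z; rewrite mulrC].
have [Id Ed] := int_lin 1 (- c) Ig Ik.
rewrite mul1r (kern_int1 r0) mulr1 in Ed; rewrite -Ed.
rewrite [leRHS](_ : e = \int[mu]_x (e * kern r x)); last by rewrite (RintegralZl _ measurableT Ik) kern_int1// mulr1.
apply: Rint_abs_le => // [|z]; first by have := integrableZl measurableT e Ik.
rewrite mul1r mulNr -mulrBl normrM [X in _ * X]ger0_norm ?kern_ge0//.
have [zr|rz] := ltP `|z| r; first by rewrite ler_wpM2r ?kern_ge0//; exact: H.
by rewrite kern_out// !mulr0.
Qed.

Lemma mollify_near f r x (c e : R) : 0 < r -> cc f -> (forall z, `|z| < r -> `|f (x + z) - c| <= e) ->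
  `|mollify f (kern r) x - c| <= e.
Proof.
move=> r0 cf H; rewrite (mollifyE _ cf (kern_cc r0).1); apply: (kern_avg (g := fun z => f (x + z))) => //.
exact: shift_continuous cf.1.
Qed.

(** Only increments of [f] are involved: with [c = 0] this bounds the derivatives of mollified
    Lipschitz functions, with [c] a partial derivative it gives convergence at points of strict
    differentiability. *)
Lemma mollify_partial_near f r x i (c e s : R) : 0 < r -> 0 < s -> cc f ->
  (forall (t : R) z, `|t| < s -> `|z| < r ->
    `|f (x + t *: delta_mx 0 i + z) - f (x + z) - t * c| <= e * `|t|) ->
  `|partial i (mollify f (kern r)) x - c| <= e.
Proof.
move=> r0 s0 cf H; apply: (partial_bound _ s0) => [|t ts].
  by apply: smooth_sderiv => k; exact: mollify_Ck (kern_smooth r0).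
have ck := (kern_cc r0).1; set y := x + _.
have cs z : cc (fun w => f (z + w)) by exact: cc_shift.
have I z : int (fun w => f (z + w) * kern r w) by apply: cc_int; exact: cc_mul (cs z) ck.
have [_ Ed] := int_lin 1 (-1) (I y) (I x).
have [cl _] := cc_lin 1 (-1) (cs y) (cs x).
have -> : mollify f (kern r) y - mollify f (kern r) x =
    \int[mu]_w ((1 * f (y + w) + -1 * f (x + w)) * kern r w).
  rewrite mul1r mulN1r in Ed; rewrite !(mollifyE _ cf ck) -Ed.
  by congr Rintegral; apply/funext => w; ring.
by apply: (kern_avg r0 cl) => z zr; rewrite mul1r mulN1r; exact: H.
Qed.

End kernels.

(** * Weak gradients *)

Section almost_everywhere.
Variables (R : realType) (n : nat).
Local Notation E := 'rV[R]_n.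
Local Notation mu := (@leb R n).
Implicit Types P Q : E -> Prop.

Lemma ae_imp P Q : (forall x, P x -> Q x) -> {ae mu, forall x, P x} -> {ae mu, forall x, Q x}.
Proof.
by move=> H [A [mA A0 sA]]; exists A; split => // x nQ; apply: sA => Px; apply: nQ; exact: H.
Qed.

Lemma ae_and P Q : {ae mu, forall x, P x} -> {ae mu, forall x, Q x} -> {ae mu, forall x, P x /\ Q x}.
Proof.
move=> [A [mA A0 sA]] [B [mB B0 sB]]; exists (A `|` B); split; first exact: measurableU.
  by apply: null_set_setU.
move=> x /= /not_andP[nP|nQ]; [left; exact: sA|right; exact: sB].
Qed.

Lemma ae_ord N (P : 'I_N -> E -> Prop) : (forall i, {ae mu, forall x, P i x}) ->
  {ae mu, forall x, forall i, P i x}.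
Proof.
move=> H; suff Hs (s : seq 'I_N) : {ae mu, forall x, forall i, i \in s -> P i x}.
  by apply: ae_imp (Hs (enum 'I_N)) => x Px i; apply: Px; rewrite mem_enum.
elim: s => [|i s IH].
  by exists set0; split => // x; rewrite /= => nH; apply: nH.
apply: ae_imp (ae_and (H i) IH) => x [Pi Ps] j; rewrite inE => /orP[/eqP->//|]; exact: Ps.
Qed.

End almost_everywhere.

Section weak_gradients.
Variables (R : realType) (n : nat) (Omega : set 'rV[R]_n).
Local Notation E := 'rV[R]_n.
Local Notation T := (lebesgueRn R n).
Local Notation mu := (@leb R n).
Implicit Types (x y z w : E) (f g eta phi psi k u v : E -> R) (i : 'I_n).
Local Notation int f := (mu.-integrable [set: T] (EFin \o (f : T -> R))).
Local Notation test := (test_function Omega).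
Hypotheses (Oo : open Omega) (Ob : bounded_set Omega).

Let mO : measurable (Omega : set T) := measurable_Omega Oo.

Lemma test_smooth phi : test phi -> smooth_cc phi.
Proof.
move=> [Hp [C [cC CO p0]]]; split => //.
have [M [_ HM]] := compact_bounded cC; exists (`|M| + 2) => [|x Mx]; first by rewrite ltr_wpDl.
apply: p0 => Cx; have := HM (`|M| + 1) _ x Cx; have := ler_norm M => h; move=> /(_ ltac:(lra))/=; lra.
Qed.

Lemma test_out phi x : test phi -> ~ Omega x -> phi x = 0.
Proof. by move=> [_ [C [_ CO p0]]] nO; apply: p0 => /CO. Qed.

Lemma test_partial phi i : test phi -> test (partial i phi).
Proof.
move=> tp; have [C cC [CO _ g0]] := test_support tp; split => [k|].
  by have [] := smooth_partial i (test_smooth tp).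
by exists C; split => // x /g0/rowP/(_ i); rewrite !mxE.
Qed.

Lemma Rint_Omega f : (forall x, ~ Omega x -> f x = 0) -> \int[mu]_(x in Omega) f x = \int[mu]_x f x.
Proof.
move=> f0; rewrite Rintegral_mkcond; congr Rintegral; apply/funext => x; rewrite patchE.
by case: ifPn => // /negP nO; rewrite f0// => Ox; apply: nO; rewrite inE.
Qed.

Lemma cc_L1 f : cc f -> in_L1 Omega f.
Proof. by move=> /cc_int If; apply: integrableS If. Qed.

Lemma test_L1 phi : test phi -> in_L1 Omega phi.
Proof. by move=> tp; apply: cc_L1; apply: smooth_cc_cc; exact: test_smooth. Qed.

Lemma test_weak_grad phi : test phi -> is_weak_grad Omega phi (grad phi).
Proof.
move=> tp; have sp := test_smooth tp; split => [i|psi tpsi i].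
  rewrite (_ : (fun x => _) = partial i phi); last by apply/funext => x; rewrite mxE.
  by apply: test_L1; exact: test_partial.
rewrite Rint_Omega; last by move=> x nO; rewrite (test_out tp nO) mul0r.
rewrite (smooth_ibp _ sp (test_smooth tpsi)) -Rint_Omega.
  by congr (- Rintegral _ _ _); apply/funext => x; rewrite mxE.
by move=> x nO; rewrite (test_out tpsi nO) mulr0.
Qed.

Lemma L1_mul k phi : in_L1 Omega k -> cc phi -> in_L1 Omega (fun x => k x * phi x).
Proof.
move=> Ik cp; have [M M0 HM] := cc_bound cp.
have Im : mu.-integrable Omega (fun x => `|M%:E * (k x)%:E|)%E.
  exact: integrable_abse (integrableZl mO M Ik).
apply: le_integrable Im => //.
  apply/measurable_EFinP; apply: measurable_funM.
    by apply/measurable_EFinP; exact: measurable_int Ik.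
  by apply: measurable_funTS; apply: continuous_measurableRn; exact: cp.1.
by move=> x _ /=; rewrite normr_id lee_fin !normrM mulrC ler_wpM2r// (gtr0_norm M0).
Qed.

Lemma L1_lin (a b : R) f g : in_L1 Omega f -> in_L1 Omega g ->
  in_L1 Omega (fun x => a * f x + b * g x) /\
  \int[mu]_(x in Omega) (a * f x + b * g x) =
  a * \int[mu]_(x in Omega) f x + b * \int[mu]_(x in Omega) g x.
Proof.
move=> If Ig.
have Iaf : in_L1 Omega (fun x => a * f x) by have := integrableZl mO a If.
have Ibg : in_L1 Omega (fun x => b * g x) by have := integrableZl mO b Ig.
by split; [have := integrableD mO Iaf Ibg|rewrite (RintegralD mO Iaf Ibg) (RintegralZl _ mO If) (RintegralZl _ mO Ig)].
Qed.

Lemma weak_grad_lin (a b : R) u v (gu gv : E -> E) : in_L1 Omega u -> in_L1 Omega v ->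
  is_weak_grad Omega u gu -> is_weak_grad Omega v gv ->
  is_weak_grad Omega (fun x => a * u x + b * v x) (fun x => a *: gu x + b *: gv x).
Proof.
move=> Iu Iv [Lu Hu] [Lv Hv]; split => [i|phi tp i].
  rewrite (_ : (fun x => _) = fun x => a * gu x 0 i + b * gv x 0 i); first exact: (L1_lin a b (Lu i) (Lv i)).1.
  by apply/funext => x; rewrite !mxE.
have cp := smooth_cc_cc (test_smooth tp); have cdp := smooth_cc_cc (smooth_partial i (test_smooth tp)).
transitivity (\int[mu]_(x in Omega) (a * (u x * partial i phi x) + b * (v x * partial i phi x))).
  by congr Rintegral; apply/funext => x; ring.
rewrite (L1_lin a b (L1_mul Iu cdp) (L1_mul Iv cdp)).2 Hu// Hv// !mulrN -opprD.
rewrite -(L1_lin a b (L1_mul (Lu i) cp) (L1_mul (Lv i) cp)).2.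
by congr (- Rintegral _ _ _); apply/funext => x; rewrite !mxE; ring.
Qed.

Lemma Ck_one_sub m f : Ck m setT f -> Ck m setT (fun x => 1 - f x).
Proof.
move=> Hf; rewrite (_ : (fun x => _) = fun x => 1 + (-1) * f x).
  by apply: Ck_add; [exact: Ck_cst|exact: Ck_scale].
by apply/funext => x; rewrite mulN1r.
Qed.

Lemma Ck_expr m N f : Ck m setT f -> Ck m setT (fun x => f x ^+ N).
Proof.
move=> Hf; elim: N => [|N IH].
  by rewrite (_ : (fun x => _) = fun=> 1); [exact: Ck_cst|apply/funext => x; rewrite expr0].
rewrite (_ : (fun x => _) = fun x => f x * f x ^+ N); first exact: Ck_mul.
by apply/funext => x; rewrite exprS.
Qed.

Lemma cell_function (c : E) (r : R) : 0 < r -> exists b : E -> R,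
  [/\ forall m, Ck m setT b, forall x, 0 <= b x <= 1, forall x, `|c - x| < r -> 0 < b x &
      forall x, ~ (`|c - x| <= r) -> b x = 0].
Proof.
move=> r0; have sc : smooth_cc (cutoff r : E -> R) by exact: cutoff_smooth.
have [M M0 HM] := cc_bound (smooth_cc_cc sc).
exists (fun x => M^-1 * cutoff r (x - c)); split => [m|x|x cx|x /negP].
- apply: Ck_scale; rewrite (_ : (fun x => _) = fun x =>
    \prod_i (flat 0 (r - c 0 i + 1 * x 0 i) * flat 0 (r + c 0 i + (-1) * x 0 i))).
    by apply: Ck_prod => i; apply: Ck_mul; exact: flat_Ck.
  by apply/funext => x; apply: eq_bigr => i _; congr (flat _ _ * flat _ _); rewrite !mxE; ring.
- rewrite mulr_ge0 ?cutoff_ge0 ?invr_ge0 ?(ltW M0)//= mulrC ler_pdivrMr// mul1r.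
  exact: le_trans (ler_norm _) (HM _).
- by rewrite mulr_gt0 ?invr_gt0// cutoff_gt0// distrC.
- by rewrite -ltNge => /ltW rx; rewrite cutoff_out ?mulr0// distrC.
Qed.

Lemma closed_cell_compact (c : E) (r : R) : compact [set x | `|c - x| <= r].
Proof.
apply: bounded_closed_compact.
  exists (r + `|c|); split; first exact: num_real.
  by move=> s Ms x /= xN; have := ler_normB c (c - x); rewrite opprB addrC subrK; lra.
rewrite (_ : [set x | _] = (fun x : E => `|c - x|) @^-1` [set s | s <= r])//.
apply: closed_comp => [x _|]; last exact: closed_le.
apply: (@continuous_comp _ _ _ (fun x => c - x) (fun x => `|x|)); last exact: norm_continuous.
exact: (@cvgB R E E (nbhs x) _ (fun=> c) id c x (cvg_cst c) cvg_id).
Qed.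

(** With bumps [B j] supported in the closed rational cells contained in [O], one minus the product
    of the powers [(1 - B j) ^+ N] for [j < N] vanishes off finitely many of these cells. It tends
    to 1 where some [B j] is positive, a factor below 1 being raised to growing powers. *)
Lemma open_test_approx (O : set E) : open O -> O `<=` Omega -> exists phi : nat -> E -> R,
  [/\ forall N, test (phi N), forall N x, 0 <= phi N x <= 1,
      forall N x, ~ O x -> phi N x = 0 & forall x, O x -> phi ^~ x @ \oo --> (1 : R)].
Proof.
move=> oO OO.
have i0 (m : nat) : 0 < m.+1%:R^-1 :> R by rewrite invr_gt0 ltr0n.
have /choice[b Hb] (p : 'rV[rat]_n * nat) := cell_function (map_mx ratr p.1) (i0 p.2).
pose clo (p : 'rV[rat]_n * nat) : set E := [set x | `|map_mx ratr p.1 - x| <= p.2.+1%:R^-1].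
have {Hb}Hb' p : [/\ forall m, Ck m setT (b p), forall x, 0 <= b p x <= 1, forall x, ratcell p x -> 0 < b p x &
      forall x, ~ clo p x -> b p x = 0] by exact: Hb.
pose B j : E -> R := if unpickle j is Some p then if `[< clo p `<=` O >] then b p else cst 0 else cst 0.
pose K j : set E := if unpickle j is Some p then if `[< clo p `<=` O >] then clo p else set0 else set0.
have HB j : [/\ forall m, Ck m setT (B j), forall x, 0 <= B j x <= 1 & forall x, ~ K j x -> B j x = 0].
  rewrite /B /K; case: unpickle => [p|].
    case: asboolP => _; first by have [] := Hb' p.
    by split => [m|x|//]; [exact: Ck_cst|rewrite lexx ler01].
  by split => [m|x|//]; [exact: Ck_cst|rewrite lexx ler01].
have KO j : K j `<=` O by rewrite /K; case: unpickle => [p|x []]; case: asboolP => // _ x [].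
have Kc j : compact (K j).
  rewrite /K; case: unpickle => [p|]; last exact: compact0.
  by case: asboolP => _; [exact: closed_cell_compact|exact: compact0].
have P01 N x : 0 <= \prod_(j < N) (1 - B j x) ^+ N <= 1.
  apply/andP; split; first by apply: prodr_ge0 => j _; apply: exprn_ge0; have [_ /(_ x)] := HB j; lra.
  apply: prodr_ile1 => j _; have [_ /(_ x) ? _] := HB j.
  by rewrite exprn_ge0 ?exprn_ile1; lra.
have phi0 N x : ~ (\big[setU/set0]_(j < N) K j) x -> 1 - \prod_(j < N) (1 - B j x) ^+ N = 0.
  move=> nK; rewrite big1 ?subrr// => j _; have [_ _ ->] := HB j; rewrite ?subr0 ?expr1n//.
  by move=> Kx; apply: nK; rewrite -bigcup_mkord; exists j => //=.
have sub N : \big[setU/set0]_(j < N) K j `<=` O by rewrite -bigcup_mkord => x [j _ /KO].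
exists (fun N x => 1 - \prod_(j < N) (1 - B j x) ^+ N); split.
- move=> N; split => [m|].
    apply: Ck_one_sub; apply: Ck_prod => j; apply: Ck_expr; apply: Ck_one_sub.
    by have [] := HB j.
  exists (\big[setU/set0]_(j < N) K j); split; first exact: bigsetU_compact.
    exact: subset_trans (sub N) OO.
  exact: phi0.
- by move=> N x; have := P01 N x; lra.
- by move=> N x nO; apply: phi0 => /sub.
- move=> x Ox.
  have [j Bj] : exists j, 0 < B j x.
    have /nbhs_ballP[r /= r0 rO] : nbhs x O by exact: open_nbhs_nbhs.
    have [p px pr] := ratcell_closed_small x r0; exists (pickle p); rewrite /B pickleK.
    rewrite asboolT; first by have [_ _ /(_ x px)] := Hb' p.
    by move=> y /pr yx; apply: rO; rewrite -ball_normE /ball_/= distrC.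
  have [_ /(_ x) Bj01 _] := HB j.
  rewrite -[X in _ --> X]subr0; apply: cvgB; first exact: cvg_cst.
  apply: (@squeeze_cvgr _ _ _ _ (cst 0) (GRing.exp (1 - B j x))); [|exact: cvg_cst|apply: cvg_expr; rewrite ger0_norm; lra].
  exists j.+1 => // N /= jN; have /andP[-> _] := P01 N x.
  rewrite (bigD1 (Ordinal jN))//= ler_piMr//; first by apply: exprn_ge0; lra.
  apply: prodr_ile1 => l _; have [_ /(_ x) ? _] := HB l.
  by rewrite exprn_ge0 ?exprn_ile1; lra.
Qed.

Lemma L1_indic_limit k (s : nat -> E -> R) (A : set T) : in_L1 Omega k -> measurable A ->
  (forall N, measurable_fun (Omega : set T) (s N : T -> R)) -> (forall N x, 0 <= s N x <= 1) ->
  {ae mu, forall x, Omega x -> s ^~ x @ \oo --> (\1_A x : R)} ->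
  (forall N, (\int[mu]_(x in Omega) (k x * s N x)%:E = 0)%E) ->
  (\int[mu]_(x in Omega) (k x * \1_A x)%:E = 0)%E.
Proof.
move=> Ik mA ms s01 sA s0.
have mk : measurable_fun (Omega : set T) (k : T -> R) by apply/measurable_EFinP; exact: measurable_int Ik.
have [|||||_ _] := @dominated_convergence _ _ _ mu Omega mO (fun N x => (k x * s N x)%:E)
   (fun x => (k x * \1_A x)%:E) (fun x => `|(k x)%:E|)%E.
- by move=> N; apply/measurable_EFinP; exact: measurable_funM mk (ms N).
- by apply/measurable_EFinP; apply: measurable_funM mk _; exact: measurable_indic.
- apply: ae_imp sA => x H Ox; apply: cvg_EFin; first by apply: nearW.
  by apply: cvgMr; exact: H.
- exact: integrable_abse.
- apply: nearW => x N _; rewrite /= lee_fin normrM ler_piMr//.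
  by have := s01 N x => ?; rewrite ger0_norm; lra.
under eq_fun do rewrite s0.
by move=> /cvg_lim <- //; rewrite lim_cst.
Qed.

(** The du Bois-Reymond lemma. Integrals over open sets vanish by [open_test_approx] and dominated
    convergence, those over a measurable set by a decreasing sequence of open sets whose
    intersection exceeds it by a null set. *)
Lemma test_determines k : in_L1 Omega k ->
  (forall phi, test phi -> \int[mu]_(x in Omega) (k x * phi x) = 0) ->
  ae_eq mu Omega (EFin \o k) (cst 0%E).
Proof.
move=> Ik H.
have mk : measurable_fun (Omega : set T) (k : T -> R) by apply/measurable_EFinP; exact: measurable_int Ik.
have HO (O : set E) : open O -> O `<=` Omega -> (\int[mu]_(x in Omega) (k x * \1_O x)%:E = 0)%E.
  move=> oO OO; have [phi [tp p01 p0 p1]] := open_test_approx oO OO.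
  apply: (@L1_indic_limit k phi O Ik) => //.
  - exact: open_measurableRn.
  - move=> N; apply: measurable_funTS; apply: continuous_measurableRn; exact: test_continuous (tp N).
  - apply: nearW => x _; rewrite indicE; have [Ox|nO] := pselect (O x).
      by rewrite mem_set//; exact: p1.
    rewrite memNset// mulr0n (_ : phi^~ x = cst 0); first exact: cvg_cst.
    by apply/funext => N; exact: p0.
  - move=> N; have Ip := L1_mul Ik (smooth_cc_cc (test_smooth (tp N))).
    rewrite -[LHS]fineK; last exact: integrable_fin_num Ip.
    by congr EFin; exact: H.
apply: (integral_ae_eq mO Ik) => [|A AO mA]; first exact: measurable_cst.
rewrite integral0.
have fA : (mu A < +oo)%E by apply: le_lt_trans (measure_Omega_lty Ob); exact: outer_le.
have i0 (m : nat) : 0 < m.+1%:R^-1 :> R by rewrite invr_gt0 ltr0n.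
have /choice[V HOj] (j : nat) := leb_outer_regular fA (i0 j).
pose U := fix U N : set E := if N is N'.+1 then U N' `&` V N' else Omega.
have HU N : [/\ open (U N), A `<=` U N & U N `<=` Omega].
  elim: N => [|N [oU AU UO]] /=; first by split; [exact: Oo|exact: AO|exact: subset_refl].
  have [oN AN _] := HOj N; split => [|x Ax|x [/UO]//].
    exact: openI.
  by split; [exact: AU|exact: AN].
have U_le N m : U (N + m)%N `<=` U N by elim: m => [|m IH]; rewrite ?addn0// addnS => x [/IH].
have null : mu ((\bigcap_N U N) `\` A) = 0%E.
  apply/eqP; rewrite eq_le measure_ge0 andbT; apply/lee_addgt0Pr => e e0; rewrite add0e.
  have [j je] : exists j : nat, j.+1%:R^-1 < e.
    by exists (Num.truncn e^-1); rewrite invf_plt ?posrE// truncnS_gt.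
  have [oj Aj mj] := HOj j; apply: (@le_trans _ _ (mu (V j `\` A))).
    by apply: outer_le => x [Ux nA]; split => //; have [] := Ux j.+1 I.
  have Ojoo : (mu (V j) < +oo)%E.
    by apply: (le_lt_trans mj); apply: lte_add_pinfty => //; exact: ltry.
  rewrite (measureD (open_measurableRn oj) mA Ojoo) (setIidr Aj) leeBlDl; last first.
    by rewrite ge0_fin_numE.
  by apply: (le_trans mj); apply: leeD => //; rewrite lee_fin ltW.
have -> : (\int[mu]_(x in A) (k x)%:E = \int[mu]_(x in Omega) (k x * \1_A x)%:E)%E.
  rewrite -{1}(setIidr AO) integral_mkcondr; apply: eq_integral => x _; rewrite patchE indicE.
  by case: ifPn => xA; rewrite ?mulr1 ?mulr0.
clearbody U; apply: (@L1_indic_limit k (fun N x => \1_(U N) x) A Ik mA).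
- move=> N; apply: measurable_funTS; apply: measurable_indic; apply: open_measurableRn.
  by have [] := HU N.
- by move=> N x; rewrite indicE; case: (_ \in _); rewrite ?lexx ?ler01.
- exists ((\bigcap_N U N) `\` A); split => //; first exact: null_measurableRn.
  move=> x /= /not_implyP[Ox nx]; apply: contrapT => nUA; apply: nx.
  have [Ax|nA] := pselect (A x).
    rewrite (_ : (fun N => _) = cst (\1_A x)); first exact: cvg_cst.
    by apply/funext => N; rewrite !indicE !mem_set//; have [_ AU _] := HU N; exact: AU.
  have [N nU] : exists N, ~ U N x.
    by apply: contrapT => /forallNP H'; apply: nUA; split => // N _; apply: contrapT; exact: H'.
  apply: cvg_near_cst; exists N => // m /= Nm; rewrite !indicE !memNset//.
  by rewrite -(subnKC Nm) => /U_le.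
- by move=> N; have [oU _ UO] := HU N; exact: HO.
Qed.

Lemma weak_grad_unique u (g1 g2 : E -> E) : is_weak_grad Omega u g1 -> is_weak_grad Omega u g2 ->
  {ae mu, forall x, Omega x -> g1 x = g2 x}.
Proof.
move=> [L1 H1] [L2 H2].
have H i : {ae mu, forall x, Omega x -> g1 x 0 i = g2 x 0 i}.
  have [Ii _] := L1_lin 1 (-1) (L1 i) (L2 i).
  apply: ae_imp (test_determines Ii _) => [x H Ox|phi tp].
    by have := H Ox => -[]; rewrite mul1r mulN1r => /eqP; rewrite subr_eq0 => /eqP.
  have cp := smooth_cc_cc (test_smooth tp).
  transitivity (\int[mu]_(x in Omega) (1 * (g1 x 0 i * phi x) + -1 * (g2 x 0 i * phi x))).
    by congr Rintegral; apply/funext => x; ring.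
  rewrite (L1_lin 1 (-1) (L1_mul (L1 i) cp) (L1_mul (L2 i) cp)).2 mul1r mulN1r.
  by rewrite -[X in X - _]opprK -H1// -[X in _ - X]opprK -H2// subrr.
apply: ae_imp (ae_ord H) => x Hx Ox; apply/rowP => i; exact: Hx.
Qed.

Lemma L1_abs f : in_L1 Omega f -> in_L1 Omega (fun x => `|f x|).
Proof. exact: integrable_norm. Qed.

Lemma fine_L1 f : in_L1 Omega f -> (\int[mu]_(x in Omega) (f x)%:E = (\int[mu]_(x in Omega) f x)%:E)%E.
Proof. by move=> If; rewrite /Rintegral fineK//; exact: integrable_fin_num. Qed.

Lemma L1_test_bound f phi (M : R) : in_L1 Omega f -> cc phi -> (forall x, `|phi x| <= M) ->
  `|\int[mu]_(x in Omega) (f x * phi x)| <= M * \int[mu]_(x in Omega) `|f x|.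
Proof.
move=> If cp HM; have Im := L1_mul If cp; apply: (le_trans (le_normr_Rintegral mO Im)).
rewrite -(RintegralZl _ mO (L1_abs If)); apply: le_Rintegral => //; first exact: L1_abs.
  by have := integrableZl mO M (L1_abs If).
by move=> x _; rewrite normrM mulrC ler_wpM2r.
Qed.

(** Approximation in the Sobolev norm with the gradient [g] given in advance, instead of the one
    chosen by [weak_grad]. *)
Definition approximable u (g : E -> E) := forall e : R, 0 < e -> exists2 phi, test phi &
  \int[mu]_(x in Omega) `|u x - phi x| <= e /\
  forall i, \int[mu]_(x in Omega) `|g x 0 i - partial i phi x| <= e.

Lemma approximable_weak_grad u (g : E -> E) : in_L1 Omega u -> (forall i, in_L1 Omega (fun x => g x 0 i)) ->
  approximable u g -> is_weak_grad Omega u g.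
Proof.
move=> Iu Ig Ha; split => // psi tpsi i.
have cp := smooth_cc_cc (test_smooth tpsi); have cdp := smooth_cc_cc (smooth_partial i (test_smooth tpsi)).
have [M M0 HM] := cc_bound cp; have [M' M'0 HM'] := cc_bound cdp.
apply/eqP; rewrite -subr_eq0 opprK -normr_le0; apply/ler_addgt0Pr => e e0; rewrite add0r.
have MM : 0 < M + M' by rewrite addr_gt0.
have [phi tp [h1 h2]] := Ha (e / (M + M')) (divr_gt0 e0 MM).
have [_ /(_ psi tpsi i)] := test_weak_grad tp.
have Ip := test_L1 tp; have Idp := test_L1 (test_partial i tp).
rewrite (_ : (fun x => grad phi x 0 i * psi x) = fun x => partial i phi x * psi x); last first.
  by apply/funext => x; rewrite mxE.
move=> W.
have [Id Ed] := L1_lin 1 (-1) (L1_mul Iu cdp) (L1_mul Ip cdp).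
have [Id' Ed'] := L1_lin 1 (-1) (L1_mul (Ig i) cp) (L1_mul Idp cp).
have -> : \int[mu]_(x in Omega) (u x * partial i psi x) + \int[mu]_(x in Omega) (g x 0 i * psi x) =
  \int[mu]_(x in Omega) ((u x - phi x) * partial i psi x) +
  \int[mu]_(x in Omega) ((g x 0 i - partial i phi x) * psi x).
  transitivity ((1 * \int[mu]_(x in Omega) (u x * partial i psi x) - 1 * \int[mu]_(x in Omega) (phi x * partial i psi x)) +
     (1 * \int[mu]_(x in Omega) (g x 0 i * psi x) - 1 * \int[mu]_(x in Omega) (partial i phi x * psi x))).
    by rewrite W; ring.
  rewrite -mulNr -Ed -mulNr -Ed'.
  by congr (_ + _); congr Rintegral; apply/funext => x; ring.
have L1 : in_L1 Omega (fun x => u x - phi x).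
  by have := integrableB mO Iu Ip.
have L2 : in_L1 Omega (fun x => g x 0 i - partial i phi x).
  by have := integrableB mO (Ig i) Idp.
apply: (le_trans (ler_normD _ _)).
have b1 := L1_test_bound L1 cdp HM'; have b2 := L1_test_bound L2 cp HM.
have c1 : M' * \int[mu]_(x in Omega) `|u x - phi x| <= M' * (e / (M + M')) by rewrite ler_pM2l.
have c2 : M * \int[mu]_(x in Omega) `|g x 0 i - partial i phi x| <= M * (e / (M + M')) by rewrite ler_pM2l.
have -> : e = M' * (e / (M + M')) + M * (e / (M + M')) by field; rewrite gt_eqF.
by apply: lerD; [apply: le_trans b1 c1|apply: le_trans b2 c2].
Qed.

Lemma ae_eq_Rint f g : {ae mu, forall x, Omega x -> f x = g x} -> in_L1 Omega f -> in_L1 Omega g ->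
  \int[mu]_(x in Omega) f x = \int[mu]_(x in Omega) g x.
Proof.
move=> H If Ig; congr fine; apply: (@ae_eq_integral _ T R mu Omega (EFin \o (g : T -> R)) (EFin \o (f : T -> R)) mO).
- exact: measurable_int If.
- exact: measurable_int Ig.
- by apply: ae_imp H => x Hx Ox; rewrite /= Hx.
Qed.

Lemma weak_gradP u (g : E -> E) : is_weak_grad Omega u g -> is_weak_grad Omega u (weak_grad Omega u).
Proof. by move=> H; apply: (@xgetPex _ (fun=> 0) [set g | is_weak_grad Omega u g]); exists g. Qed.

(** The norm refers to the weak gradient chosen for the difference; uniqueness almost everywhere
    identifies it with the difference of the gradients. *)
Lemma W11_norm_sub u (g : E -> E) phi : in_L1 Omega u -> is_weak_grad Omega u g -> test phi ->
  W11_norm Omega (u \- phi) = (\int[mu]_(x in Omega) `|u x - phi x| +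
    \sum_(i < n) \int[mu]_(x in Omega) `|g x 0 i - partial i phi x|)%:E.
Proof.
move=> Iu Wu tp; have [Lu _] := Wu; have Ip := test_L1 tp.
have W0 := weak_grad_lin 1 (-1) Iu Ip Wu (test_weak_grad tp).
have W : is_weak_grad Omega (u \- phi) (fun x => 1 *: g x + -1 *: grad phi x).
  by rewrite (_ : u \- phi = fun x => 1 * u x + -1 * phi x)//; apply/funext => x /=; ring.
have U := weak_grad_unique (weak_gradP W) W; have [LW _] := weak_gradP W.
have Id : in_L1 Omega (fun x => u x - phi x) by have := integrableB mO Iu Ip.
rewrite /W11_norm (fine_L1 (L1_abs Id)) EFinD; congr (_ + _)%E.
rewrite -sumEFin; apply: eq_bigr => i _; rewrite (fine_L1 (L1_abs (LW i))); congr EFin.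
apply: ae_eq_Rint; last 2 first.
- exact: L1_abs.
- by apply: L1_abs; have := integrableB mO (Lu i) (test_L1 (test_partial i tp)).
by apply: ae_imp U => x Hx Ox; rewrite Hx// !mxE mul1r mulN1r.
Qed.

Lemma W110_approximable u : W110 Omega u -> [/\ in_L1 Omega u, is_weak_grad Omega u (weak_grad Omega u) &
  approximable u (weak_grad Omega u)].
Proof.
move=> [[Iu [g /weak_gradP Wu]] Ha]; split => // e /Ha[phi tp].
have nn i : 0 <= \int[mu]_(x in Omega) `|weak_grad Omega u x 0 i - partial i phi x| by apply: Rintegral_ge0.
rewrite (W11_norm_sub Iu Wu tp) lte_fin => lte; exists phi => //; split.
  by apply: ltW; apply: le_lt_trans lte; rewrite lerDl sumr_ge0.
move=> i; apply: ltW; apply: le_lt_trans lte; rewrite (bigD1 i)//= addrCA lerDl.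
by rewrite addr_ge0 ?sumr_ge0//; apply: Rintegral_ge0.
Qed.

Lemma approximable_W110 u (g : E -> E) : in_L1 Omega u -> (forall i, in_L1 Omega (fun x => g x 0 i)) ->
  approximable u g -> W110 Omega u /\ {ae mu, forall x, Omega x -> weak_grad Omega u x = g x}.
Proof.
move=> Iu Ig Ha; have Wu := approximable_weak_grad Iu Ig Ha; split; last first.
  exact: weak_grad_unique (weak_gradP Wu) Wu.
split; first by split => //; exists g.
move=> e e0; have n1 : 0 < n%:R + 2 :> R by rewrite ltr_wpDl.
have [phi tp [h1 h2]] := Ha (e / (n%:R + 2)) (divr_gt0 e0 n1); exists phi => //.
rewrite (W11_norm_sub Iu Wu tp) lte_fin.
apply: (@le_lt_trans _ _ (e / (n%:R + 2) + n%:R * (e / (n%:R + 2)))).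
  apply: lerD => //; rewrite mulr_natl -[X in _ <= _ *+ X](card_ord n) -sumr_const.
  by apply: ler_sum.
rewrite -{1}[e / _]mul1r -mulrDl mulrA ltr_pdivrMr// mulrC ltr_pM2l//; lra.
Qed.

End weak_gradients.

(** * The distance is a Sobolev function *)

Section bounded_limits.
Variables (R : realType) (n : nat) (Omega : set 'rV[R]_n).
Local Notation E := 'rV[R]_n.
Local Notation T := (lebesgueRn R n).
Local Notation mu := (@leb R n).
Hypotheses (Oo : open Omega) (Ob : bounded_set Omega).

Let mO : measurable (Omega : set T) := measurable_Omega Oo.

Lemma bounded_L1 (f : E -> R) (M : R) : measurable_fun (Omega : set T) (f : T -> R) ->
  (forall x, Omega x -> `|f x| <= M) -> in_L1 Omega f.
Proof.
move=> mf HM; apply: measurable_bounded_integrable => //; first exact: measure_Omega_lty.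
exists M; split; first exact: num_real.
by move=> s Ms x /= Ox; apply: (le_trans (HM x Ox)); exact: ltW.
Qed.

Lemma bounded_cvg_L1 (s : nat -> E -> R) (M e : R) :
  (forall N, measurable_fun (Omega : set T) (s N : T -> R)) ->
  (forall N x, Omega x -> `|s N x| <= M) ->
  {ae mu, forall x, Omega x -> s ^~ x @ \oo --> (0 : R)} -> 0 < e ->
  \forall N \near \oo, \int[mu]_(x in Omega) `|s N x| <= e.
Proof.
move=> ms HM s0 e0.
have [|||||_ _] := @dominated_convergence _ _ _ mu Omega mO (fun N x => `|s N x|%:E)
   (fun x => 0%E) (fun x => M%:E).
- by move=> N; apply/measurable_EFinP; apply: measurableT_comp (ms N).
- exact: measurable_cst.
- apply: ae_imp s0 => x H Ox; apply: cvg_EFin; first by apply: nearW.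
  by rewrite -(normr0 R); apply: cvg_norm; exact: H.
- apply: (@bounded_L1 (fun=> M) `|M|) => //; exact: measurable_cst.
- by exists set0; split => // x /= nH; apply: nH => N Ox; rewrite lee_fin normr_id; exact: HM.
rewrite integral0 => /fine_cvgP[_] /(@cvgrPdist_le _ _ _ _)/(_ e e0).
apply: filterS => N /=; rewrite sub0r normrN; exact: le_trans (ler_norm _).
Qed.

Lemma approximable_of_cvg (u : E -> R) (g : E -> E) (phi : nat -> E -> R) (M : R) :
  measurable_fun (Omega : set T) (u : T -> R) ->
  (forall i, measurable_fun (Omega : set T) ((fun x => g x 0 i) : T -> R)) ->
  (forall N, test_function Omega (phi N)) ->
  (forall N x, Omega x -> `|u x - phi N x| <= M) ->
  (forall N i x, Omega x -> `|g x 0 i - partial i (phi N) x| <= M) ->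
  {ae mu, forall x, Omega x -> (fun N => u x - phi N x) @ \oo --> (0 : R)} ->
  (forall i, {ae mu, forall x, Omega x -> (fun N => g x 0 i - partial i (phi N) x) @ \oo --> (0 : R)}) ->
  approximable Omega u g.
Proof.
move=> mu_ mg tp b1 b2 c1 c2 e e0.
have cm N : measurable_fun (Omega : set T) (phi N : T -> R).
  by apply: measurable_funTS; apply: continuous_measurableRn; exact: test_continuous (tp N).
have cdm i N : measurable_fun (Omega : set T) (partial i (phi N) : T -> R).
  by apply: measurable_funTS; apply: continuous_measurableRn; exact: test_continuous (test_partial i (tp N)).
have n1 := @bounded_cvg_L1 (fun N x => u x - phi N x) M e (fun N => measurable_funB mu_ (cm N)) b1 c1 e0.
have n2 i := @bounded_cvg_L1 (fun N x => g x 0 i - partial i (phi N) x) M e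
   (fun N => measurable_funB (mg i) (cdm i N)) (fun N x => @b2 N i x) (c2 i) e0.
have {}n2 : \forall N \near \oo, forall i, \int[mu]_(x in Omega) `|g x 0 i - partial i (phi N) x| <= e.
  exact: filter_forall.
have [N [h1 h2]] := filter_ex (filterI n1 n2).
by exists (phi N).
Qed.

End bounded_limits.

Section distance_W110.
Variables (R : realType) (n : nat) (Omega K : set 'rV[R]_n).
Local Notation E := 'rV[R]_n.
Local Notation T := (lebesgueRn R n).
Local Notation mu := (@leb R n).
Local Notation sf := (gauge (polar K)).
Local Notation S := (boundary Omega).
Local Notation d := (minkowski_dist Omega K).
Local Notation ds := (signed_dist Omega K).
Local Notation pr := (mproj Omega K).
Local Notation reaches := (reaches Omega K).
Local Notation Nu := (unit_bnormal Omega K).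
Hypotheses (bK : convex_body K) (KC2 : C2_boundary K).
Hypotheses (O0 : Omega !=set0) (Ob : bounded_set Omega) (Oo : open Omega)
  (OC2 : C2_boundary Omega) (n2 : (2 <= n)%N).
Hypothesis mu0 : mu [set: T] <> 0%E.
Let bP := convex_body_polar bK.
Let n0 : (0 < n)%N := ltnW n2.
Implicit Types (x y z v w p q : E).

Lemma signed_dist_Omega x : Omega x -> ds x = d x.
Proof. by move=> Ox; rewrite signed_dist_in//; exact: subset_closure. Qed.

Lemma signed_dist_le0 x : ~ Omega x -> ds x <= 0.
Proof.
move=> nO; have [cx|nc] := pselect (closure Omega x).
  rewrite signed_dist_in// (mdist0 bK O0 Ob Oo n0)//.
  by rewrite boundaryE.
rewrite /signed_dist memNset// oppr_le0; apply: lb_le_inf.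
  by have [z Oz] := O0; exists (sf (z - x)), z => //; exact: subset_closure.
by move=> _ [z _ <-]; exact: gauge_ge0.
Qed.

Section trunc.
Variables (C : R) (C0 : 0 < C) (HC : forall x z, `|ds x - ds z| <= C * `|x - z|).

(** Vanishing where [ds <= e] leaves room for a mollification with support inside [Omega]. *)
Definition dtrunc (e : R) x : R := Num.max 0 (ds x - e).

Lemma dtrunc_lip e x z : `|dtrunc e x - dtrunc e z| <= C * `|x - z|.
Proof. by apply: (le_trans (pos_lip _ _)); rewrite opprB addrA subrK. Qed.

Lemma signed_dist_continuous : continuous ds.
Proof. exact: lipschitz_row_continuous C0 HC. Qed.

Lemma dtrunc_cc e : 0 < e -> cc (dtrunc e).
Proof.
move=> e0; split; first exact: lipschitz_row_continuous C0 (dtrunc_lip e).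
have /pinfty_ex_gt0[B B0 HB] := Ob; exists (B + 1) => [|x Bx]; first by rewrite addr_gt0.
have [Ox|nO] := pselect (Omega x); first by have := HB x Ox; rewrite /=; lra.
by rewrite /dtrunc max_l//; have := signed_dist_le0 nO; lra.
Qed.

(** Within the radius of the kernel [ds] varies by at most [e / 2], so the mollified function still
    vanishes where [ds < e / 2]. *)
Definition dapprox (e : R) : E -> R := mollify (dtrunc e) (kern (e / (2 * C))).

Let de0 e : 0 < e -> 0 < e / (2 * C).
Proof. by move=> e0; rewrite divr_gt0// mulr_gt0. Qed.

Let deC e : C * (e / (2 * C)) = e / 2.
Proof. by field; rewrite gt_eqF. Qed.

Lemma dapprox_test e : 0 < e -> test_function Omega (dapprox e).
Proof.
move=> e0; split => [k|]; first by rewrite /dapprox; apply: mollify_Ck; [exact: dtrunc_cc|exact: kern_smooth (de0 e0)].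
exists [set x | e / 2 <= ds x]; split.
- have /pinfty_ex_gt0[B B0 HB] := Ob; apply: bounded_closed_compact.
    exists B; split; first exact: num_real.
    move=> s Bs x /= ex; apply: le_trans (ltW Bs); apply: HB; apply: contrapT => /signed_dist_le0; lra.
  rewrite (_ : [set x | _] = ds @^-1` [set s | e / 2 <= s])//.
  by apply: closed_comp => [x _|]; [exact: signed_dist_continuous|exact: closed_ge].
- by move=> x /= ex; apply: contrapT => /signed_dist_le0; lra.
- move=> x /= /negP; rewrite -ltNge => xe; apply/eqP; rewrite -normr_le0 -[X in `|X|]subr0.
  apply: (mollify_near mu0 (de0 e0) (dtrunc_cc e0)) => z zr; rewrite subr0 normr_le0; apply/eqP.
  rewrite /dtrunc max_l//; have := HC (x + z) x; rewrite [x + z]addrC addrK => h.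
  have : C * `|z| <= C * (e / (2 * C)) by rewrite ler_pM2l// ltW.
  rewrite deC; have := ler_norm (ds (z + x) - ds x); lra.
Qed.

Lemma dapprox_close e x : 0 < e -> Omega x -> `|d x - dapprox e x| <= 2 * e.
Proof.
move=> e0 Ox; rewrite distrC; apply: (mollify_near mu0 (de0 e0) (dtrunc_cc e0)) => z zr.
have := dtrunc_lip e (x + z) x; rewrite [x + z]addrC addrK => h.
have h2 : C * `|z| <= C * (e / (2 * C)) by rewrite ler_pM2l// ltW.
rewrite deC in h2; have dx0 := mdist_pos bK O0 Ob Oo n0 Ox.
have h3 : `|dtrunc e x - d x| <= e.
  rewrite /dtrunc (signed_dist_Omega Ox) maxEle; case: ifP => h'; first by rewrite addrAC subrr sub0r normrN gtr0_norm.
  by rewrite sub0r normrN gtr0_norm//; move/negbT: h'; rewrite -ltNge; lra.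
rewrite -[_ - d x](subrKA (dtrunc e x)); apply: (le_trans (ler_normD _ _)); lra.
Qed.

Lemma dapprox_partial_bound e i x : 0 < e -> `|partial i (dapprox e) x| <= C.
Proof.
move=> e0; rewrite -[X in `|X|]subr0.
apply: (mollify_partial_near mu0 (de0 e0) ltr01 (dtrunc_cc e0)) => t z t1 zr.
rewrite mulr0 subr0; apply: (le_trans (dtrunc_lip _ _ _)); rewrite ler_pM2l//.
rewrite (_ : x + t *: 'e_i + z - (x + z) = t *: 'e_i); last first.
  by rewrite opprD addrACA subrr addr0 addrC addKr.
rewrite normrZ ler_piMr//.
exact: norm_delta_le.
Qed.

(** Strict differentiability controls the increments between all pairs of points near [x], hence
    their averages; for small [e'] these points lie where [dtrunc] is [d] minus a constant. *)
Lemma dapprox_partial_near i x (e : R) : reaches 0 x -> 0 < e -> exists2 s, 0 < s &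
  forall e', 0 < e' -> e' < s -> `|partial i (dapprox e') x - partial i d x| <= e.
Proof.
move=> rx e0; have [Ox _] := rx; have sd := reach_sderiv bK KC2 O0 Ob Oo OC2 n2 rx.
have [r r0 Hr] := sderiv_near sd e0.
have /nbhs_ballP[r' /= r'0 rO] : nbhs x Omega by exact: open_nbhs_nbhs.
have dx0 := mdist_pos bK O0 Ob Oo n0 Ox.
set q := d x / (2 * C); have q0 : 0 < q by rewrite divr_gt0// mulr_gt0.
pose r1 := Num.min q (Num.min r r'); have r10 : 0 < r1 by rewrite !lt_min q0 r0.
have near z : `|z| < r1 -> [/\ Omega (x + z), `|x + z - x| < r & d x / 2 < d (x + z)].
  rewrite !lt_min => /and3P[zq zr zr'].
  have Oz : Omega (x + z).
    by apply: rO; rewrite -ball_normE /ball_/= opprD addrA subrr sub0r normrN.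
  split => //; first by rewrite [x + z]addrC addrK.
  have := HC (x + z) x; rewrite !signed_dist_Omega// [x + z]addrC addrK => h.
  have : C * `|z| < C * q by rewrite ltr_pM2l.
  have -> : C * q = d x / 2 by rewrite /q; field; rewrite gt_eqF.
  by have := ler_norm (d x - d (z + x)); rewrite distrC in h; lra.
exists (Num.min (d x / 2) (C * r1)) => [|e' e'0]; first by rewrite lt_min divr_gt0// mulr_gt0.
rewrite lt_min => /andP[ed er].
rewrite (_ : partial i d x = Nu (pr x) 0 i); last by rewrite -(sderiv_grad sd) mxE.
have r12 : 0 < r1 / 2 by rewrite divr_gt0.
apply: (mollify_partial_near mu0 (de0 e'0) r12 (dtrunc_cc e'0)) => t z t1 zr.
have zr1 : `|z| < r1 / 2.
  apply: (lt_trans zr); rewrite ltr_pdivrMr ?mulr_gt0//; lra.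
have nt : `|t *: ('e_i : E)| <= `|t|.
  rewrite normrZ ler_piMr//.
  exact: norm_delta_le.
have [|O1 H1 D1] := near z; first lra.
have [|O2 H2 D2] := near (t *: 'e_i + z); first by have := ler_normD (t *: ('e_i : E)) z; lra.
rewrite addrA in O2 H2 D2.
rewrite /dtrunc !signed_dist_Omega// !max_r ?subr_ge0 ?(ltW (lt_trans ed D1)) ?(ltW (lt_trans ed D2))//.
rewrite opprB addrA subrK; have := Hr _ _ H2 H1.
rewrite (_ : x + t *: 'e_i + z - (x + z) = t *: 'e_i); last first.
  by rewrite opprD addrACA subrr addr0 addrC addKr.
rewrite dotpZr dotp_delta => h; apply: (le_trans h).
by rewrite ler_pM2l.
Qed.

End trunc.

Theorem mdist_W110 : W110 Omega d /\
  {ae mu, forall x, Omega x -> weak_grad Omega d x = Nu (pr x) /\ S (pr x)}.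
Proof.
have [C C0 HC] := signed_dist_lip bK O0 Ob Oo n0.
pose e N : R := N.+1%:R^-1; have e0 N : 0 < e N by rewrite invr_gt0 ltr0n.
(* Outside [reaches 0] the gradient is set to 0; on this set it is the pointwise limit of the
   gradients of the [phi N], hence measurable. *)
pose phi N := dapprox C (e N); pose g x : E := \row_i ((partial i d \_ (reaches 0)) x).
have mO : measurable (Omega : set T) := measurable_Omega Oo.
have mr : measurable (reaches 0 : set T) by exact: (measurable_reaches bK KC2 O0 Ob Oo OC2 n2).
have tp N : test_function Omega (phi N) by exact: (dapprox_test C0 HC).
have cv i x : reaches 0 x -> (fun N => partial i (phi N) x) @ \oo --> (partial i d x : R).
  move=> rx; apply/cvgrPdist_le => e1 e10.
  have [s s0 Hs] := dapprox_partial_near C0 HC i rx e10.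
  have := near_infty_natSinv_lt (PosNum s0); apply: filterS => N /= Ns.
  by rewrite distrC; exact: Hs.
have cdm i N : measurable_fun (reaches 0 : set T) (partial i (phi N) : T -> R).
  by apply: measurable_funTS; apply: continuous_measurableRn; exact: test_continuous (test_partial i (tp N)).
have mg i : measurable_fun (setT : set T) ((fun x => g x 0 i) : T -> R).
  rewrite (_ : (fun x => _) = (partial i d \_ (reaches 0))); last by apply/funext => x; rewrite mxE.
  by apply/(measurable_restrictT _ mr); apply: (measurable_fun_cvg (cdm i)) => x; exact: cv.
have gC x i : `|g x 0 i| <= C.
  rewrite mxE patchE; case: ifPn => [|_]; last by rewrite normr0 ltW.
  rewrite inE => rx; have sd := reach_sderiv bK KC2 O0 Ob Oo OC2 n2 rx.
  apply/ler_addgt0Pr => e1 e10; have [s s0 Hs] := dapprox_partial_near C0 HC i rx e10.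
  have s20 : 0 < s / 2 by rewrite divr_gt0.
  have := Hs (s / 2) s20; rewrite ltr_pdivrMr// ltr_pMr// ltr1n => /(_ isT).
  rewrite distrC => h; rewrite -[partial i d x](subrK (partial i (dapprox C (s / 2)) x)).
  apply: (le_trans (ler_normD _ _)); rewrite addrC; apply: lerD => //.
  exact: (dapprox_partial_bound C0 HC i x s20).
have nr : {ae mu, forall x, Omega x -> reaches 0 x}.
  exists (Omega `\` reaches 0); split.
  - exact: measurableD.
  - exact: (nonreach_null bK KC2 O0 Ob Oo OC2 n2).
  - by move=> x /= /not_implyP.
have md : measurable_fun (Omega : set T) (d : T -> R).
  by apply: measurable_funTS; apply: continuous_measurableRn; exact: (mdist_continuous bK O0 Ob Oo n2).
have [B B0 HB] := mdist_bounded bK O0 Ob Oo n2.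
have HB' x : Omega x -> `|d x| <= B.
  by move=> Ox; rewrite ger0_norm ?HB//; exact: (mdist_nonneg bK O0 Ob Oo n0).
have e1 N : e N <= 1 by rewrite invf_le1 ?ltr0n// ler1n.
have [|Wd Hg] := @approximable_W110 _ _ Omega Oo Ob d g (bounded_L1 Oo Ob md HB')
  (fun i => bounded_L1 Oo Ob (measurable_funTS (mg i)) (M := C) (fun x _ => gC x i)).
- apply: (@approximable_of_cvg _ _ Omega Oo Ob d g phi (2 + 2 * C) md (fun i => measurable_funTS (mg i)) tp).
  + move=> N x Ox; apply: (le_trans (dapprox_close C0 HC (e0 N) Ox)).
    by have := e1 N; lra.
  + move=> N i x Ox; apply: (le_trans (ler_normB _ _)).
    by have := gC x i; have := dapprox_partial_bound C0 HC i x (e0 N); rewrite -/(phi N); lra.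
  + exists set0; split => // x /= nH; apply: nH => Ox.
    apply/cvgrPdist_le => r r0; have r20 : 0 < r / 2 by rewrite divr_gt0.
    have := near_infty_natSinv_lt (PosNum r20); apply: filterS => N /= Ns.
    rewrite sub0r normrN; apply: (le_trans (dapprox_close C0 HC (e0 N) Ox)).
    by have h : e N < r / 2 := Ns; lra.
  + move=> i; apply: ae_imp nr => x Hx Ox; have rx := Hx Ox.
    rewrite mxE patchE mem_set// -(subrr (partial i d x)); apply: cvgB; first exact: cvg_cst.
    exact: cv.
split => //; apply: ae_imp (ae_and nr Hg) => x [Hr Hx] Ox; have rx := Hr Ox.
rewrite Hx//; split; last by have [] := mprojP bK O0 Ob Oo n2 x.
rewrite -(sderiv_grad (reach_sderiv bK KC2 O0 Ob Oo OC2 n2 rx)).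
by apply/rowP => i; rewrite !mxE patchE mem_set.
Qed.

End distance_W110.

(** * Lipschitz representatives *)

Section L1_mollify.
Variables (R : realType) (n : nat).
Local Notation E := 'rV[R]_n.
Local Notation T := (lebesgueRn R n).
Local Notation mu := (@leb R n).
Implicit Types (x y z w h : E) (f g eta phi psi : E -> R) (i : 'I_n).
Local Notation int f := (mu.-integrable [set: T] (EFin \o (f : T -> R))).

Lemma open_norm_ball (c : E) (r : R) : open [set x : E | `|x - c| < r].
Proof.
rewrite (_ : [set x : E | _] = ball c r); first exact: ball_open.
by rewrite -ball_normE; apply/seteqP; split => x /=; rewrite distrC.
Qed.

Lemma finite_ball_cover (r s : R) : 0 < s -> exists l : seq E,
  forall z, `|z| <= r -> exists2 c, c \in l & `|z - c| < s.
Proof.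
move=> s0; have : compact [set z : E | `|z| <= r].
  apply: bounded_closed_compact.
    exists r; split; first exact: num_real.
    by move=> t rt x /= xr; apply: (le_trans xr); exact: ltW.
  rewrite (_ : [set x | _] = (fun x : E => `|x|) @^-1` [set t | t <= r])//.
  by apply: closed_comp => [x _|]; [exact: norm_continuous|exact: closed_le].
rewrite compact_cover => /(_ _ setT (fun c : E => [set z : E | `|z - c| < s]))[].
- by move=> c _; exact: open_norm_ball.
- by move=> z _; exists z => //=; rewrite subrr normr0.
move=> D _ HD; exists (finmap.enum_fset D) => z /HD[c /= cD zc]; exists c => //.
Qed.

Lemma masked_int eta (D : set E) : measurable (D : set T) -> cc eta -> int (fun z => \1_D z * eta z).
Proof.
move=> mD ce; have [M M0 HM] := cc_bound ce; have [N N0 eN] := ce.2.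
apply: (@int_bounded _ _ _ M N) => [|x|x /eN ->]; last by rewrite mulr0.
  by apply: measurable_funM; [exact: measurable_indic|exact: continuous_measurableRn ce.1].
by rewrite normrM indicE; case: (_ \in _); rewrite ?normr1 ?mul1r// normr0 mul0r ltW.
Qed.

(** Takes the place of Fubini's theorem in [mollify_L1]. The set [D] is cut along the balls of
    radius [s] about the centres in [l], and on each piece [phi (x + z)] differs from [phi (x + c)]
    by at most [e]. The majorant [A] combines translates of the absolute value of [phi], weighted by
    the kernel masses of the pieces. *)
Lemma masked_mollify_bound phi eta (s e : R) : cc phi -> cc eta -> (forall z, 0 <= eta z) -> 0 <= e ->
  (forall a b, `|a - b| < s -> `|phi a - phi b| <= e) ->
  forall (l : seq E) (D : set E), measurable (D : set T) ->
  (forall z, D z -> exists2 c, c \in l & `|z - c| < s) ->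
  exists A : E -> R, [/\ cc A, forall x, 0 <= A x, \int[mu]_x A x = \int[mu]_z (\1_D z * eta z) * \int[mu]_x `|phi x| &
    forall x, `|\int[mu]_z (phi (x + z) * (\1_D z * eta z))| <= A x + e * \int[mu]_z (\1_D z * eta z)].
Proof.
move=> cp ce e0 ee Hs; elim => [|c l IH] D mD HD.
  have D0 : D = set0 by apply/seteqP; split => // z /HD[].
  exists (fun=> 0); rewrite D0.
  have z1 : (fun z : T => \1_(set0 : set E) z * eta z) = fun=> 0.
    by apply/funext => z; rewrite indicE memNset// mul0r.
  have z2 x : (fun z : T => phi (x + z) * (\1_(set0 : set E) z * eta z)) = fun=> 0.
    by apply/funext => z; rewrite indicE memNset// mul0r mulr0.
  have i0 : \int[mu]_(x in [set: T]) (0 : R) = 0 by rewrite /Rintegral integral0.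
  split; last by move=> x; rewrite z1 z2 i0 mulr0 addr0 normr0.
    by split; [move=> x; exact: cst_for|exists 1].
    by [].
  by rewrite z1 i0 mul0r.
pose B : set E := [set x | `|x - c| < s].
have mB : measurable (B : set T) by apply: open_measurableRn; exact: open_norm_ball.
have m1 : measurable (D `&` B : set T) by exact: measurableI.
have m2 : measurable (D `\` B : set T) by exact: measurableD.
have [|A [cA A0 iA HA]] := IH (D `\` B) m2.
  by move=> z [/HD[c' + zc'] nB]; rewrite inE => /orP[/eqP cc'|]; [rewrite cc' in zc'|exists c'].
have spl z : \1_D z * eta z = \1_(D `&` B) z * eta z + \1_(D `\` B) z * eta z :> R.
  rewrite -mulrDl; congr (_ * _); rewrite !indicE.
  have [Dz|nD] := pselect (D z); last by rewrite !memNset ?addr0// => -[].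
  have [Bz|nB] := pselect (B z).
    by rewrite (mem_set Dz) (@mem_set _ (D `&` B))// (@memNset _ (D `\` B)) ?addr0// => -[].
  by rewrite (mem_set Dz) (@memNset _ (D `&` B)) ?(@mem_set _ (D `\` B)) ?add0r// => -[].
set J1 := \int[mu]_z (\1_(D `&` B) z * eta z) in iA *.
set J2 := \int[mu]_z (\1_(D `\` B) z * eta z) in iA HA *.
have I1 := masked_int m1 ce; have I2 := masked_int m2 ce.
have EJ : \int[mu]_z (\1_D z * eta z) = J1 + J2.
  by rewrite -(RintegralD measurableT I1 I2); congr Rintegral; apply/funext => z; exact: spl.
have J10 : 0 <= J1 by apply: Rintegral_ge0 => z _; rewrite mulr_ge0// indicE ler0n.
have cpc : cc (fun x => `|phi (c + x)|) by apply: cc_norm; exact: cc_shift.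
exists (fun x => J1 * `|phi (c + x)| + 1 * A x); split.
- exact: cc_lin.
- by move=> x; rewrite mul1r addr_ge0 ?mulr_ge0.
- rewrite (int_lin _ _ (cc_int cpc) (cc_int cA)).2 mul1r iA EJ mulrDl; congr (_ * _ + _).
  exact: (@Rint_shift R n (fun x => `|phi x|) c (cc_int (cc_norm cp))).
- move=> x; rewrite EJ mul1r.
  have cps := cc_shift x cp; have cpe := cc_mul ce cps.1.
  have K1 : int (fun z => phi (x + z) * (\1_(D `&` B) z * eta z)).
    have := masked_int m1 cpe; rewrite (_ : (fun z => _) = fun z => phi (x + z) * (\1_(D `&` B) z * eta z))//.
    by apply/funext => z; ring.
  have K2 : int (fun z => phi (x + z) * (\1_(D `\` B) z * eta z)).
    have := masked_int m2 cpe; rewrite (_ : (fun z => _) = fun z => phi (x + z) * (\1_(D `\` B) z * eta z))//.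
    by apply/funext => z; ring.
  rewrite (_ : (fun z => _) = fun z => phi (x + z) * (\1_(D `&` B) z * eta z) + phi (x + z) * (\1_(D `\` B) z * eta z)); last first.
    by apply/funext => z; rewrite spl mulrDr.
  rewrite (RintegralD measurableT K1 K2); apply: (le_trans (ler_normD _ _)).
  have -> : J1 * `|phi (c + x)| + A x + e * (J1 + J2) = (`|phi (c + x)| + e) * J1 + (A x + e * J2) by ring.
  apply: lerD; last exact: HA.
  rewrite -(RintegralZl _ measurableT I1); apply: Rint_abs_le => // [|z].
    by have := integrableZl measurableT (`|phi (c + x)| + e) I1.
  rewrite normrM [X in _ * X]ger0_norm; last by rewrite mulr_ge0// indicE ler0n.
  rewrite indicE; have [[Dz Bz]|nDB] := pselect ((D `&` B) z); last by rewrite memNset// !mul0r !mulr0.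
  rewrite mem_set// mul1r ler_wpM2r//.
  have := Hs (x + z) (c + x); rewrite [c + x]addrC opprD addrACA subrr add0r => /(_ Bz).
  by move=> h1; have := ler_normB (phi (x + z)) (phi (x + c)); have := ler_normD (phi (x + z) - phi (x + c)) (phi (x + c)); rewrite subrK; lra.
Qed.

Lemma mollify_cc f eta : cc f -> cc eta -> cc (mollify f eta).
Proof.
move=> cf ce; split; first exact: mollify_continuous.
have [N N0 fN] := cf.2; have [M M0 eM] := ce.2.
exists (N + M) => [|x xN]; first exact: addr_gt0.
rewrite /mollify (_ : (fun y => _) = fun=> 0); first by rewrite /Rintegral integral0.
apply/funext => y; have [yN|Ny] := ltP `|y| N; last by rewrite fN// mul0r.
rewrite eM ?mulr0//; have := ler_normB y (y - x); rewrite opprB addrC subrK; lra.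
Qed.

Lemma ball_indic_int (N : R) : int (fun x => \1_[set x : E | `|x| < N] x : R).
Proof.
apply: (@int_bounded _ _ _ 1 N) => [|x|x Nx].
- apply: measurable_indic; apply: open_measurableRn.
  by have := @open_norm_ball 0 N; rewrite (_ : [set x : E | `|x - 0| < N] = [set x | `|x| < N])//; apply/seteqP; split => x /=; rewrite subr0.
- by rewrite indicE; case: (_ \in _); rewrite ?normr1 ?normr0.
- by rewrite indicE memNset//=; apply/negP; rewrite -leNgt.
Qed.

Hypothesis mu0 : mu [set: T] <> 0%E.

Lemma mollify_L1 phi (r : R) : 0 < r -> cc phi ->
  \int[mu]_x `|mollify phi (kern r) x| <= \int[mu]_x `|phi x|.
Proof.
move=> r0 cp; have ck : cc (kern r : E -> R) by exact: kern_cc.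
apply/ler_addgt0Pr => e e0.
have cm := mollify_cc cp ck; have [N N0 mN] := cm.2.
(* The pointwise error is a constant; a ball containing the support of the mollification makes it
   integrable. *)
pose chi (x : E) : R := \1_[set x : E | `|x| < N] x.
have Ic : int chi by exact: ball_indic_int.
set c := \int[mu]_x chi x; have c0 : 0 <= c by apply: Rintegral_ge0 => x _; rewrite /chi indicE ler0n.
have e1 : 0 < e / (c + 1) by rewrite divr_gt0// ltr_wpDl.
have [s s0 Hs] := cc_uniform cp e1; have [l Hl] := finite_ball_cover r s0.
pose D : set E := [set x | `|x| < r].
have mD : measurable (D : set T).
  by apply: open_measurableRn; have := @open_norm_ball 0 r; rewrite (_ : [set x : E | `|x - 0| < r] = D)//; apply/seteqP; split => x /=; rewrite subr0.
have [|A [cA A0 iA HA]] := @masked_mollify_bound _ _ s _ cp ck (fun z => kern_ge0 mu0 z r0) (ltW e1) Hs l D mD.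
  by move=> z /ltW/Hl.
have Dk : (fun z : T => \1_D z * kern r z) = kern r :> (E -> R).
  apply/funext => z; rewrite indicE; have [Dz|nD] := pselect (D z); first by rewrite mem_set// mul1r.
  by rewrite memNset// mul0r kern_out// leNgt; apply/negP.
rewrite Dk kern_int1// mul1r in iA.
have {}HA x : `|mollify phi (kern r) x| <= 1 * A x + e / (c + 1) * chi x.
  have h : `|mollify phi (kern r) x| <= A x + e / (c + 1).
    rewrite (mollifyE _ cp ck.1); have := HA x; rewrite Dk kern_int1// mulr1.
    congr (`|_| <= _); congr Rintegral; apply/funext => z; congr (_ * _).
    exact: (congr1 (fun g => g z) Dk).
  rewrite mul1r /chi indicE; have [Dz|nD] := pselect (`|x| < N).
    by rewrite mem_set// mulr1.
  by rewrite memNset// mulr0 addr0 mN ?normr0// leNgt; apply/negP.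
have [Il El] := int_lin 1 (e / (c + 1)) (cc_int cA) Ic.
apply: (le_trans (le_Rintegral measurableT (int_abs (cc_int cm)) Il (fun x _ => HA x))).
rewrite El mul1r iA lerD2l -/c mulrAC ler_pdivrMr ?ltr_wpDl//; rewrite ler_pM2l//; lra.
Qed.

Lemma mollify_close_L1 phi (e : R) : cc phi -> 0 < e -> exists2 s, 0 < s &
  forall r, 0 < r -> r < s -> \int[mu]_x `|mollify phi (kern r) x - phi x| <= e.
Proof.
move=> cp e0; have [N N0 pN] := cp.2.
pose chi (x : E) : R := \1_[set x : E | `|x| < N + 1] x.
have Ic : int chi by exact: ball_indic_int.
set c := \int[mu]_x chi x; have c0 : 0 <= c by apply: Rintegral_ge0 => x _; rewrite /chi indicE ler0n.
have e1 : 0 < e / (c + 1) by rewrite divr_gt0// ltr_wpDl.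
have [s s0 Hs] := cc_uniform cp e1.
exists (Num.min s 1) => [|r r0]; first by rewrite lt_min s0/=.
rewrite lt_min => /andP[rs r1]; have ck : cc (kern r : E -> R) by exact: kern_cc.
have [cl _] : cc (fun x => 1 * mollify phi (kern r) x + -1 * phi x) /\ True.
  by split => //; apply: cc_lin => //; exact: mollify_cc.
have Il : int (fun x => `|mollify phi (kern r) x - phi x|).
  apply: int_abs; have := cc_int cl; rewrite (_ : (fun x => _) = fun x => mollify phi (kern r) x - phi x)//.
  by apply/funext => x; rewrite mul1r mulN1r.
have Iec : int (fun x => e / (c + 1) * chi x) by have := integrableZl measurableT (e / (c + 1)) Ic.
apply: (@le_trans _ _ (\int[mu]_x (e / (c + 1) * chi x))); last first.
  rewrite (RintegralZl _ measurableT Ic) -/c mulrAC ler_pdivrMr ?ltr_wpDl//; rewrite ler_pM2l//; lra.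
apply: le_Rintegral => // x _.
have [xN|Nx] := ltP `|x| (N + 1); last first.
  rewrite /chi indicE memNset ?mulr0; last by apply/negP; rewrite -leNgt.
  rewrite normr_le0 subr_eq0; apply/eqP; rewrite pN; last by lra.
  apply/eqP; rewrite -normr_le0 -[X in `|X|]subr0; apply: (mollify_near mu0 r0 cp) => z zr.
  rewrite subr0 pN ?normr0//; have := ler_normB (x + z) z; rewrite addrK; lra.
rewrite /chi indicE mem_set// mulr1; apply: (mollify_near mu0 r0 cp) => z zr.
by apply: Hs; rewrite [x + z]addrC addrK; exact: lt_trans rs.
Qed.

Variable K : set E.
Hypothesis bK : convex_body K.
Let bP := convex_body_polar bK.
Local Notation sf := (gauge (polar K)).
Local Notation GE phi := (fun x => excess K (grad phi x)).

Lemma excess_grad_cc phi : smooth_cc phi -> cc (GE phi).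
Proof.
move=> sp; split.
  move=> x; apply: (@continuous_comp _ _ _ (grad phi) (excess K)); last exact: excess_continuous.
  exact: sjacobian_continuous (Ck2_sjacobian openT (sp.1 2%N) I).
have [N N0 pN] := sp.2; exists (N + 1) => [|x Nx]; first by rewrite ltr_wpDr.
by rewrite (grad0_outside pN Nx) /excess gauge0// sub0r max_l// oppr_le0.
Qed.

Lemma shift_sum (G : E -> R) (c : nat -> E) (m : nat) : cc G ->
  cc (fun y => \sum_(j < m) G (c j + y)) /\
  \int[mu]_y (\sum_(j < m) G (c j + y)) = m%:R * \int[mu]_y G y.
Proof.
move=> cG; elim: m => [|m [IH1 IH2]].
  rewrite (_ : (fun y => _) = fun=> 0); last by apply/funext => y; rewrite big_ord0.
  split; first by split; [move=> x; exact: cst_for|exists 1].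
  by rewrite mul0r /Rintegral integral0.
have cs := cc_shift (c m) cG.
have E1 : (fun y : T => \sum_(j < m.+1) G (c j + y)) =
    fun y => 1 * (\sum_(j < m) G (c j + y)) + 1 * G (c m + y).
  by apply/funext => y; rewrite big_ord_recr/= !mul1r.
split; first by have := cc_lin 1 1 IH1 cs; rewrite -E1.
rewrite E1 (int_lin 1 1 (cc_int IH1) (cc_int cs)).2 !mul1r IH2 (Rint_shift (c m) (cc_int cG)).
by rewrite -natr1 mulrDl mul1r.
Qed.

(** A Riemann sum along the segment from [y] to [y + h], the gauge of a gradient being at most 1
    plus its excess. By uniform continuity one number of pieces serves all [y], so that the sum can
    then be integrated in [y]. *)
Lemma increment_le phi h (e : R) : smooth_cc phi -> 0 < e -> exists2 N, (0 < N)%N & forall y,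
  phi (y + h) - phi y <= sf h * (1 + e) + sf h / N%:R * \sum_(j < N) excess K (grad phi ((j%:R / N%:R) *: h + y)).
Proof.
move=> sp e0; have [r r0 Hr] := cc_uniform (excess_grad_cc sp) e0.
exists (Num.truncn (`|h| / r)).+1 => //; set N := (Num.truncn _).+1 => y.
have N0 : 0 < N%:R :> R by rewrite ltr0n.
have hN : `|h| / N%:R < r.
  by rewrite ltr_pdivrMr// mulrC -ltr_pdivrMr// /N truncnS_gt.
pose F (j : nat) := phi (y + (j%:R / N%:R) *: h).
have -> : phi (y + h) - phi y = \sum_(j < N) (F j.+1 - F j).
  rewrite -(big_mkord xpredT (fun j => F j.+1 - F j)) telescope_sumr// /F.
  by rewrite divff ?gt_eqF// scale1r mul0r scale0r addr0.
have -> : sf h * (1 + e) = \sum_(j < N) (sf h / N%:R * (1 + e)).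
  by rewrite sumr_const card_ord -[RHS]mulr_natr; field; rewrite gt_eqF.
rewrite mulr_sumr -big_split/=; apply: ler_sum => j _; rewrite -mulrDr.
set a := y + (j%:R / N%:R) *: h; set v := N%:R^-1 *: h.
have -> : F j.+1 = phi (a + v).
  by rewrite /F /a /v -addrA -scalerDl -natr1 mulrDl mul1r.
have [|t /andP[t0 t1] ->] := @MVT_line _ _ phi a v (fun s => dotp (grad phi (a + s *: v)) v).
  by move=> s _; apply: sderiv_line; exact: smooth_sderiv sp.1.
apply: (le_trans (dotp_le_gauge bK _ _)); rewrite mulrC.
have -> : sf v = sf h / N%:R by rewrite /v (gaugeZ _ bP) ?invr_gt0// mulrC.
apply: ler_wpM2l; first by rewrite mulr_ge0 ?gauge_ge0// invr_ge0 ltW.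
apply: (le_trans (gauge_excess _ _)); rewrite -[leRHS]addrA lerD2l -lerBlDr.
apply: le_trans (ler_norm _) _; rewrite [(j%:R / N%:R) *: h + y]addrC -/a; apply: Hr.
rewrite addrC addKr normrZ ger0_norm//; apply: le_lt_trans hN.
have -> : `|v| = `|h| / N%:R by rewrite /v normrZ ger0_norm ?invr_ge0 ?ltW// mulrC.
by rewrite ler_piMl// mulr_ge0// invr_ge0 ltW.
Qed.

(** The average of the excess against the kernel is at most the maximum of the kernel times the L1
    norm. For a fixed radius, a small excess in L1 thus makes the mollification almost 1-Lipschitz
    for [sf]. *)
Lemma mollify_increment phi (r M : R) x h : smooth_cc phi -> 0 < r -> (forall z : E, kern r z <= M) ->
  mollify phi (kern r) (x + h) - mollify phi (kern r) x <=
  sf h * (1 + M * \int[mu]_y excess K (grad phi y)).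
Proof.
move=> sp r0 HM; have cp := smooth_cc_cc sp; have ck : cc (kern r : E -> R) by exact: kern_cc.
have sh : 0 <= sf h by exact: gauge_ge0.
apply/ler_addgt0Pr => e e0; have e1 : 0 < e / (sf h + 1) by rewrite divr_gt0// ltr_wpDl.
have [N N0 HN] := increment_le h sp e1; set e' := e / _ in HN e1.
have NR : 0 < N%:R :> R by rewrite ltr0n.
have [cA iA] := shift_sum (fun j => (j%:R / N%:R) *: h) N (excess_grad_cc sp).
set A := (fun y : E => \sum_(j < N) _) in cA iA.
have A0 y : 0 <= A y by apply: sumr_ge0 => j _; exact: excess_ge0.
have cAx := cc_shift x cA.
have I z : int (fun w => phi (z + w) * kern r w) by apply: cc_int; exact: cc_mul (cc_shift z cp) ck.1.
have [Id Ed] := int_lin 1 (-1) (I (x + h)) (I x).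
rewrite mul1r mulN1r in Ed; rewrite !(mollifyE _ cp ck.1) -Ed.
have [Ir Er] := int_lin (sf h * (1 + e')) (sf h / N%:R * M) (cc_int ck) (cc_int cAx).
apply: (le_trans (le_Rintegral measurableT Id Ir _)); last first.
  rewrite Er kern_int1// (Rint_shift x (cc_int cA)) iA mulr1.
  have -> : sf h / N%:R * M * (N%:R * \int[mu]_y excess K (grad phi y)) = sf h * (M * \int[mu]_y excess K (grad phi y)).
    by field; rewrite gt_eqF.
  rewrite !mulrDr mulr1 -!addrA lerD2l [leRHS]addrC lerD2r /e' mulrA ler_pdivrMr ?ltr_wpDl//.
  by rewrite mulrC ler_pM2l// lerDl.
move=> z _; rewrite mul1r mulN1r -mulrBl.
have := HN (x + z); rewrite -/(A (x + z)) (_ : x + z + h = x + h + z); last by rewrite addrAC.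
move=> h1; apply: (@le_trans _ _ ((sf h * (1 + e') + sf h / N%:R * A (x + z)) * kern r z)).
  by rewrite ler_wpM2r ?kern_ge0.
rewrite mulrDl lerD2l -!mulrA; apply: ler_wpM2l => //; apply: ler_wpM2l; first by rewrite invr_ge0 ltW.
by rewrite mulrC ler_wpM2r.
Qed.

End L1_mollify.

Section lipschitz_representative.
Variables (R : realType) (n : nat) (Omega K : set 'rV[R]_n).
Local Notation E := 'rV[R]_n.
Local Notation T := (lebesgueRn R n).
Local Notation mu := (@leb R n).
Local Notation sf := (gauge (polar K)).
Implicit Types (x y z w h : E) (f g eta phi psi u v W : E -> R) (i : 'I_n).
Local Notation int f := (mu.-integrable [set: T] (EFin \o (f : T -> R))).
Local Notation test := (test_function Omega).
Hypotheses (Oo : open Omega) (Ob : bounded_set Omega) (bK : convex_body K).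
Hypothesis mu0 : mu [set: T] <> 0%E.
Let bP := convex_body_polar bK.

Let mO : measurable (Omega : set T) := measurable_Omega Oo.

Lemma norm_le_sum (p q : E) : `|p - q| <= \sum_i `|p 0 i - q 0 i|.
Proof.
apply: norm_row_le => [|i]; first exact: sumr_ge0.
by rewrite !mxE (bigD1 i)//= lerDl; exact: sumr_ge0.
Qed.

Lemma L1_sum (F : 'I_n -> E -> R) (b : R) : (forall i, in_L1 Omega (F i)) ->
  (forall i, \int[mu]_(x in Omega) F i x <= b) -> in_L1 Omega (fun x => \sum_i F i x) /\
  \int[mu]_(x in Omega) (\sum_i F i x) <= n%:R * b.
Proof.
move=> L Hb; have Ls (s : seq 'I_n) : in_L1 Omega (fun x => \sum_(i <- s) F i x) /\
   \int[mu]_(x in Omega) (\sum_(i <- s) F i x) <= (size s)%:R * b.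
  elim: s => [|i s [IH1 IH2]].
    rewrite (_ : (fun x => _) = fun=> 0); last by apply/funext => x; rewrite big_nil.
    by rewrite mul0r /Rintegral integral0; split => //; exact: integrable0.
  rewrite (_ : (fun x => _) = fun x => 1 * F i x + 1 * \sum_(j <- s) F j x); last first.
    by apply/funext => x; rewrite big_cons !mul1r.
  have [I1 I2] := L1_lin Oo 1 1 (L i) IH1; split => //; rewrite I2 !mul1r /= -natr1 mulrDl mul1r addrC.
  by apply: lerD.
have [L1 L2] := Ls (index_enum 'I_n); split => //; apply: (le_trans L2).
by rewrite -[index_enum _]enumT size_enum_ord.
Qed.

(** Since [excess] is Lipschitz, it is small in L1 on gradients close to one on which it
    vanishes. *)
Lemma excess0_approx u : W110 Omega u ->
  {ae mu, forall x, Omega x -> excess K (weak_grad Omega u x) = 0} ->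
  forall e : R, 0 < e -> exists2 phi, test phi &
    \int[mu]_(x in Omega) `|u x - phi x| <= e /\ \int[mu]_x excess K (grad phi x) <= e.
Proof.
move=> Wu Hu e e0; have [Iu [Lg _] Ha] := W110_approximable Oo Ob Wu.
have [C C0 HC] := excess_lip bK.
have nC : 0 < n%:R * C + 1 by rewrite ltr_wpDl// mulr_ge0// ltW.
pose e1 := e / (n%:R * C + 1); have e10 : 0 < e1 by rewrite divr_gt0.
have [phi tp [h1 h2]] := Ha e1 e10; exists phi => //; split.
  apply: (le_trans h1); rewrite ler_pdivrMr// ler_peMr ?(ltW e0)//.
  by rewrite lerDr mulr_ge0// ltW.
have sp := test_smooth tp; have cE := excess_grad_cc bK sp.
have L i : in_L1 Omega (fun x => `|weak_grad Omega u x 0 i - partial i phi x|).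
  by apply: L1_abs; have := integrableB mO (Lg i) (test_L1 Oo (test_partial i tp)).
have [LS1 LS2] := L1_sum L h2.
have IE : in_L1 Omega (fun x => excess K (grad phi x)) by exact: cc_L1.
rewrite -(Rint_Omega (Omega := Omega)); last first.
  move=> x nO; have [Cs cCs [CO _ g0]] := test_support tp.
  by rewrite g0 ?/excess ?gauge0// ?sub0r ?max_l ?oppr_le0// => /CO.
apply: (@le_trans _ _ (\int[mu]_(x in Omega) (C * \sum_i `|weak_grad Omega u x 0 i - partial i phi x|))).
  have IR : in_L1 Omega (fun x => C * \sum_i `|weak_grad Omega u x 0 i - partial i phi x|).
    by have := integrableZl mO C LS1.
  rewrite -lee_fin -(fine_L1 Oo IE) -(fine_L1 Oo IR).
  apply: ae_ge0_le_integral; [exact: mO| | | | |].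
  - by move=> x _; rewrite lee_fin excess_ge0.
  - exact: measurable_int IE.
  - by move=> x _; rewrite lee_fin mulr_ge0 ?sumr_ge0// ltW.
  - exact: measurable_int IR.
  - apply: ae_imp Hu => x Hx Ox; rewrite lee_fin.
    have := HC (grad phi x) (weak_grad Omega u x); rewrite (Hx Ox) subr0 ger0_norm ?excess_ge0// => h.
    apply: (le_trans h); rewrite ler_pM2l// distrC; apply: (le_trans (norm_le_sum _ _)).
    by rewrite le_eqVlt; apply/orP; left; apply/eqP; apply: eq_bigr => i _; rewrite mxE.
rewrite (RintegralZl _ mO LS1); apply: (@le_trans _ _ (C * (n%:R * e1))).
  by rewrite ler_pM2l.
have -> : C * (n%:R * e1) = n%:R * C / (n%:R * C + 1) * e by rewrite /e1; ring.
by rewrite ler_piMl ?(ltW e0)// ler_pdivrMr// mul1r lerDl.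
Qed.

Local Notation ext u := (u \_ Omega).

(** Two test functions resolve the conflict between radius and excess: [phi1] fixes a radius [r] at
    which mollification is close in L1, then [phi2] is chosen with an excess small relative to the
    maximum of the kernel of that radius. The L1 contraction carries the closeness over from [phi1]
    to [phi2]. *)
Lemma lipschitz_approx u : in_L1 Omega u -> (forall e : R, 0 < e -> exists2 phi, test phi &
    \int[mu]_(x in Omega) `|u x - phi x| <= e /\ \int[mu]_x excess K (grad phi x) <= e) ->
  forall e : R, 0 < e -> exists W, [/\ cc W, forall x h, W (x + h) - W x <= sf h * (1 + e),
    forall x, (forall z, Omega z -> e <= `|x - z|) -> W x = 0 &
    \int[mu]_x `|ext u x - W x| <= e].
Proof.
move=> Iu H e e0; have e4 : 0 < e / 4 by rewrite divr_gt0.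
have Ie : int (ext u).
  by have := (integrable_mkcond (EFin \o (u : T -> R)) mO).1 Iu; rewrite restrict_EFin.
have extd phi : test phi -> \int[mu]_x `|ext u x - phi x| = \int[mu]_(x in Omega) `|u x - phi x|.
  move=> tp; rewrite [RHS]Rintegral_mkcond; congr Rintegral; apply/funext => x; rewrite !patchE.
  by case: ifPn => // /negP nO; rewrite (test_out tp) ?subrr ?normr0// => Ox; apply: nO; rewrite inE.
have [phi1 t1 [a1 _]] := H _ e4; have c1 := smooth_cc_cc (test_smooth t1).
have [s s0 Hs] := mollify_close_L1 mu0 c1 e4.
pose r := Num.min s e / 2; have m0 : 0 < Num.min s e by rewrite lt_min s0.
have r0 : 0 < r by rewrite divr_gt0.
have : r < Num.min s e by rewrite /r; lra.
rewrite lt_min => /andP[rs re].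
have ck : cc (kern r : E -> R) by exact: kern_cc.
have [M M0 HM] := cc_bound ck.
pose e2 := Num.min (e / 4) (e / M); have e20 : 0 < e2 by rewrite lt_min e4 divr_gt0.
have [phi2 t2 [a2 b2]] := H _ e20; have c2 := smooth_cc_cc (test_smooth t2).
have e24 : e2 <= e / 4 by rewrite /e2 ge_min lexx.
have e2M : M * e2 <= e by rewrite mulrC -ler_pdivlMr// /e2 ge_min lexx orbT.
have cm2 := mollify_cc c2 ck; exists (mollify phi2 (kern r)); split => //.
- move=> x h; have := mollify_increment mu0 bK x h (test_smooth t2) r0 (fun z => le_trans (ler_norm _) (HM z)).
  move=> h1; apply: (le_trans h1); apply: ler_wpM2l; first exact: gauge_ge0.
  by rewrite lerD2l; apply: le_trans e2M; rewrite ler_pM2l.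
- move=> x Hx; apply/eqP; rewrite -normr_le0 -[X in `|X|]subr0; apply: (mollify_near mu0 r0 c2) => z zr.
  rewrite subr0 (test_out t2) ?normr0// => Oz; have := Hx _ Oz; rewrite opprD addrA subrr sub0r normrN; lra.
- pose D x := 1 * phi2 x + -1 * phi1 x; have cD : cc D by exact: cc_lin.
  have cm1 := mollify_cc c1 ck; have cmD := mollify_cc cD ck.
  have mD x : mollify D (kern r) x = mollify phi2 (kern r) x - mollify phi1 (kern r) x.
    have [_ E1] := int_lin 1 (-1) (mollify_int x c2 ck.1) (mollify_int x c1 ck.1).
    rewrite mul1r mulN1r in E1; rewrite /mollify -E1; congr Rintegral; apply/funext => y; rewrite /D; ring.
  have i1 : int (fun x => `|ext u x - phi1 x|).
    by apply: int_abs; have := integrableB measurableT Ie (cc_int c1).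
  have i1' : int (fun x => `|ext u x - phi2 x|).
    by apply: int_abs; have := integrableB measurableT Ie (cc_int c2).
  have i2 : int (fun x => `|mollify phi1 (kern r) x - phi1 x|).
    by apply: int_abs; have := integrableB measurableT (cc_int cm1) (cc_int c1).
  have i3 := int_abs (cc_int cmD).
  have [i12 E12] := int_lin 1 1 i1 i2; have [i123 E123] := int_lin 1 1 i12 i3.
  have iW : int (fun x => `|ext u x - mollify phi2 (kern r) x|).
    by apply: int_abs; have := integrableB measurableT Ie (cc_int cm2).
  have [iD ED] := int_lin 1 1 i1' i1.
  have b3 : \int[mu]_x `|mollify D (kern r) x| <= e / 4 + e / 4.
    apply: (le_trans (mollify_L1 mu0 r0 cD)).
    apply: (le_trans (le_Rintegral measurableT (int_abs (cc_int cD)) iD _)).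
      move=> x _; rewrite /D !mul1r mulN1r.
      rewrite (_ : phi2 x - phi1 x = ext u x - phi1 x - (ext u x - phi2 x)); last by ring.
      by rewrite [leRHS]addrC; exact: ler_normB.
    by rewrite ED !mul1r !extd//; apply: lerD => //; exact: le_trans a2 e24.
  apply: (le_trans (le_Rintegral measurableT iW i123 _)).
    move=> x _; rewrite !mul1r mD.
    rewrite (_ : ext u x - mollify phi2 (kern r) x = ext u x - phi1 x - (mollify phi1 (kern r) x - phi1 x) -
      (mollify phi2 (kern r) x - mollify phi1 (kern r) x)); last by ring.
    by apply: (le_trans (ler_normB _ _)); rewrite lerD2r; exact: ler_normB.
  rewrite E123 E12 !mul1r (extd _ t1) (_ : e = e / 4 + e / 4 + (e / 4 + e / 4)); last by field.
  by apply: lerD b3; apply: lerD a1 _; exact: Hs.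
Qed.

(** Where two functions with Lipschitz constant [L] differ by more than [e], they differ by at least
    [e / 2] on a ball of radius [e / (4 * L)], whose measure is positive and the same everywhere. *)
Lemma uniform_of_L1 (L e : R) : 0 < L -> 0 < e -> exists2 t, 0 < t & forall W W',
  cc W -> cc W' -> (forall x y, `|W x - W y| <= L * `|x - y|) ->
  (forall x y, `|W' x - W' y| <= L * `|x - y|) ->
  \int[mu]_x `|W x - W' x| <= t -> forall x, `|W x - W' x| <= e.
Proof.
move=> L0 e0; pose r := e / (4 * L); have r0 : 0 < r by rewrite divr_gt0// mulr_gt0.
pose B : set E := [set x | `|x| < r]; pose chi x : R := \1_B x.
have Ic : int chi by exact: ball_indic_int.
have c0 : 0 < \int[mu]_x chi x.
  have mB : measurable (B : set T).
    apply: open_measurableRn; have := @open_norm_ball R n 0 r.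
    by rewrite (_ : [set x : E | `|x - 0| < r] = B)//; apply/seteqP; split => x /=; rewrite subr0.
  rewrite /Rintegral /chi integral_indic// setIT fine_gt0// leb_ball_gt0//=.
  apply: leb_bounded_lty; exists r; split; first exact: num_real.
  by move=> s rs x /= xr; apply: ltW; exact: lt_trans xr rs.
exists (e / 4 * \int[mu]_x chi x) => [|W W' cW cW' HW HW' HI x]; first by rewrite mulr_gt0// divr_gt0.
rewrite leNgt; apply/negP => ex.
have [cD _] : cc (fun y => 1 * W y + -1 * W' y) /\ True by split => //; exact: cc_lin.
have ID : int (fun y => `|W y - W' y|).
  by apply: int_abs; have := integrableB measurableT (cc_int cW) (cc_int cW').
have IDx := int_shift x ID.
have Ie : int (fun y => e / 2 * chi y) by have := integrableZl measurableT (e / 2) Ic.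
have : e / 2 * \int[mu]_y chi y <= \int[mu]_y `|W y - W' y|.
  rewrite -(Rint_shift x ID) -(RintegralZl _ measurableT Ic).
  apply: (le_Rintegral measurableT Ie IDx) => y _.
  rewrite /chi indicE; have [yB|nB] := pselect (B y); last by rewrite memNset// mulr0.
  rewrite mem_set// mulr1.
  have := HW (x + y) x; have := HW' (x + y) x; rewrite [x + y]addrC addrK => h1 h2.
  have h3 : L * `|y| <= L * r by rewrite ler_pM2l// ltW.
  have Lr : L * r = e / 4 by rewrite /r; field; rewrite gt_eqF.
  have := ler_normB (W (y + x) - W x) (W' (y + x) - W' x).
  have := ler_normB (W (y + x) - W' (y + x)) (W (y + x) - W x - (W' (y + x) - W' x)).
  rewrite (_ : W (y + x) - W' (y + x) - (W (y + x) - W x - (W' (y + x) - W' x)) = W x - W' x); last by ring.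
  by lra.
move: c0 HI; set c := \int[mu]_x chi x => c0 HI h.
have : e / 4 * c < e / 2 * c by rewrite ltr_pM2r//; lra.
lra.
Qed.

(** The functions of [lipschitz_approx] are equi-Lipschitz and Cauchy in L1, hence uniformly Cauchy.
    They live on the whole space, so the limit satisfies the inequality for all pairs of points and
    vanishes outside the closure. *)
Theorem lipschitz_representative u : in_L1 Omega u -> (forall e : R, 0 < e -> exists2 phi, test phi &
    \int[mu]_(x in Omega) `|u x - phi x| <= e /\ \int[mu]_x excess K (grad phi x) <= e) ->
  exists v, [/\ forall x z, v x - v z <= sf (x - z), forall x, ~ closure Omega x -> v x = 0 &
    {ae mu, forall x, Omega x -> u x = v x}].
Proof.
move=> Iu H; have [C [M [C0 M0 HC]]] := gauge_norm bP.
pose e N : R := N.+1%:R^-1; have e0 N : 0 < e N by rewrite invr_gt0 ltr0n.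
have e1 N : e N <= 1 by rewrite invf_le1 ?ltr0n// ler1n.
have eN (s : R) : 0 < s -> \forall N \near \oo, e N < s.
  by move=> s0; exact: near_infty_natSinv_lt (PosNum s0).
have /choice[W HW] N := lipschitz_approx Iu H (e0 N).
have cW N : cc (W N) by have [] := HW N.
pose L := 2 * C; have L0 : 0 < L by rewrite mulr_gt0.
have Winc N x z : W N x - W N z <= L * `|x - z|.
  have [_ /(_ z (x - z)) + _ _] := HW N; rewrite [z + _]addrC subrK => h; apply: (le_trans h).
  apply: (@le_trans _ _ (C * `|x - z| * 2)); last by rewrite /L mulrAC [C * 2]mulrC.
  apply: ler_pM; rewrite ?gauge_ge0//; first by rewrite addr_ge0// ltW.
    by have [] := HC (x - z).
  by have := e1 N; lra.
have WL N x z : `|W N x - W N z| <= L * `|x - z|.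
  by rewrite ler_norml lerNl opprB [`|x - z|]distrC Winc distrC Winc.
have Ie : int (ext u).
  by have := (integrable_mkcond (EFin \o (u : T -> R)) mO).1 Iu; rewrite restrict_EFin.
have iW N : int (fun x => `|ext u x - W N x|).
  by apply: int_abs; have := integrableB measurableT Ie (cc_int (cW N)).
have WW N m : \int[mu]_x `|W N x - W m x| <= e N + e m.
  have [iD ED] := int_lin 1 1 (iW N) (iW m).
  have iNm : int (fun x => `|W N x - W m x|).
    by apply: int_abs; have := integrableB measurableT (cc_int (cW N)) (cc_int (cW m)).
  apply: (le_trans (le_Rintegral measurableT iNm iD _)).
    move=> x _; have := ler_normB (ext u x - W m x) (ext u x - W N x); rewrite !mul1r.
    by rewrite (_ : ext u x - W m x - (ext u x - W N x) = W N x - W m x); [lra|ring].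
  by rewrite ED !mul1r; apply: lerD; have [] := HW N; have [] := HW m.
have ucauchy (s : R) : 0 < s -> exists N0, forall N m, (N0 <= N)%N -> (N0 <= m)%N ->
    forall x, `|W N x - W m x| <= s.
  move=> s0; have [t t0 Ht] := uniform_of_L1 L0 s0.
  have [N0 _ HN0] := eN (t / 2) (divr_gt0 t0 (ltr0Sn _ 1)).
  exists N0 => N m N1 m1 x; apply: Ht => //; apply: (le_trans (WW N m)).
  by have := HN0 N N1; have := HN0 m m1; rewrite /=; lra.
have cvgW x : cvg (W ^~ x @ \oo).
  apply: cauchy_cvg; apply: cauchy_exP => s /= s0.
  have [N0 HN0] := ucauchy (s / 2) (divr_gt0 s0 (ltr0Sn _ 1)).
  exists (W N0 x), N0 => // N /= N0N; rewrite -ball_normE /ball_/=.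
  by apply: (le_lt_trans (HN0 N0 N (leqnn _) N0N x)); lra.
pose v x : R := lim (W ^~ x @ \oo).
have vW x : W ^~ x @ \oo --> v x by exact: cvgW.
have unif (s : R) : 0 < s -> exists N0, forall N, (N0 <= N)%N -> forall x, `|v x - W N x| <= s.
  move=> s0; have [N0 HN0] := ucauchy (s / 2) (divr_gt0 s0 (ltr0Sn _ 1)).
  exists N0 => N N0N x.
  have /(@cvgrPdist_le _ _ _ _)/(_ (s / 2) (divr_gt0 s0 (ltr0Sn _ 1)))[N1 _ HN1] := vW x.
  have := HN1 (maxn N0 N1) (leq_maxr _ _) => /=; have := HN0 _ N (leq_maxl N0 N1) N0N x.
  have := ler_normD (v x - W (maxn N0 N1) x) (W (maxn N0 N1) x - W N x); rewrite addrA subrK; lra.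
exists v; split.
- move=> x z; apply/ler_addgt0Pr => s s0.
  have s3 : 0 < s / 3 by rewrite divr_gt0.
  have s4 : 0 < s / 3 / (sf (x - z) + 1) by rewrite divr_gt0// ltr_wpDl// gauge_ge0.
  have [N0 HN0] := unif _ s3; have [N1 _ HN1] := eN _ s4.
  pose N := maxn N0 N1; have h1 := HN0 N (leq_maxl _ _) x; have h2 := HN0 N (leq_maxl _ _) z.
  have h3 := HN1 N (leq_maxr _ _); rewrite /= in h3.
  have [_ /(_ z (x - z)) + _ _] := HW N; rewrite [z + _]addrC subrK mulrDr mulr1 => h4.
  have h5 : sf (x - z) * e N <= s / 3.
    apply: (@le_trans _ _ ((sf (x - z) + 1) * (s / 3 / (sf (x - z) + 1)))).
      by apply: ler_pM; rewrite ?gauge_ge0 ?(ltW (e0 N)) ?lerDl// ltW.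
    by rewrite mulrC divfK// gt_eqF// ltr_wpDl// gauge_ge0.
  move: h1 h2; rewrite ler_norml => /andP[_ h1]; rewrite ler_norml => /andP[h2 _].
  by move: (sf (x - z)) (v x) (v z) (W N x) (W N z) (sf (x - z) * e N) h1 h2 h4 h5 => *; lra.
- move=> x nx; have oC : open (~` closure Omega) by apply: closed_openC; exact: closed_closure.
  have /nbhs_ballP[r /= r0 rO] : nbhs x (~` closure Omega) by exact: open_nbhs_nbhs.
  have [N1 _ HN1] := eN _ r0; apply: cvg_lim => //; apply: cvg_near_cst.
  exists N1 => // N /HN1/= Nr; have [_ _ Hz _] := HW N; apply: Hz => z Oz.
  rewrite leNgt; apply/negP => xz; have : (~` closure Omega) z.
    by apply: rO; rewrite -ball_normE /ball_/=; exact: lt_trans Nr.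
  by apply; exact: subset_closure.
- have cv : continuous v.
    apply: (lipschitz_row_continuous L0) => x z; apply/ler_addgt0Pr => s s0.
    have [N0 HN0] := unif _ (divr_gt0 s0 (ltr0Sn _ 1)).
    have := HN0 N0 (leqnn _) x; have := HN0 N0 (leqnn _) z; have := WL N0 x z.
    have := ler_normD (v x - W N0 x) (W N0 x - W N0 z); have := ler_normB (v x - W N0 x + (W N0 x - W N0 z)) (v z - W N0 z).
    rewrite (_ : v x - W N0 x + (W N0 x - W N0 z) - (v z - W N0 z) = v x - v z); last by ring.
    by move: (`|_|) (`|_|) (`|_|) (`|_|) (`|_|) => *; lra.
  have [N1 HN1] := unif 1 ltr01; have [B B0 HB] := cc_bound (cW N1).
  have mv : measurable_fun (Omega : set T) (v : T -> R) by apply: measurable_funTS; exact: continuous_measurableRn.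
  have Iv : in_L1 Omega v.
    apply: (@bounded_L1 _ _ _ Oo Ob v (1 + B) mv) => x _.
    have := ler_normD (v x - W N1 x) (W N1 x); rewrite subrK => h; apply: (le_trans h).
    by apply: lerD; [exact: HN1|exact: HB].
  have Id : in_L1 Omega (fun x => u x - v x) by have := integrableB mO Iu Iv.
  pose chi x : R := \1_Omega x.
  have Ic : int chi.
    have /pinfty_ex_gt0[D D0 HD] := Ob; apply: (@int_bounded _ _ _ 1 (D + 1)) => [|x|x Dx].
    - exact: measurable_indic.
    - by rewrite /chi indicE; case: (_ \in _); rewrite ?normr1 ?normr0.
    - by rewrite /chi indicE memNset// => Ox; have := HD x Ox; rewrite /=; lra.
  set c := \int[mu]_x chi x; have c0 : 0 <= c by apply: Rintegral_ge0 => x _; rewrite /chi indicE ler0n.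
  have I0 : \int[mu]_(x in Omega) `|u x - v x| = 0.
    apply/eqP; rewrite eq_le Rintegral_ge0// andbT; apply/ler_addgt0Pr => s s0; rewrite add0r.
    have s2 : 0 < s / 2 by rewrite divr_gt0.
    have s3 : 0 < s / 2 / (c + 1) by rewrite divr_gt0// ltr_wpDl.
    have [N2 HN2] := unif _ s3; have [N3 _ HN3] := eN _ s2.
    pose N := maxn N2 N3; have h2 := HN2 N (leq_maxl _ _); have h3 := HN3 N (leq_maxr _ _).
    have [iS ES] := int_lin 1 (s / 2 / (c + 1)) (iW N) Ic.
    have If : int (ext (fun x => `|u x - v x|)).
      by have := (integrable_mkcond (EFin \o ((fun x => `|u x - v x|) : T -> R)) mO).1 (L1_abs Id); rewrite restrict_EFin.
    rewrite Rintegral_mkcond; apply: (le_trans (le_Rintegral measurableT If iS _)).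
      move=> x _; rewrite mul1r /chi indicE !patchE; have [Ox|nO] := pselect (Omega x); last first.
        by rewrite !memNset// mulr0 addr0; exact: normr_ge0.
      rewrite !mem_set// mulr1; rewrite (_ : u x - v x = u x - W N x - (v x - W N x)); last by ring.
      by apply: (le_trans (ler_normB _ _)); rewrite lerD2l; exact: h2.
    rewrite ES mul1r; have [_ _ _ hN] := HW N; rewrite -/c.
    have h4 : s / 2 / (c + 1) * c <= s / 2 by rewrite mulrAC ler_pdivrMr ?ltr_wpDl// ler_pM2l// lerDl.
    by rewrite [leRHS]splitr; apply: lerD h4; exact: le_trans hN (ltW h3).
  have H0 : (\int[mu]_(x in Omega) `|(EFin \o (fun x : T => u x - v x)%R) x| = 0)%E.
    by rewrite -[RHS]/(0%:E) -I0 -(fine_L1 Oo (L1_abs Id)).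
  apply: ae_imp ((ae_eq_integral_abs mu mO (measurable_int mu Id)).1 H0) => x Hx Ox.
  by have := Hx Ox => -[] /eqP; rewrite subr_eq0 => /eqP.
Qed.

End lipschitz_representative.

(** * Minimizers *)

Section borel_composition.
Variables (R : realType) (n : nat).
Local Notation E := 'rV[R]_n.
Local Notation T := (lebesgueRn R n).
Implicit Types (D : set T) (g : E -> E).

(** An open set is a countable union of rational cells, whose preimages are intersections of
    coordinate conditions. *)
Lemma measurable_row D g : measurable D ->
  (forall i, measurable_fun D ((fun x => g x 0 i) : T -> R)) ->
  measurable_fun D (g : T -> borelRn R n).
Proof.
move=> mD mg; apply: (@measurability _ _ T (borelRn R n) D g (@open E) erefl) => _ [V oV <-].
pose F k : set E := if unpickle k is Some p then
  (if `[< ratcell p `<=` V >] then ratcell p else set0) else set0.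
have -> : V = \bigcup_k F k.
  apply/seteqP; split => x; last first.
    by move=> [k _]; rewrite /F; case: unpickle => // p; case: asboolP => // pO px; exact: pO.
  move=> Vx; have /nbhs_ballP[r /= r0 rO] : nbhs x V by exact: open_nbhs_nbhs.
  have [p px pr] := ratcell_small x r0; exists (pickle p) => //.
  rewrite /F pickleK asboolT// => y /pr yx.
  by apply: rO; rewrite -ball_normE /ball_/= distrC.
rewrite preimage_bigcup setI_bigcupr; apply: bigcupT_measurable => k; rewrite /F.
case: unpickle => [p|]; last by rewrite preimage_set0 setI0.
case: asboolP => _; last by rewrite preimage_set0 setI0.
pose I (i : 'I_n) : interval R := `](ratr (p.1 0 i) - p.2.+1%:R^-1), (ratr (p.1 0 i) + p.2.+1%:R^-1)[.
have e0 : 0 < p.2.+1%:R^-1 :> R by rewrite invr_gt0 ltr0n.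
have -> : D `&` g @^-1` ratcell p = D `&` \bigcap_(i in [set: 'I_n]) (D `&` (fun x => g x 0 i) @^-1` [set` I i]).
  apply/seteqP; split => x [Dx Hx]; split => //.
    move=> i _; split => //=; rewrite in_itv/=.
    by have := le_lt_trans (norm_coord_le _ i) Hx; rewrite !mxE distrC ltr_distl.
  rewrite /ratcell/= [X in X < _]mx_normrE; apply/bigmax_ltP; split => // -[i j] _; rewrite !mxE /= ord1 distrC ltr_distl.
  by have [_] := Hx j Logic.I; rewrite /= in_itv/=.
apply: measurableI => //; apply: fin_bigcap_measurable => // i _.
by apply: mg.
Qed.

Lemma borel_row (H : E -> \bar R) D g : borel_fun H -> measurable D ->
  (forall i, measurable_fun D ((fun x => g x 0 i) : T -> R)) ->
  measurable_fun D ((fun x => H (g x)) : T -> \bar R).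
Proof. by move=> bH mD mg; exact: (measurableT_comp bH (measurable_row mD mg)). Qed.

Lemma continuous_borel (f : E -> R) : continuous f -> borel_fun (EFin \o f).
Proof.
move=> cf; apply/measurable_EFinP.
apply: (measurability _ (RGenInftyO.measurableE R)) => _ [_ [c ->] <-].
rewrite setTI; apply: sub_sigma_algebra; apply: open_comp => // x _; exact: cf.
Qed.

End borel_composition.

Section measurable_monotonicity.
Local Open Scope ereal_scope.
Context d (T : measurableType d) (R : realType) (m : {measure set T -> \bar R}).
Variables (D : set T) (mD : measurable D) (f g : T -> \bar R).

(** The values may be infinite and no integrability is supposed, so positive and negative parts are
    compared separately. *)
Lemma le_integral_measurable : measurable_fun D f -> measurable_fun D g ->
  (forall x, D x -> f x <= g x) -> \int[m]_(x in D) f x <= \int[m]_(x in D) g x.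
Proof.
move=> mf mg fg; rewrite [leLHS]integralE [leRHS]integralE; apply: leeB.
- apply: ge0_le_integral; [exact: mD| | | |].
  + by move=> x _; exact: funepos_ge0.
  + exact: measurable_funepos.
  + exact: measurable_funepos.
  + by move=> x Dx; rewrite !funeposE ge_max !le_max lexx orbT andbT fg.
- apply: ge0_le_integral; [exact: mD| | | |].
  + by move=> x _; exact: funeneg_ge0.
  + exact: measurable_funeneg.
  + exact: measurable_funeneg.
  + by move=> x Dx; rewrite !funenegE ge_max !le_max lexx orbT andbT leeN2 fg.
Qed.

End measurable_monotonicity.

Section variational.
Variables (R : realType) (n : nat) (Omega K : set 'rV[R]_n).
Local Notation E := 'rV[R]_n.
Local Notation T := (lebesgueRn R n).
Local Notation mu := (@leb R n).
Local Notation S := (boundary Omega).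
Local Notation d := (minkowski_dist Omega K).
Local Notation r := (inradius Omega K).
Local Notation D := (weak_grad Omega).
Hypotheses (bK : convex_body K) (KC2 : C2_boundary K).
Hypotheses (O0 : Omega !=set0) (Ob : bounded_set Omega) (Oo : open Omega)
  (OC2 : C2_boundary Omega) (n2 : (2 <= n)%N).
Hypothesis mu0 : mu [set: T] <> 0%E.
Variable Hs : R.
Hypothesis HHs : Hs <= min_mean_rho_curvature Omega K.
Let bP := convex_body_polar bK.
Let n0 : (0 < n)%N := ltnW n2.
Implicit Types (x y z w p q : E) (u v f : E -> R).
Let mO : measurable (Omega : set T) := measurable_Omega Oo.

Definition cpoint x : R := cfun n Hs (r - d x).

Let dr x : Omega x -> 0 <= r - d x < r.
Proof.
move=> Ox; rewrite subr_ge0 (mdist_le_inradius bK O0 Ob Oo n2 Ox)/=.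
by have := mdist_pos bK O0 Ob Oo n0 Ox; lra.
Qed.

Let curv (t : R) : 0 <= t <= r -> 0 <= 1 - Hs * t.
Proof. exact: (curvature_inradius bK KC2 O0 Ob Oo OC2 n2 HHs). Qed.

Lemma cpoint_ge0 x : Omega x -> 0 <= cpoint x.
Proof.
move=> /dr/andP[a b]; rewrite -(cfun0 n Hs); apply: cfun_le => //; first by rewrite mulr0 subr0.
by apply: curv; rewrite a ltW.
Qed.

(** Points of [Omega] have positive distance, and the factor [1 - Hs * (r - d x)] stays positive
    even if [1 - Hs * r] vanishes. The strict sign is what annihilates the excess of a minimizer. *)
Lemma cpoint_lt x : Omega x -> cpoint x < cfun n Hs r.
Proof.
move=> /dr/andP[a b]; have r0 := inradius_gt0 bK O0 Ob Oo n2.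
have cr : 0 <= 1 - Hs * r by apply: curv; rewrite lexx ltW.
apply: cfun_lt => //; have [H0|H0] := leP Hs 0; last by have := ltr_pM2l H0 (r - d x) r; rewrite b; lra.
by have : Hs * (r - d x) <= 0 by [rewrite mulr_le0_ge0|]; lra.
Qed.

Lemma cmax_ge0 : 0 <= cfun n Hs r.
Proof. by have [x Ox] := O0; apply: le_trans (cpoint_ge0 Ox) (ltW (cpoint_lt Ox)). Qed.

Lemma L1_bounded_mul (k b : E -> R) (M : R) : in_L1 Omega k -> measurable_fun (Omega : set T) (b : T -> R) ->
  (forall x, Omega x -> `|b x| <= M) -> in_L1 Omega (fun x => k x * b x).
Proof.
move=> Ik mb HM; have Im : mu.-integrable Omega (fun x => `|M%:E * (k x)%:E|)%E.
  exact: integrable_abse (integrableZl mO M Ik).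
apply: (le_integrable mO _ _ Im).
  apply/measurable_EFinP; apply: measurable_funM => //.
  by apply/measurable_EFinP; exact: measurable_int Ik.
move=> x Ox /=; rewrite normr_id lee_fin !normrM mulrC ler_wpM2r//.
exact: le_trans (HM x Ox) (ler_norm _).
Qed.

Lemma measurable_cpoint : measurable_fun (Omega : set T) (cpoint : T -> R).
Proof. exact: (measurable_cfun bK O0 Ob Oo n2). Qed.

Lemma cpoint_bound x : Omega x -> `|cpoint x| <= cfun n Hs r.
Proof. by move=> Ox; rewrite ger0_norm ?cpoint_ge0// ltW// cpoint_lt. Qed.

Let md : measurable_fun (Omega : set T) (d : T -> R).
Proof. by apply: measurable_funTS; apply: continuous_measurableRn; exact: (mdist_continuous bK O0 Ob Oo n2). Qed.

Lemma mdist_L1 : in_L1 Omega d.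
Proof.
have [B B0 HB] := mdist_bounded bK O0 Ob Oo n2; apply: (bounded_L1 Oo Ob md (M := B)) => x Ox.
by rewrite ger0_norm ?HB//; exact: (mdist_nonneg bK O0 Ob Oo n0).
Qed.

Lemma measurable_L1 f : in_L1 Omega f -> measurable_fun (Omega : set T) (f : T -> R).
Proof. by move=> If; apply/measurable_EFinP; exact: measurable_int If. Qed.

Lemma excess_L1 (g : E -> E) : (forall i, in_L1 Omega (fun x => g x 0 i)) -> in_L1 Omega (fun x => excess K (g x)).
Proof.
move=> Ig; have [C C0 HC] := excess_lip bK.
have [LS _] := @L1_sum _ _ _ Oo (fun i x => `|g x 0 i|) (\sum_i \int[mu]_(x in Omega) `|g x 0 i|)
  (fun i => L1_abs (Ig i)) (fun i => ltac:(by rewrite (bigD1 i)//= lerDl sumr_ge0// => j _; apply: Rintegral_ge0)).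
have Im : mu.-integrable Omega (fun x => C%:E * (\sum_i `|g x 0 i|)%:E)%E by have := integrableZl mO C LS.
apply: (le_integrable mO _ _ Im).
  have ce : continuous (excess K) by exact: excess_continuous.
  exact: (borel_row (continuous_borel ce) mO (fun i => measurable_L1 (Ig i))).
move=> x Ox /=; rewrite lee_fin ger0_norm ?excess_ge0// ger0_norm; last by rewrite mulr_ge0 ?sumr_ge0// ltW.
have := HC (g x) 0; rewrite [excess K 0]/excess gauge0// sub0r max_l ?oppr_le0// !subr0 ger0_norm ?excess_ge0//.
move=> h; apply: (le_trans h); rewrite ler_pM2l//.
have hs := norm_le_sum (g x) 0; rewrite subr0 in hs; apply: (le_trans hs).
by apply: ler_sum => i _; rewrite [(0 : E) 0 i]mxE subr0.
Qed.

Lemma pos_L1 u : in_L1 Omega u -> in_L1 Omega (fun x => Num.max 0 (u x - d x)).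
Proof.
move=> Iu; have Id : in_L1 Omega (fun x => u x - d x) by have := integrableB mO Iu mdist_L1.
apply: (le_integrable mO _ _ Id).
  by apply/measurable_EFinP; apply: measurable_maxr; [exact: measurable_cst|exact: measurable_L1].
move=> x _ /=; rewrite lee_fin; have := pos_lip (u x - d x) 0; by rewrite maxxx !subr0.
Qed.

(** By density of test functions: both sides are continuous for the Sobolev norm, as [excess] is
    Lipschitz and [cpoint] is bounded. *)
Lemma integral_pos_diff_le_W110 u : W110 Omega u ->
  \int[mu]_(x in Omega) Num.max 0 (u x - d x) <=
  \int[mu]_(x in Omega) (excess K (D u x) * cpoint x).
Proof.
move=> Wu; have [Iu [Lg _] Ha] := W110_approximable Oo Ob Wu.
have [C C0 HC] := excess_lip bK; have c0 := cmax_ge0; set c := cfun n Hs r in c0.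
have L0 : 0 < 1 + c * (C * n%:R) + 1 by rewrite ltr_wpDl// addr_ge0// !mulr_ge0// ltW.
apply/ler_addgt0Pr => e e0; set L := 1 + _ + 1 in L0.
have [phi tp [h1 h2]] := Ha _ (divr_gt0 e0 L0); set e1 := e / L in h1 h2.
have Ip := test_L1 Oo tp.
have Iup : in_L1 Omega (fun x => `|u x - phi x|) by apply: L1_abs; have := integrableB mO Iu Ip.
have Ig i : in_L1 Omega (fun x => `|D u x 0 i - partial i phi x|).
  by apply: L1_abs; have := integrableB mO (Lg i) (test_L1 Oo (test_partial i tp)).
have [LS1 LS2] := L1_sum Oo Ig h2.
have Iex : in_L1 Omega (fun x => excess K (D u x) * cpoint x).
  by apply: (L1_bounded_mul (M := c)) (excess_L1 Lg) measurable_cpoint _ => x; exact: cpoint_bound.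
have Igp : in_L1 Omega (fun x => excess K (grad phi x)).
  have sp := test_smooth tp; have cE := excess_grad_cc bK sp.
  exact: (cc_L1 Oo cE).
have Iep : in_L1 Omega (fun x => excess K (grad phi x) * cpoint x).
  by apply: (L1_bounded_mul (M := c)) Igp measurable_cpoint _ => x; exact: cpoint_bound.
have s1 : \int[mu]_(x in Omega) Num.max 0 (u x - d x) <= \int[mu]_(x in Omega) Num.max 0 (phi x - d x) + e1.
  have [J1 J2] := L1_lin Oo 1 1 (pos_L1 Ip) Iup.
  apply: (le_trans (le_Rintegral mO (pos_L1 Iu) J1 _)).
    move=> x _; rewrite !mul1r; have := pos_lip (u x - d x) (phi x - d x).
    rewrite (_ : u x - d x - (phi x - d x) = u x - phi x); last by ring.
    by have := ler_norm (Num.max 0 (u x - d x) - Num.max 0 (phi x - d x)); lra.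
  by rewrite J2 !mul1r lerD2l.
have s2 : \int[mu]_(x in Omega) Num.max 0 (phi x - d x) <= \int[mu]_(x in Omega) (excess K (grad phi x) * cpoint x).
  have := integral_pos_diff_le bK KC2 O0 Ob Oo OC2 n2 HHs tp.
  by rewrite (fine_L1 Oo (pos_L1 Ip)) (fine_L1 Oo Iep) lee_fin.
have s3 : \int[mu]_(x in Omega) (excess K (grad phi x) * cpoint x) <=
    \int[mu]_(x in Omega) (excess K (D u x) * cpoint x) + c * (C * (n%:R * e1)).
  have [J1 J2] := L1_lin Oo 1 (c * C) Iex LS1.
  apply: (le_trans (le_Rintegral mO Iep J1 _)).
    move=> x Ox; rewrite mul1r -lerBlDl -mulrBl.
    apply: (le_trans (ler_norm _)); rewrite normrM mulrC -mulrA; apply: ler_pM => //; first exact: cpoint_bound.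
    apply: (le_trans (HC _ _)); rewrite ler_pM2l// distrC; apply: (le_trans (norm_le_sum _ _)).
    by rewrite le_eqVlt; apply/orP; left; apply/eqP; apply: eq_bigr => i _; rewrite mxE.
  rewrite J2 mul1r lerD2l -mulrA; apply: ler_wpM2l => //; by rewrite ler_pM2l.
have e1L : e1 * L = e by rewrite /e1 divfK// gt_eqF.
have e10 : 0 < e1 by rewrite divr_gt0.
apply: (le_trans s1); apply: (@le_trans _ _ (\int[mu]_(x in Omega) (excess K (D u x) * cpoint x) + c * (C * (n%:R * e1)) + e1)).
  by rewrite lerD2r; exact: le_trans s2 s3.
rewrite -addrA lerD2l -e1L /L !mulrDr mulr1 (_ : e1 * (c * (C * n%:R)) = c * (C * (n%:R * e1))); last by ring.
by lra.
Qed.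

Local Notation c := (cfun n Hs r).
Local Notation cp := cpoint.

Variables (h : E -> \bar R) (f : E -> R) (F : R).
Hypotheses (h_ge0 : forall xi, (0 <= h xi)%E) (hb : borel_fun h).
Hypotheses (h_boundary : forall k, boundary K k -> h k = 0%E) (h0 : forall k, h k = 0%E -> K k).
Hypotheses (F0 : 0 <= F) (mf : measurable_fun (Omega : set T) (f : T -> R)) (fF : forall x, 0 <= f x <= F).
Hypothesis growth : forall xi, ((c * F * excess K xi)%:E <= h xi)%E.
Local Notation J := (functional_J Omega h f).

Let Ifu u : in_L1 Omega u -> in_L1 Omega (fun x => u x * f x).
Proof.
move=> Iu; apply: (L1_bounded_mul (M := F) Iu mf) => x _.
by have := fF x => /andP[a b]; rewrite ger0_norm.
Qed.

Let hD u : W110 Omega u -> measurable_fun (Omega : set T) ((fun x => h (D u x)) : T -> \bar R).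
Proof.
move=> Wu; have [_ [Lg _] _] := W110_approximable Oo Ob Wu.
exact: (borel_row hb mO (fun i => measurable_L1 (Lg i))).
Qed.

Let Iex u : W110 Omega u -> in_L1 Omega (fun x => excess K (D u x)).
Proof. by move=> Wu; have [_ [Lg _] _] := W110_approximable Oo Ob Wu; exact: (excess_L1 Lg). Qed.

Lemma functional_lower u : W110 Omega u ->
  ((c * F * \int[mu]_(x in Omega) excess K (D u x) - \int[mu]_(x in Omega) (u x * f x))%:E <= J u)%E.
Proof.
move=> Wu; have [Iu _ _] := W110_approximable Oo Ob Wu.
have [I1 E1] := L1_lin Oo (c * F) (-1) (Iex Wu) (Ifu Iu).
rewrite mulN1r in E1; rewrite -E1 -(fine_L1 Oo I1); apply: (@le_integral_measurable _ T R mu Omega mO (fun x => (c * F * excess K (D u x) + -1 * (u x * f x))%:E)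
  (fun x => h (D u x) - (f x * u x)%:E)%E).
- exact: measurable_int I1.
- apply: emeasurable_funB; first exact: hD.
  by apply/measurable_EFinP; apply: measurable_funM => //; exact: measurable_L1.
- move=> x _; rewrite mulN1r EFinB [u x * f x]mulrC; apply: leeB => //; exact: growth.
Qed.

Lemma functional_mdist : J d = (- \int[mu]_(x in Omega) (d x * f x))%:E.
Proof.
have [Wd Hd] := mdist_W110 bK KC2 O0 Ob Oo OC2 n2 mu0.
have Id := mdist_L1.
have [I1 E1] := L1_lin Oo 0 (-1) Id (Ifu Id); rewrite mul0r add0r mulN1r in E1.
rewrite -E1 -(fine_L1 Oo I1) ; apply: (@ae_eq_integral _ T R mu Omega (fun x => (0 * d x + -1 * (d x * f x))%:E)
  (fun x => h (D d x) - (f x * d x)%:E)%E mO).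
- apply: emeasurable_funB; first exact: hD.
  by apply/measurable_EFinP; apply: measurable_funM => //; exact: measurable_L1.
- exact: measurable_int I1.
- apply: ae_imp Hd => x Hx Ox; have [-> Sx] := Hx Ox.
  rewrite h_boundary; last by apply: boundary_gauge => //; exact: gauge_unit_bnormal.
  by rewrite sub0e mul0r add0r mulN1r EFinN [f x * _]mulrC.
Qed.

Let Icx u : W110 Omega u -> in_L1 Omega (fun x => excess K (D u x) * cp x).
Proof.
move=> Wu; apply: (L1_bounded_mul (M := c) (Iex Wu)).
  exact: (measurable_cpoint).
by move=> x; exact: (cpoint_bound).
Qed.

(** With [functional_lower] and [functional_mdist] this bounds [J u - J d] from below by [F] times
    the integral of the excess multiplied by the positive weight [c - cp x]. *)
Lemma functional_gap u : W110 Omega u ->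
  F * \int[mu]_(x in Omega) (c * excess K (D u x) + -1 * (excess K (D u x) * cp x)) <=
  c * F * \int[mu]_(x in Omega) excess K (D u x) - \int[mu]_(x in Omega) (u x * f x)
  + \int[mu]_(x in Omega) (d x * f x).
Proof.
move=> Wu; have [Iu _ _] := W110_approximable Oo Ob Wu; have Id := mdist_L1.
have [I1 ->] := L1_lin Oo c (-1) (Iex Wu) (Icx Wu).
have [I2 E2] := L1_lin Oo 1 (-1) (Ifu Iu) (Ifu Id).
have Ip := pos_L1 Iu; have IFp : in_L1 Omega (fun x => F * Num.max 0 (u x - d x)).
  by have := integrableZl mO F Ip.
have b1 : \int[mu]_(x in Omega) (1 * (u x * f x) + -1 * (d x * f x)) <= F * \int[mu]_(x in Omega) Num.max 0 (u x - d x).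
  rewrite -(RintegralZl _ mO Ip); apply: (le_Rintegral mO I2 IFp) => x _.
  rewrite mul1r mulN1r -mulrBl mulrC; have /andP[f0 f1] := fF x.
  apply: (@le_trans _ _ (f x * Num.max 0 (u x - d x))); first by rewrite ler_wpM2l// le_max lexx orbT.
  by rewrite ler_wpM2r// le_max lexx.
have b2 := integral_pos_diff_le_W110 Wu.
have := le_trans b1 (ler_wpM2l F0 b2); rewrite E2.
by move: (\int[mu]_(x in Omega) _) (\int[mu]_(x in Omega) _) (\int[mu]_(x in Omega) _) (\int[mu]_(x in Omega) _) => *; nra.
Qed.

Let gap_ge0 u x : Omega x -> 0 <= c * excess K (D u x) + -1 * (excess K (D u x) * cp x).
Proof.
move=> Ox; rewrite mulN1r mulrC -mulrBr mulr_ge0 ?excess_ge0// subr_ge0 ltW//.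
exact: (cpoint_lt).
Qed.

Lemma mdist_minimizer : minimizer J (W110 Omega) d.
Proof.
have [Wd _] := mdist_W110 bK KC2 O0 Ob Oo OC2 n2 mu0; split => // u Wu.
apply: le_trans (functional_lower Wu); rewrite functional_mdist lee_fin -subr_ge0 opprK.
apply: le_trans (functional_gap Wu); apply: mulr_ge0 => //; apply: Rintegral_ge0 => x; exact: gap_ge0.
Qed.

Lemma L1_eq0 (k : E -> R) : in_L1 Omega k -> (forall x, Omega x -> 0 <= k x) ->
  \int[mu]_(x in Omega) k x <= 0 -> {ae mu, forall x, Omega x -> k x = 0}.
Proof.
move=> Ik k0 kI.
have H0 : (\int[mu]_(x in Omega) `|(EFin \o (k : T -> R)) x| = 0)%E.
  transitivity (\int[mu]_(x in Omega) (k x)%:E)%E.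
    by apply: eq_integral => x; rewrite inE => Ox /=; rewrite ger0_norm ?k0.
  rewrite (fine_L1 Oo Ik); congr EFin; apply/eqP; rewrite eq_le kI/=; exact: Rintegral_ge0.
apply: ae_imp ((ae_eq_integral_abs mu mO (measurable_int mu Ik)).1 H0) => x Hx Ox.
by have := Hx Ox => -[].
Qed.

(** For [F > 0] minimality annihilates the integral of [functional_gap], whose weight is positive.
    For [F = 0] the source vanishes, so [h] of the gradient is 0 almost everywhere, and the zeros of
    [h] lie in [K]. *)
Lemma minimizer_excess u : minimizer J (W110 Omega) u ->
  {ae mu, forall x, Omega x -> excess K (D u x) = 0}.
Proof.
have [Wd _] := mdist_W110 bK KC2 O0 Ob Oo OC2 n2 mu0.
move=> [Wu /(_ d Wd)]; rewrite functional_mdist => Jd.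
have gap := functional_gap Wu; have low := le_trans (functional_lower Wu) Jd.
rewrite lee_fin in low; have [I1 _] := L1_lin Oo c (-1) (Iex Wu) (Icx Wu).
have [Fp|Fn] := ltP 0 F.
  have {}gap : \int[mu]_(x in Omega) (c * excess K (D u x) + -1 * (excess K (D u x) * cp x)) <= 0.
    by rewrite -(pmulr_rle0 _ Fp); apply: (le_trans gap); rewrite -lerBrDr sub0r.
  apply: ae_imp (L1_eq0 I1 (@gap_ge0 u) gap) => x Hx Ox; have := Hx Ox.
  have := cpoint_lt Ox; rewrite -subr_gt0 => clt.
  rewrite mulN1r [c * _]mulrC -mulrBr => /eqP; rewrite mulf_eq0 (gt_eqF clt) orbF => /eqP //.
have f0 x : f x = 0 by have := fF x; lra.
have Jh : (\int[mu]_(x in Omega) `|h (D u x)| = 0)%E.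
  apply/eqP; rewrite eq_le integral_ge0// andbT.
  rewrite (_ : \int[mu]_(x in Omega) _ = J u)%E; last first.
    by apply: eq_integral => x _; rewrite f0 mul0r sube0 gee0_abs.
  apply: (le_trans Jd); rewrite lee_fin oppr_le0; apply: Rintegral_ge0 => x Ox.
  by rewrite f0 mulr0.
apply: ae_imp ((ae_eq_integral_abs mu mO (hD Wu)).1 Jh) => x Hx Ox.
have /h0 Kx := Hx Ox; rewrite /excess max_l// subr_le0; exact/(gauge_le1 _ bK).
Qed.

(** A defining function grows along its gradient, so boundary points are limits of points outside
    the closure. There the Lipschitz representative is 0, which gives its boundary values. *)
Lemma exterior_near y (e : R) : S y -> 0 < e -> exists2 x, `|x - y| < e & ~ closure Omega x.
Proof.
move=> Sy e0; have [U [psi [Uy dpsi]]] := OC2 Sy; have [oU cpsi g0 Hpsi] := dpsi.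
have p0 := defining_zero dpsi Uy Sy; set g := grad psi y; have gy : g != 0 := g0 y Uy.
have sd : sderiv psi y g by apply: (Ck1_sderiv oU) => //; exact: Ck2_Ck1 cpsi.
have gg : 0 < dotp g g by exact: dotp_gt0.
have ng : 0 < `|g| by rewrite normr_gt0.
have [s s0 Hs'] := sderiv_near sd (divr_gt0 gg (mulr_gt0 (ltr0Sn _ 1) ng)).
have /nbhs_ballP[q /= q0 qU] : nbhs y U by exact: open_nbhs_nbhs.
pose m := Num.min s (Num.min q e); have m0 : 0 < m by rewrite !lt_min s0 q0.
pose t := m / (2 * `|g|); have t0 : 0 < t by rewrite divr_gt0// mulr_gt0.
have tg : `|t *: g| = m / 2 by rewrite normrZ gtr0_norm// /t; field; rewrite gt_eqF.
have : `|t *: g| < m by rewrite tg; lra.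
rewrite !lt_min => /and3P[ts tq te]; exists (y + t *: g); first by rewrite [y + _]addrC addrK.
have Ux : U (y + t *: g) by apply: qU; rewrite -ball_normE /ball_/= opprD addrA subrr sub0r normrN.
have [_ Hc] := Hpsi _ Ux; move=> /Hc; apply/negP; rewrite -ltNge.
have := Hs' (y + t *: g) y; rewrite [y + _]addrC addrK subrr normr0 => /(_ ts s0).
rewrite p0 subr0 dotpZr normrZ (gtr0_norm t0).
have -> : dotp g g / (2 * `|g|) * (t * `|g|) = t * dotp g g / 2 by field; rewrite gt_eqF.
rewrite ler_norml => /andP[+ _]; have : 0 < t * dotp g g by exact: mulr_gt0.
lra.
Qed.

Lemma minimizer_Lip10 u : minimizer J (W110 Omega) u ->
  exists2 v, Lip10 Omega K v & {ae mu, forall x, Omega x -> u x = v x}.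
Proof.
move=> mu_; have ex := minimizer_excess mu_; have [Wu _] := mu_.
have [Iu _ _] := W110_approximable Oo Ob Wu.
have [v [vl vo vu]] := lipschitz_representative Oo Ob bK mu0 Iu (excess0_approx Oo Ob bK Wu ex).
exists v => //; have [C [M [C0 M0 HC]]] := gauge_norm bP.
have vL x z : `|v x - v z| <= C * `|x - z|.
  rewrite ler_norml lerNl opprB (le_trans (vl z x)) ?(le_trans (vl x z))//; first exact: (HC _).1.
  by rewrite distrC; exact: (HC _).1.
split; first split.
- by apply: continuous_subspaceT; exact: lipschitz_row_continuous C0 vL.
- by move=> x y _; exact: vl.
- move=> y Sy; apply/eqP; rewrite -normr_le0; apply/ler_addgt0Pr => e e0; rewrite add0r.
  have [x xy /vo vx] := exterior_near Sy (divr_gt0 e0 C0).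
  have := vL y x; rewrite vx subr0 distrC => hh; apply: (le_trans hh).
  by rewrite mulrC -ler_pdivlMr// ltW.
Qed.

End variational.

(** * Reduction to a source bounded everywhere and a nonzero measure *)

Section theorem_reduction.
Variables (R : realType) (n : nat) (Omega K : set 'rV[R]_n).
Local Notation E := 'rV[R]_n.
Local Notation T := (lebesgueRn R n).
Local Notation mu := (@leb R n).
Implicit Types (x y : E) (h : E -> \bar R) (f u : E -> R).

(** Where the gauge exceeds 1, a finite value of [h] bounds all admissible constants [lam], hence
    their supremum; it does not matter whether the supremum is attained. *)
Lemma growth_excess h (a : R) : (forall xi, (0 <= h xi)%E) -> 0 <= a -> (a%:E <= growth_const K h)%E ->
  forall xi, ((a * excess K xi)%:E <= h xi)%E.
Proof.
move=> hge0 a0 ha xi; have [x1|x1] := leP (gauge K xi - 1) 0.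
  by rewrite /excess max_l// mulr0 hge0.
rewrite /excess (max_r (ltW x1)); case E1 : (h xi) (hge0 xi) => [s| |] s0 //; last by rewrite leey.
rewrite lee_fin -ler_pdivlMr// -lee_fin; apply: (le_trans ha); apply: ge_ereal_sup => _ [lam [l0 Hl] <-].
by rewrite lee_fin ler_pdivlMr// -lee_fin -E1.
Qed.

Lemma integral_leb0 (D : set T) (g : T -> \bar R) : mu [set: T] = 0%E -> (\int[mu]_(x in D) g x = 0)%E.
Proof.
move=> m0; rewrite (@eq_measure_integral _ T R D mzero mu g) ?integral_measure_zero// => A mA _.
apply/eqP; rewrite eq_le /mzero measure_ge0 andbT -[leRHS]m0; exact: outer_le.
Qed.

Lemma ae_leb0 (P : E -> Prop) : mu [set: T] = 0%E -> {ae mu, forall x, P x}.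
Proof. by move=> m0; exists setT; split. Qed.

Lemma Linf_norm_ge f : mu [set: T] <> 0%E -> {ae mu, forall x, Omega x -> (`|f x|%:E <= Linf_norm Omega f)%E}.
Proof.
move=> m0; rewrite /Linf_norm unlock /= ifT; last by rewrite lt0e measure_ge0 andbT; apply/eqP.
apply: ae_imp (ess_sup_inf.ess_sup_ge mu (abse \o (EFin \o (f \_ Omega)))) => x /= + Ox.
by rewrite patchE mem_set.
Qed.

Hypotheses (Oo : open Omega) (Ob : bounded_set Omega).
Let mO : measurable (Omega : set T) := measurable_Omega Oo.

Lemma functional_ae_eq h f f' u : borel_fun h -> measurable_fun (Omega : set T) (f : T -> R) ->
  measurable_fun (Omega : set T) (f' : T -> R) -> {ae mu, forall x, Omega x -> f x = f' x} ->
  W110 Omega u -> functional_J Omega h f u = functional_J Omega h f' u.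
Proof.
move=> bh mf mf' ff Wu; have [Iu [Lg _] _] := W110_approximable Oo Ob Wu.
have mh := borel_row bh mO (fun i => measurable_L1 (Lg i)).
rewrite /functional_J; apply: (@ae_eq_integral _ T R mu Omega (fun x => h (weak_grad Omega u x) - (f' x * u x)%:E)%E
  (fun x => h (weak_grad Omega u x) - (f x * u x)%:E)%E mO).
- by apply: (emeasurable_funB mh); apply/measurable_EFinP; exact: measurable_funM mf (measurable_L1 Iu).
- by apply: (emeasurable_funB mh); apply/measurable_EFinP; exact: measurable_funM mf' (measurable_L1 Iu).
- by apply: ae_imp ff => x Hx Ox; rewrite Hx.
Qed.

End theorem_reduction.

Theorem theorem3p2 (R : realType) (n : nat) (Omega K : set 'rV[R]_n)
  (f : 'rV[R]_n -> R) (h : 'rV[R]_n -> \bar R)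
  (n_ge2 : (2 <= n)%N)
  (Omega_neq0 : Omega !=set0) (Omega_bounded : bounded_set Omega)
  (Omega_open : open Omega) (Omega_connected : connected Omega)
  (Omega_C2 : C2_boundary Omega)
  (f_Linf : in_Linf Omega f)
  (f_ge0 : {ae @leb R n, forall x, Omega x -> 0 <= f x})
  (h_ge0 : forall xi, (0 <= h xi)%E)
  (h_borel : borel_fun h)
  (K_def : K = convex_hull [set xi | h xi = 0%E])
  (K_compact : compact K) (K_interior : interior K 0)
  (K_C2 : C2_boundary K)
  (K_curv : forall y k, boundary K y -> principal_curvature K y k -> 0 < k)
  (growth : exists2 Hs : R, Hs <= min_mean_rho_curvature Omega K &
    ((cfun n Hs (inradius Omega K))%:E * Linf_norm Omega f <= growth_const K h)%E) :
  minimizer (functional_J Omega h f) (W110 Omega) (minkowski_dist Omega K) /\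
  (forall u, minimizer (functional_J Omega h f) (W110 Omega) u ->
    exists2 v, Lip10 Omega K v & {ae @leb R n, forall x, Omega x -> u x = v x}).
Proof.
have bK : convex_body K by exact: hull_convex_body K_def K_compact K_interior.
have hbd k : boundary K k -> h k = 0%E := fun bk => hull_boundary K_def K_compact K_interior K_C2 K_curv bk.
have hK k : h k = 0%E -> K k by move=> hk; rewrite K_def => C [_ ZC]; exact: ZC.
have [Hs HHs gro] := growth.
(* If the whole space is null, the functional is constantly 0 and the zero function is a
   representative of everything. *)
have [m0|/eqP m0] := eqVneq (@leb R n setT) 0%E.
  have J0 u : functional_J Omega h f u = 0%E by exact: integral_leb0.
  split; last first.
    move=> u _; exists (fun=> 0); last exact: ae_leb0.
    split; [split|by []]; first by move=> x; exact: cst_continuous.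
    by move=> x y _; rewrite subrr gauge_ge0.
  split; last by move=> v _; rewrite !J0.
  have Ld := mdist_L1 bK Omega_neq0 Omega_bounded Omega_open n_ge2.
  split.
    split => //; exists (fun=> 0); split => [i|phi _ i].
      by rewrite (_ : (fun x => _) = fun=> 0); [exact: integrable0|apply/funext => x; rewrite mxE].
    by rewrite /Rintegral !integral_leb0// oppr0.
  move=> e e0; exists (fun=> 0).
    split => [k|]; first exact: Ck_cst.
    by exists set0; split => //; exact: compact0.
  by rewrite /W11_norm !integral_leb0// big1 ?adde0// => i _; rewrite integral_leb0.
have [mf Lf] := f_Linf.
have L0 : (0 <= Linf_norm Omega f)%E by exact: Lnorm_ge0.
have Lfin : Linf_norm Omega f \is a fin_num by rewrite ge0_fin_numE.
pose F := fine (Linf_norm Omega f); have F0 : 0 <= F by exact: fine_ge0.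
have FE : Linf_norm Omega f = F%:E by rewrite fineK.
(* The truncation agrees with [f] almost everywhere and satisfies at every point the bounds assumed
   by the variational lemmas. *)
pose f' x := Num.max 0 (Num.min F (f x)).
have f'F x : 0 <= f' x <= F by rewrite /f' le_max lexx/= ge_max F0 ge_min lexx.
have mf' : measurable_fun (Omega : set (lebesgueRn R n)) (f' : lebesgueRn R n -> R).
  apply: measurable_maxr; first exact: measurable_cst.
  by apply: measurable_minr => //; exact: measurable_cst.
have ff' : {ae @leb R n, forall x, Omega x -> f x = f' x}.
  apply: ae_imp (ae_and f_ge0 (Linf_norm_ge Omega f m0)) => x [H1 H2] Ox.
  have := H2 Ox; rewrite FE lee_fin => h2; have h1 := H1 Ox.
  have h3 := le_trans (ler_norm _) h2.
  by rewrite /f' min_r// max_r.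
have c0 := cmax_ge0 bK K_C2 Omega_neq0 Omega_bounded Omega_open Omega_C2 n_ge2 HHs.
have gr : forall xi, ((cfun n Hs (inradius Omega K) * F * excess K xi)%:E <= h xi)%E.
  apply: growth_excess => //; first exact: mulr_ge0.
  by rewrite EFinM -FE.
have JE u : W110 Omega u -> functional_J Omega h f u = functional_J Omega h f' u.
  exact: functional_ae_eq.
have mm u : minimizer (functional_J Omega h f) (W110 Omega) u <-> minimizer (functional_J Omega h f') (W110 Omega) u.
  by split => -[Wu Hu]; split => // v Wv; have := Hu v Wv; rewrite !JE.
split.
  apply/mm; exact: (mdist_minimizer bK K_C2 Omega_neq0 Omega_bounded Omega_open Omega_C2 n_ge2 m0 HHs h_borel hbd F0 mf' f'F gr).
move=> u /mm mu_.
exact: (minimizer_Lip10 bK K_C2 Omega_neq0 Omega_bounded Omega_open Omega_C2 n_ge2 m0 HHs h_ge0 h_borel hbd hK F0 mf' f'F gr mu_).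
Qed.
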